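(* Let $m,\ell\in\mathbb{R}$ with $4m-\ell^2\neq0$ and let $\Sigma$ be an isoparametric immersed surface in the Bianchi-Cartan-Vranceanu space $M^3_{m,\ell}$. If $\Sigma$ is proper triharmonic, then $4m>\ell^2$ and $\Sigma$ is an open part of a CMC Hopf cylinder whose base curve has geodesic curvature $\kappa_g$ satisfying $$\kappa_g^2=2(4m-\ell^2).$$
   Context: For $m,\ell\in\mathbb{R}$ the Bianchi-Cartan-Vranceanu (BCV) space is $M^3_{m,\ell}=(\bar M\times\mathbb{R},g)$, where $\bar M=\{(x,y)\in\mathbb{R}^2: 1+m(x^2+y^2)>0\}$ and $$g=\frac{dx^2+dy^2}{[1+m(x^2+y^2)]^2}+\Big[dz+\frac{\ell}{2}\,\frac{y\,dx-x\,dy}{1+m(x^2+y^2)}\Big]^2 .$$ The map $\pi(x,y,z)=(x,y)$ is a Riemannian submersion of $M^3_{m,\ell}$ onto $M^2(4m)=\big(\bar M,h=\frac{dx^2+dy^2}{[1+m(x^2+y^2)]^2}\big)$, a surface of constant curvature $4m$. Given a smooth curve $\gamma:I\to M^2(4m)$ parametrized by arc length ($I$ an interval), the Hopf cylinder over the base curve $\gamma$ is the surface $\bigcup_{s\in I}\pi^{-1}(\gamma(s))$, parametrized by $(s,t)\mapsto(x(s),y(s),t)$, where $\gamma(s)=(x(s),y(s))$. The geodesic curvature $\kappa_g$ of $\gamma$ is computed in $M^2(4m)$. CMC means that the mean curvature function is constant. A hypersurface of a Riemannian manifold is isoparametric if itself and its locally defined nearby equidistant hypersurfaces have constant mean curvature.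 Triharmonicity: for an isometric immersion $\varphi:M\to N$ between Riemannian manifolds, let $\tau(\varphi)=\mathrm{trace}\,\nabla d\varphi$ be the tension field, $\nabla^\varphi$ the induced connection on $\varphi^{-1}TN$, and $\overline{\Delta}=-\sum_i\big(\nabla^\varphi_{e_i}\nabla^\varphi_{e_i}-\nabla^\varphi_{\nabla^M_{e_i}e_i}\big)$ the rough Laplacian on sections of $\varphi^{-1}TN$, with $\{e_i\}$ a local orthonormal frame tangent to $M$. The curvature convention is $R^N(X,Y)Z=\nabla_X\nabla_YZ-\nabla_Y\nabla_XZ-\nabla_{[X,Y]}Z$. The immersion (submanifold) is called triharmonic ($3$-harmonic) if its $3$-tension field vanishes: $$\tau_3(\varphi)=\overline{\Delta}^2\tau(\varphi)-\sum_iR^N\big(\overline{\Delta}\tau(\varphi),d\varphi(e_i)\big)d\varphi(e_i)-\sum_iR^N\big(\nabla^\varphi_{e_i}\tau(\varphi),\tau(\varphi)\big)d\varphi(e_i)=0 .$$ It is proper triharmonic if it is triharmonic and not minimal. *)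

(* Defs.v *)
From HB Require Import structures.
From mathcomp Require Import all_boot all_order all_algebra.
From mathcomp Require Import all_classical all_reals all_analysis.
Import Order.TTheory GRing.Theory Num.Theory.
Import numFieldNormedType.Exports.
Set Implicit Arguments.
Unset Strict Implicit.
Unset Printing Implicit Defensive.
Local Open Scope classical_set_scope.
Local Open Scope ring_scope.

(* On an open set of a finite-dimensional space this is the usual class C^k:
   iterated directional derivatives exist and are continuous. *)
Fixpoint Ck_on (R : realType) (V W : normedModType R) (k : nat) (A : set V)
    (f : V -> W) : Prop :=
  (forall x, A x -> {for x, continuous f}) /\
  (if k is k'.+1 then
     forall v : V, (forall x, A x -> derivable f x v) /\ Ck_on k' A ('D_v f)
   else True).

Definition smooth_on (R : realType) (V W : normedModType R) (A : set V)
    (f : V -> W) : Prop := forall k, Ck_on k A f.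

Section Riemannian.
Context {R : realType} {n : nat}.
Local Notation vec := 'rV[R]_n.+1.
Implicit Types (G : 'M[R]_n.+1) (g : vec -> 'M[R]_n.+1) (p : vec).

Definition inner G (u v : vec) : R := (u *m G *m v^T) 0 0.

Definition basis_vec (i : 'I_n.+1) : vec := delta_mx 0 i.

(* Gamma^k_{ij}; all metrics are given by their matrices in global coordinates. *)
Definition christoffel g (k i j : 'I_n.+1) p : R :=
  2^-1 * \sum_l invmx (g p) k l *
    ('D_(basis_vec i) (fun q => g q j l) p
     + 'D_(basis_vec j) (fun q => g q i l) p
     - 'D_(basis_vec l) (fun q => g q i j) p).

(* Components of R(X,Y)Z for the convention
   R(X,Y)Z = nabla_X nabla_Y Z - nabla_Y nabla_X Z - nabla_[X,Y] Z. *)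
Definition curvature g p (X Y Z : vec) : vec :=
  \row_l \sum_i \sum_j \sum_k X 0 i * Y 0 j * Z 0 k *
    ('D_(basis_vec i) (christoffel g l j k) p
     - 'D_(basis_vec j) (christoffel g l i k) p
     + \sum_q (christoffel g l i q p * christoffel g q j k p
               - christoffel g l j q p * christoffel g q i k p)).

(* nabla^psi_X S at u, for a section S of psi^{-1}T(R^n) and X tangent at u.
   For psi = id this is the Levi-Civita connection of g itself. *)
Definition cov_deriv (V : normedModType R) g (psi : V -> vec) (X : V)
    (S : V -> vec) (u : V) : vec :=
  'D_X S u + \row_k \sum_i \sum_j
     christoffel g k i j (psi u) * ('D_X psi u) 0 i * (S u) 0 j.

Definition geodesic_on g (J : set R) (c : R -> vec) : Prop :=
  forall r, J r -> cov_deriv g c 1 ('D_1 c) r = 0.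

End Riemannian.

Section Patch.
Context {R : realType} (g : 'rV[R]_3 -> 'M[R]_3).
Implicit Types (U : set 'rV[R]_2) (psi : 'rV[R]_2 -> 'rV[R]_3).

Definition immersion_on U psi : Prop :=
  smooth_on U psi /\ forall u X, U u -> 'D_X psi u = 0 -> X = 0.

Definition induced_metric psi (u : 'rV[R]_2) : 'M[R]_2 :=
  \matrix_(a, b) inner (g (psi u)) ('D_(basis_vec a) psi u)
                                   ('D_(basis_vec b) psi u).

Definition unit_normal psi (u : 'rV[R]_2) (nu : 'rV[R]_3) : Prop :=
  inner (g (psi u)) nu nu = 1 /\
  forall X, inner (g (psi u)) nu ('D_X psi u) = 0.

Definition second_form psi (u : 'rV[R]_2) (nu : 'rV[R]_3) : 'M[R]_2 :=
  \matrix_(a, b) inner (g (psi u))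
    (cov_deriv g psi (basis_vec a) ('D_(basis_vec b) psi) u) nu.

Definition mean_curvature psi (u : 'rV[R]_2) (nu : 'rV[R]_3) : R :=
  2^-1 * \tr (invmx (induced_metric psi u) *m second_form psi u nu).

Definition cmc_on U psi : Prop :=
  exists (N : 'rV[R]_2 -> 'rV[R]_3) (H : R), smooth_on U N /\
    forall u, U u -> unit_normal psi u (N u) /\ mean_curvature psi u (N u) = H.

Definition minimal_on U psi : Prop :=
  forall u nu, U u -> unit_normal psi u nu -> mean_curvature psi u nu = 0.

(* F (r, u) = exp_{psi u} (r N(u)); M is the domain of g. *)
Definition isoparametric_on (M : set 'rV[R]_3) U psi : Prop :=
  forall u0, U u0 ->
  exists (V : set 'rV[R]_2) (eps : R) (N : 'rV[R]_2 -> 'rV[R]_3)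
         (F : R * 'rV[R]_2 -> 'rV[R]_3),
  let J := [set r : R | `|r| < eps] in
  [/\ [/\ open V, V u0, V `<=` U & 0 < eps],
      smooth_on V N /\ (forall u, V u -> unit_normal psi u (N u)),
      smooth_on (J `*` V) F /\ F @` (J `*` V) `<=` M,
      forall u, V u -> [/\ F (0, u) = psi u,
        'D_1 (fun r => F (r, u)) 0 = N u &
        geodesic_on g J (fun r => F (r, u))] &
      forall r, J r -> immersion_on V (fun u => F (r, u)) /\
                       cmc_on V (fun u => F (r, u))].

(* A frame e is given by the coordinates of its vectors in the patch. *)
Definition orthonormal_frame_on U psi (e : 'I_2 -> 'rV[R]_2 -> 'rV[R]_2) : Prop :=
  (forall i, smooth_on U (e i)) /\
  forall u i j, U u -> inner (induced_metric psi u) (e i u) (e j u) = (i == j)%:R.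

Section Frame.
Variables (psi : 'rV[R]_2 -> 'rV[R]_3) (e : 'I_2 -> 'rV[R]_2 -> 'rV[R]_2).

Definition nabla_surf (X : 'rV[R]_2) (Y : 'rV[R]_2 -> 'rV[R]_2) (u : 'rV[R]_2) :=
  cov_deriv (induced_metric psi) id X Y u.

Definition tension (u : 'rV[R]_2) : 'rV[R]_3 :=
  \sum_i (cov_deriv g psi (e i u) (fun w => 'D_(e i w) psi w) u
          - 'D_(nabla_surf (e i u) (e i) u) psi u).

Definition rough_laplacian (S : 'rV[R]_2 -> 'rV[R]_3) (u : 'rV[R]_2) : 'rV[R]_3 :=
  - \sum_i (cov_deriv g psi (e i u) (fun w => cov_deriv g psi (e i w) S w) u
            - cov_deriv g psi (nabla_surf (e i u) (e i) u) S u).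

Definition tension3 (u : 'rV[R]_2) : 'rV[R]_3 :=
  rough_laplacian (rough_laplacian tension) u
  - \sum_i curvature g (psi u) (rough_laplacian tension u)
             ('D_(e i u) psi u) ('D_(e i u) psi u)
  - \sum_i curvature g (psi u) (cov_deriv g psi (e i u) tension u)
             (tension u) ('D_(e i u) psi u).

End Frame.

Definition triharmonic_on U psi : Prop :=
  forall (V : set 'rV[R]_2) (e : 'I_2 -> 'rV[R]_2 -> 'rV[R]_2),
    open V -> V `<=` U -> orthonormal_frame_on V psi e ->
    forall u, V u -> tension3 psi e u = 0.

End Patch.

(* The atlas consists of local parametrizations: a pair c is an open domain c.1
   of R^2 together with c.2 : R^2 -> S, of which only the restriction to c.1
   matters. *)
Record smooth_surface (R : realType) (S : topologicalType) := SmoothSurface {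
  atlas : set (set 'rV[R]_2 * ('rV[R]_2 -> S));
  surface_hausdorff : hausdorff_space S;
  surface_second_countable : @second_countable S;
  surface_connected : connected [set: S];
  chart_open : forall c, atlas c -> open c.1;
  chart_inj : forall c, atlas c -> {in c.1 &, injective c.2};
  chart_continuous : forall c u, atlas c -> c.1 u -> {for u, continuous c.2};
  chart_open_map : forall c O, atlas c -> open O -> O `<=` c.1 -> open (c.2 @` O);
  chart_cover : forall p : S, exists2 c, atlas c & (c.2 @` c.1) p;
  chart_transition : forall c d, atlas c -> atlas d ->
    let W := c.1 `&` c.2 @^-1` (d.2 @` d.1) in
    exists2 T : 'rV[R]_2 -> 'rV[R]_2,
      smooth_on W T & forall u, W u -> d.1 (T u) /\ d.2 (T u) = c.2 u }.

Section ImmersedSurface.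
Context {R : realType} {S : topologicalType} (Sigma : smooth_surface R S).
Variables (M : set 'rV[R]_3) (g : 'rV[R]_3 -> 'M[R]_3) (phi : S -> 'rV[R]_3).

Definition immersed_surface : Prop :=
  (forall p, M (phi p)) /\
  forall c, atlas Sigma c -> immersion_on c.1 (phi \o c.2).

Definition isoparametric : Prop :=
  forall c, atlas Sigma c -> isoparametric_on g M c.1 (phi \o c.2).

Definition minimal : Prop :=
  forall c, atlas Sigma c -> minimal_on g c.1 (phi \o c.2).

Definition triharmonic : Prop :=
  forall c, atlas Sigma c -> triharmonic_on g c.1 (phi \o c.2).

Definition proper_triharmonic : Prop := triharmonic /\ ~ minimal.

End ImmersedSurface.

Section BCV.
Context {R : realType}.
Variables m l : R.

Definition conf_factor (q : 'rV[R]_2) : R := 1 + m * (q 0 0 ^+ 2 + q 0 1 ^+ 2).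

Definition base_dom : set 'rV[R]_2 := [set q | 0 < conf_factor q].

Definition base_metric (q : 'rV[R]_2) : 'M[R]_2 := (conf_factor q ^- 2)%:M.

Definition hopf_proj (p : 'rV[R]_3) : 'rV[R]_2 := @lsubmx R 1 2 1 p.

Definition bcv_dom : set 'rV[R]_3 := hopf_proj @^-1` base_dom.

(* Covectors are rows, so that a^T *m b is the matrix of the tensor a (x) b. *)
Definition bcv_metric (p : 'rV[R]_3) : 'M[R]_3 :=
  let dx : 'rV[R]_3 := delta_mx 0 0 in
  let dy : 'rV[R]_3 := delta_mx 0 1 in
  let dz : 'rV[R]_3 := delta_mx 0 ord_max in
  let x := p 0 0 in
  let y := p 0 1 in
  let lam := conf_factor (hopf_proj p) in
  let theta := dz + (l / 2 / lam) *: (y *: dx - x *: dy) in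
  lam ^- 2 *: (dx^T *m dx + dy^T *m dy) + theta^T *m theta.

Definition arclength_curve (I : set R) (gam : R -> 'rV[R]_2) : Prop :=
  [/\ smooth_on I gam, gam @` I `<=` base_dom &
      forall s, I s -> inner (base_metric (gam s)) ('D_1 gam s) ('D_1 gam s) = 1].

(* base_metric is conformal to the Euclidean metric, so the Euclidean rotation
   by a right angle gives the unit normal of gam. *)
Definition geodesic_curvature (gam : R -> 'rV[R]_2) (s : R) : R :=
  let T := 'D_1 gam s in
  let nu : 'rV[R]_2 := T 0 0 *: delta_mx 0 1 - T 0 1 *: delta_mx 0 0 in
  inner (base_metric (gam s)) (cov_deriv base_metric gam 1 ('D_1 gam) s) nu.

Definition hopf_cylinder (I : set R) (gam : R -> 'rV[R]_2) : set 'rV[R]_3 :=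
  \bigcup_(s in I) (hopf_proj @^-1` [set gam s]).

Definition hopf_param (gam : R -> 'rV[R]_2) (w : 'rV[R]_2) : 'rV[R]_3 :=
  @row_mx R 1 2 1 (gam (w 0 0)) (w 0 1)%:M.

Definition cmc_hopf_cylinder (I : set R) (gam : R -> 'rV[R]_2) : Prop :=
  cmc_on bcv_metric [set w | I (w 0 0)] (hopf_param gam).

End BCV.

(* Main.v *)
(* Work in the orthonormal frame E1 = lam d/dx - (l/2) y d/dz, E2 = lam d/dy + (l/2) x d/dz, E3 = d/dz,
   where lam = 1 + m (x^2 + y^2).

   Along the parallel surfaces F(r, .) of an isoparametric surface, let W be the triple product of
   F_u, F_v and the unit normal n, so that W' / W = - 2H depends on r only. The Jacobi equation makes
   W a solution of the linear equation W5 + 2 E W3 + E^2 W1 = 0, where Wi is the i-th derivative and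
   E = l^2 + (4m - l^2)(1 - nu^2) with nu = <n, E3> constant in r. Since W is, up to a factor
   depending on the point only, the same function of r everywhere, E is a root of a fixed quadratic
   polynomial as soon as H <> 0; hence the angle function nu is locally constant.

   For constant nu the shape operator is explicit in the frame T = E3 - nu n, K = n x E3, the
   Gauss-type integrability condition reads nu (4m (1 - nu^2) + l^2 nu^2 + h^2) = 0 with h = 2H,
   and the normal component of the 3-tension field becomes a polynomial in l, h, nu. The two
   equations force nu = 0 and h^2 = 2 (4m - l^2).

   For nu = 0 the surface is vertical over a curve q with n' = k q', where
   k = (2m <q, n> - h) / lam is constant. So b = n - k q is a constant vector and the projection
   lies on the circle m k |q|^2 + 2m <b, q> = h + k, which has an explicit parametrization by arc
   length. The mean curvature determines (k, b) on any patch, so connectedness yields a single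
   cylinder for the whole surface. Its image is relatively open: the point of a small closed disc
   nearest to a point p of the cylinder is interior, hence a critical point of the distance
   to p, and this forces it to be p. *)
From HB Require Import structures.
From mathcomp Require Import all_boot all_order all_algebra.
From mathcomp Require Import all_classical all_reals all_analysis.
From mathcomp Require Import ring lra.
Require Import Defs.
Import Order.TTheory GRing.Theory Num.Theory.
Import numFieldNormedType.Exports.
Set Implicit Arguments.
Unset Strict Implicit.
Unset Printing Implicit Defensive.
Local Open Scope classical_set_scope.
Local Open Scope ring_scope.

(** * Calculus of smooth maps *)

(** Isoparametricity controls only the trace of the shape operator of each equidistant surface, that
    is, the logarithmic derivative in r of the area element W; the angle nu has to be recovered from
    this single function. This works because E3 is a Killing field: nu does not change along the
    normal geodesics, so the equation for W has coefficients constant in r. Comparing the equations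
    at two points, whose W are proportional, leaves only two values for E, and a continuous function
    with two possible values is constant on a ball. The comparison divides by the derivative of W at
    r = 0, so points with H = 0 escape it; they stay as an alternative in the local statement and
    are excluded at the end by connectedness. The constant 2 (4m - l^2) comes from the normal part
    of the 3-tension field, which at nu = 0 is h (h^2 + l^2/4) (h^2 - 2 (4m - l^2)). For m > 0 the
    base is a sphere of curvature 4m minus a point, in stereographic projection; its circles of
    curvature h are trigonometric of frequency sqrt (h^2 + 4m) in the arc length, which gives the
    explicit base curve. *)

Section Calculus.
Context {R : realType}.
Implicit Types V W : normedModType R.

Lemma is_derive_line V W (f : V -> W) x v t :
  derivable f (x + t *: v) v ->
  is_derive t 1 (fun s : R => f (x + s *: v)) ('D_v f (x + t *: v)).
Proof.
move=> df.
have e : (fun h : R => h^-1 *: (((fun s : R => f (x + s *: v)) \o shift t) (h *: 1) -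
     f (x + t *: v))) =
   (fun h => h^-1 *: ((f \o shift (x + t *: v)) (h *: v) - f (x + t *: v))).
  apply/funext => h /=.
  by rewrite [h *: (1 : R)]mulr1 scalerDl addrCA.
by split; rewrite /derivable /derive /= e.
Qed.

Lemma derive_scale V W (f : V -> W) x v (a : R) :
  derivable f x v -> is_derive x (a *: v) f (a *: 'D_v f x).
Proof.
move=> df; have [->|a0] := eqVneq a 0.
  by rewrite !scale0r; exact: is_derive0.
have c : (fun h : R => h^-1 *: ((f \o shift x) (h *: (a *: v)) - f x)) @ 0^' -->
    a *: 'D_v f x.
  rewrite (_ : (fun h : R => _) =
    (fun h : R => a *: ((fun k => k^-1 *: ((f \o shift x) (k *: v) - f x)) (h * a)))).
    apply: cvgZr.
    apply: (@cvg_comp _ _ _ (fun h : R => h * a) (fun k => k^-1 *: ((f \o shift x) (k *: v) - f x)) _ (0^')); last exact: df.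
    move=> P [e e0 Pe].
    exists (e / `|a|); first by rewrite /= divr_gt0 // normr_gt0.
    move=> h /=; rewrite sub0r normrN => hlt h0; apply: Pe => /=.
      rewrite sub0r normrN normrM -ltr_pdivlMr ?normr_gt0 //.
    by rewrite mulf_neq0.
  apply/funext => h /=.
  by rewrite !scalerA invfM mulrCA mulfV // mulr1.
by split; [apply/cvg_ex; eexists; exact: c | exact: cvg_lim c].
Qed.

Lemma line_MVT V (f : V -> R) x v (h : R) :
  0 <= h -> (forall t, 0 <= t <= h -> derivable f (x + t *: v) v) ->
  exists2 t, 0 <= t <= h & f (x + h *: v) - f x = h * 'D_v f (x + t *: v).
Proof.
move=> h0 df.
have [||t th E] := @MVT_segment R (fun s => f (x + s *: v))
   (fun s => 'D_v f (x + s *: v)) 0 h h0.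
- move=> t; rewrite in_itv /= => /andP[t0 th].
  by apply: is_derive_line; apply: df; rewrite !ltW.
- apply: derivable_within_continuous => t; rewrite in_itv /= => th.
  by have [] := is_derive_line (df _ th).
- move: th E; rewrite in_itv /= scale0r addr0 subr0 => th E.
  by exists t => //; rewrite E mulrC.
Qed.

Lemma eq_of_dist_le (a b : R) : (forall e, 0 < e -> `|a - b| <= e) -> a = b.
Proof.
move=> H; apply/eqP; rewrite -subr_eq0 -normr_le0; apply/ler_addgt0Pl => e e0.
by rewrite addr0; exact: H.
Qed.

Lemma near_line V (A : set V) x v w : open A -> A x ->
  \forall h \near 0^'+, forall s t, 0 <= s <= h -> 0 <= t <= h ->
    A (x + s *: v + t *: w).
Proof.
move=> oA Ax; have /nbhs_ballP[e /= e0 eA] : nbhs x A by exact: open_nbhs_nbhs.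
have d0 : 0 < e / (1 + `|v| + `|w|).
  by rewrite divr_gt0 // -addrA ltr_wpDr // addr_ge0.
near=> h => s t /andP[s0 sh] /andP[t0 th]; apply: eA.
rewrite -ball_normE /= -addrA opprD addrA subrr sub0r normrN.
apply: (le_lt_trans (ler_normD _ _)); rewrite !normrZ !ger0_norm //.
have hd : h < e / (1 + `|v| + `|w|) by near: h; exact: nbhs_right_lt.
have h0 : 0 < h by near: h; exact: nbhs_right_gt.
move: hd; rewrite ltr_pdivlMr; last by rewrite -addrA ltr_wpDr // addr_ge0.
apply: le_lt_trans; rewrite !mulrDr mulr1 -addrA.
by apply: ler_wpDl; [exact: ltW | rewrite lerD // ler_wpM2r].
Unshelve. all: by end_near. Qed.

Lemma near_line_lt V (A : set V) (f : V -> R) x v w e : open A -> A x -> 0 < e ->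
  {for x, continuous f} ->
  \forall h \near 0^'+, forall s t, 0 <= s <= h -> 0 <= t <= h ->
    A (x + s *: v + t *: w) /\ `|f x - f (x + s *: v + t *: w)| < e.
Proof.
move=> oA Ax e0 cf.
have [B [[oB Bx] Bf]] : exists B, open_nbhs x B /\ B `<=` [set y | `|f x - f y| < e].
  have /cvgrPdist_lt/(_ e e0) := cf.
  rewrite -nbhs_nearE nbhsE => -[B nB sB].
  by exists B; split => // y By; exact: sB.
have := @near_line _ (A `&` B) x v w (openI oA oB) (conj Ax Bx).
apply: filterS => h H s t sh th; have [Ay By] := H s t sh th.
by split => //; exact: Bf.
Qed.

Lemma derive_right_lim V (f : V -> R) x v e : derivable f x v -> 0 < e ->
  \forall h \near 0^'+, `|'D_v f x - h^-1 * (f (x + h *: v) - f x)| < e.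
Proof.
move=> df e0.
have /cvgrPdist_lt/(_ e e0) := df.
move=> [d /= d0 H]; exists d => //= h hd h0.
have := H h hd (lt0r_neq0 h0).
by rewrite /= [_ + x]addrC.
Qed.

Lemma near_right_ex (P : R -> Prop) :
  (\forall h \near 0^'+, P h) -> exists2 h, 0 < h & P h.
Proof.
move=> /(filterI (nbhs_right_gt (0 : R))) H.
by have [h [h0 Ph]] := filter_ex H; exists h.
Qed.

Lemma dist2_le (a b c e : R) : `|a - c| < e / 2 -> `|b - c| < e / 2 -> `|a - b| <= e.
Proof.
rewrite !ltr_norml ler_norml => /andP[? ?] /andP[? ?]; apply/andP; split; lra.
Qed.

(** Smoothness is phrased through directional derivatives, so additivity in the direction does not
    come from a differential. The increment from x to x + h (v + w) is split at x + h v; the mean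
    value theorem turns the second half into a value of ['D_w f] near x, and continuity of ['D_w f]
    at x concludes. *)
Lemma deriveD_dir V (f : V -> R) (A : set V) x v w : open A -> A x ->
  (forall y u, A y -> derivable f y u) -> {for x, continuous ('D_w f)} ->
  'D_(v + w) f x = 'D_v f x + 'D_w f x.
Proof.
move=> oA Ax df cw; apply: eq_of_dist_le => e e0.
have e30 : 0 < e / 3 by rewrite divr_gt0.
have [h h0 [d1 [d2 d3]]] := near_right_ex (filterI (derive_right_lim (df _ (v + w) Ax) e30)
  (filterI (derive_right_lim (df _ v Ax) e30) (near_line_lt v w oA Ax e30 cw))).
have hh : 0 <= h <= h by rewrite lexx ltW.
have [|t th E] := @line_MVT _ f (x + h *: v) w h (ltW h0).
  by move=> t th; exact: (df _ _ (d3 h t hh th).1).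
have [_ d4] := d3 h t hh th.
have E' : h^-1 * (f (x + h *: (v + w)) - f x) =
    h^-1 * (f (x + h *: v) - f x) + 'D_w f (x + h *: v + t *: w).
  have -> : 'D_w f (x + h *: v + t *: w) =
    h^-1 * (f (x + h *: v + h *: w) - f (x + h *: v)).
    by rewrite E mulKf // lt0r_neq0.
  by rewrite scalerDr addrA -mulrDr; congr (_ * _); ring.
move: d1 d2 d4; rewrite {}E'; move: (h^-1 * _) ('D_w f (_ + _)) => a b.
move: ('D_(v + w) f x) ('D_v f x) ('D_w f x) => p q r.
rewrite !ltr_norml ler_norml => /andP[d1 d1'] /andP[d2 d2'] /andP[d4 d4'].
clear -d1 d1' d2 d2' d4 d4'; apply/andP; split; lra.
Qed.

Lemma is_derive_translate V (f : V -> R) x v z df :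
  is_derive (x + z) v f df -> is_derive x v (fun y => f (y + z)) df.
Proof.
have e1 : (fun k : R => k^-1 *: (((fun y => f (y + z)) \o shift x) (k *: v) - f (x + z))) =
  (fun k => k^-1 *: ((f \o shift (x + z)) (k *: v) - f (x + z))).
  by apply/funext => k /=; rewrite !addrA.
by move=> [d1 d2]; split; rewrite /derivable /derive /= e1.
Qed.

(** The mean value theorem is applied twice: to y |-> f (y + h w) - f y in direction v, then to
    ['D_v f] in direction w. The second difference over h^2 is thereby a value of ['D_w ('D_v f)] in
    a small parallelogram at x. *)
Lemma second_difference V (f : V -> R) (A : set V) x v w e : open A -> A x -> 0 < e ->
  (forall y u, A y -> derivable f y u) ->
  (forall y u, A y -> derivable ('D_v f) y u) ->
  {for x, continuous ('D_w ('D_v f))} ->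
  \forall h \near 0^'+,
    `|'D_w ('D_v f) x - h^-1 * h^-1 *
        (f (x + h *: v + h *: w) - f (x + h *: v) - f (x + h *: w) + f x)| < e.
Proof.
move=> oA Ax e0 df ddf cwv.
have FF : Filter ((0 : R)^'+) by exact: at_right_proper_filter.
have H := filterI (nbhs_right_gt (0 : R)) (near_line_lt v w oA Ax e0 cwv).
apply: (@filterS _ _ FF _ _ _ (H FF)) => h [h0 d3].
have hh : 0 <= h <= h by rewrite lexx ltW.
have h00 : 0 <= (0:R) <= h by rewrite lexx ltW.
pose g y := f (y + h *: w) - f y.
have dg s : 0 <= s <= h -> is_derive (x + s *: v) v g
    ('D_v f (x + s *: v + h *: w) - 'D_v f (x + s *: v)).
  move=> sh.
  have D1 := df _ v (d3 s h sh hh).1.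
  have := (d3 s 0 sh h00).1; rewrite scale0r addr0 => /(df _ v) D2.
  apply: is_deriveB; last exact: derivableP.
  apply: is_derive_translate; exact: derivableP.
have [|s sh E] := @line_MVT _ g x v h (ltW h0).
  by move=> s sh; case: (dg s sh).
have [|t th E2] := @line_MVT _ ('D_v f) (x + s *: v) w h (ltW h0).
  by move=> t th; exact: (ddf _ _ (d3 s t sh th).1).
have [_ d4] := d3 s t sh th.
suff -> : h^-1 * h^-1 *
        (f (x + h *: v + h *: w) - f (x + h *: v) - f (x + h *: w) + f x) =
   'D_w ('D_v f) (x + s *: v + t *: w) by [].
have -> : f (x + h *: v + h *: w) - f (x + h *: v) - f (x + h *: w) + f x =
     g (x + h *: v) - g x by rewrite /g; ring.
have [_ dv] := dg s sh.
have hn : h != 0 by rewrite lt0r_neq0.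
by rewrite E dv E2 -mulrA !mulKf.
Qed.

(** The second difference is symmetric in v and w, so both mixed derivatives are approximated by the
    same number. *)
Lemma derive_comm V (f : V -> R) (A : set V) x v w : open A -> A x ->
  (forall y u, A y -> derivable f y u) ->
  (forall y u u', A y -> derivable ('D_u' f) y u) ->
  (forall u u', {for x, continuous ('D_u ('D_u' f))}) ->
  'D_v ('D_w f) x = 'D_w ('D_v f) x.
Proof.
move=> oA Ax df ddf cf; apply: eq_of_dist_le => e e0.
have e20 : 0 < e / 2 by rewrite divr_gt0.
have [h _ [d1 d2]] := near_right_ex
  (filterI (second_difference oA Ax e20 df (fun y u => ddf y u v) (cf w v))
     (second_difference oA Ax e20 df (fun y u => ddf y u w) (cf v w))).
rewrite distrC; apply: dist2_le d1 _; move: d2.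
suff -> : f (x + h *: w + h *: v) - f (x + h *: w) - f (x + h *: v) + f x =
   f (x + h *: v + h *: w) - f (x + h *: v) - f (x + h *: w) + f x by [].
by rewrite (addrAC x); ring.
Qed.

End Calculus.

Section Smooth.
Context {R : realType}.
Implicit Types V W : normedModType R.

Lemma Ck_onW V W k (A : set V) (f : V -> W) : Ck_on k.+1 A f -> Ck_on k A f.
Proof.
elim: k f => [|k IH] f [c H]; first by split.
by split => // v; have [d1 d2] := H v; split => //; exact: IH.
Qed.

Lemma Ck_on_sub V W k (A B : set V) (f : V -> W) : B `<=` A -> Ck_on k A f -> Ck_on k B f.
Proof.
move=> sBA; elim: k f => [|k IH] f [c H]; (split; first by move=> x /sBA; exact: c) => //.
by move=> v; have [d1 d2] := H v; split; [move=> x /sBA; exact: d1 | exact: IH].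
Qed.

Lemma near_on V W (A : set V) (f g : V -> W) x : open A -> A x ->
  (forall y, A y -> f y = g y) -> {near x, f =1 g}.
Proof.
by move=> oA Ax fg; apply: (filterS fg); apply: open_nbhs_nbhs.
Qed.

Lemma near_continuous V W (f g : V -> W) x : {near x, f =1 g} ->
  {for x, continuous f} -> {for x, continuous g}.
Proof.
move=> fg cf; rewrite /prop_for /continuous_at -(nbhs_singleton fg).
exact: cvg_trans (near_eq_cvg fg) cf.
Qed.

Lemma Ck_on_ext V W k (A : set V) (f g : V -> W) : open A ->
  (forall y, A y -> f y = g y) -> Ck_on k A f -> Ck_on k A g.
Proof.
move=> oA; elim: k f g => [|k IH] f g fg [c H].
  by split => // x Ax; exact: near_continuous (near_on oA Ax fg) (c x Ax).
split; first by move=> x Ax; exact: near_continuous (near_on oA Ax fg) (c x Ax).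
move=> v; have [d1 d2] := H v; split.
  by move=> x Ax; exact: near_eq_derivable (near_on oA Ax fg) (d1 x Ax).
by apply: IH d2 => y Ay; exact: near_eq_derive (near_on oA Ay fg).
Qed.

Lemma Ck_on_cst V W k (A : set V) (a : W) : Ck_on k A (fun=> a).
Proof.
elim: k a => [|k IH] a; first by split => // x _; exact: cvg_cst.
split; first by move=> x _; exact: cvg_cst.
move=> v; split; first by move=> x _; exact: derivable_cst.
by rewrite (_ : 'D_v _ = fun=> 0) //; apply/funext => x; exact: derive_cst.
Qed.

Lemma Ck_onD V W k (A : set V) (f g : V -> W) : open A ->
  Ck_on k A f -> Ck_on k A g -> Ck_on k A (f + g).
Proof.
move=> oA; elim: k f g => [|k IH] f g [cf Hf] [cg Hg].
  by split => // x Ax; exact: continuousD (cf x Ax) (cg x Ax).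
split; first by move=> x Ax; exact: continuousD (cf x Ax) (cg x Ax).
move=> v; have [df Df] := Hf v; have [dg Dg] := Hg v; split.
  by move=> x Ax; exact: derivableD (df x Ax) (dg x Ax).
apply: (Ck_on_ext oA _ (IH _ _ Df Dg)) => y Ay.
exact: (esym (deriveD (df y Ay) (dg y Ay))).
Qed.

Lemma Ck_onM V k (A : set V) (f g : V -> R) : open A ->
  Ck_on k A f -> Ck_on k A g -> Ck_on k A (f * g).
Proof.
move=> oA; elim: k f g => [|k IH] f g Cf Cg.
  have [cf _] := Cf; have [cg _] := Cg.
  by split => // x Ax; exact: continuousM (cf x Ax) (cg x Ax).
have [cf Hf] := Cf; have [cg Hg] := Cg.
split; first by move=> x Ax; exact: continuousM (cf x Ax) (cg x Ax).
move=> v; have [df Df] := Hf v; have [dg Dg] := Hg v; split.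
  by move=> x Ax; exact: derivableM (df x Ax) (dg x Ax).
apply: (Ck_on_ext oA _ (Ck_onD oA (IH _ _ (Ck_onW Cf) Dg) (IH _ _ (Ck_onW Cg) Df))) => y Ay.
exact: (esym (deriveM (df y Ay) (dg y Ay))).
Qed.

Lemma Ck_onV V k (A : set V) (f : V -> R) : open A -> (forall x, A x -> f x != 0) ->
  Ck_on k A f -> Ck_on k A (fun x => (f x)^-1).
Proof.
move=> oA f0; elim: k => [|k IH] Cf; have [cf Hf] := Cf.
  by split => // x Ax; exact: continuousV (f0 x Ax) (cf x Ax).
split; first by move=> x Ax; exact: continuousV (f0 x Ax) (cf x Ax).
move=> v; have [df Df] := Hf v; split.
  by move=> x Ax; exact: derivableV (f0 x Ax) (df x Ax).
(* The derivative of 1/f is - (1/f)^2 f', so class C^k of 1/f, given by the induction hypothesis,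
   yields class C^(k+1). *)
have C1 := IH (Ck_onW Cf).
have C2 : Ck_on k A (fun _ : V => -1 : R) by exact: Ck_on_cst.
apply: (Ck_on_ext oA _ (Ck_onM oA (Ck_onM oA C2 (Ck_onM oA C1 C1)) Df)) => y Ay.
rewrite (deriveV (f0 y Ay) (df y Ay)).
change (-1 * ((f y)^-1 * (f y)^-1) * 'D_v f y = - (f y) ^- 2 * 'D_v f y).
by rewrite -exprVn expr2 mulN1r.
Qed.

Lemma smooth_onD V W (A : set V) (f g : V -> W) : open A ->
  smooth_on A f -> smooth_on A g -> smooth_on A (fun x => f x + g x).
Proof. by move=> oA sf sg k; exact: (Ck_onD oA (sf k) (sg k)). Qed.

Lemma smooth_onM V (A : set V) (f g : V -> R) : open A ->
  smooth_on A f -> smooth_on A g -> smooth_on A (fun x => f x * g x).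
Proof. by move=> oA sf sg k; exact: (Ck_onM oA (sf k) (sg k)). Qed.

Lemma smooth_on_cst V W (A : set V) (a : W) : smooth_on A (fun=> a).
Proof. by move=> k; exact: Ck_on_cst. Qed.

Lemma smooth_onN V (A : set V) (f : V -> R) : open A ->
  smooth_on A f -> smooth_on A (fun x => - f x).
Proof.
move=> oA sf k.
have C2 : Ck_on k A (fun _ : V => -1 : R) by exact: Ck_on_cst.
apply: (Ck_on_ext oA _ (Ck_onM oA C2 (sf k))) => y _.
by rewrite [LHS]mulN1r.
Qed.

Lemma smooth_onB V (A : set V) (f g : V -> R) : open A ->
  smooth_on A f -> smooth_on A g -> smooth_on A (fun x => f x - g x).
Proof. by move=> oA sf sg; apply: smooth_onD => //; exact: smooth_onN. Qed.

Lemma smooth_onV V (A : set V) (f : V -> R) : open A -> (forall x, A x -> f x != 0) ->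
  smooth_on A f -> smooth_on A (fun x => (f x)^-1).
Proof. by move=> oA f0 sf k; exact: (Ck_onV oA f0 (sf k)). Qed.

Lemma smooth_onX V (A : set V) (f : V -> R) n : open A ->
  smooth_on A f -> smooth_on A (fun x => f x ^+ n).
Proof.
move=> oA sf; elim: n => [|n IH]; first exact: smooth_on_cst.
by rewrite (_ : (fun x => _) = fun x => f x * f x ^+ n);
   [exact: smooth_onM | apply/funext => x; rewrite exprS].
Qed.

Lemma smooth_on_derive V W (A : set V) (f : V -> W) v :
  smooth_on A f -> smooth_on A ('D_v f).
Proof. by move=> sf k; case: (sf k.+1) => _ /(_ v)[]. Qed.

Lemma smooth_on_ext V W (A : set V) (f g : V -> W) : open A ->
  (forall y, A y -> f y = g y) -> smooth_on A f -> smooth_on A g.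
Proof. by move=> oA fg sf k; exact: (Ck_on_ext oA fg (sf k)). Qed.

Lemma smooth_on_sub V W (A B : set V) (f : V -> W) :
  B `<=` A -> smooth_on A f -> smooth_on B f.
Proof. by move=> sBA sf k; exact: (Ck_on_sub sBA (sf k)). Qed.

Lemma smooth_on_derivable V W (A : set V) (f : V -> W) x v :
  smooth_on A f -> A x -> derivable f x v.
Proof. by move=> sf Ax; case: (sf 1%N) => _ /(_ v)[+ _]; exact. Qed.

Lemma smooth_on_continuous V W (A : set V) (f : V -> W) x :
  smooth_on A f -> A x -> {for x, continuous f}.
Proof. by move=> sf Ax; case: (sf 0%N) => + _; exact. Qed.

Lemma smooth_on_deriveD V (A : set V) (f : V -> R) x v w : open A -> A x ->
  smooth_on A f -> 'D_(v + w) f x = 'D_v f x + 'D_w f x.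
Proof.
move=> oA Ax sf; apply: (@deriveD_dir R V f A x v w oA Ax).
  by move=> y u Ay; exact: smooth_on_derivable sf Ay.
exact: smooth_on_continuous (smooth_on_derive w sf) Ax.
Qed.

Lemma smooth_on_derive_comm V (A : set V) (f : V -> R) x v w : open A -> A x ->
  smooth_on A f -> 'D_v ('D_w f) x = 'D_w ('D_v f) x.
Proof.
move=> oA Ax sf; apply: (@derive_comm R V f A x v w oA Ax).
- by move=> y u Ay; exact: smooth_on_derivable sf Ay.
- by move=> y u u' Ay; exact: smooth_on_derivable (smooth_on_derive u' sf) Ay.
- move=> u u'; exact: smooth_on_continuous (smooth_on_derive u (smooth_on_derive u' sf)) Ax.
Qed.

Lemma mx_continuous V m n (f : V -> 'M[R]_(m.+1, n.+1)) x :
  (forall i j, {for x, continuous (fun y => f y i j)}) -> {for x, continuous f}.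
Proof.
move=> cf; apply/cvgrPdist_lt => e e0; near=> y.
rewrite /Num.Def.normr/= mx_normrE; apply: bigmax_lt => //= i _.
rewrite !mxE/=; move: i; near: y; apply: filter_forall => /= i.
exact: ((cvgrPdist_lt _ _).1 (cf i.1 i.2)).
Unshelve. all: by end_near. Qed.

Lemma derive_coord V m n (f : V -> 'M[R]_(m.+1, n.+1)) x v i j :
  derivable f x v -> is_derive x v (fun y => f y i j) ('D_v f x i j).
Proof.
move=> df; rewrite derive_mx // mxE; apply: derivableP.
by move/derivable_mxP: df.
Qed.

Lemma smooth_on_coord V m n (A : set V) (f : V -> 'M[R]_(m.+1, n.+1)) i j : open A ->
  smooth_on A f -> smooth_on A (fun y => f y i j).
Proof.
move=> oA sf k; move: {sf}(sf k); elim: k f => [|k IH] f [cf Hf].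
  split => // x Ax; apply: (@continuous_comp _ _ _ f (fun M : 'M[R]_(m.+1, n.+1) => M i j)); [exact: cf | exact: coord_continuous].
split; first by move=> x Ax; apply: (@continuous_comp _ _ _ f (fun M : 'M[R]_(m.+1, n.+1) => M i j)); [exact: cf | exact: coord_continuous].
move=> v; have [df Df] := Hf v; split.
  by move=> x Ax; case: (derive_coord i j (df x Ax)).
apply: (Ck_on_ext oA _ (IH _ Df)) => y Ay.
by case: (derive_coord i j (df y Ay)) => _ ->.
Qed.

Lemma smooth_on_mx V m n (A : set V) (f : V -> 'M[R]_(m.+1, n.+1)) : open A ->
  (forall i j, smooth_on A (fun y => f y i j)) -> smooth_on A f.
Proof.
move=> oA sf k; move: {sf}(fun i j => sf i j k); elim: k f => [|k IH] f H.
  by split => // x Ax; apply: mx_continuous => i j; case: (H i j) => + _; exact.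
split; first by move=> x Ax; apply: mx_continuous => i j; case: (H i j) => + _; exact.
have df x v : A x -> derivable f x v.
  by move=> Ax; apply/derivable_mxP => i j; case: (H i j) => _ /(_ v)[+ _]; exact.
move=> v; split; first by move=> x Ax; exact: df.
apply: IH => i j.
case: (H i j) => _ /(_ v)[_]; apply: (Ck_on_ext oA) => y Ay.
by case: (derive_coord i j (df y v Ay)) => _ ->.
Qed.

End Smooth.

Section Local.
Context {R : realType}.
Implicit Types V W : normedModType R.

Lemma ball_segment V (x y : V) d (t : R) : ball x d y -> 0 <= t <= 1 ->
  ball x d (x + t *: (y - x)).
Proof.
rewrite -ball_normE /= => xy /andP[t0 t1].
rewrite opprD addrA subrr sub0r normrN normrZ ger0_norm // distrC.
by apply: le_lt_trans xy; rewrite ler_piMl.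
Qed.

Lemma ball_derive0 V (f : V -> R) x d : (forall y v, ball x d y -> is_derive y v f 0) ->
  forall y, ball x d y -> f y = f x.
Proof.
move=> df y xy.
have [|t t01 E] := @line_MVT R V f x (y - x) 1 ler01.
  by move=> t t01; case: (df _ (y - x) (ball_segment xy t01)).
have [_ D] := df _ (y - x) (ball_segment xy t01).
by move: E; rewrite D mulr0 scale1r (addrC x) subrK => /eqP; rewrite subr_eq0 => /eqP.
Qed.

(** If two different values a and b were taken, the intermediate value theorem on the segment
    joining the two points would produce the value (a + b) / 2, which is no root of the quadratic.
    This is the tool that turns statements up to sign, or up to the choice of a root, into
    constancy. *)
Lemma ball_two_values V (f : V -> R) x d (a b : R) :
  (forall y, ball x d y -> {for y, continuous f}) ->
  (forall y, ball x d y -> (f y - a) * (f y - b) = 0) ->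
  forall y, ball x d y -> f y = f x.
Proof.
move=> cf fab y xy; apply/eqP/negPn/negP => fxy.
pose g (t : R) := f (x + t *: (y - x)).
have x0 : x + (0 : R) *: (y - x) = x by rewrite scale0r addr0.
have x1 : x + (1 : R) *: (y - x) = y by rewrite scale1r addrC subrK.
have bx : ball x d x.
  by rewrite -{2}x0; apply: ball_segment xy _; rewrite lexx ler01.
have cg : {within `[0, 1], continuous g}.
  apply: continuous_in_subspaceT => t; rewrite inE /= in_itv /= => t01.
  apply: (@continuous_comp _ _ _ (fun t : R => x + t *: (y - x)) f).
    by apply: cvgD; [exact: cvg_cst | apply: cvgZl; exact: cvg_id].
  by apply: cf; exact: ball_segment.
have mid : Num.min (g 0) (g 1) <= (g 0 + g 1) / 2 <= Num.max (g 0) (g 1).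
  by rewrite ge_min le_max; case: (lerP (g 0) (g 1)) => H; apply/andP; split; apply/orP; [left|right|right|left]; lra.
have [t] := IVT ler01 cg mid.
rewrite in_itv /= => t01 gt.
have := fab _ (ball_segment xy t01); rewrite -/(g t) gt /g x0 x1.
have /eqP := fab _ bx; have /eqP := fab _ xy; rewrite !mulf_eq0 !subr_eq0.
move=> /orP[]/eqP E1 /orP[]/eqP E2; move: fxy; rewrite E1 E2 ?eqxx // => ab.
  have -> : ((b + a) / 2 - a) * ((b + a) / 2 - b) = - ((a - b) / 2) ^+ 2 by field.
  by move/eqP; rewrite oppr_eq0 sqrf_eq0 mulf_eq0 subr_eq0 (negPf ab) invr_eq0 pnatr_eq0.
have -> : ((a + b) / 2 - a) * ((a + b) / 2 - b) = - ((a - b) / 2) ^+ 2 by field.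
by move/eqP; rewrite oppr_eq0 sqrf_eq0 mulf_eq0 subr_eq0 eq_sym (negPf ab) invr_eq0 pnatr_eq0.
Qed.

Lemma is_deriveV1 V (f : V -> R) x v df : f x != 0 -> is_derive x v f df ->
  is_derive x v (fun y => (f y)^-1) (- df / f x ^+ 2).
Proof.
move=> f0 [d1 d2]; split; first exact: derivableV.
by rewrite deriveV // d2 [LHS]mulNr mulNr mulrC.
Qed.

Lemma derive_pair1 W V (F : R * V -> W) (r : R) (u : V) (df : W) :
  is_derive (r, u) ((1 : R), (0 : V)) F df -> is_derive r 1 (fun s => F (s, u)) df.
Proof.
have e1 : (fun k : R => k^-1 *: (((fun s => F (s, u)) \o shift r) (k *: 1) - F (r, u))) =
  (fun k => k^-1 *: ((F \o shift (r, u)) (k *: (1 : R, 0 : V)) - F (r, u))).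
  apply/funext => k /=; congr (_ *: (F _ - _)).
  by rewrite [RHS]surjective_pairing /= scaler0 add0r.
by move=> [d1 d2]; split; rewrite /derivable /derive /= e1.
Qed.

Lemma derive_pair2 W V (F : R * V -> W) (r : R) (u v : V) (df : W) :
  is_derive (r, u) ((0 : R), (v : V)) F df -> is_derive u v (fun w => F (r, w)) df.
Proof.
have e1 : (fun k : R => k^-1 *: (((fun w => F (r, w)) \o shift u) (k *: v) - F (r, u))) =
  (fun k => k^-1 *: ((F \o shift (r, u)) (k *: (0 : R, v : V)) - F (r, u))).
  apply/funext => k /=; congr (_ *: (F _ - _)).
  by rewrite [RHS]surjective_pairing /= scaler0 add0r.
by move=> [d1 d2]; split; rewrite /derivable /derive /= e1.
Qed.

Lemma rV2_basis (X : 'rV[R]_2) :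
  X = X 0 0 *: (@basis_vec R 1 0) + X 0 1 *: (@basis_vec R 1 1).
Proof.
apply/rowP => j; rewrite !mxE /=.
by case: j => [[|[|//]] ?]; rewrite /= ?mulr1 ?mulr0 ?addr0 ?add0r; congr (X _ _); exact: val_inj.
Qed.

Lemma smooth_on_derive_rV2 (A : set 'rV[R]_2) (f : 'rV[R]_2 -> R) u X : open A -> A u ->
  smooth_on A f ->
  'D_X f u = X 0 0 * 'D_(basis_vec 0) f u + X 0 1 * 'D_(basis_vec 1) f u.
Proof.
move=> oA Au sf; rewrite {1}(rV2_basis X).
rewrite (@smooth_on_deriveD R _ A f u _ _ oA Au sf).
have H v a : 'D_(a *: v) f u = a * 'D_v f u.
  by case: (derive_scale a (@smooth_on_derivable R _ _ A f u v sf Au)).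
by rewrite !H.
Qed.

Lemma rowE3 (v w : 'rV[R]_3) : (forall k, v 0 k = w 0 k) -> v = w.
Proof. by move=> e; apply/rowP. Qed.

Lemma smooth_mx_derive_rV2 (U : set 'rV[R]_2) (oU : open U) (f : 'rV[R]_2 -> 'rV[R]_3) u X : U u -> smooth_on U f ->
  'D_X f u = X 0 0 *: 'D_(basis_vec 0) f u + X 0 1 *: 'D_(basis_vec 1) f u.
Proof.
move=> Uu sf; apply: rowE3 => i.
have E Z : 'D_Z f u 0 i = 'D_Z (fun y => f y 0 i) u.
  by case: (derive_coord 0 i (@smooth_on_derivable _ _ _ U f u Z sf Uu)).
have L (a b : R) (v w : 'rV[R]_3) : (a *: v + b *: w) 0 i = a * v 0 i + b * w 0 i by rewrite !mxE.
apply: (etrans (E X)); apply: (etrans _ (esym (L _ _ _ _))).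
apply: (etrans (smooth_on_derive_rV2 X oU Uu (smooth_on_coord 0 i oU sf))).
exact: (congr2 (fun a b => X 0 0 * a + X 0 1 * b) (esym (E _)) (esym (E _))).
Qed.

End Local.

(** * The frame, connection and curvature of BCV spaces *)

Section DeriveRules.
Context {R : realType} {V : normedModType R}.
Implicit Types (f g : V -> R) (x v : V).

Lemma dcst x v (c : R) : is_derive x v (fun=> c) 0.
Proof. exact: is_derive_cst. Qed.

Lemma dadd x v f g df dg : is_derive x v f df -> is_derive x v g dg ->
  is_derive x v (fun y => f y + g y) (df + dg).
Proof. by move=> ? ?; exact: is_deriveD. Qed.

Lemma dopp x v f df : is_derive x v f df -> is_derive x v (fun y => - f y) (- df).
Proof. by move=> ?; exact: is_deriveN. Qed.

Lemma dmul x v f g df dg : is_derive x v f df -> is_derive x v g dg ->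
  is_derive x v (fun y => f y * g y) (df * g x + f x * dg).
Proof.
move=> ? ?; apply: (is_derive_eq (is_deriveM _ _)).
by rewrite addrC; congr (_ + _); exact: mulrC.
Qed.

Lemma dexp x v f n df : is_derive x v f df ->
  is_derive x v (fun y => f y ^+ n.+1) (n.+1%:R * f x ^+ n * df).
Proof.
move=> dfx; elim: n => [|n IH].
  by rewrite expr0 mulr1 mul1r.
rewrite (_ : (fun y => _) = fun y => f y * f y ^+ n.+1).
  apply: (is_derive_eq (dmul dfx IH)).
  by rewrite -[n.+2%:R]natr1 !exprS; ring.
by apply/funext => y; rewrite exprS.
Qed.

End DeriveRules.

Section Index3.
Context {R : realType}.

Lemma sum3 (F : 'I_3 -> R) : \sum_i F i = F 0 + F 1 + F ord_max.
Proof.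
rewrite !big_ord_recr big_ord0 /= add0r.
by congr (F _ + F _ + F _); exact: val_inj.
Qed.

Lemma sum2 (V : nmodType) (F : 'I_2 -> V) : \sum_i F i = F 0 + F 1.
Proof.
rewrite !big_ord_recr big_ord0 /= add0r.
by congr (F _ + F _); exact: val_inj.
Qed.

Lemma row3P (u v : 'rV[R]_3) :
  u 0 0 = v 0 0 -> u 0 1 = v 0 1 -> u 0 ord_max = v 0 ord_max -> u = v.
Proof.
move=> e0 e1 e2; apply/rowP => -[[|[|[|//]]] ?].
- by rewrite (_ : Ordinal _ = 0) //; exact: val_inj.
- by rewrite (_ : Ordinal _ = 1) //; exact: val_inj.
- by rewrite (_ : Ordinal _ = ord_max) //; exact: val_inj.
Qed.

Lemma forall3 (P : 'I_3 -> Prop) : P 0 -> P 1 -> P ord_max -> forall i, P i.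
Proof.
move=> p0 p1 p2 -[[|[|[|//]]] ?].
- by rewrite (_ : Ordinal _ = 0) //; exact: val_inj.
- by rewrite (_ : Ordinal _ = 1) //; exact: val_inj.
- by rewrite (_ : Ordinal _ = ord_max) //; exact: val_inj.
Qed.

Lemma forall2 (P : 'I_2 -> Prop) : P 0 -> P 1 -> forall i, P i.
Proof.
move=> p0 p1 -[[|[|//]] ?].
- by rewrite (_ : Ordinal _ = 0) //; exact: val_inj.
- by rewrite (_ : Ordinal _ = 1) //; exact: val_inj.
Qed.

Lemma definite_unitmx n (G : 'M[R]_n.+1) :
  (forall v : 'rV[R]_n.+1, inner G v v = 0 -> v = 0) -> G \in unitmx.
Proof.
move=> H; rewrite -row_free_unit; apply: inj_row_free => v vG; apply: H.
by rewrite /inner vG mul0mx mxE.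
Qed.

(** Certifies a candidate c for the Christoffel symbols through the Koszul equations with lowered
    index, so that the metric matrix is never inverted explicitly. It serves the BCV metric, the
    induced metric and the base metric. *)
Lemma christoffel_koszul n (g : 'rV[R]_n.+1 -> 'M[R]_n.+1) p (c : 'I_n.+1 -> R) i j :
  g p \in unitmx ->
  (forall l, 'D_(basis_vec i) (fun q => g q j l) p
     + 'D_(basis_vec j) (fun q => g q i l) p
     - 'D_(basis_vec l) (fun q => g q i j) p = 2 * \sum_k g p l k * c k) ->
  forall k, christoffel g k i j p = c k.
Proof.
move=> ug H k; rewrite /christoffel.
under eq_bigr => a _ do rewrite H mulrCA.
rewrite -mulr_sumr mulKf ?pnatr_eq0 //.
under eq_bigr => a _ do rewrite mulr_sumr.
rewrite exchange_big /=.
have E a : \sum_b invmx (g p) k b * g p b a = (k == a)%:R.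
  by have /matrixP/(_ k a) := mulVmx ug; rewrite !mxE.
transitivity (\sum_a (k == a)%:R * c a).
  by apply: eq_bigr => a _; rewrite -E mulr_suml; apply: eq_bigr => b _; rewrite mulrA.
rewrite (bigD1 k) //= eqxx mul1r big1 ?addr0 // => a ak.
by rewrite eq_sym (negPf ak) mul0r.
Qed.

End Index3.

Section BCVFrame.
Context {R : realType}.
Variables m l : R.
Implicit Types (p v a S : 'rV[R]_3).

Definition bcv_lam p : R := 1 + m * (p 0 0 ^+ 2 + p 0 1 ^+ 2).
Local Notation lam := bcv_lam.

(** Rewriting rule for [field]: eliminating m x^2 lets lam be treated as an independent nonzero
    variable, and the relation between lam, x and y is used up. *)
Lemma lam_eq p : m * p 0 0 ^+ 2 = lam p - 1 - m * p 0 1 ^+ 2.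
Proof. by rewrite /bcv_lam; ring. Qed.

Lemma lamE p : conf_factor m (hopf_proj p) = lam p.
Proof.
rewrite /conf_factor /hopf_proj /bcv_lam !mxE.
have e0 : lshift 1 (0 : 'I_2) = (0 : 'I_3) by exact: val_inj.
have e1 : lshift 1 (1 : 'I_2) = (1 : 'I_3) by exact: val_inj.
by rewrite e0 e1.
Qed.

Lemma bcv_domE p : bcv_dom m p -> 0 < lam p.
Proof. by rewrite /bcv_dom /preimage /base_dom /= lamE. Qed.

(** [bcv_fr1], [bcv_fr2], [bcv_fr3] are the components of v in the orthonormal frame E1, E2, E3; the
    third is the connection 1-form of the fibration evaluated on v. *)
Definition bcv_fr1 p v : R := v 0 0 / lam p.
Definition bcv_fr2 p v : R := v 0 1 / lam p.
Definition bcv_fr3 p v : R :=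
  v 0 ord_max + l / 2 / lam p * (p 0 1 * v 0 0 - p 0 0 * v 0 1).
Local Notation fr1 := bcv_fr1.
Local Notation fr2 := bcv_fr2.
Local Notation fr3 := bcv_fr3.

Definition bcv_theta p (i : 'I_3) : R :=
  (i == ord_max)%:R + l / 2 / lam p * (p 0 1 * (i == 0)%:R - p 0 0 * (i == 1)%:R).
Local Notation theta := bcv_theta.

Lemma bcv_metricE p i j : bcv_metric m l p i j =
  lam p ^- 2 * ((i == 0)%:R * (j == 0)%:R + (i == 1)%:R * (j == 1)%:R)
  + theta p i * theta p j.
Proof.
rewrite /bcv_metric lamE !mxE !big_ord1 !mxE /bcv_theta /= ![_ == 0]eq_sym.
by [].
Qed.

Lemma ord3E : ((0 == 1 :> 'I_3) = false) * ((1 == 0 :> 'I_3) = false) *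
  ((0 == ord_max :> 'I_3) = false) * ((ord_max == 0 :> 'I_3) = false) *
  ((1 == ord_max :> 'I_3) = false) * ((ord_max == 1 :> 'I_3) = false).
Proof. by []. Qed.

Lemma theta0 p : theta p 0 = l / 2 / lam p * p 0 1.
Proof. by rewrite /bcv_theta !ord3E eqxx /= mulr1 mulr0 subr0 add0r. Qed.

Lemma theta1 p : theta p 1 = - (l / 2 / lam p * p 0 0).
Proof. by rewrite /bcv_theta !ord3E eqxx /= mulr1 mulr0 sub0r add0r mulrN. Qed.

Lemma theta2 p : theta p ord_max = 1.
Proof. by rewrite /bcv_theta !ord3E eqxx /= !mulr0 subr0 mulr0 addr0. Qed.

Lemma inner_bcv p u v : inner (bcv_metric m l p) u v =
  fr1 p u * fr1 p v + fr2 p u * fr2 p v + fr3 p u * fr3 p v.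
Proof.
rewrite /inner mxE sum3 !mxE !sum3 !bcv_metricE.
rewrite !theta0 !theta1 !theta2 !ord3E !eqxx /= /bcv_fr1 /bcv_fr2 /bcv_fr3 -exprVn.
by ring.
Qed.

Lemma fr_eq0 p v : lam p != 0 -> fr1 p v = 0 -> fr2 p v = 0 -> fr3 p v = 0 -> v = 0.
Proof.
rewrite /bcv_fr1 /bcv_fr2 /bcv_fr3 => l0 /eqP; rewrite mulf_eq0 invr_eq0 (negPf l0) orbF => /eqP v0.
move=> /eqP; rewrite mulf_eq0 invr_eq0 (negPf l0) orbF => /eqP v1.
rewrite v0 v1 !mulr0 subr0 mulr0 addr0 => v2.
by apply: row3P; rewrite mxE.
Qed.

Lemma sum_sqr3_eq0 (a b c : R) : a * a + b * b + c * c = 0 -> [/\ a = 0, b = 0 & c = 0].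
Proof. by move=> H; split; nra. Qed.

Lemma bcv_unitmx p : lam p != 0 -> bcv_metric m l p \in unitmx.
Proof.
move=> l0; apply: definite_unitmx => v.
by rewrite inner_bcv => /sum_sqr3_eq0[]; exact: fr_eq0.
Qed.

End BCVFrame.

Ltac derV := first
  [ eassumption
  | lazymatch goal with
    | |- is_derive _ _ (fun _ => ?c) _ => exact: dcst
    | |- is_derive _ _ (fun y => @?f y + @?g y) _ => eapply (@dadd _ _ _ _ f g); derV
    | |- is_derive _ _ (fun y => - @?f y) _ => eapply (@dopp _ _ _ _ f); derV
    | |- is_derive _ _ (fun y => @?f y * @?g y) _ => eapply (@dmul _ _ _ _ f g); derV
    | |- is_derive _ _ (fun y => @?f y ^+ _) _ => eapply (@dexp _ _ _ _ f); derV
    | |- is_derive _ _ (fun y => (@?f y)^-1) _ =>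
        eapply (@is_deriveV1 _ _ f); [eassumption | derV]
    end ].

Section BCVConnection.
Context {R : realType}.
Variables m l : R.
Implicit Types (p v a S : 'rV[R]_3).
Local Notation lam := (bcv_lam m).
Local Notation theta := (bcv_theta m l).
Local Notation fr1 := (bcv_fr1 m).
Local Notation fr2 := (bcv_fr2 m).
Local Notation fr3 := (bcv_fr3 m l).
Local Notation g := (bcv_metric m l).

Lemma is_derive_coordinate n (p v : 'rV[R]_n.+1) i :
  is_derive p v (fun q : 'rV[R]_n.+1 => q 0 i) (v 0 i).
Proof.
have [d1 d2] := @is_derive_id R 'rV[R]_n.+1 p v.
by have := @derive_coord R _ 0 n id p v 0 i d1; rewrite d2.
Qed.

Definition dlam p v : R := m * (2 * p 0 0 * v 0 0 + 2 * p 0 1 * v 0 1).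

Lemma is_derive_lam p v : is_derive p v lam (dlam p v).
Proof.
have d0 := is_derive_coordinate p v 0.
have d1 := is_derive_coordinate p v 1.
rewrite /bcv_lam; eapply is_derive_eq; first by derV.
by rewrite /dlam; ring.
Qed.

Definition gam1 p a S : R :=
  - (2 * m / lam p) * (p 0 0 * a 0 0 * S 0 0 + p 0 1 * a 0 1 * S 0 0
     + p 0 1 * a 0 0 * S 0 1 - p 0 0 * a 0 1 * S 0 1)
  + l / 2 * (a 0 1 * fr3 p S + fr3 p a * S 0 1).

Definition gam2 p a S : R :=
  - (2 * m / lam p) * (p 0 0 * a 0 0 * S 0 1 + p 0 1 * a 0 1 * S 0 1
     - p 0 1 * a 0 0 * S 0 0 + p 0 0 * a 0 1 * S 0 0)
  - l / 2 * (fr3 p a * S 0 0 + a 0 0 * fr3 p S).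

Definition gam3 p a S : R :=
  l / 2 * m / lam p ^+ 2 *
    (- 2 * (p 0 0 * a 0 0 + p 0 1 * a 0 1) * (p 0 1 * S 0 0 - p 0 0 * S 0 1)
     + (p 0 0 ^+ 2 + p 0 1 ^+ 2) * (a 0 1 * S 0 0 - a 0 0 * S 0 1))
  - l / 2 / lam p * (p 0 1 * gam1 p a S - p 0 0 * gam2 p a S).

Definition bcv_gam (k : 'I_3) p a S : R :=
  if k == 0 then gam1 p a S else if k == 1 then gam2 p a S else gam3 p a S.
Local Notation gam := bcv_gam.

Definition dtheta p v (i : 'I_3) : R :=
  l / 2 * (- dlam p v / lam p ^+ 2) * (p 0 1 * (i == 0)%:R - p 0 0 * (i == 1)%:R)
  + l / 2 / lam p * (v 0 1 * (i == 0)%:R - v 0 0 * (i == 1)%:R).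

Lemma is_derive_bcv p v i j : lam p != 0 ->
  is_derive p v (fun q => g q i j)
    (- (2 * dlam p v / lam p ^+ 3)
       * ((i == 0)%:R * (j == 0)%:R + (i == 1)%:R * (j == 1)%:R)
     + dtheta p v i * theta p j + theta p i * dtheta p v j).
Proof.
move=> l0.
have d0 := is_derive_coordinate p v 0.
have d1 := is_derive_coordinate p v 1.
have dl := is_derive_lam p v.
rewrite (_ : (fun q => g q i j) = fun q =>
  (lam q)^-1 * (lam q)^-1 * ((i == 0)%:R * (j == 0)%:R + (i == 1)%:R * (j == 1)%:R)
  + theta q i * theta q j); last first.
  by apply/funext => q; rewrite bcv_metricE -exprVn expr2.
rewrite /bcv_theta; eapply is_derive_eq; first by derV.
by rewrite /dtheta /bcv_theta; field.
Qed.

Lemma basis_vecE n (i j : 'I_n.+1) : (@basis_vec R n i) 0 j = (j == i)%:R.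
Proof. by rewrite /basis_vec mxE eqxx. Qed.

Lemma christoffel_bcv p : lam p != 0 ->
  forall k i j, christoffel g k i j p = gam k p (basis_vec i) (basis_vec j).
Proof.
move=> l0 k i j; move: k.
apply: (@christoffel_koszul R _ g p (fun k => gam k p (basis_vec i) (basis_vec j)) i j).
  exact: bcv_unitmx.
have D v (i' j' : 'I_3) := @derive_val _ _ _ _ _ _ _ (@is_derive_bcv p v i' j' l0).
have lE := lam_eq m p.
move=> h; rewrite !D; move: h i j.
rewrite /dtheta /dlam.
apply: forall3; apply: forall3; apply: forall3;
  rewrite sum3 !bcv_metricE !basis_vecE !theta0 !theta1 !theta2 /bcv_gam !(ord3E, eqxx) /=
  /gam3 /gam2 /gam1 /bcv_fr3 !basis_vecE !(ord3E, eqxx) /=; (field: lE); exact: l0.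
Qed.

Lemma gam_sum p a S k :
  \sum_i \sum_j gam k p (basis_vec i) (basis_vec j) * a 0 i * S 0 j = gam k p a S.
Proof.
rewrite !sum3; move: k; apply: forall3;
  rewrite /bcv_gam !(ord3E, eqxx) /= /gam3 /gam2 /gam1 /bcv_fr3 !basis_vecE !(ord3E, eqxx) /=; ring.
Qed.

Lemma cov_deriv_bcvE (V : normedModType R) (psi S : V -> 'rV[R]_3) X u k :
  lam (psi u) != 0 -> cov_deriv g psi X S u 0 k =
  ('D_X S u) 0 k + gam k (psi u) ('D_X psi u) (S u).
Proof.
move=> l0; rewrite /cov_deriv !mxE -gam_sum; congr (_ + _).
by apply: eq_bigr => i _; apply: eq_bigr => j _; rewrite christoffel_bcv.
Qed.

(** In frame components nabla_v S = dS(v) + Omega(v) x S, where Omega(v) = ((l/2) v1, (l/2) v2,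
    [bcv_om3] p v). The lemmas [is_derive_fr1], [is_derive_fr2], [is_derive_fr3] are the three
    components of this formula, solved for dS. *)
Definition bcv_om3 p v : R :=
  - (l / 2) * fr3 p v + 2 * m * (p 0 1 * fr1 p v - p 0 0 * fr2 p v).
Local Notation om3 := bcv_om3.

Section Along.
Variables (V : normedModType R) (psi S : V -> 'rV[R]_3) (X u : V).
Hypotheses (l0 : lam (psi u) != 0) (dpsi : derivable psi u X) (dS : derivable S u X).
Let p := psi u.
Let v := 'D_X psi u.
Let s := S u.
Let N := cov_deriv g psi X S u.

Let dp i : is_derive u X (fun w => psi w 0 i) (v 0 i).
Proof. exact: derive_coord. Qed.

Let ds i : is_derive u X (fun w => S w 0 i) (N 0 i - gam i p v s).
Proof. by rewrite /N cov_deriv_bcvE // addrK; exact: derive_coord. Qed.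

Lemma is_derive_lam_along : is_derive u X (fun w => lam (psi w)) (dlam p v).
Proof.
have d0 := dp 0; have d1 := dp 1.
rewrite /bcv_lam; eapply is_derive_eq; first by derV.
by rewrite /dlam /p; ring.
Qed.

Lemma is_derive_fr1 : is_derive u X (fun w => fr1 (psi w) (S w))
  (fr1 p N - (l / 2 * fr2 p v * fr3 p s - om3 p v * fr2 p s)).
Proof.
have d0 := ds 0; have dl := is_derive_lam_along.
rewrite /bcv_fr1; eapply is_derive_eq; first by derV.
rewrite /bcv_gam /= /gam1 /bcv_om3 /bcv_fr1 /bcv_fr2 /bcv_fr3 /dlam -/p -/s.
by field.
Qed.

Lemma is_derive_fr2 : is_derive u X (fun w => fr2 (psi w) (S w))
  (fr2 p N - (om3 p v * fr1 p s - l / 2 * fr1 p v * fr3 p s)).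
Proof.
have d0 := ds 1; have dl := is_derive_lam_along.
rewrite /bcv_fr2; eapply is_derive_eq; first by derV.
rewrite /bcv_gam !(ord3E, eqxx) /= /gam2 /bcv_om3 /bcv_fr1 /bcv_fr2 /bcv_fr3 /dlam -/p -/s.
by field.
Qed.

Lemma is_derive_fr3 : is_derive u X (fun w => fr3 (psi w) (S w))
  (fr3 p N - (l / 2 * fr1 p v * fr2 p s - l / 2 * fr2 p v * fr1 p s)).
Proof.
have d0 := ds 0; have d1 := ds 1; have d2 := ds ord_max.
have e0 := dp 0; have e1 := dp 1; have dl := is_derive_lam_along.
rewrite /bcv_fr3; eapply is_derive_eq; first by derV.
rewrite /bcv_gam !(ord3E, eqxx) /= /gam3 /gam2 /gam1 /bcv_om3 /bcv_fr1 /bcv_fr2 /bcv_fr3 /dlam -/p -/s.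
have lE := lam_eq m p.
by field: lE.
Qed.

End Along.

End BCVConnection.

(** * The curvature tensor in the frame *)

Section BCVCurvature.
Context {R : realType}.
Variables m l : R.
Implicit Types (p v a S X Y Z : 'rV[R]_3).
Local Notation lam := (bcv_lam m).
Local Notation fr1 := (bcv_fr1 m).
Local Notation fr2 := (bcv_fr2 m).
Local Notation fr3 := (bcv_fr3 m l).
Local Notation g := (bcv_metric m l).
Local Notation gam := (bcv_gam m l).

Definition dfr3 p v S : R := l / 2 * ((- dlam m p v / lam p ^+ 2) * (p 0 1 * S 0 0 - p 0 0 * S 0 1)
   + (v 0 1 * S 0 0 - v 0 0 * S 0 1) / lam p).

Definition dgam1 p v a S : R :=
  2 * m * dlam m p v / lam p ^+ 2 * (p 0 0 * a 0 0 * S 0 0 + p 0 1 * a 0 1 * S 0 0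
     + p 0 1 * a 0 0 * S 0 1 - p 0 0 * a 0 1 * S 0 1)
  - 2 * m / lam p * (v 0 0 * a 0 0 * S 0 0 + v 0 1 * a 0 1 * S 0 0
     + v 0 1 * a 0 0 * S 0 1 - v 0 0 * a 0 1 * S 0 1)
  + l / 2 * (a 0 1 * dfr3 p v S + dfr3 p v a * S 0 1).

Definition dgam2 p v a S : R :=
  2 * m * dlam m p v / lam p ^+ 2 * (p 0 0 * a 0 0 * S 0 1 + p 0 1 * a 0 1 * S 0 1
     - p 0 1 * a 0 0 * S 0 0 + p 0 0 * a 0 1 * S 0 0)
  - 2 * m / lam p * (v 0 0 * a 0 0 * S 0 1 + v 0 1 * a 0 1 * S 0 1
     - v 0 1 * a 0 0 * S 0 0 + v 0 0 * a 0 1 * S 0 0)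
  - l / 2 * (dfr3 p v a * S 0 0 + a 0 0 * dfr3 p v S).

Definition dgam3 p v a S : R :=
  - (l * m * dlam m p v / lam p ^+ 3) *
    (- 2 * (p 0 0 * a 0 0 + p 0 1 * a 0 1) * (p 0 1 * S 0 0 - p 0 0 * S 0 1)
     + (p 0 0 ^+ 2 + p 0 1 ^+ 2) * (a 0 1 * S 0 0 - a 0 0 * S 0 1))
  + l / 2 * m / lam p ^+ 2 *
    (- 2 * (v 0 0 * a 0 0 + v 0 1 * a 0 1) * (p 0 1 * S 0 0 - p 0 0 * S 0 1)
     - 2 * (p 0 0 * a 0 0 + p 0 1 * a 0 1) * (v 0 1 * S 0 0 - v 0 0 * S 0 1)
     + 2 * (p 0 0 * v 0 0 + p 0 1 * v 0 1) * (a 0 1 * S 0 0 - a 0 0 * S 0 1))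
  + l / 2 * dlam m p v / lam p ^+ 2 * (p 0 1 * gam1 m l p a S - p 0 0 * gam2 m l p a S)
  - l / 2 / lam p * (v 0 1 * gam1 m l p a S + p 0 1 * dgam1 p v a S
     - v 0 0 * gam2 m l p a S - p 0 0 * dgam2 p v a S).

Definition bcv_dgam (k : 'I_3) p v a S : R :=
  if k == 0 then dgam1 p v a S else if k == 1 then dgam2 p v a S else dgam3 p v a S.
Local Notation dgam := bcv_dgam.

Lemma is_derive_gam k p v a S : lam p != 0 ->
  is_derive p v (fun q => gam k q a S) (dgam k p v a S).
Proof.
move=> l0.
have d0 := is_derive_coordinate p v 0.
have d1 := is_derive_coordinate p v 1.
have dl := is_derive_lam m p v.
have D1 : is_derive p v (fun q => gam1 m l q a S) (dgam1 p v a S).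
  rewrite /gam1 /bcv_fr3; eapply is_derive_eq; first by derV.
  by rewrite /dgam1 /dfr3; field.
have D2 : is_derive p v (fun q => gam2 m l q a S) (dgam2 p v a S).
  rewrite /gam2 /bcv_fr3; eapply is_derive_eq; first by derV.
  by rewrite /dgam2 /dfr3; field.
rewrite /bcv_gam /bcv_dgam; case: (k == 0) => //; case: (k == 1) => //.
have l2 : lam p ^+ 2 != 0 by rewrite expf_eq0.
rewrite /gam3; eapply is_derive_eq; first by derV.
by rewrite /dgam3; field.
Qed.

(** In frame components R(X,Y)Z = Z x rho(X x Y), where the curvature operator rho is diagonal:
    l^2/4 on E1 and E2 (planes containing E3) and 4m - 3 l^2/4 on E3 (the horizontal plane). The
    last lines convert the frame components w1, w2, w3 back to coordinates. *)
Definition bcv_crv (k : 'I_3) p X Y Z : R :=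
  let c1 := fr2 p X * fr3 p Y - fr3 p X * fr2 p Y in
  let c2 := fr3 p X * fr1 p Y - fr1 p X * fr3 p Y in
  let c3 := fr1 p X * fr2 p Y - fr2 p X * fr1 p Y in
  let r1 := (l / 2) ^+ 2 * c1 in
  let r2 := (l / 2) ^+ 2 * c2 in
  let r3 := (4 * m - 3 / 4 * l ^+ 2) * c3 in
  let w1 := r3 * fr2 p Z - r2 * fr3 p Z in
  let w2 := r1 * fr3 p Z - r3 * fr1 p Z in
  let w3 := r2 * fr1 p Z - r1 * fr2 p Z in
  if k == 0 then lam p * w1 else if k == 1 then lam p * w2 else
  w3 - l / 2 * (p 0 1 * w1 - p 0 0 * w2).
Local Notation crv := bcv_crv.

Definition bcv_bracket p (k i j h : 'I_3) : R :=
  dgam k p (basis_vec i) (basis_vec j) (basis_vec h)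
  - dgam k p (basis_vec j) (basis_vec i) (basis_vec h)
  + \sum_q (gam k p (basis_vec i) (basis_vec q) * gam q p (basis_vec j) (basis_vec h)
     - gam k p (basis_vec j) (basis_vec q) * gam q p (basis_vec i) (basis_vec h)).
Local Notation bracket := bcv_bracket.

(** Both sides are antisymmetric in the first two indices, so only the three pairs i < j call for a
    computation. *)
Lemma bracketE01 p k h : lam p != 0 ->
  bracket p k 0 1 h = crv k p (basis_vec 0) (basis_vec 1) (basis_vec h).
Proof.
move=> l0; have lE := lam_eq m p; move: k h; rewrite /bcv_bracket.
apply: forall3; apply: forall3;
 rewrite sum3 /bcv_dgam /bcv_gam /bcv_crv !(ord3E, eqxx) /= /dgam3 /dgam2 /dgam1 /gam3 /gam2 /gam1
   /dfr3 /dlam /bcv_fr3 /bcv_fr1 /bcv_fr2 !basis_vecE !(ord3E, eqxx) /=; (field: lE); exact: l0.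
Qed.

Lemma bracketE02 p k h : lam p != 0 ->
  bracket p k 0 ord_max h = crv k p (basis_vec 0) (basis_vec ord_max) (basis_vec h).
Proof.
move=> l0; have lE := lam_eq m p; move: k h; rewrite /bcv_bracket.
apply: forall3; apply: forall3;
 rewrite sum3 /bcv_dgam /bcv_gam /bcv_crv !(ord3E, eqxx) /= /dgam3 /dgam2 /dgam1 /gam3 /gam2 /gam1
   /dfr3 /dlam /bcv_fr3 /bcv_fr1 /bcv_fr2 !basis_vecE !(ord3E, eqxx) /=; (field: lE); exact: l0.
Qed.

Lemma bracketE12 p k h : lam p != 0 ->
  bracket p k 1 ord_max h = crv k p (basis_vec 1) (basis_vec ord_max) (basis_vec h).
Proof.
move=> l0; have lE := lam_eq m p; move: k h; rewrite /bcv_bracket.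
apply: forall3; apply: forall3;
 rewrite sum3 /bcv_dgam /bcv_gam /bcv_crv !(ord3E, eqxx) /= /dgam3 /dgam2 /dgam1 /gam3 /gam2 /gam1
   /dfr3 /dlam /bcv_fr3 /bcv_fr1 /bcv_fr2 !basis_vecE !(ord3E, eqxx) /=; (field: lE); exact: l0.
Qed.

Lemma bracketN p k i j h : bracket p k i j h = - bracket p k j i h.
Proof.
rewrite /bcv_bracket opprD opprB -sumrN; congr (_ + _).
by apply: eq_bigr => q _; rewrite opprB.
Qed.

Lemma crvN p k X Y Z : crv k p X Y Z = - crv k p Y X Z.
Proof. by rewrite /bcv_crv; case: (k == 0); [ring | case: (k == 1); ring]. Qed.

Lemma bracketE p k i j h : lam p != 0 ->
  bracket p k i j h = crv k p (basis_vec i) (basis_vec j) (basis_vec h).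
Proof.
move=> l0; have D (x : R) : x = - x -> x = 0 by move=> H; lra.
move: i j; apply: forall3; apply: forall3; rewrite ?bracketE01 ?bracketE02 ?bracketE12 //;
 try (rewrite bracketN crvN ?bracketE01 ?bracketE02 ?bracketE12 //);
 by rewrite (D _ (bracketN _ _ _ _ _)) (D _ (crvN _ _ _ _ _)).
Qed.

End BCVCurvature.

Section BCVCurvature2.
Context {R : realType}.
Variables m l : R.
Implicit Types (p v a S X Y Z : 'rV[R]_3).
Local Notation lam := (bcv_lam m).
Local Notation fr1 := (bcv_fr1 m).
Local Notation fr2 := (bcv_fr2 m).
Local Notation fr3 := (bcv_fr3 m l).
Local Notation g := (bcv_metric m l).
Local Notation gam := (bcv_gam m l).
Local Notation crv := (bcv_crv m l).
Local Notation dgam := (bcv_dgam m l).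
Local Notation bracket := (bcv_bracket m l).

Lemma smooth_on_id (V : normedModType R) (A : set V) : smooth_on A (id : V -> V).
Proof.
move=> [|k]; split => //; try by move=> x _; exact: cvg_id.
move=> v; split; first by move=> x _; exact: derivable_id.
by rewrite (_ : 'D_v _ = fun=> v);
  [exact: Ck_on_cst | apply/funext => x; exact: derive_id].
Qed.

Lemma smooth_on_lam (V : normedModType R) (A : set V) (psi : V -> 'rV[R]_3) : open A ->
  smooth_on A psi -> smooth_on A (fun w => lam (psi w)).
Proof.
move=> oA sp; have s0 := smooth_on_coord 0 0 oA sp; have s1 := smooth_on_coord 0 1 oA sp.
apply: (smooth_onD oA); first exact: smooth_on_cst.
apply: (smooth_onM oA); first exact: smooth_on_cst.
by apply: (smooth_onD oA); apply: (smooth_onX _ oA).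
Qed.

Lemma continuous_lam p : {for p, continuous lam}.
Proof.
exact: (smooth_on_continuous (smooth_on_lam openT (@smooth_on_id 'rV[R]_3 setT)) I).
Qed.

Lemma near_lam_neq0 p : lam p != 0 -> \forall q \near p, lam q != 0.
Proof.
move=> l0; apply: (@continuous_lam p [set x | x != 0]).
apply: open_nbhs_nbhs; split => //; exact: open_neq.
Qed.

(** Both sides are trilinear, and the arguments are reduced to coordinate vectors one at a time.
    Differentiating the Christoffel symbols requires their closed form on a neighbourhood of p,
    where lam stays nonzero. *)
Lemma curvature_bcvE p X Y Z k : lam p != 0 -> curvature g p X Y Z 0 k = crv k p X Y Z.
Proof.
move=> l0; rewrite /curvature mxE.
transitivity (\sum_i \sum_j \sum_h X 0 i * Y 0 j * Z 0 h * bracket p k i j h).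
  apply: eq_bigr => i _; apply: eq_bigr => j _; apply: eq_bigr => h _; congr (_ * _).
  have D i' j' k' v : 'D_v (christoffel g k' i' j') p = dgam k' p v (basis_vec i') (basis_vec j').
    have [_ <-] := @is_derive_gam R m l k' p v (basis_vec i') (basis_vec j') l0.
    apply: near_eq_derive; apply: filterS (near_lam_neq0 l0) => q lq.
    by rewrite christoffel_bcv.
  rewrite /bcv_bracket !D; congr (_ + _); apply: eq_bigr => q _.
  by rewrite !christoffel_bcv.
transitivity (\sum_i \sum_j X 0 i * Y 0 j * crv k p (basis_vec i) (basis_vec j) Z).
  apply: eq_bigr => i _; apply: eq_bigr => j _; rewrite sum3 !bracketE //.
  rewrite -!mulrA -!mulrDr; congr (_ * (_ * _)).
  rewrite /bcv_crv; case: (k == 0); last case: (k == 1);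
   by rewrite /bcv_fr1 /bcv_fr2 /bcv_fr3 !basis_vecE !(ord3E, eqxx) /=; ring.
transitivity (\sum_i X 0 i * crv k p (basis_vec i) Y Z).
  apply: eq_bigr => i _; rewrite sum3 -!mulrA -!mulrDr; congr (_ * _).
  rewrite /bcv_crv; case: (k == 0); last case: (k == 1);
   by rewrite /bcv_fr1 /bcv_fr2 /bcv_fr3 !basis_vecE !(ord3E, eqxx) /=; ring.
rewrite sum3.
rewrite /bcv_crv; case: (k == 0); last case: (k == 1);
  by rewrite /bcv_fr1 /bcv_fr2 /bcv_fr3 !basis_vecE !(ord3E, eqxx) /=; ring.
Qed.

Lemma fr_curvature p X Y Z : lam p != 0 ->
  let C := curvature g p X Y Z in
  let c1 := fr2 p X * fr3 p Y - fr3 p X * fr2 p Y in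
  let c2 := fr3 p X * fr1 p Y - fr1 p X * fr3 p Y in
  let c3 := fr1 p X * fr2 p Y - fr2 p X * fr1 p Y in
  let r1 := (l / 2) ^+ 2 * c1 in
  let r2 := (l / 2) ^+ 2 * c2 in
  let r3 := (4 * m - 3 / 4 * l ^+ 2) * c3 in
  [/\ fr1 p C = r3 * fr2 p Z - r2 * fr3 p Z,
      fr2 p C = r1 * fr3 p Z - r3 * fr1 p Z &
      fr3 p C = r2 * fr1 p Z - r1 * fr2 p Z].
Proof.
move=> l0 C c1 c2 c3 r1 r2 r3; have E k : C 0 k = _ := @curvature_bcvE p X Y Z k l0.
split.
- by rewrite {1}/bcv_fr1 E /bcv_crv eqxx -/c1 -/c2 -/c3 -/r1 -/r2 -/r3 mulrAC mulfV ?mul1r.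
- by rewrite {1}/bcv_fr2 E /bcv_crv !(ord3E, eqxx) /= -/c1 -/c2 -/c3 -/r1 -/r2 -/r3 mulrAC mulfV ?mul1r.
- rewrite {1}/bcv_fr3 !E /bcv_crv !(ord3E, eqxx) /= -/c1 -/c2 -/c3 -/r1 -/r2 -/r3.
  by field.
Qed.

End BCVCurvature2.

(** * Parallel surfaces *)

Section RiccatiAbstract.
Context {R : realType}.
Variables (m l : R) (V : normedModType R) (A : set V) (d0 da : V).
Variables x y n1 n2 n3 f1 f2 f3 b1 b2 b3 : V -> R.
Let t := l / 2.
Let L w := 1 + m * (x w ^+ 2 + y w ^+ 2).
Let o w := - t * n3 w + 2 * m * (y w * n1 w - x w * n2 w).
Let oa w := - t * f3 w + 2 * m * (y w * f1 w - x w * f2 w).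
Hypotheses (oA : open A) (sn1 : smooth_on A n1) (sn2 : smooth_on A n2)
  (sn3 : smooth_on A n3).
Hypothesis x0 : forall w, A w -> is_derive w d0 x (L w * n1 w).
Hypothesis y0 : forall w, A w -> is_derive w d0 y (L w * n2 w).
Hypothesis xa : forall w, A w -> is_derive w da x (L w * f1 w).
Hypothesis ya : forall w, A w -> is_derive w da y (L w * f2 w).
Hypothesis geo : forall w, A w ->
  [/\ is_derive w d0 n1 (- (t * n2 w * n3 w - o w * n2 w)),
      is_derive w d0 n2 (- (o w * n1 w - t * n1 w * n3 w)) &
      is_derive w d0 n3 0].
Hypothesis nor : forall w, A w ->
  [/\ is_derive w da n1 (b1 w - (t * f2 w * n3 w - oa w * n2 w)),
      is_derive w da n2 (b2 w - (oa w * n1 w - t * f1 w * n3 w)) &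
      is_derive w da n3 (b3 w - (t * f1 w * n2 w - t * f2 w * n1 w))].
Hypothesis tan : forall w, A w ->
  [/\ is_derive w d0 f1 (b1 w - (t * n2 w * f3 w - o w * f2 w)),
      is_derive w d0 f2 (b2 w - (o w * f1 w - t * n1 w * f3 w)) &
      is_derive w d0 f3 (b3 w - (t * n1 w * f2 w - t * n2 w * f1 w))].

(** Symmetry of second derivatives in the form needed for the Riccati equation: the d0-derivative of
    ['D_da h] is read off from the known formula k for the d0-derivative of h. *)
Lemma is_derive_swap (h k : V -> R) w c : A w -> smooth_on A h ->
  (forall w, A w -> is_derive w d0 h (k w)) -> is_derive w da k c ->
  is_derive w d0 ('D_da h) c.
Proof.
move=> Aw sh hk [dk ck]; split.
  exact: smooth_on_derivable (smooth_on_derive da sh) Aw.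
rewrite (@smooth_on_derive_comm R V A h w d0 da oA Aw sh) -ck.
apply: near_eq_derive; apply: filterS (open_nbhs_nbhs (conj oA Aw)) => z Az.
by case: (hk z Az).
Qed.

(* The Riccati equation: [R(F_r, F_a) F_r] enters because [nabla_r F_r = 0]. *)
Lemma riccati_abstract w : A w ->
  let c1 := n2 w * f3 w - n3 w * f2 w in
  let c2 := n3 w * f1 w - n1 w * f3 w in
  let c3 := n1 w * f2 w - n2 w * f1 w in
  let r1 := t ^+ 2 * c1 in
  let r2 := t ^+ 2 * c2 in
  let r3 := (4 * m - 3 / 4 * l ^+ 2) * c3 in
  [/\ is_derive w d0 b1 (r3 * n2 w - r2 * n3 w - (t * n2 w * b3 w - o w * b2 w)),
      is_derive w d0 b2 (r1 * n3 w - r3 * n1 w - (o w * b1 w - t * n1 w * b3 w)) &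
      is_derive w d0 b3 (r2 * n1 w - r1 * n2 w - (t * n1 w * b2 w - t * n2 w * b1 w))].
Proof.
move=> Aw c1 c2 c3 r1 r2 r3.
have [gn1 gn2 gn3] := geo Aw.
have [an1 an2 an3] := nor Aw.
have [gf1 gf2 gf3] := tan Aw.
have hx0 := x0 Aw; have hy0 := y0 Aw; have hxa := xa Aw; have hya := ya Aw.
have lE : m * x w ^+ 2 = L w - 1 - m * y w ^+ 2 by rewrite /L; ring.
have ho : is_derive w da o (- t * (b3 w - (t * f1 w * n2 w - t * f2 w * n1 w))
   + 2 * m * (L w * f2 w * n1 w + y w * (b1 w - (t * f2 w * n3 w - oa w * n2 w))
     - (L w * f1 w * n2 w + x w * (b2 w - (oa w * n1 w - t * f1 w * n3 w))))).
  by rewrite /o; eapply is_derive_eq; [derV | ring].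
have hoa : is_derive w d0 oa (- t * (b3 w - (t * n1 w * f2 w - t * n2 w * f1 w))
   + 2 * m * (L w * n2 w * f1 w + y w * (b1 w - (t * n2 w * f3 w - o w * f2 w))
     - (L w * n1 w * f2 w + x w * (b2 w - (o w * f1 w - t * n1 w * f3 w))))).
  by rewrite /oa; eapply is_derive_eq; [derV | ring].
(* No derivative of b is given. Near w, however, b equals the da-derivative of n plus connection
   terms, and this expression can be differentiated along d0. *)
have ab1 : \near w, 'D_da n1 w + (t * f2 w * n3 w - oa w * n2 w) = b1 w.
  apply: filterS (open_nbhs_nbhs (conj oA Aw)) => z Az.
  by have [[_ ->] _ _] := nor Az; rewrite subrK.
have ab2 : \near w, 'D_da n2 w + (oa w * n1 w - t * f1 w * n3 w) = b2 w.
  apply: filterS (open_nbhs_nbhs (conj oA Aw)) => z Az.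
  by have [_ [_ ->] _] := nor Az; rewrite subrK.
have ab3 : \near w, 'D_da n3 w + (t * f1 w * n2 w - t * f2 w * n1 w) = b3 w.
  apply: filterS (open_nbhs_nbhs (conj oA Aw)) => z Az.
  by have [_ _ [_ ->]] := nor Az; rewrite subrK.
have oE : o w = - t * n3 w + 2 * m * (y w * n1 w - x w * n2 w) by [].
have oaE : oa w = - t * f3 w + 2 * m * (y w * f1 w - x w * f2 w) by [].
clearbody o oa L.
split.
- have H1 := dopp (dadd (dmul (dmul (dcst w da t) an2) an3) (dopp (dmul ho an2))).
  have H := is_derive_swap Aw sn1 (fun z Az => let: And3 h _ _ := geo Az in h) H1.
  apply: (near_eq_is_derive ab1); eapply is_derive_eq; first by derV.
  by rewrite /r3 /r2 /c2 /c3 oE oaE /t; field: lE.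
- have H1 := dopp (dadd (dmul ho an1) (dopp (dmul (dmul (dcst w da t) an1) an3))).
  have H := is_derive_swap Aw sn2 (fun z Az => let: And3 _ h _ := geo Az in h) H1.
  apply: (near_eq_is_derive ab2); eapply is_derive_eq; first by derV.
  by rewrite /r3 /r1 /c1 /c3 oE oaE /t; field: lE.
- have H := is_derive_swap Aw sn3 (fun z Az => let: And3 _ _ h := geo Az in h) (dcst w da 0).
  apply: (near_eq_is_derive ab3); eapply is_derive_eq; first by derV.
  by rewrite /r2 /r1 /c1 /c2; ring.
Qed.

End RiccatiAbstract.

Section AlongMap.
Context {R : realType}.
Variables m l : R.
Local Notation lam := (bcv_lam m).
Local Notation fr1 := (bcv_fr1 m).
Local Notation fr2 := (bcv_fr2 m).
Local Notation fr3 := (bcv_fr3 m l).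
Local Notation om3 := (bcv_om3 m l).
Local Notation g := (bcv_metric m l).
Local Notation gam := (bcv_gam m l).
Variables (V : normedModType R) (A : set V) (F : V -> 'rV[R]_3).
Hypotheses (oA : open A) (sF : smooth_on A F) (lF : forall w, A w -> lam (F w) != 0).

Lemma smooth_on_fr (S : V -> 'rV[R]_3) : smooth_on A S ->
  [/\ smooth_on A (fun w => fr1 (F w) (S w)), smooth_on A (fun w => fr2 (F w) (S w)) &
      smooth_on A (fun w => fr3 (F w) (S w))].
Proof.
move=> sS.
have s i := smooth_on_coord 0 i oA sS; have f i := smooth_on_coord 0 i oA sF.
have sl := smooth_onV oA lF (smooth_on_lam m oA sF).
have c := smooth_on_cst A (l / 2 : R).
split; [exact: (smooth_onM oA) | exact: (smooth_onM oA) | apply: (smooth_onD oA) => //].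
apply: (smooth_onM oA); first exact: (smooth_onM oA).
by apply: (smooth_onB oA); exact: (smooth_onM oA).
Qed.

Lemma smooth_on_derive_comm_mx (f : V -> 'rV[R]_3) w X Y : A w -> smooth_on A f ->
  'D_X ('D_Y f) w = 'D_Y ('D_X f) w.
Proof.
move=> Aw sf; apply/rowP => i.
have H Z Z' : 'D_Z ('D_Z' f) w 0 i = 'D_Z ('D_Z' (fun y => f y 0 i)) w.
  have [_ <-] := derive_coord 0 i
    (@smooth_on_derivable _ _ _ A _ w Z (smooth_on_derive Z' sf) Aw).
  apply: near_eq_derive; apply: filterS (open_nbhs_nbhs (conj oA Aw)) => y Ay.
  by have [_ ->] := derive_coord 0 i (@smooth_on_derivable _ _ _ A _ y Z' sf Ay).
have C := @smooth_on_derive_comm R V A (fun y => f y 0 i) w X Y oA Aw (smooth_on_coord 0 i oA sf).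
exact: (etrans (H X Y) (etrans C (esym (H Y X)))).
Qed.

Lemma gam_sym k p a S : gam k p a S = gam k p S a.
Proof.
rewrite /bcv_gam; case: (k == 0); first by rewrite /gam1; ring.
case: (k == 1); first by rewrite /gam2; ring.
rewrite /gam3.
rewrite /gam2.
rewrite /gam1.
move: (lam p) (fr3 p a) (fr3 p S) => L A1 A2.
ring.
Qed.

(** Absence of torsion: second derivatives commute, and the Christoffel map is symmetric. *)
Lemma cov_deriv_sym w X Y : A w ->
  cov_deriv g F X ('D_Y F) w = cov_deriv g F Y ('D_X F) w.
Proof.
move=> Aw; apply/rowP => i; have l0 := lF Aw.
have E Z Z' := @cov_deriv_bcvE R m l V F ('D_Z F) Z' w i l0.
apply: (etrans (E Y X)); apply: (etrans _ (esym (E X Y))).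
rewrite (gam_sym i _ ('D_X F w)).
by rewrite (smooth_on_derive_comm_mx X Y Aw sF).
Qed.

Variables (d0 da : V).
Let n1 w := fr1 (F w) ('D_d0 F w).
Let n2 w := fr2 (F w) ('D_d0 F w).
Let n3 w := fr3 (F w) ('D_d0 F w).
Let f1 w := fr1 (F w) ('D_da F w).
Let f2 w := fr2 (F w) ('D_da F w).
Let f3 w := fr3 (F w) ('D_da F w).
Let b1 w := fr1 (F w) (cov_deriv g F da ('D_d0 F) w).
Let b2 w := fr2 (F w) (cov_deriv g F da ('D_d0 F) w).
Let b3 w := fr3 (F w) (cov_deriv g F da ('D_d0 F) w).
Let t := l / 2.
Let o w := om3 (F w) ('D_d0 F w).
Let oa w := om3 (F w) ('D_da F w).

Lemma is_derive_normal w : A w ->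
  [/\ is_derive w da n1 (b1 w - (t * f2 w * n3 w - oa w * n2 w)),
      is_derive w da n2 (b2 w - (oa w * n1 w - t * f1 w * n3 w)) &
      is_derive w da n3 (b3 w - (t * f1 w * n2 w - t * f2 w * n1 w))].
Proof.
move=> Aw; have dF := @smooth_on_derivable _ _ _ A F w da sF Aw.
have dD := @smooth_on_derivable _ _ _ A _ w da (smooth_on_derive d0 sF) Aw.
have l0 := lF Aw.
by split; [exact: is_derive_fr1 | exact: is_derive_fr2 | exact: is_derive_fr3].
Qed.

Lemma is_derive_tangent w : A w ->
  [/\ is_derive w d0 f1 (b1 w - (t * n2 w * f3 w - o w * f2 w)),
      is_derive w d0 f2 (b2 w - (o w * f1 w - t * n1 w * f3 w)) &
      is_derive w d0 f3 (b3 w - (t * n1 w * f2 w - t * n2 w * f1 w))].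
Proof.
move=> Aw; have dF := @smooth_on_derivable _ _ _ A F w d0 sF Aw.
have dD := @smooth_on_derivable _ _ _ A _ w d0 (smooth_on_derive da sF) Aw.
have l0 := lF Aw.
rewrite /b1 /b2 /b3 (cov_deriv_sym da d0 Aw).
by split; [exact: is_derive_fr1 | exact: is_derive_fr2 | exact: is_derive_fr3].
Qed.

Hypothesis geo : forall w, A w -> cov_deriv g F d0 ('D_d0 F) w = 0.

Lemma is_derive_geodesic w : A w ->
  [/\ is_derive w d0 n1 (- (t * n2 w * n3 w - o w * n2 w)),
      is_derive w d0 n2 (- (o w * n1 w - t * n1 w * n3 w)) &
      is_derive w d0 n3 0].
Proof.
move=> Aw; have dF := @smooth_on_derivable _ _ _ A F w d0 sF Aw.
have dD := @smooth_on_derivable _ _ _ A _ w d0 (smooth_on_derive d0 sF) Aw.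
have l0 := lF Aw.
have E1 : fr1 (F w) (0 : 'rV[R]_3) = 0 by rewrite /bcv_fr1 mxE mul0r.
have E2 : fr2 (F w) (0 : 'rV[R]_3) = 0 by rewrite /bcv_fr2 mxE mul0r.
have E3 : fr3 (F w) (0 : 'rV[R]_3) = 0 by rewrite /bcv_fr3 !mxE !mulr0 subrr mulr0 addr0.
split.
- by have := @is_derive_fr1 R m l V F _ d0 w l0 dF dD; rewrite geo // E1 sub0r.
- by have := @is_derive_fr2 R m l V F _ d0 w l0 dF dD; rewrite geo // E2 sub0r.
- have := @is_derive_fr3 R m l V F _ d0 w l0 dF dD; rewrite geo // E3 sub0r => H.
  by apply: is_derive_eq H _; ring.
Qed.

Let dx (X : V) w : A w -> is_derive w X (fun w => F w 0 0) (lam (F w) * fr1 (F w) ('D_X F w)).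
Proof.
move=> Aw; have dF := @smooth_on_derivable _ _ _ A F w X sF Aw.
by rewrite /bcv_fr1 mulrC divfK ?lF //; exact: derive_coord.
Qed.

Let dy (X : V) w : A w -> is_derive w X (fun w => F w 0 1) (lam (F w) * fr2 (F w) ('D_X F w)).
Proof.
move=> Aw; have dF := @smooth_on_derivable _ _ _ A F w X sF Aw.
by rewrite /bcv_fr2 mulrC divfK ?lF //; exact: derive_coord.
Qed.

Lemma is_derive_shape w : A w ->
  let c1 := n2 w * f3 w - n3 w * f2 w in
  let c2 := n3 w * f1 w - n1 w * f3 w in
  let c3 := n1 w * f2 w - n2 w * f1 w in
  let r1 := t ^+ 2 * c1 in
  let r2 := t ^+ 2 * c2 in
  let r3 := (4 * m - 3 / 4 * l ^+ 2) * c3 in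
  [/\ is_derive w d0 b1 (r3 * n2 w - r2 * n3 w - (t * n2 w * b3 w - o w * b2 w)),
      is_derive w d0 b2 (r1 * n3 w - r3 * n1 w - (o w * b1 w - t * n1 w * b3 w)) &
      is_derive w d0 b3 (r2 * n1 w - r1 * n2 w - (t * n1 w * b2 w - t * n2 w * b1 w))].
Proof.
move=> Aw.
have [sn1 sn2 sn3] := smooth_on_fr (smooth_on_derive d0 sF).
apply: (@riccati_abstract R m l V A d0 da (fun y => F y 0 0) (fun y => F y 0 1)
   n1 n2 n3 f1 f2 f3 b1 b2 b3 oA sn1 sn2 sn3 (fun y => dx d0 (w := y)) (fun y => dy d0 (w := y))
   (fun y => dx da (w := y)) (fun y => dy da (w := y))
   (fun y => @is_derive_geodesic y) (fun y => @is_derive_normal y)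
   (fun y => @is_derive_tangent y) w Aw).
Qed.

End AlongMap.

(** The triple product (u x v) . n. *)
Definition tri {R : realType} (u1 u2 u3 v1 v2 v3 n1 n2 n3 : R) : R :=
  (u2 * v3 - u3 * v2) * n1 + (u3 * v1 - u1 * v3) * n2 + (u1 * v2 - u2 * v1) * n3.

(** A vector f orthogonal to a unit vector n is p x n with p = n x f. Substituting this
    parametrization absorbs the orthogonality hypotheses, so that what remains is a polynomial
    identity modulo |n|^2 = 1, which [ring] decides. *)
Lemma perp_cross {R : realType} (n1 n2 n3 f1 f2 f3 : R) :
  n1 * n1 + n2 * n2 + n3 * n3 = 1 -> n1 * f1 + n2 * f2 + n3 * f3 = 0 ->
  exists p : R * R * R, [/\ f1 = p.1.2 * n3 - p.2 * n2, f2 = p.2 * n1 - p.1.1 * n3 &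
    f3 = p.1.1 * n2 - p.1.2 * n1].
Proof.
move=> nn nf; exists (n2 * f3 - n3 * f2, n3 * f1 - n1 * f3, n1 * f2 - n2 * f1).
split => /=.
- transitivity (f1 * (n1 * n1 + n2 * n2 + n3 * n3) - n1 * (n1 * f1 + n2 * f2 + n3 * f3)).
    by rewrite nn nf; ring.
  by ring.
- transitivity (f2 * (n1 * n1 + n2 * n2 + n3 * n3) - n2 * (n1 * f1 + n2 * f2 + n3 * f3)).
    by rewrite nn nf; ring.
  by ring.
- transitivity (f3 * (n1 * n1 + n2 * n2 + n3 * n3) - n3 * (n1 * f1 + n2 * f2 + n3 * f3)).
    by rewrite nn nf; ring.
  by ring.
Qed.

Section IsoparametricODE.
Context {R : realType}.
Variables (m l : R) (V : normedModType R) (w d0 : V) (o : R).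
Variables n1 n2 n3 f1 f2 f3 g1 g2 g3 b1 b2 b3 k1 k2 k3 : V -> R.
Let t := l / 2.
Let c := 4 * m - l ^+ 2.

Hypotheses (dn1 : is_derive w d0 n1 (- (t * n2 w * n3 w - o * n2 w)))
 (dn2 : is_derive w d0 n2 (- (o * n1 w - t * n1 w * n3 w)))
 (dn3 : is_derive w d0 n3 0)
 (df1 : is_derive w d0 f1 (b1 w - (t * n2 w * f3 w - o * f2 w)))
 (df2 : is_derive w d0 f2 (b2 w - (o * f1 w - t * n1 w * f3 w)))
 (df3 : is_derive w d0 f3 (b3 w - (t * n1 w * f2 w - t * n2 w * f1 w)))
 (dg1 : is_derive w d0 g1 (k1 w - (t * n2 w * g3 w - o * g2 w)))
 (dg2 : is_derive w d0 g2 (k2 w - (o * g1 w - t * n1 w * g3 w)))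
 (dg3 : is_derive w d0 g3 (k3 w - (t * n1 w * g2 w - t * n2 w * g1 w)))
 (db1 : is_derive w d0 b1 ((t ^+ 2 + c) * (n1 w * f2 w - n2 w * f1 w) * n2 w
    - t ^+ 2 * (n3 w * f1 w - n1 w * f3 w) * n3 w - (t * n2 w * b3 w - o * b2 w)))
 (db2 : is_derive w d0 b2 (t ^+ 2 * (n2 w * f3 w - n3 w * f2 w) * n3 w
    - (t ^+ 2 + c) * (n1 w * f2 w - n2 w * f1 w) * n1 w - (o * b1 w - t * n1 w * b3 w)))
 (db3 : is_derive w d0 b3 (t ^+ 2 * (n3 w * f1 w - n1 w * f3 w) * n1 w
    - t ^+ 2 * (n2 w * f3 w - n3 w * f2 w) * n2 w - (t * n1 w * b2 w - t * n2 w * b1 w)))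
 (dk1 : is_derive w d0 k1 ((t ^+ 2 + c) * (n1 w * g2 w - n2 w * g1 w) * n2 w
    - t ^+ 2 * (n3 w * g1 w - n1 w * g3 w) * n3 w - (t * n2 w * k3 w - o * k2 w)))
 (dk2 : is_derive w d0 k2 (t ^+ 2 * (n2 w * g3 w - n3 w * g2 w) * n3 w
    - (t ^+ 2 + c) * (n1 w * g2 w - n2 w * g1 w) * n1 w - (o * k1 w - t * n1 w * k3 w)))
 (dk3 : is_derive w d0 k3 (t ^+ 2 * (n3 w * g1 w - n1 w * g3 w) * n1 w
    - t ^+ 2 * (n2 w * g3 w - n3 w * g2 w) * n2 w - (t * n1 w * k2 w - t * n2 w * k1 w))).
Hypotheses
 (nn : n1 w * n1 w + n2 w * n2 w + n3 w * n3 w = 1)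
 (nf : n1 w * f1 w + n2 w * f2 w + n3 w * f3 w = 0)
 (ng : n1 w * g1 w + n2 w * g2 w + n3 w * g3 w = 0)
 (nb : n1 w * b1 w + n2 w * b2 w + n3 w * b3 w = 0)
 (nk : n1 w * k1 w + n2 w * k2 w + n3 w * k3 w = 0).

(** Quantities that close up the r-derivatives of the area element [jac_W]. With A the shape
    operator, [jac_X1] is minus the derivative of [jac_W] and [jac_X2] is (det A + t^2) times
    [jac_W]; [jac_nuf] and [jac_nug] are the derivatives of nu along f and g, and [jac_X3], [jac_X4]
    pair them with the components of f and g along K = n x E3 and with the r-derivatives of these
    components. The resulting system is linear, and r enters its coefficients only through n3, which
    is constant along the geodesics. *)
Definition jac_W z := tri (f1 z) (f2 z) (f3 z) (g1 z) (g2 z) (g3 z) (n1 z) (n2 z) (n3 z).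
Definition jac_X1 z := - (tri (b1 z) (b2 z) (b3 z) (g1 z) (g2 z) (g3 z) (n1 z) (n2 z) (n3 z)
  + tri (f1 z) (f2 z) (f3 z) (k1 z) (k2 z) (k3 z) (n1 z) (n2 z) (n3 z)).
Definition jac_X2 z := tri (b1 z) (b2 z) (b3 z) (k1 z) (k2 z) (k3 z) (n1 z) (n2 z) (n3 z)
  + t ^+ 2 * jac_W z.
Definition jac_nuf z := b3 z - t * (f1 z * n2 z - f2 z * n1 z).
Definition jac_nug z := k3 z - t * (g1 z * n2 z - g2 z * n1 z).
Definition jac_X3 z := - (jac_nuf z * (g1 z * n2 z - g2 z * n1 z) - jac_nug z * (f1 z * n2 z - f2 z * n1 z)).
Definition jac_X4 z := - (jac_nuf z * (k1 z * n2 z - k2 z * n1 z - t * g3 z)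
  - jac_nug z * (b1 z * n2 z - b2 z * n1 z - t * f3 z)).
Definition jac_E z := 4 * t ^+ 2 + c * (1 - n3 z ^+ 2).

Lemma dW : is_derive w d0 jac_W (- jac_X1 w).
Proof.
rewrite /jac_W /tri; eapply is_derive_eq; first by derV.
by rewrite /jac_X1 /tri; ring.
Qed.

Lemma n3E : n3 w ^+ 2 = 1 - n1 w ^+ 2 - n2 w ^+ 2.
Proof. by rewrite -nn; ring. Qed.

Lemma dX1 : is_derive w d0 jac_X1 (jac_E w * jac_W w - 2 * jac_X2 w).
Proof.
rewrite /jac_X1 /tri; eapply is_derive_eq; first by derV.
by rewrite /jac_X2 /jac_W /jac_E /tri; ring: n3E.
Qed.

Lemma dX2 : is_derive w d0 jac_X2 (c * jac_X3 w).
Proof.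
rewrite /jac_X2 /jac_W /tri; eapply is_derive_eq; first by derV.
rewrite /jac_X3 /jac_nuf /jac_nug.
have [p [-> -> ->]] := perp_cross nn nf; have [q [-> -> ->]] := perp_cross nn ng.
have [p' [-> -> ->]] := perp_cross nn nb; have [q' [-> -> ->]] := perp_cross nn nk.
ring: n3E.
Qed.

(** As nu is constant along every normal geodesic, its derivative in a direction carried along by
    the geodesics does not depend on r either. *)
Lemma dnuf : is_derive w d0 jac_nuf 0.
Proof. by rewrite /jac_nuf; eapply is_derive_eq; [derV | ring]. Qed.

Lemma dnug : is_derive w d0 jac_nug 0.
Proof. by rewrite /jac_nug; eapply is_derive_eq; [derV | ring]. Qed.

Lemma dX3 : is_derive w d0 jac_X3 (jac_X4 w).
Proof.
have hf := dnuf; have hg := dnug.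
rewrite /jac_X3; eapply is_derive_eq; first by derV.
rewrite /jac_X4 /jac_nuf /jac_nug.
have [p [e1 e2 e3]] := perp_cross nn nf; have [q [e4 e5 e6]] := perp_cross nn ng.
have [p' [e1' e2' e3']] := perp_cross nn nb; have [q' [e4' e5' e6']] := perp_cross nn nk.
rewrite ?e1 ?e2 ?e3 ?e4 ?e5 ?e6 ?e1' ?e2' ?e3' ?e4' ?e5' ?e6'.
ring: n3E.
Qed.

Lemma dX4 : is_derive w d0 jac_X4 (- jac_E w * jac_X3 w).
Proof.
have hf := dnuf; have hg := dnug.
rewrite /jac_X4; eapply is_derive_eq; first by derV.
rewrite /jac_X3 /jac_E /jac_nuf /jac_nug.
have [p [e1 e2 e3]] := perp_cross nn nf; have [q [e4 e5 e6]] := perp_cross nn ng.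
have [p' [e1' e2' e3']] := perp_cross nn nb; have [q' [e4' e5' e6']] := perp_cross nn nk.
rewrite ?e1 ?e2 ?e3 ?e4 ?e5 ?e6 ?e1' ?e2' ?e3' ?e4' ?e5' ?e6'.
ring: n3E.
Qed.

Lemma jacobi_pointwise :
  [/\ is_derive w d0 jac_W (- jac_X1 w), is_derive w d0 jac_X1 (jac_E w * jac_W w - 2 * jac_X2 w),
    is_derive w d0 jac_X2 (c * jac_X3 w), is_derive w d0 jac_X3 (jac_X4 w) &
    is_derive w d0 jac_X4 (- jac_E w * jac_X3 w)].
Proof. by split; [exact: dW | exact: dX1 | exact: dX2 | exact: dX3 | exact: dX4]. Qed.

End IsoparametricODE.

(** * Comparison of the linear equations at two points *)

Section Quintic.
Context {R : realType}.
Variables (c eps : R) (E E' : R) (W X1 X2 X3 X4 W' X1' X2' X3' X4' : R -> R).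
Let J := ball (0 : R) eps.

Definition jacobi_system (E : R) (W X1 X2 X3 X4 : R -> R) :=
  forall r, J r -> [/\ is_derive r 1 W (- X1 r), is_derive r 1 X1 (E * W r - 2 * X2 r),
    is_derive r 1 X2 (c * X3 r), is_derive r 1 X3 (X4 r) &
    is_derive r 1 X4 (- E * X3 r)].

Hypotheses (H : jacobi_system E W X1 X2 X3 X4) (H' : jacobi_system E' W' X1' X2' X3' X4').

Let Jopen : open J. Proof. exact: ball_open. Qed.

Lemma eq_derive (f f' d d' : R -> R) (rho : R) : (forall s, J s -> f' s = rho * f s) ->
  (forall s, J s -> is_derive s 1 f (d s)) -> (forall s, J s -> is_derive s 1 f' (d' s)) ->
  forall s, J s -> d' s = rho * d s.
Proof.
move=> e df df' s Js; have [_ <-] := df' s Js.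
have D : is_derive s 1 (fun s => rho * f s) (rho * d s).
  by apply: is_derive_eq (dmul (dcst s 1 rho) (df s Js)) _; rewrite mul0r add0r.
have [_ <-] := D; apply: near_eq_derive.
by apply: filterS (open_nbhs_nbhs (conj Jopen Js)) => y Jy; exact: e.
Qed.

Hypotheses (J0 : J 0) (W0 : forall r, J r -> W r != 0) (W0' : W' 0 != 0)
  (XW : forall r, J r -> X1' r * W r = X1 r * W' r) (X10 : X1 0 != 0).

(** The primed letters belong to a second point of the patch; they are not derivatives. Equal mean
    curvatures make the two area elements proportional. With Y the second derivative of X1, the
    fourth derivative of X1 is - 2 E Y - E^2 X1, and likewise for E'; subtracting gives (E' - E) (2
    Y + (E' + E) X1) = 0 at r = 0, where Y = - E X1 - 2 c X3. The second root depends on the first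
    point only. *)
Lemma spectral_pair : (E' - E) * (E' - (- E - 2 * (- E * X1 0 - 2 * c * X3 0) / X1 0)) = 0.
Proof.
(* The logarithmic derivatives of the two area elements agree, so their quotient has derivative zero
   and keeps its value at r = 0. *)
pose rho := W' 0 / W 0.
have rho0 : rho != 0 by rewrite mulf_neq0 ?invr_neq0 // W0.
have e0 s : J s -> W' s = rho * W s.
  move=> Js; have D r v : J r -> is_derive r v (fun z => W' z * (W z)^-1) 0.
    move=> Jr; have [a _ _ _ _] := H Jr; have [b _ _ _ _] := H' Jr; have w0 := W0 Jr.
    have D1 : is_derive r 1 (fun z => W' z * (W z)^-1) 0.
      eapply is_derive_eq; first by derV.
      apply/eqP; rewrite addrC mulrA -mulf_div.
      rewrite [X in _ + X == 0](_ : _ = - (X1' r * W r) / W r ^+ 2); last by field.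
      by rewrite XW //; apply/eqP; field.
    have -> : v = v *: (1 : R) by rewrite [RHS]mulr1.
    by case: D1 => D1 D2; have := derive_scale v D1; rewrite D2 scaler0.
  have := @ball_derive0 R R (fun z => W' z * (W z)^-1) 0 eps D s Js.
  by rewrite -/rho => <-; rewrite divfK // W0.
have e1 s : J s -> - X1' s = rho * - X1 s.
  apply: (@eq_derive W W' (fun z => - X1 z) (fun z => - X1' z) rho e0) => z Jz.
    by case: (H Jz).
  by case: (H' Jz).
have e1' s : J s -> X1' s = rho * X1 s.
  by move=> /e1 e; apply: oppr_inj; rewrite e mulrN.
have e2 : forall s, J s -> E' * W' s - 2 * X2' s = rho * (E * W s - 2 * X2 s).
  apply: (@eq_derive X1 X1' (fun s => E * W s - 2 * X2 s) (fun s => E' * W' s - 2 * X2' s) rho e1') => z Jz.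
    by case: (H Jz).
  by case: (H' Jz).
have d2 s : J s -> is_derive s 1 (fun s => E * W s - 2 * X2 s) (- E * X1 s - 2 * c * X3 s).
  by case/H => ? ? ? ? ?; eapply is_derive_eq; [derV | ring].
have d2' s : J s -> is_derive s 1 (fun s => E' * W' s - 2 * X2' s) (- E' * X1' s - 2 * c * X3' s).
  by case/H' => ? ? ? ? ?; eapply is_derive_eq; [derV | ring].
have e3 := eq_derive e2 d2 d2'.
have d3 s : J s -> is_derive s 1 (fun s => - E * X1 s - 2 * c * X3 s)
    (- E * (E * W s - 2 * X2 s) - 2 * c * X4 s).
  by case/H => ? ? ? ? ?; eapply is_derive_eq; [derV | ring].
have d3' s : J s -> is_derive s 1 (fun s => - E' * X1' s - 2 * c * X3' s)
    (- E' * (E' * W' s - 2 * X2' s) - 2 * c * X4' s).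
  by case/H' => ? ? ? ? ?; eapply is_derive_eq; [derV | ring].
have e4 := eq_derive e3 d3 d3'.
have d4 s : J s -> is_derive s 1 (fun s => - E * (E * W s - 2 * X2 s) - 2 * c * X4 s)
    (- E * (- E * X1 s - 2 * c * X3 s) + 2 * c * E * X3 s).
  by case/H => ? ? ? ? ?; eapply is_derive_eq; [derV | ring].
have d4' s : J s -> is_derive s 1 (fun s => - E' * (E' * W' s - 2 * X2' s) - 2 * c * X4' s)
    (- E' * (- E' * X1' s - 2 * c * X3' s) + 2 * c * E' * X3' s).
  by case/H' => ? ? ? ? ?; eapply is_derive_eq; [derV | ring].
have e5 := eq_derive e4 d4 d4'.
move: (e1' 0 J0) (e3 0 J0) (e5 0 J0) => {e0 e1 e1' e2 e3 e4 e5 d2 d2' d3 d3' d4 d4'}.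
move: (X1 0) (X1' 0) (X3 0) (X3' 0) X10 => x x' y y' x0 q1 q3 q5.
(* The difference of the two fifth-order relations at r = 0, after all primed quantities are
   replaced by rho times unprimed ones. *)
have K : rho * ((E' - E) * (2 * (- E * x - 2 * c * y) + (E' + E) * x)) = 0.
  have q3' : 2 * c * y' = - E' * (rho * x) - rho * (- E * x - 2 * c * y).
    by rewrite -q3 q1; ring.
  have : - E' * (- E' * x' - 2 * c * y') + E' * (2 * c * y') -
     rho * (- E * (- E * x - 2 * c * y) + 2 * c * E * y) = 0.
    by rewrite -q5; ring.
  by rewrite q3' q1 => K; rewrite -[RHS]oppr0 -K; ring.
move/eqP: K; rewrite mulf_eq0 (negPf rho0) /= => /eqP K.
apply: (mulfI x0); rewrite mulr0 -K; field.
exact: x0.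
Qed.
End Quintic.

(* Otherwise unification unfolds the derivatives occurring inside matrix entries. *)
#[local] Opaque derive cov_deriv.

Lemma tr_invmx2 {R : realType} (G M : 'M[R]_2) (D := G 0 0 * G 1 1 - G 0 1 * G 1 0) : D != 0 ->
  D * \tr (invmx G *m M) = G 1 1 * M 0 0 - G 0 1 * M 1 0 - G 1 0 * M 0 1 + G 0 0 * M 1 1.
Proof.
move=> D0.
have e01 : (0 == 1 :> 'I_2) = false by [].
have e10 : (1 == 0 :> 'I_2) = false by [].
pose K : 'M[R]_2 := D^-1 *: \matrix_(i, j) (if i == j then (if i == 0 then G 1 1 else G 0 0) else - G i j).
have GK : G *m K = 1%:M.
  apply/matrixP => i j; rewrite !mxE sum2 !mxE; move: i j; apply: forall2; apply: forall2;
  by rewrite ?eqxx ?e01 ?e10 /=; rewrite /D; field; exact: D0.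
have [uG _] := mulmx1_unit GK.
have -> : invmx G = K by rewrite -[LHS]mulmx1 -GK mulmxA mulVmx // mul1mx.
by rewrite /mxtrace sum2 !mxE !sum2 !mxE ?eqxx ?e01 ?e10 /=; rewrite /D; field; exact: D0.
Qed.

(** * Mean curvature and the area element of a patch *)

Section PatchGeometry.
Context {R : realType}.
Variables m l : R.
Local Notation lam := (bcv_lam m).
Local Notation fr1 := (bcv_fr1 m).
Local Notation fr2 := (bcv_fr2 m).
Local Notation fr3 := (bcv_fr3 m l).
Local Notation g := (bcv_metric m l).

Lemma is_derive_inner (V : normedModType R) (F S T : V -> 'rV[R]_3) X w :
  lam (F w) != 0 -> derivable F w X -> derivable S w X -> derivable T w X ->
  is_derive w X (fun y => inner (g (F y)) (S y) (T y))
   (inner (g (F w)) (cov_deriv g F X S w) (T w) + inner (g (F w)) (S w) (cov_deriv g F X T w)).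
Proof.
move=> l0 dF dS dT.
have s1 := @is_derive_fr1 R m l V F S X w l0 dF dS.
have s2 := @is_derive_fr2 R m l V F S X w l0 dF dS.
have s3 := @is_derive_fr3 R m l V F S X w l0 dF dS.
have t1 := @is_derive_fr1 R m l V F T X w l0 dF dT.
have t2 := @is_derive_fr2 R m l V F T X w l0 dF dT.
have t3 := @is_derive_fr3 R m l V F T X w l0 dF dT.
rewrite (_ : (fun y => _) = fun y => fr1 (F y) (S y) * fr1 (F y) (T y) +
  fr2 (F y) (S y) * fr2 (F y) (T y) + fr3 (F y) (S y) * fr3 (F y) (T y)); last first.
  by apply/funext => y; rewrite inner_bcv.
eapply is_derive_eq; first by derV.
by rewrite !inner_bcv; ring.
Qed.

Lemma fr_inj p (v w : 'rV[R]_3) : lam p != 0 ->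
  fr1 p v = fr1 p w -> fr2 p v = fr2 p w -> fr3 p v = fr3 p w -> v = w.
Proof.
move=> l0 e1 e2 e3; apply/eqP; rewrite -subr_eq0; apply/eqP; apply: (fr_eq0 l0 (l := l)).
- by move: e1; rewrite /bcv_fr1 !mxE mulrBl => ->; rewrite subrr.
- by move: e2; rewrite /bcv_fr2 !mxE mulrBl => ->; rewrite subrr.
- have -> : fr3 p (v - w) = fr3 p v - fr3 p w by rewrite /bcv_fr3 !mxE; ring.
  by rewrite e3 subrr.
Qed.

Lemma fr_lin p (a b : R) (v w : 'rV[R]_3) :
  [/\ fr1 p (a *: v + b *: w) = a * fr1 p v + b * fr1 p w,
      fr2 p (a *: v + b *: w) = a * fr2 p v + b * fr2 p w &
      fr3 p (a *: v + b *: w) = a * fr3 p v + b * fr3 p w].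
Proof. by rewrite /bcv_fr1 /bcv_fr2 /bcv_fr3 !mxE; split; ring. Qed.

Definition area (S1 S2 N p : 'rV[R]_3) : R := tri (fr1 p S1) (fr2 p S1) (fr3 p S1)
  (fr1 p S2) (fr2 p S2) (fr3 p S2) (fr1 p N) (fr2 p N) (fr3 p N).

Lemma area_sqr p S1 S2 N : inner (g p) N N = 1 -> inner (g p) N S1 = 0 -> inner (g p) N S2 = 0 ->
  area S1 S2 N p ^+ 2 = inner (g p) S1 S1 * inner (g p) S2 S2 - inner (g p) S1 S2 * inner (g p) S2 S1.
Proof.
rewrite !inner_bcv => nn nf ng; rewrite /area /tri.
have n3E : fr3 p N ^+ 2 = 1 - fr1 p N ^+ 2 - fr2 p N ^+ 2 by rewrite -nn; ring.
have [p1 [-> -> ->]] := perp_cross nn nf; have [p2 [-> -> ->]] := perp_cross nn ng.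
by ring: n3E.
Qed.

(** By [area_sqr] the square of the area is the Gram determinant of S1 and S2, hence by Lagrange's
    identity the squared length of S1 x S2. A vanishing cross product makes S1 and S2 dependent. *)
Lemma area_eq0 p S1 S2 N : lam p != 0 ->
  inner (g p) N N = 1 -> inner (g p) N S1 = 0 -> inner (g p) N S2 = 0 ->
  (forall a b, a *: S1 + b *: S2 = 0 -> a = 0 /\ b = 0) -> area S1 S2 N p != 0.
Proof.
move=> l0 nn nf ng ind; apply/negP => /eqP a0.
have A := area_sqr nn nf ng; move: A; rewrite a0 expr2 mul0r !inner_bcv => A.
have [z1 z2 z3] : [/\ fr2 p S1 * fr3 p S2 - fr3 p S1 * fr2 p S2 = 0,
   fr3 p S1 * fr1 p S2 - fr1 p S1 * fr3 p S2 = 0 & fr1 p S1 * fr2 p S2 - fr2 p S1 * fr1 p S2 = 0].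
  by apply: sum_sqr3_eq0; rewrite A; ring.
have q (a b : R) : a * fr1 p S1 + b * fr1 p S2 = 0 -> a * fr2 p S1 + b * fr2 p S2 = 0 ->
    a * fr3 p S1 + b * fr3 p S2 = 0 -> a = 0 /\ b = 0.
  move=> e1 e2 e3; apply: ind; have [h1 h2 h3] := fr_lin p a b S1 S2.
  by apply: (fr_eq0 l0 (l := l)); rewrite ?h1 ?h2 ?h3.
(* For each index i the combination of S1 and S2 with coefficients (S2)_i and - (S1)_i vanishes, its
   components being components of S1 x S2. So S1 = 0, and then the coefficients 1 and 0 contradict
   independence. *)
have [_ h1] : fr1 p S2 = 0 /\ - fr1 p S1 = 0 by apply: q; lra.
have [_ h2] : fr2 p S2 = 0 /\ - fr2 p S1 = 0 by apply: q; lra.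
have [_ h3] : fr3 p S2 = 0 /\ - fr3 p S1 = 0 by apply: q; lra.
have [/eqP] : (1 : R) = 0 /\ (0 : R) = 0 by apply: q; lra.
by rewrite oner_eq0.
Qed.

(** The left side is the cofactor form of det G times the trace of G^-1 II from [tr_invmx2], with
    the second fundamental form expressed by B and K, the derivatives of N. Since det G is the
    square of the area, one factor of the area cancels later. *)
Lemma shape_identity p S1 S2 N B K : inner (g p) N N = 1 ->
  inner (g p) N S1 = 0 -> inner (g p) N S2 = 0 -> inner (g p) N B = 0 -> inner (g p) N K = 0 ->
  inner (g p) S2 S2 * - inner (g p) B S1 - inner (g p) S1 S2 * - inner (g p) K S1
   - inner (g p) S2 S1 * - inner (g p) B S2 + inner (g p) S1 S1 * - inner (g p) K S2
  = area S1 S2 N p * - (area B S2 N p + area S1 K N p).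
Proof.
rewrite !inner_bcv => nn nf ng nb nk; rewrite /area /tri.
have n3E : fr3 p N ^+ 2 = 1 - fr1 p N ^+ 2 - fr2 p N ^+ 2 by rewrite -nn; ring.
have [p1 [-> -> ->]] := perp_cross nn nf; have [p2 [-> -> ->]] := perp_cross nn ng.
have [p3 [-> -> ->]] := perp_cross nn nb; have [p4 [-> -> ->]] := perp_cross nn nk.
by ring: n3E.
Qed.

Variables (U : set 'rV[R]_2) (psi : 'rV[R]_2 -> 'rV[R]_3).
Hypotheses (oU : open U) (ipsi : immersion_on U psi) (lpsi : forall u, U u -> lam (psi u) != 0).

Local Notation d1 u := ('D_(basis_vec 0) psi u).
Local Notation d2 u := ('D_(basis_vec 1) psi u).

Lemma smooth_psi : smooth_on U psi. Proof. by case: ipsi. Qed.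

Lemma area_neq0 u N : U u -> unit_normal g psi u N -> area (d1 u) (d2 u) N (psi u) != 0.
Proof.
move=> Uu [nn nt]; apply: (area_eq0 (lpsi Uu) nn (nt (basis_vec 0)) (nt (basis_vec 1))) => a b e.
pose X : 'rV[R]_2 := \row_(j < 2) (if j == 0 then a else b).
have X0 : X 0 0 = a by rewrite mxE.
have X1 : X 0 1 = b by rewrite mxE.
have [_ inj] := ipsi.
have : X = 0 by apply: (inj u X Uu); apply: (etrans (smooth_mx_derive_rV2 oU X Uu smooth_psi)); rewrite X0 X1.
by move=> XX; rewrite -X0 -X1 XX !mxE.
Qed.

Variable N : 'rV[R]_2 -> 'rV[R]_3.
Hypotheses (sN : smooth_on U N) (uN : forall u, U u -> unit_normal g psi u (N u)).

(** Trace of the shape operator times the area: in the triple product each tangent vector in turn is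
    replaced by its image, which is minus the covariant derivative of N. *)
Definition shape_trace u : R :=
  - (area (cov_deriv g psi (basis_vec 0) N u) (d2 u) (N u) (psi u)
     + area (d1 u) (cov_deriv g psi (basis_vec 1) N u) (N u) (psi u)).

Lemma normal_cov X u : U u -> inner (g (psi u)) (N u) (cov_deriv g psi X N u) = 0.
Proof.
move=> Uu; have dp := @smooth_on_derivable _ _ _ U psi u X smooth_psi Uu.
have dN := @smooth_on_derivable _ _ _ U N u X sN Uu.
have [_ D] := is_derive_inner (lpsi Uu) dp dN dN.
have : 'D_X (fun y => inner (g (psi y)) (N y) (N y)) u = 0.
  apply: (etrans (@near_eq_derive R _ _ _ (fun=> (1 : R)) u X _)); last exact: derive_cst.
  by apply: filterS (open_nbhs_nbhs (conj oU Uu)) => y Uy; case: (uN Uy).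
rewrite D.
move: (cov_deriv _ _ _ _ _) => B; rewrite !inner_bcv => H; lra.
Qed.

Lemma second_formE a b u : U u -> second_form g psi u (N u) a b =
  - inner (g (psi u)) (cov_deriv g psi (basis_vec a) N u) ('D_(basis_vec b) psi u).
Proof.
move=> Uu; rewrite /second_form mxE.
have dp := @smooth_on_derivable _ _ _ U psi u (basis_vec a) smooth_psi Uu.
have dN := @smooth_on_derivable _ _ _ U N u (basis_vec a) sN Uu.
have dD := @smooth_on_derivable _ _ _ U _ u (basis_vec a) (smooth_on_derive (basis_vec b) smooth_psi) Uu.
have [_ D] := is_derive_inner (lpsi Uu) dp dN dD.
have : 'D_(basis_vec a) (fun y => inner (g (psi y)) (N y) ('D_(basis_vec b) psi y)) u = 0.
  apply: (etrans (@near_eq_derive R _ _ _ (fun=> (0 : R)) u (basis_vec a) _)); last exact: derive_cst.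
  by apply: filterS (open_nbhs_nbhs (conj oU Uu)) => y Uy; case: (uN Uy) => _; exact.
rewrite D.
move: (cov_deriv g psi _ ('D_(basis_vec b) psi) _) (cov_deriv _ _ _ _ _) ('D_(basis_vec b) psi u) (N u) => B K T n.
by rewrite !inner_bcv => H; lra.
Qed.

Lemma mean_curvature_shape u : U u ->
  2 * mean_curvature g psi u (N u) * area (d1 u) (d2 u) (N u) (psi u) = shape_trace u.
Proof.
move=> Uu; have a0 := area_neq0 Uu (uN Uu); have [nn nt] := uN Uu.
have A := area_sqr nn (nt (basis_vec 0)) (nt (basis_vec 1)).
have e a b : induced_metric g psi u a b =
   inner (g (psi u)) ('D_(basis_vec a) psi u) ('D_(basis_vec b) psi u) by rewrite mxE.
have T := @tr_invmx2 R (induced_metric g psi u) (second_form g psi u (N u)).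
have SI := shape_identity nn (nt (basis_vec 0)) (nt (basis_vec 1))
  (normal_cov (basis_vec 0) Uu) (normal_cov (basis_vec 1) Uu).
have D0 : area (d1 u) (d2 u) (N u) (psi u) ^+ 2 != 0 by rewrite expf_neq0.
move: T; cbv zeta; rewrite (e 0 0) (e 1 1) (e 0 1) (e 1 0) -A => /(_ D0) T.
rewrite (second_formE 0 0 Uu) (second_formE 1 0 Uu) (second_formE 0 1 Uu)
  (second_formE 1 1 Uu) in T.
apply: (mulfI a0); apply: (etrans _ (etrans T SI)).
rewrite /mean_curvature; move: (\tr _) (area _ _ _ _) => q a.
by field.
Qed.

End PatchGeometry.

#[local] Transparent cov_deriv.

Section Locality.
Context {R : realType}.
Variable g : 'rV[R]_3 -> 'M[R]_3.

Lemma cov_deriv_near (V : normedModType R) (psi psi' S T : V -> 'rV[R]_3) X u :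
  {near u, psi =1 psi'} -> {near u, S =1 T} ->
  cov_deriv g psi X S u = cov_deriv g psi' X T u.
Proof.
move=> e1 e2; rewrite /cov_deriv (near_eq_derive X e2) (near_eq_derive X e1).
by rewrite (nbhs_singleton e1) (nbhs_singleton e2).
Qed.

Lemma cov_deriv_slice1 (F S : R * 'rV[R]_2 -> 'rV[R]_3) r u :
  derivable F (r, u) (1, 0) -> derivable S (r, u) (1, 0) ->
  cov_deriv g (fun s => F (s, u)) 1 (fun s => S (s, u)) r = cov_deriv g F (1, 0) S (r, u).
Proof.
move=> dF dS; rewrite /cov_deriv.
have [_ ->] := derive_pair1 (derivableP dF); have [_ ->] := derive_pair1 (derivableP dS).
by [].
Qed.

Lemma cov_deriv_slice2 (F S : R * 'rV[R]_2 -> 'rV[R]_3) r u X :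
  derivable F (r, u) (0, X) -> derivable S (r, u) (0, X) ->
  cov_deriv g (fun w => F (r, w)) X (fun w => S (r, w)) u = cov_deriv g F (0, X) S (r, u).
Proof.
move=> dF dS; rewrite /cov_deriv.
have [_ ->] := derive_pair2 (derivableP dF); have [_ ->] := derive_pair2 (derivableP dS).
by [].
Qed.

Lemma near_near (V W : normedModType R) (f h : V -> W) (u : V) : {near u, f =1 h} ->
  forall X, \forall y \near u, 'D_X f y = 'D_X h y.
Proof.
by move=> fh X; apply: filterS (near_join fh) => y hy; exact: near_eq_derive.
Qed.

#[local] Opaque derive cov_deriv.

Lemma mean_curvature_near (psi psi' : 'rV[R]_2 -> 'rV[R]_3) u nu :
  {near u, psi =1 psi'} -> mean_curvature g psi u nu = mean_curvature g psi' u nu.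
Proof.
move=> e; have e0 := nbhs_singleton e.
have e1 a := nbhs_singleton (near_near e a).
have e2 a b := cov_deriv_near a e (near_near e b).
have h1 : induced_metric g psi u = induced_metric g psi' u.
  apply/matrixP => a b.
  apply: (etrans (mxE _ _ _ _)); apply: (etrans _ (esym (mxE _ _ _ _))).
  by rewrite e0 (e1 (basis_vec a)) (e1 (basis_vec b)).
have h2 : second_form g psi u nu = second_form g psi' u nu.
  apply/matrixP => a b.
  apply: (etrans (mxE _ _ _ _)); apply: (etrans _ (esym (mxE _ _ _ _))).
  by rewrite e0 (e2 (basis_vec a) (basis_vec b)).
by rewrite /mean_curvature h1 h2.
Qed.

Lemma mean_curvatureN (psi : 'rV[R]_2 -> 'rV[R]_3) u nu :
  mean_curvature g psi u (- nu) = - mean_curvature g psi u nu.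
Proof.
rewrite /mean_curvature -mulrN -raddfN -mulmxN; congr (_ * \tr (_ *m _)).
apply/matrixP => a b.
apply: (etrans (mxE _ _ _ _)); apply: (etrans _ (esym (mxE _ _ _ _))).
apply: (etrans _ (congr1 -%R (esym (mxE _ _ _ _)))).
move: (cov_deriv _ _ _ _ _) => K; rewrite /inner linearN /= mulmxN.
exact: mxE.
Qed.

End Locality.

(** With W the triple product, f x g = W n, and k x (f x g) = f (k.g) - g (k.f) = 0. So k is
    parallel to n, and both have length 1. *)
Lemma unit_perp_pm {R : realType} (n1 n2 n3 f1 f2 f3 g1 g2 g3 k1 k2 k3 : R) :
  tri f1 f2 f3 g1 g2 g3 n1 n2 n3 != 0 ->
  n1 * n1 + n2 * n2 + n3 * n3 = 1 -> n1 * f1 + n2 * f2 + n3 * f3 = 0 ->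
  n1 * g1 + n2 * g2 + n3 * g3 = 0 ->
  k1 * k1 + k2 * k2 + k3 * k3 = 1 -> k1 * f1 + k2 * f2 + k3 * f3 = 0 ->
  k1 * g1 + k2 * g2 + k3 * g3 = 0 ->
  [/\ k1 = n1, k2 = n2 & k3 = n3] \/ [/\ k1 = - n1, k2 = - n2 & k3 = - n3].
Proof.
move=> W0 nn nf ng kk kf kg.
pose s := k1 * n1 + k2 * n2 + k3 * n3.
have W2 : tri f1 f2 f3 g1 g2 g3 n1 n2 n3 * tri f1 f2 f3 g1 g2 g3 n1 n2 n3 != 0.
  by rewrite mulf_neq0.
have [p [ef1 ef2 ef3]] := perp_cross nn nf; have [q [eg1 eg2 eg3]] := perp_cross nn ng.
have cross_f : [/\ f2 * g3 - f3 * g2 = tri f1 f2 f3 g1 g2 g3 n1 n2 n3 * n1,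
  f3 * g1 - f1 * g3 = tri f1 f2 f3 g1 g2 g3 n1 n2 n3 * n2 &
  f1 * g2 - f2 * g1 = tri f1 f2 f3 g1 g2 g3 n1 n2 n3 * n3].
  have n3E : n3 ^+ 2 = 1 - n1 ^+ 2 - n2 ^+ 2 by rewrite -nn; ring.
  by rewrite /tri ef1 ef2 ef3 eg1 eg2 eg3; split; ring: n3E.
have [c1 c2 c3] := cross_f; move: W0 c1 c2 c3; move: (tri _ _ _ _ _ _ _ _ _) => W W0 c1 c2 c3.
have e1 : W * (k2 * n3 - k3 * n2) = 0.
  rewrite mulrBr -!(mulrCA k2) -!(mulrCA k3) -c3 -c2.
  transitivity (f1 * (k1 * g1 + k2 * g2 + k3 * g3) - g1 * (k1 * f1 + k2 * f2 + k3 * f3)); first by ring.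
  by rewrite kf kg; ring.
have e2 : W * (k3 * n1 - k1 * n3) = 0.
  rewrite mulrBr -!(mulrCA k3) -!(mulrCA k1) -c1 -c3.
  transitivity (f2 * (k1 * g1 + k2 * g2 + k3 * g3) - g2 * (k1 * f1 + k2 * f2 + k3 * f3)); first by ring.
  by rewrite kf kg; ring.
have e3 : W * (k1 * n2 - k2 * n1) = 0.
  rewrite mulrBr -!(mulrCA k1) -!(mulrCA k2) -c2 -c1.
  transitivity (f3 * (k1 * g1 + k2 * g2 + k3 * g3) - g3 * (k1 * f1 + k2 * f2 + k3 * f3)); first by ring.
  by rewrite kf kg; ring.
have z1 : k2 * n3 - k3 * n2 = 0 by apply: (mulfI W0); rewrite e1 mulr0.
have z2 : k3 * n1 - k1 * n3 = 0 by apply: (mulfI W0); rewrite e2 mulr0.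
have z3 : k1 * n2 - k2 * n1 = 0 by apply: (mulfI W0); rewrite e3 mulr0.
have h1 : k1 = s * n1.
  transitivity (k1 * (n1 * n1 + n2 * n2 + n3 * n3) - n2 * (k1 * n2 - k2 * n1) + n3 * (k3 * n1 - k1 * n3)).
    by rewrite nn z3 z2; ring.
  by rewrite /s; ring.
have h2 : k2 = s * n2.
  transitivity (k2 * (n1 * n1 + n2 * n2 + n3 * n3) + n1 * (k1 * n2 - k2 * n1) - n3 * (k2 * n3 - k3 * n2)).
    by rewrite nn z3 z1; ring.
  by rewrite /s; ring.
have h3 : k3 = s * n3.
  transitivity (k3 * (n1 * n1 + n2 * n2 + n3 * n3) - n1 * (k3 * n1 - k1 * n3) + n2 * (k2 * n3 - k3 * n2)).
    by rewrite nn z2 z1; ring.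
  by rewrite /s; ring.
have : s * s = 1.
  transitivity (s * s * (n1 * n1 + n2 * n2 + n3 * n3)); first by rewrite nn mulr1.
  transitivity ((s * n1) * (s * n1) + (s * n2) * (s * n2) + (s * n3) * (s * n3)); first by ring.
  by rewrite -h1 -h2 -h3.
move/eqP; rewrite -expr2 sqrf_eq1 => /orP[/eqP s1|/eqP s1]; [left|right];
  by rewrite h1 h2 h3 s1; split; ring.
Qed.

Lemma continuous_slice {R : realType} (V W : normedModType R) (G : R * V -> W) (r : R) (u : V) :
  {for (r, u), continuous G} -> {for u, continuous (fun w => G (r, w))}.
Proof.
move=> cG; apply: (@continuous_comp _ _ _ (fun w : V => (r, w)) G) => //.
move=> P [[P1 P2] [/= n1 n2] sP]; apply: filterS n2 => w P2w; apply: sP; split => //=.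
exact: nbhs_singleton n1.
Qed.

Lemma smooth_slice {R : realType} (V W : normedModType R) (I : set R) (B : set V)
  (G : R * V -> W) r : open B -> I r ->
  smooth_on (I `*` B) G -> smooth_on B (fun u => G (r, u)).
Proof.
move=> oB Ir sG k; move: {sG}(sG k); elim: k G => [|k IH] G [cG HG].
  by split => // u Bu; apply: continuous_slice; exact: cG.
split; first by move=> u Bu; apply: continuous_slice; exact: cG.
move=> X; have [dG DG] := HG (0, X); split.
  by move=> u Bu; case: (derive_pair2 (derivableP (dG (r, u) (conj Ir Bu)))).
apply: (Ck_on_ext oB _ (IH _ DG)) => u Bu.
by case: (derive_pair2 (derivableP (dG (r, u) (conj Ir Bu)))) => _ ->.
Qed.

Lemma div_eq_of_mul {R : realType} (a b c : R) : b != 0 -> a * b = c -> c / b = a.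
Proof. by move=> b0 <-; rewrite mulfK. Qed.

Lemma cross_mul_eq {R : realType} (a b c d : R) : b != 0 -> d != 0 ->
  a / b = c / d -> a * d = c * b.
Proof. by move=> b0 d0 /eqP; rewrite eqr_div // => /eqP. Qed.

Lemma sqr_eq_mul0 {R : realType} (a b : R) : a ^+ 2 = b ^+ 2 -> (a - b) * (a - - b) = 0.
Proof. by move=> e; rewrite opprK -subr_sqr e subrr. Qed.

Lemma unit_normal_pm {R : realType} (m l : R) (p S1 S2 N N' : 'rV[R]_3) : bcv_lam m p != 0 ->
  area m l S1 S2 N p != 0 ->
  inner (bcv_metric m l p) N N = 1 -> inner (bcv_metric m l p) N S1 = 0 ->
  inner (bcv_metric m l p) N S2 = 0 ->
  inner (bcv_metric m l p) N' N' = 1 -> inner (bcv_metric m l p) N' S1 = 0 ->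
  inner (bcv_metric m l p) N' S2 = 0 -> N' = N \/ N' = - N.
Proof.
rewrite !inner_bcv => l0 a0 nn nf ng kk kf kg.
have [[e1 e2 e3]|[e1 e2 e3]] := unit_perp_pm a0 nn nf ng kk kf kg; [left|right];
  apply: (fr_inj l0 (l := l)) => //.
- by rewrite e1 /bcv_fr1 mxE mulNr.
- by rewrite e2 /bcv_fr2 mxE mulNr.
- by rewrite e3 /bcv_fr3 !mxE; ring.
Qed.

(** * The equidistant surfaces of an isoparametric patch *)

Section Isoparametric.
Context {R : realType}.
Variables m l : R.
Local Notation lam := (bcv_lam m).
Local Notation fr1 := (bcv_fr1 m).
Local Notation fr2 := (bcv_fr2 m).
Local Notation fr3 := (bcv_fr3 m l).
Local Notation g := (bcv_metric m l).
Variables (V : set 'rV[R]_2) (psi : 'rV[R]_2 -> 'rV[R]_3) (eps : R)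
  (N : 'rV[R]_2 -> 'rV[R]_3) (F : R * 'rV[R]_2 -> 'rV[R]_3).
Local Notation J := [set r : R | `|r| < eps].
Hypotheses (oV : open V) (eps0 : 0 < eps)
  (uN : forall u, V u -> unit_normal g psi u (N u))
  (sF : smooth_on (J `*` V) F) (FM : F @` (J `*` V) `<=` bcv_dom m)
  (F0 : forall u, V u -> F (0, u) = psi u)
  (FN : forall u, V u -> 'D_1 (fun r => F (r, u)) 0 = N u)
  (Fgeo : forall u, V u -> geodesic_on g J (fun r => F (r, u)))
  (Fim : forall r, J r -> immersion_on V (fun u => F (r, u)))
  (Fcmc : forall r, J r -> cmc_on g V (fun u => F (r, u))).
Let A := J `*` V.
Let d0 : R * 'rV[R]_2 := (1, 0).
Let dir (X : 'rV[R]_2) : R * 'rV[R]_2 := (0, X).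
Let n z := 'D_d0 F z.

Lemma JE : J = ball (0 : R) eps.
Proof. by apply/seteqP; split => r; rewrite -ball_normE /= sub0r normrN. Qed.

Lemma openJ : open J. Proof. by rewrite JE; exact: ball_open. Qed.

Lemma openA : open A.
Proof.
rewrite openE => -[r u] [/= Jr Vu]; exists (J, V) => //; split => /=.
  exact: open_nbhs_nbhs (conj openJ Jr).
exact: open_nbhs_nbhs (conj oV Vu).
Qed.

Lemma J0 : J 0. Proof. by rewrite /= normr0. Qed.

Lemma lF z : A z -> lam (F z) != 0.
Proof. by move=> Az; rewrite gt_eqF //; apply: bcv_domE; apply: FM; exists z. Qed.

Lemma dF z v : A z -> derivable F z v.
Proof. exact: smooth_on_derivable. Qed.

Lemma dDF z v w : A z -> derivable ('D_v F) z w.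
Proof. by apply: smooth_on_derivable; exact: smooth_on_derive. Qed.

Lemma geo z : A z -> cov_deriv g F d0 ('D_d0 F) z = 0.
Proof.
case: z => r u [Jr Vu]; have Az : A (r, u) by [].
rewrite -(cov_deriv_slice1 g (@dF _ d0 Az) (@dDF _ d0 d0 Az)) -(Fgeo Vu Jr).
apply: cov_deriv_near; first by apply: filterE.
apply: filterS (open_nbhs_nbhs (conj openJ Jr)) => s Js.
have As : A (s, u) by [].
by have [_ ->] := derive_pair1 (derivableP (@dF _ d0 As)).
Qed.

Lemma slice_derive r u X : A (r, u) -> 'D_X (fun w => F (r, w)) u = 'D_(dir X) F (r, u).
Proof. by move=> Az; have [_ ->] := derive_pair2 (derivableP (@dF _ (dir X) Az)). Qed.

Lemma n0 u : V u -> n (0, u) = N u.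
Proof.
move=> Vu; rewrite -(FN Vu).
by have [_ ->] := derive_pair1 (derivableP (@dF _ d0 (conj J0 Vu : A (0, u)))).
Qed.

Lemma near_psi u : V u -> {near u, (fun w => F (0, w)) =1 psi}.
Proof.
by move=> Vu; apply: filterS (open_nbhs_nbhs (conj oV Vu)) => w Vw; exact: F0.
Qed.

Lemma constant_in_r (h : R * 'rV[R]_2 -> R) r u : V u -> J r ->
  (forall z, A z -> is_derive z d0 h 0) -> h (r, u) = h (0, u).
Proof.
move=> Vu Jr dh; apply: (@ball_derive0 R R (fun s => h (s, u)) 0 eps); last by rewrite -JE.
move=> s v; rewrite -JE => Js.
have [D1 D2] := derive_pair1 (dh (s, u) (conj Js Vu)).
have -> : v = v *: (1 : R) by rewrite [RHS]mulr1.
by have := derive_scale v D1; rewrite D2 scaler0.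
Qed.

Lemma inner0l p (v : 'rV[R]_3) : inner (g p) 0 v = 0.
Proof. by rewrite /inner !mul0mx mxE. Qed.

Lemma inner0r p (v : 'rV[R]_3) : inner (g p) v 0 = 0.
Proof. by rewrite /inner trmx0 mulmx0 mxE. Qed.

Lemma innerC p (v w : 'rV[R]_3) : inner (g p) v w = inner (g p) w v.
Proof. by rewrite !inner_bcv; ring. Qed.

Lemma nn z : A z -> inner (g (F z)) (n z) (n z) = 1.
Proof.
case: z => r u [Jr Vu].
apply: (etrans (@constant_in_r (fun z => inner (g (F z)) (n z) (n z)) r u Vu Jr _)); last first.
  by rewrite n0 // F0 //; case: (uN Vu).
move=> z Az; apply: is_derive_eq (is_derive_inner l (lF Az) (@dF _ d0 Az) (@dDF _ d0 d0 Az) (@dDF _ d0 d0 Az)) _.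
by rewrite (geo Az) inner0l inner0r addr0.
Qed.

Lemma nB z X : A z -> inner (g (F z)) (n z) (cov_deriv g F (dir X) n z) = 0.
Proof.
move=> Az; have [_ D] := is_derive_inner l (lF Az) (@dF _ (dir X) Az) (@dDF _ d0 (dir X) Az) (@dDF _ d0 (dir X) Az).
have : 'D_(dir X) (fun y => inner (g (F y)) (n y) (n y)) z = 0.
  apply: (etrans (@near_eq_derive R _ _ _ (fun=> (1 : R)) z (dir X) _)); last exact: derive_cst.
  by apply: filterS (open_nbhs_nbhs (conj openA Az)) => y Ay; exact: nn.
by rewrite D innerC => H; lra.
Qed.

(* Gauss' lemma. *)
Lemma nf z X : A z -> inner (g (F z)) (n z) ('D_(dir X) F z) = 0.
Proof.
case: z => r u [Jr Vu].
apply: (etrans (@constant_in_r (fun z => inner (g (F z)) (n z) ('D_(dir X) F z)) r u Vu Jr _)); last first.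
  rewrite n0 // -slice_derive; last by split => //; exact: J0.
  rewrite (near_eq_derive X (near_psi Vu)) F0 //.
  by case: (uN Vu) => _; exact.
move=> z Az; apply: is_derive_eq (is_derive_inner l (lF Az) (@dF _ d0 Az) (@dDF _ d0 d0 Az) (@dDF _ (dir X) d0 Az)) _.
have C := @cov_deriv_sym R m l _ A F openA sF lF z d0 (dir X) Az.
have e1 := etrans (congr1 (fun q => inner (g (F z)) q ('D_(dir X) F z)) (geo Az)) (inner0l _ _).
have e2 := etrans (congr1 (inner (g (F z)) (n z)) C) (@nB z X Az).
exact: (etrans (congr2 +%R e1 e2) (addr0 0)).
Qed.

Lemma slice_normal r u : J r -> V u -> unit_normal g (fun w => F (r, w)) u (n (r, u)).
Proof.
move=> Jr Vu; split; first exact: (@nn (r, u)).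
by move=> X; rewrite slice_derive //; exact: (@nf (r, u)).
Qed.

Let b0 := @basis_vec R 1 0.
Let b1 := @basis_vec R 1 1.
Local Notation n1 := (fun z => fr1 (F z) ('D_d0 F z)).
Local Notation n2 := (fun z => fr2 (F z) ('D_d0 F z)).
Local Notation n3 := (fun z => fr3 (F z) ('D_d0 F z)).
Local Notation f1 := (fun z => fr1 (F z) ('D_(dir b0) F z)).
Local Notation f2 := (fun z => fr2 (F z) ('D_(dir b0) F z)).
Local Notation f3 := (fun z => fr3 (F z) ('D_(dir b0) F z)).
Local Notation g1 := (fun z => fr1 (F z) ('D_(dir b1) F z)).
Local Notation g2 := (fun z => fr2 (F z) ('D_(dir b1) F z)).
Local Notation g3 := (fun z => fr3 (F z) ('D_(dir b1) F z)).
Local Notation B1 := (fun z => fr1 (F z) (cov_deriv g F (dir b0) ('D_d0 F) z)).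
Local Notation B2 := (fun z => fr2 (F z) (cov_deriv g F (dir b0) ('D_d0 F) z)).
Local Notation B3 := (fun z => fr3 (F z) (cov_deriv g F (dir b0) ('D_d0 F) z)).
Local Notation K1 := (fun z => fr1 (F z) (cov_deriv g F (dir b1) ('D_d0 F) z)).
Local Notation K2 := (fun z => fr2 (F z) (cov_deriv g F (dir b1) ('D_d0 F) z)).
Local Notation K3 := (fun z => fr3 (F z) (cov_deriv g F (dir b1) ('D_d0 F) z)).
Let W := jac_W n1 n2 n3 f1 f2 f3 g1 g2 g3.
Let X1 := jac_X1 n1 n2 n3 f1 f2 f3 g1 g2 g3 B1 B2 B3 K1 K2 K3.
Let X2 := jac_X2 l n1 n2 n3 f1 f2 f3 g1 g2 g3 B1 B2 B3 K1 K2 K3.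
Let X3 := jac_X3 l n1 n2 f1 f2 g1 g2 B3 K3.
Let X4 := jac_X4 l n1 n2 f1 f2 f3 g1 g2 g3 B1 B2 B3 K1 K2 K3.
Let E := jac_E m l n3.

Lemma jacobi_at z : A z ->
  [/\ is_derive z d0 W (- X1 z), is_derive z d0 X1 (E z * W z - 2 * X2 z),
    is_derive z d0 X2 ((4 * m - l ^+ 2) * X3 z), is_derive z d0 X3 (X4 z) &
    is_derive z d0 X4 (- E z * X3 z)].
Proof.
move=> Az.
have [a1 a2 a3] := @is_derive_geodesic R m l _ A F sF lF d0 geo z Az.
have [c1 c2 c3] := @is_derive_tangent R m l _ A F openA sF lF d0 (dir b0) z Az.
have [e1 e2 e3] := @is_derive_tangent R m l _ A F openA sF lF d0 (dir b1) z Az.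
have [h1 h2 h3] := @is_derive_shape R m l _ A F openA sF lF d0 (dir b0) geo z Az.
have [k1 k2 k3] := @is_derive_shape R m l _ A F openA sF lF d0 (dir b1) geo z Az.
have q1 := etrans (esym (inner_bcv m l (F z) _ _)) (nn Az).
have q2 := etrans (esym (inner_bcv m l (F z) _ _)) (@nf z b0 Az).
have q3 := etrans (esym (inner_bcv m l (F z) _ _)) (@nf z b1 Az).
have q4 := etrans (esym (inner_bcv m l (F z) _ _)) (@nB z b0 Az).
have q5 := etrans (esym (inner_bcv m l (F z) _ _)) (@nB z b1 Az).
have t2 : (l / 2) ^+ 2 + (4 * m - l ^+ 2) = 4 * m - 3 / 4 * l ^+ 2 by field.
rewrite -t2 in h1 h2 k1 k2.
exact: (@jacobi_pointwise R m l _ z d0 (bcv_om3 m l (F z) ('D_d0 F z))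
  n1 n2 n3 f1 f2 f3 g1 g2 g3 B1 B2 B3 K1 K2 K3 a1 a2 a3 c1 c2 c3 e1 e2 e3
  h1 h2 h3 k1 k2 k3 q1 q2 q3 q4 q5).
Qed.

Lemma n3_constant r u : V u -> J r -> n3 (r, u) = n3 (0, u).
Proof.
move=> Vu Jr; apply: (@constant_in_r n3 r u Vu Jr) => z Az.
by case: (@is_derive_geodesic R m l _ A F sF lF d0 geo z Az).
Qed.

Lemma E_constant r u : V u -> J r -> E (r, u) = E (0, u).
Proof. by move=> Vu Jr; rewrite /E /jac_E (n3_constant Vu Jr). Qed.

Lemma jacobi_slice u : V u -> jacobi_system (4 * m - l ^+ 2) eps (E (0, u))
  (fun r => W (r, u)) (fun r => X1 (r, u)) (fun r => X2 (r, u)) (fun r => X3 (r, u))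
  (fun r => X4 (r, u)).
Proof.
move=> Vu r; rewrite -JE => Jr; rewrite -(E_constant Vu Jr).
have [h1 h2 h3 h4 h5] := jacobi_at (conj Jr Vu : A (r, u)).
by split; [exact: derive_pair1 h1 | exact: derive_pair1 h2 | exact: derive_pair1 h3
  | exact: derive_pair1 h4 | exact: derive_pair1 h5].
Qed.

Lemma slice_lam r : J r -> forall u, V u -> lam (F (r, u)) != 0.
Proof. by move=> Jr u Vu; exact: (@lF (r, u)). Qed.

Lemma area_slice r u : J r -> V u ->
  area m l ('D_b0 (fun w => F (r, w)) u) ('D_b1 (fun w => F (r, w)) u) (n (r, u)) (F (r, u)) = W (r, u).
Proof.
move=> Jr Vu; have Az : A (r, u) by [].
exact: (congr2 (fun a b => area m l a b (n (r, u)) (F (r, u))) (slice_derive b0 Az) (slice_derive b1 Az)).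
Qed.

Lemma W_neq0 r u : J r -> V u -> W (r, u) != 0.
Proof.
move=> Jr Vu; rewrite -(area_slice Jr Vu).
exact: (area_neq0 oV (Fim Jr) (slice_lam Jr) Vu (slice_normal Jr Vu)).
Qed.

(** Since the r-derivative of W is - X1, this is the first variation of area: the logarithmic
    derivative of W is minus twice the mean curvature of the slice. *)
Lemma mean_curvature_slice r u : J r -> V u ->
  2 * mean_curvature g (fun w => F (r, w)) u (n (r, u)) * W (r, u) = X1 (r, u).
Proof.
move=> Jr Vu; have Az : A (r, u) by [].
have sn : smooth_on V (fun u => n (r, u)).
  exact: (smooth_slice oV Jr (smooth_on_derive d0 sF)).
have := @mean_curvature_shape R m l V (fun w => F (r, w)) oV (Fim Jr) (slice_lam Jr)
  (fun w => n (r, w)) sn (fun w Vw => slice_normal Jr Vw) u Vu.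
have C X := cov_deriv_slice2 g (@dF _ (dir X) Az) (@dDF _ d0 (dir X) Az).
rewrite (area_slice Jr Vu) => ->.
have D X := slice_derive X Az.
exact: (congr1 -%R (congr2 +%R
  (congr2 (fun a b => area m l a b (n (r, u)) (F (r, u))) (C b0) (D b1))
  (congr2 (fun a b => area m l a b (n (r, u)) (F (r, u))) (D b0) (C b1)))).
Qed.

Lemma smooth_W : smooth_on A W.
Proof.
have [sn1 sn2 sn3] := smooth_on_fr l openA sF lF (smooth_on_derive d0 sF).
have [sf1 sf2 sf3] := smooth_on_fr l openA sF lF (smooth_on_derive (dir b0) sF).
have [sg1 sg2 sg3] := smooth_on_fr l openA sF lF (smooth_on_derive (dir b1) sF).
have oA := openA.
by apply: (smooth_onD oA); [apply: (smooth_onD oA)|]; apply: (smooth_onM oA) => //;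
  apply: (smooth_onB oA); apply: (smooth_onM oA).
Qed.

Lemma smooth_X1 : smooth_on A X1.
Proof.
apply: (smooth_on_ext openA _ (smooth_onN openA (smooth_on_derive d0 smooth_W))) => z Az.
by have [[_ ->] _ _ _ _] := jacobi_at Az; rewrite opprK.
Qed.

Lemma continuous_slice_on (h : R * 'rV[R]_2 -> R) r u : smooth_on A h -> J r -> V u ->
  {for u, continuous (fun w => h (r, w))}.
Proof.
by move=> sh Jr Vu; apply: continuous_slice; exact: (smooth_on_continuous sh (conj Jr Vu : A (r, u))).
Qed.

Variables (u0 : 'rV[R]_2) (dlt : R).
Hypothesis (dlt0 : 0 < dlt) (bV : ball u0 dlt `<=` V).

Lemma bu0 : ball u0 dlt u0. Proof. exact: ballxx. Qed.

(** The quotient is twice the mean curvature with respect to the velocity field of the geodesics.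
    The hypothesis on the slice fixes it only for some normal field, which may differ from the
    velocity by a sign at each point; continuity removes the two-fold ambiguity. *)
Lemma quotient_constant r u : J r -> ball u0 dlt u ->
  X1 (r, u) / W (r, u) = X1 (r, u0) / W (r, u0).
Proof.
move=> Jr; have [N' [H [_ NH]]] := Fcmc Jr.
apply: (@ball_two_values R _ (fun u => X1 (r, u) / W (r, u)) u0 dlt (2 * H) (- (2 * H))).
  move=> w /bV Vw; apply: (@continuousM _ _ (fun u => X1 (r, u)) (fun u => (W (r, u))^-1)).
    exact: (continuous_slice_on smooth_X1 Jr Vw).
  apply: (@continuousV _ _ (fun u => W (r, u))); first exact: W_neq0.
  exact: (continuous_slice_on smooth_W Jr Vw).
move=> w /bV Vw; have w0 := W_neq0 Jr Vw.
have [nn' nt'] := slice_normal Jr Vw; have [[kk kt] kH] := NH w Vw.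
have a0 : area m l ('D_b0 (fun w => F (r, w)) w) ('D_b1 (fun w => F (r, w)) w) (n (r, w)) (F (r, w)) != 0.
  by rewrite (area_slice Jr Vw).
have mc := mean_curvature_slice Jr Vw.
have -> : X1 (r, w) / W (r, w) = 2 * mean_curvature g (fun w => F (r, w)) w (n (r, w)).
  exact: div_eq_of_mul mc.
have [e|e] := unit_normal_pm (slice_lam Jr Vw) a0 nn' (nt' b0) (nt' b1) kk (kt b0) (kt b1).
  by rewrite -e kH subrr mul0r.
have -> : mean_curvature g (fun w => F (r, w)) w (n (r, w)) = - H.
  by rewrite -kH e mean_curvatureN opprK.
by ring.
Qed.

(** By [spectral_pair] the continuous function E takes at most two values, so it is constant. As 4m
    - l^2 is nonzero, nu^2 is constant, and a second appeal to continuity fixes the sign of nu. *)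
Lemma angle_two_values u : 4 * m - l ^+ 2 != 0 -> X1 (0, u0) != 0 -> ball u0 dlt u ->
  n3 (0, u) = n3 (0, u0).
Proof.
move=> c0 x0 bu.
have Vu0 := bV bu0.
pose E1 := - E (0, u0) - 2 * (- E (0, u0) * X1 (0, u0) - 2 * (4 * m - l ^+ 2) * X3 (0, u0)) / X1 (0, u0).
have H w : ball u0 dlt w -> (E (0, w) - E (0, u0)) * (E (0, w) - E1) = 0.
  move=> bw; have Vw := bV bw.
  apply: (spectral_pair (jacobi_slice Vu0) (jacobi_slice Vw)).
  - by rewrite -JE; exact: J0.
  - by move=> r; rewrite -JE => Jr; exact: W_neq0.
  - exact: (W_neq0 J0 Vw).
  - move=> r; rewrite -JE => Jr; exact: (cross_mul_eq (W_neq0 Jr Vw) (W_neq0 Jr Vu0) (quotient_constant Jr bw)).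
  - exact: x0.
have [_ _ sn3] := smooth_on_fr l openA sF lF (smooth_on_derive d0 sF).
have cn3 w : ball u0 dlt w -> {for w, continuous (fun w => n3 (0, w))}.
  by move=> /bV Vw; exact: (continuous_slice_on sn3 J0 Vw).
have oA := openA.
have sE : smooth_on A E.
  apply: (smooth_onD oA); first exact: smooth_on_cst.
  apply: (smooth_onM oA); first exact: smooth_on_cst.
  apply: (smooth_onB oA); first exact: smooth_on_cst.
  exact: smooth_onX.
have cE w : ball u0 dlt w -> {for w, continuous (fun w => E (0, w))}.
  by move=> /bV Vw; exact: (continuous_slice_on sE J0 Vw).
have Ec := ball_two_values cE H.
apply: (ball_two_values (a := n3 (0, u0)) (b := - n3 (0, u0)) cn3 _ bu) => w bw.
have := Ec w bw; rewrite /E /jac_E => /addrI /(mulfI c0) /addrI /oppr_inj e.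
exact: sqr_eq_mul0 e.
Qed.

Lemma isoparametric_constants : exists h : R,
  (forall u, ball u0 dlt u -> 2 * mean_curvature g psi u (N u) = h) /\
  (4 * m - l ^+ 2 != 0 -> h != 0 -> forall u, ball u0 dlt u ->
     fr3 (psi u) (N u) = fr3 (psi u0) (N u0)).
Proof.
exists (X1 (0, u0) / W (0, u0)); split.
  move=> u bu; have Vu := bV bu.
  rewrite -(quotient_constant J0 bu) -(mean_curvature_slice J0 Vu) mulfK; last exact: (W_neq0 J0 Vu).
  by rewrite (mean_curvature_near g _ (near_psi Vu)) (n0 Vu).
move=> c0 h0 u bu.
have x0 : X1 (0, u0) != 0 by move: h0; rewrite mulf_eq0 negb_or => /andP[].
have := angle_two_values c0 x0 bu.
rewrite -(F0 (bV bu)) -(F0 (bV bu0)) -(n0 (bV bu)) -(n0 (bV bu0)).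
exact.
Qed.

End Isoparametric.

(** What is carried further of the isoparametric hypothesis; the equidistant surfaces do not occur
    after this point. *)
Lemma isoparametric_local {R : realType} (m l : R) (U : set 'rV[R]_2) (psi : 'rV[R]_2 -> 'rV[R]_3) :
  isoparametric_on (bcv_metric m l) (bcv_dom m) U psi -> forall u0, U u0 ->
  exists (d : R) (N : 'rV[R]_2 -> 'rV[R]_3) (h : R),
    [/\ 0 < d, ball u0 d `<=` U, smooth_on (ball u0 d) N,
      forall u, ball u0 d u -> unit_normal (bcv_metric m l) psi u (N u)
        /\ 2 * mean_curvature (bcv_metric m l) psi u (N u) = h &
      4 * m - l ^+ 2 != 0 -> h != 0 -> forall u, ball u0 d u ->
        bcv_fr3 m l (psi u) (N u) = bcv_fr3 m l (psi u0) (N u0)].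
Proof.
move=> iso u0 Uu0; have [V [eps [N [F [[oV Vu0 VU e0] [sN uN] [sF FM] FF Fr]]]]] := iso u0 Uu0.
have [d /= d0 bV] : nbhs_ball u0 V by apply/nbhs_ballP; exact: open_nbhs_nbhs.
have F0 u : V u -> F (0, u) = psi u by case/FF.
have FN u : V u -> 'D_1 (fun r => F (r, u)) 0 = N u by case/FF.
have Fgeo u : V u -> geodesic_on (bcv_metric m l) [set r | `|r| < eps] (fun r => F (r, u)).
  by case/FF.
have Fim r : `|r| < eps -> immersion_on V (fun u => F (r, u)) by case/Fr.
have Fcmc r : `|r| < eps -> cmc_on (bcv_metric m l) V (fun u => F (r, u)) by case/Fr.
have [h [h1 h2]] := isoparametric_constants oV e0 uN sF FM F0 FN Fgeo Fim Fcmc d0 bV.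
exists d, N, h; split => //.
- by move=> u /bV /VU.
- exact: smooth_on_sub bV sN.
- by move=> u bu; split; [exact: uN (bV _ bu) | exact: h1].
Qed.

(** * Surfaces of constant angle *)

#[local] Transparent cov_deriv.

Lemma lin_swap {R : realType} (a b x y c d : R) :
  a * x + b * y + (a * c + b * d) = a * (x + c) + b * (y + d).
Proof. by ring. Qed.

Lemma product_swap {R : realType} (a b c d x y p q s t : R) :
  a * b + c * d + (x * y + p * q) + (c * s + p * t) =
  a * b + x * y + (c * (d + s) + p * (q + t)).
Proof. by ring. Qed.

Section CovRules.
Context {R : realType}.
Variables m l : R.
Local Notation lam := (bcv_lam m).
Local Notation fr1 := (bcv_fr1 m).
Local Notation fr2 := (bcv_fr2 m).
Local Notation fr3 := (bcv_fr3 m l).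
Local Notation g := (bcv_metric m l).
Local Notation gam := (bcv_gam m l).

Lemma gam_lin k p (a b : R) (v w S : 'rV[R]_3) :
  gam k p (a *: v + b *: w) S = a * gam k p v S + b * gam k p w S.
Proof.
rewrite /bcv_gam; case: (k == 0); last case: (k == 1);
  by rewrite /gam3 /gam2 /gam1 /bcv_fr3 !mxE; ring.
Qed.

Lemma inner_lin p (a b : R) (v w S : 'rV[R]_3) :
  inner (g p) (a *: v + b *: w) S = a * inner (g p) v S + b * inner (g p) w S.
Proof.
by rewrite !inner_bcv; have [-> -> ->] := fr_lin m l p a b v w; ring.
Qed.

Lemma inner_sym p (v w : 'rV[R]_3) : inner (g p) v w = inner (g p) w v.
Proof. by rewrite !inner_bcv; ring. Qed.

Lemma inner_addl p (v w S : 'rV[R]_3) :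
  inner (g p) (v + w) S = inner (g p) v S + inner (g p) w S.
Proof. by rewrite -[v]scale1r -[w]scale1r inner_lin !scale1r !mul1r. Qed.

Lemma inner_scalel p a (v S : 'rV[R]_3) : inner (g p) (a *: v) S = a * inner (g p) v S.
Proof. by rewrite -[a *: v]addr0 -(scale0r v) inner_lin mul0r addr0. Qed.

(** Linear algebra behind Gauss' formula for arbitrary fields: v0, v1 are the coordinate vectors of
    the patch, vc is one of them, c_ij are the ambient derivatives of the coordinate vectors, and
    a_ij, b_ij are the Christoffel symbols of the induced metric. *)
Lemma tangential_algebra p (v0 v1 vc c00 c01 c10 c11 : 'rV[R]_3)
  (dy0 dy1 x0 x1 y0 y1 a00 a01 a10 a11 b00 b01 b10 b11 : R) :
  inner (g p) vc v0 * a00 + inner (g p) vc v1 * b00 = inner (g p) c00 vc ->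
  inner (g p) vc v0 * a01 + inner (g p) vc v1 * b01 = inner (g p) c01 vc ->
  inner (g p) vc v0 * a10 + inner (g p) vc v1 * b10 = inner (g p) c10 vc ->
  inner (g p) vc v0 * a11 + inner (g p) vc v1 * b11 = inner (g p) c11 vc ->
  inner (g p) ((dy0 + (a00 * x0 * y0 + a01 * x0 * y1 + (a10 * x1 * y0 + a11 * x1 * y1))) *: v0
   + (dy1 + (b00 * x0 * y0 + b01 * x0 * y1 + (b10 * x1 * y0 + b11 * x1 * y1))) *: v1) vc =
  inner (g p) ((dy0 *: v0 + dy1 *: v1)
   + (y0 *: (x0 *: c00 + x1 *: c10) + y1 *: (x0 *: c01 + x1 *: c11))) vc.
Proof.
move=> e00 e01 e10 e11; rewrite !(inner_addl, inner_scalel) -e00 -e01 -e10 -e11.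
by rewrite (inner_sym p v0 vc) (inner_sym p v1 vc); ring.
Qed.

Variables (U : set 'rV[R]_2) (psi : 'rV[R]_2 -> 'rV[R]_3).
Hypotheses (oU : open U) (spsi : smooth_on U psi) (lpsi : forall u, U u -> lam (psi u) != 0).

Lemma mx_lin (a b : R) (v w : 'rV[R]_3) i : (a *: v + b *: w) 0 i = a * v 0 i + b * w 0 i.
Proof. by rewrite !mxE. Qed.

Lemma cov_deriv_dir S u X : U u -> smooth_on U S ->
  cov_deriv g psi X S u = X 0 0 *: cov_deriv g psi (basis_vec 0) S u
    + X 0 1 *: cov_deriv g psi (basis_vec 1) S u.
Proof.
move=> Uu sS; apply: rowE3 => k; have l0 := lpsi Uu.
have C Z := @cov_deriv_bcvE R m l _ psi S Z u k l0.
have E1 := smooth_mx_derive_rV2 oU X Uu sS; have E2 := smooth_mx_derive_rV2 oU X Uu spsi.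
apply: (etrans (C X)); apply: (etrans _ (esym (mx_lin _ _ _ _ _))).
apply: (etrans _ (esym (congr2 (fun a b => X 0 0 * a + X 0 1 * b) (C _) (C _)))).
apply: (etrans (congr2 +%R (etrans (congr1 (fun q : 'rV[R]_3 => q 0 k) E1) (mx_lin _ _ _ _ _))
  (etrans (congr1 (fun q => gam k (psi u) q (S u)) E2) (gam_lin _ _ _ _ _ _ _)))).
exact: lin_swap.
Qed.

Lemma cov_deriv_scale S u X (a : R) : U u -> smooth_on U S ->
  cov_deriv g psi (a *: X) S u = a *: cov_deriv g psi X S u.
Proof.
move=> Uu sS; apply: (etrans (cov_deriv_dir _ Uu sS)).
apply: (etrans _ (congr1 (fun q => a *: q) (esym (cov_deriv_dir X Uu sS)))).
by move: (cov_deriv _ _ _ _ _) (cov_deriv _ _ _ _ _) => x y; rewrite !mxE scalerDr !scalerA.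
Qed.

Lemma smooth_onZ_mx (f : 'rV[R]_2 -> R) (S : 'rV[R]_2 -> 'rV[R]_3) :
  smooth_on U f -> smooth_on U S -> smooth_on U (fun u => f u *: S u).
Proof.
move=> sf sS; apply: (smooth_on_mx oU) => i j.
rewrite (_ : (fun y => _) = fun y => f y * S y i j); last by apply/funext => y; rewrite mxE.
exact: (smooth_onM oU sf (smooth_on_coord i j oU sS)).
Qed.

Lemma cov_deriv_comb (f f' : 'rV[R]_2 -> R) (S T : 'rV[R]_2 -> 'rV[R]_3) u X : U u ->
  smooth_on U f -> smooth_on U f' -> smooth_on U S -> smooth_on U T ->
  cov_deriv g psi X (fun w => f w *: S w + f' w *: T w) u =
   ('D_X f u *: S u + 'D_X f' u *: T u)
   + (f u *: cov_deriv g psi X S u + f' u *: cov_deriv g psi X T u).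
Proof.
move=> Uu sf sf' sS sT; apply: rowE3 => k; have l0 := lpsi Uu.
have sC := smooth_onD oU (smooth_onZ_mx sf sS) (smooth_onZ_mx sf' sT).
have C Z := @cov_deriv_bcvE R m l _ psi Z X u k l0.
apply: (etrans (C _)).
have Addk (v w : 'rV[R]_3) : (v + w) 0 k = v 0 k + w 0 k by rewrite mxE.
apply: (etrans _ (esym (Addk _ _))).
apply: (etrans _ (esym (congr2 +%R (mx_lin _ _ _ _ _) (mx_lin _ _ _ _ _)))).
have d1 := derivableP (@smooth_on_derivable _ _ _ U f u X sf Uu).
have d2 := derivableP (@smooth_on_derivable _ _ _ U f' u X sf' Uu).
have e1 := derive_coord 0 k (@smooth_on_derivable _ _ _ U S u X sS Uu).
have e2 := derive_coord 0 k (@smooth_on_derivable _ _ _ U T u X sT Uu).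
have [_ e3] := derive_coord 0 k (@smooth_on_derivable _ _ _ U _ u X sC Uu).
have e4 : is_derive u X (fun w => f w * S w 0 k + f' w * T w 0 k)
   ('D_X f u * S u 0 k + f u * 'D_X S u 0 k + ('D_X f' u * T u 0 k + f' u * 'D_X T u 0 k)).
  exact: (dadd (dmul d1 e1) (dmul d2 e2)).
have E5 : (fun w => (f w *: S w + f' w *: T w) 0 k) = (fun w => f w * S w 0 k + f' w * T w 0 k).
  by apply/funext => w; exact: mx_lin.
have e5 := etrans (esym e3) (etrans (congr1 (fun q => 'D_X q u) E5) (@derive_val _ _ _ _ _ _ _ e4)).
apply: (etrans (congr2 +%R e5 (etrans (gam_sym _ _ _ _ _ _) (gam_lin _ _ _ _ _ _ _)))).
apply: (etrans _ (esym (congr2 (fun a b => 'D_X f u * S u 0 k + 'D_X f' u * T u 0 k +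
  (f u * a + f' u * b)) (C S) (C T)))).
apply: (etrans (congr2 (fun a b => _ + (f u * a + f' u * b)) (gam_sym _ _ _ _ _ _) (gam_sym _ _ _ _ _ _))).
exact: product_swap.
Qed.
Hypothesis ipsi : immersion_on U psi.
Local Notation G := (induced_metric g psi).
Local Notation d_ i := ('D_(basis_vec i) psi).

Lemma induced_metricE u a b : G u a b = inner (g (psi u)) (d_ a u) (d_ b u).
Proof. exact: mxE. Qed.

Lemma inner2E (M : 'M[R]_2) (X Y : 'rV[R]_2) : inner M X Y =
  X 0 0 * (M 0 0 * Y 0 0 + M 0 1 * Y 0 1) + X 0 1 * (M 1 0 * Y 0 0 + M 1 1 * Y 0 1).
Proof. by rewrite /inner mxE sum2 !mxE !sum2; ring. Qed.

Lemma inner_induced u X Y : U u -> inner (G u) X Y = inner (g (psi u)) ('D_X psi u) ('D_Y psi u).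
Proof.
move=> Uu; apply: (etrans (inner2E _ _ _)).
rewrite (induced_metricE u 0 0) (induced_metricE u 0 1) (induced_metricE u 1 0) (induced_metricE u 1 1).
apply: (etrans _ (esym (congr2 (inner (g (psi u))) (smooth_mx_derive_rV2 oU X Uu spsi)
  (smooth_mx_derive_rV2 oU Y Uu spsi)))).
move: (d_ 0 u) (d_ 1 u) => v w; rewrite inner_lin !(inner_sym _ _ (_ + _)) !inner_lin.
rewrite (inner_sym _ w v); ring.
Qed.

Lemma induced_unitmx u : U u -> G u \in unitmx.
Proof.
move=> Uu; apply: definite_unitmx => X; rewrite inner_induced //.
have [_ inj] := ipsi => H; apply: (inj u X Uu); move: H; move: ('D_X psi u) => v.
by rewrite inner_bcv => /sum_sqr3_eq0[]; apply: fr_eq0; exact: lpsi.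
Qed.

Lemma derive_induced u i j k : U u -> 'D_(basis_vec i) (fun q => G q j k) u =
  inner (g (psi u)) (cov_deriv g psi (basis_vec i) (d_ j) u) (d_ k u)
  + inner (g (psi u)) (d_ j u) (cov_deriv g psi (basis_vec i) (d_ k) u).
Proof.
move=> Uu; have D := is_derive_inner l (lpsi Uu)
  (@smooth_on_derivable _ _ _ U psi u (basis_vec i) spsi Uu)
  (@smooth_on_derivable _ _ _ U _ u (basis_vec i) (smooth_on_derive (basis_vec j) spsi) Uu)
  (@smooth_on_derivable _ _ _ U _ u (basis_vec i) (smooth_on_derive (basis_vec k) spsi) Uu).
rewrite (_ : (fun q => G q j k) = fun y => inner (g (psi y)) (d_ j y) (d_ k y)).
  by case: D.
by apply/funext => y; exact: induced_metricE.
Qed.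

Lemma koszul_sum (a a' b b' c c' : R) : a' = a -> b' = b -> c' = c ->
  a + b + (a' + c) - (b' + c') = 2 * a.
Proof. by move=> -> -> ->; ring. Qed.

(* Gauss' formula: the induced connection is the tangential part of the ambient one. *)
Lemma christoffel_induced u i j c : U u ->
  \sum_k G u c k * christoffel G k i j u =
  inner (g (psi u)) (cov_deriv g psi (basis_vec i) (d_ j) u) (d_ c u).
Proof.
move=> Uu; have uG := induced_unitmx Uu.
pose v := \col_h inner (g (psi u)) (cov_deriv g psi (basis_vec i) (d_ j) u) (d_ h u).
pose K k := (invmx (G u) *m v) k 0.
have GK h : \sum_k G u h k * K k = v h 0.
  have /matrixP/(_ h 0) : G u *m (invmx (G u) *m v) = v by rewrite mulmxA mulmxV // mul1mx.
  by rewrite mxE.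
have sym h k := @cov_deriv_sym R m l _ U psi oU spsi lpsi u (basis_vec h) (basis_vec k) Uu.
have S h k r : inner (g (psi u)) (cov_deriv g psi (basis_vec h) (d_ k) u) (d_ r u) =
    inner (g (psi u)) (cov_deriv g psi (basis_vec k) (d_ h) u) (d_ r u).
  exact: (congr1 (fun q => inner (g (psi u)) q (d_ r u)) (sym h k)).
have S' h k r : inner (g (psi u)) (d_ r u) (cov_deriv g psi (basis_vec h) (d_ k) u) =
    inner (g (psi u)) (d_ r u) (cov_deriv g psi (basis_vec k) (d_ h) u).
  exact: (congr1 (fun q => inner (g (psi u)) (d_ r u) q) (sym h k)).
have CK : forall k, christoffel G k i j u = K k.
  apply: (@christoffel_koszul R 1 G u K i j uG) => h.
  apply: (etrans _ (congr1 (fun q => 2 * q) (esym (GK h)))).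
  apply: (etrans _ (congr1 (fun q => 2 * q) (esym (mxE _ _ _ _)))).
  apply: (etrans (congr2 (fun a b => a - b) (congr2 +%R (derive_induced i j h Uu)
     (derive_induced j i h Uu)) (derive_induced h i j Uu))).
  apply: koszul_sum.
  - exact: S.
  - exact: (etrans (S _ _ _) (inner_sym _ _ _)).
  - exact: S'.
apply: (etrans (eq_bigr _ (fun k _ => congr1 (fun q => G u c k * q) (CK k)))).
exact: (etrans (GK c) (mxE _ _ _ _)).
Qed.

(** Gauss' formula for a tangent field that is not a coordinate field. It is needed because the
    tension fields are computed in an adapted frame. *)
Lemma nabla_surf_tangential (Y : 'rV[R]_2 -> 'rV[R]_2) u X c : U u -> smooth_on U Y ->
  inner (g (psi u)) ('D_(nabla_surf g psi X Y u) psi u) (d_ c u) =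
  inner (g (psi u)) (cov_deriv g psi X (fun w => 'D_(Y w) psi w) u) (d_ c u).
Proof.
move=> Uu sY.
have sY0 := smooth_on_coord 0 0 oU sY; have sY1 := smooth_on_coord 0 1 oU sY.
have sd i := smooth_on_derive (basis_vec i) spsi.
have eC : cov_deriv g psi X (fun w => 'D_(Y w) psi w) u =
    cov_deriv g psi X (fun w => Y w 0 0 *: d_ 0 w + Y w 0 1 *: d_ 1 w) u.
  apply: cov_deriv_near; first by apply: filterE.
  by apply: filterS (open_nbhs_nbhs (conj oU Uu)) => w Uw; exact: (smooth_mx_derive_rV2 oU).
apply: (etrans _ (congr1 (fun q => inner (g (psi u)) q (d_ c u)) (esym eC))).
apply: (etrans _ (congr1 (fun q => inner (g (psi u)) q (d_ c u))
  (esym (cov_deriv_comb X Uu sY0 sY1 (sd 0) (sd 1))))).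
apply: (etrans (congr1 (fun q => inner (g (psi u)) q (d_ c u)) (smooth_mx_derive_rV2 oU _ Uu spsi))).
have D i := cov_deriv_dir X Uu (sd i).
have ex : (nabla_surf g psi X Y u) = 'D_X Y u + \row_k \sum_i \sum_j
    christoffel G k i j u * X 0 i * Y u 0 j.
  rewrite /nabla_surf /cov_deriv; congr (_ + _); apply/rowP => k.
  apply: (etrans (mxE _ _ _ _)); apply: (etrans _ (esym (mxE _ _ _ _))).
  apply: eq_bigr => i _; apply: eq_bigr => j _.
  by rewrite derive_id.
have dY i : 'D_X Y u 0 i = 'D_X (fun w => Y w 0 i) u.
  by case: (derive_coord 0 i (@smooth_on_derivable _ _ _ U Y u X sY Uu)).
have nk k : nabla_surf g psi X Y u 0 k = 'D_X (fun w => Y w 0 k) u +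
   (christoffel G k 0 0 u * X 0 0 * Y u 0 0 + christoffel G k 0 1 u * X 0 0 * Y u 0 1
   + (christoffel G k 1 0 u * X 0 1 * Y u 0 0 + christoffel G k 1 1 u * X 0 1 * Y u 0 1)).
  rewrite ex; apply: (etrans (mxE _ _ _ _)); rewrite (dY k); congr (_ + _).
  by apply: (etrans (mxE _ _ _ _)); rewrite !sum2.
have CI i j := christoffel_induced i j c Uu.
have e i j : inner (g (psi u)) (d_ c u) (d_ 0 u) * christoffel G 0 i j u
   + inner (g (psi u)) (d_ c u) (d_ 1 u) * christoffel G 1 i j u
   = inner (g (psi u)) (cov_deriv g psi (basis_vec i) (d_ j) u) (d_ c u).
  apply: (etrans _ (CI i j)); apply: (etrans _ (esym (sum2 _))).
  exact: (congr2 (fun a b => a * _ + b * _) (esym (induced_metricE u c 0)) (esym (induced_metricE u c 1))).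
apply: (etrans (congr2 (fun a b => inner (g (psi u)) (a *: d_ 0 u + b *: d_ 1 u) (d_ c u)) (nk 0) (nk 1))).
apply: (etrans (tangential_algebra _ _ _ _ _ _ (e 0 0) (e 0 1) (e 1 0) (e 1 1))).
exact: (congr2 (fun a b => inner (g (psi u)) (_ + (Y u 0 0 *: a + Y u 0 1 *: b)) (d_ c u))
  (esym (D 0)) (esym (D 1))).
Qed.

End CovRules.

#[local] Opaque derive cov_deriv.

Section ShapeAlgebra.
Context {R : realType}.
Variables (n1 n2 nu t h : R).
Hypothesis nn : n1 * n1 + n2 * n2 + nu * nu = 1.

(** For f orthogonal to n, the numbers f3 and f1 n2 - f2 n1 are the inner products of f with T and
    K. These two tangent vectors are orthogonal of squared length 1 - nu^2, so the area form and, in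
    [perp_dot], the inner product have the usual expression up to this factor. *)
Lemma perp_tri f1 f2 f3 g1 g2 g3 :
  n1 * f1 + n2 * f2 + nu * f3 = 0 -> n1 * g1 + n2 * g2 + nu * g3 = 0 ->
  (1 - nu ^+ 2) * tri f1 f2 f3 g1 g2 g3 n1 n2 nu =
    f3 * (g1 * n2 - g2 * n1) - g3 * (f1 * n2 - f2 * n1).
Proof.
move=> nf ng; rewrite /tri.
have e : nu ^+ 2 = 1 - n1 ^+ 2 - n2 ^+ 2 by rewrite -nn; ring.
have [p [-> -> ->]] := perp_cross nn nf; have [q [-> -> ->]] := perp_cross nn ng.
by ring: e.
Qed.

Lemma perp_dot f1 f2 f3 g1 g2 g3 :
  n1 * f1 + n2 * f2 + nu * f3 = 0 -> n1 * g1 + n2 * g2 + nu * g3 = 0 ->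
  (1 - nu ^+ 2) * (f1 * g1 + f2 * g2 + f3 * g3) =
    f3 * g3 + (f1 * n2 - f2 * n1) * (g1 * n2 - g2 * n1).
Proof.
move=> nf ng.
have e : nu ^+ 2 = 1 - n1 ^+ 2 - n2 ^+ 2 by rewrite -nn; ring.
have [p [-> -> ->]] := perp_cross nn nf; have [q [-> -> ->]] := perp_cross nn ng.
by ring: e.
Qed.

Variables (f1 f2 f3 g1 g2 g3 b1 b2 k1 k2 : R).
Let kf := f1 * n2 - f2 * n1.
Let kg := g1 * n2 - g2 * n1.
Hypotheses (nf : n1 * f1 + n2 * f2 + nu * f3 = 0) (ng : n1 * g1 + n2 * g2 + nu * g3 = 0)
  (nb : n1 * b1 + n2 * b2 + nu * (t * kf) = 0) (nk : n1 * k1 + n2 * k2 + nu * (t * kg) = 0)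
  (sym : f1 * k1 + f2 * k2 + f3 * (t * kg) = g1 * b1 + g2 * b2 + g3 * (t * kf))
  (W0 : tri f1 f2 f3 g1 g2 g3 n1 n2 nu != 0)
  (tr : h * tri f1 f2 f3 g1 g2 g3 n1 n2 nu =
    - (tri b1 b2 (t * kf) g1 g2 g3 n1 n2 nu + tri f1 f2 f3 k1 k2 (t * kg) n1 n2 nu))
  (D0 : 1 - nu ^+ 2 != 0).

Lemma shape_kernel (x y p q p' q' : R) : p * y - p' * x = 0 -> q' * x - q * y = 0 ->
  p * q' - p' * q != 0 -> x = 0 /\ y = 0.
Proof.
move=> e1 e2 w; split; apply: (mulfI w); rewrite mulr0.
  transitivity (p * (q' * x - q * y) + q * (p * y - p' * x)); first by ring.
  by rewrite e1 e2; ring.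
transitivity (q' * (p * y - p' * x) + p' * (q' * x - q * y)); first by ring.
by rewrite e1 e2; ring.
Qed.

(** Constancy of nu prescribes the component of the derivative of n along T: it is t times the
    K-component of the direction. Symmetry and trace are then two linear equations for the
    K-components bf and bg, with the area as determinant. In the basis T, K the derivative of n has
    the matrix with rows (0, t) and (t, - h). *)
Lemma shape_solution :
  [/\ (1 - nu ^+ 2) * b1 = t * (f3 * n2 - kf * nu * n1) - h * kf * n2,
      (1 - nu ^+ 2) * b2 = - t * (f3 * n1 + kf * nu * n2) + h * kf * n1,
      (1 - nu ^+ 2) * k1 = t * (g3 * n2 - kg * nu * n1) - h * kg * n2 &
      (1 - nu ^+ 2) * k2 = - t * (g3 * n1 + kg * nu * n2) + h * kg * n1].
Proof.
pose bf := b1 * n2 - b2 * n1; pose bg := k1 * n2 - k2 * n1.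
have w0 : f3 * kg - g3 * kf != 0 by rewrite -(perp_tri nf ng) mulf_neq0.
have s1 : f3 * (t * kg) + kf * bg = g3 * (t * kf) + kg * bf.
  by rewrite -(perp_dot nf nk) -(perp_dot ng nb) sym.
have s2 : h * (f3 * kg - g3 * kf) = - (t * kf * kg - g3 * bf + (f3 * bg - t * kg * kf)).
  by rewrite -(perp_tri nf ng) -(perp_tri nb ng) -(perp_tri nf nk) mulrCA tr; ring.
have [ef eg] : bf - t * f3 + h * kf = 0 /\ bg - t * g3 + h * kg = 0.
  apply: (@shape_kernel _ _ f3 kf g3 kg); last exact: w0.
  - transitivity (f3 * bg - g3 * bf + h * (f3 * kg - g3 * kf)); first by ring.
    by rewrite s2; ring.
  - transitivity (g3 * (t * kf) + kg * bf - (f3 * (t * kg) + kf * bg)); first by ring.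
    by rewrite s1; ring.
have bfE : bf = t * f3 - h * kf by move: ef; lra.
have bgE : bg = t * g3 - h * kg by move: eg; lra.
have DE : 1 - nu ^+ 2 = n1 * n1 + n2 * n2 by rewrite -nn; ring.
rewrite DE; split.
- transitivity (n1 * (n1 * b1 + n2 * b2 + nu * (t * kf)) - n1 * nu * t * kf + n2 * bf).
    by rewrite /bf; ring.
  by rewrite nb bfE; ring.
- transitivity (n2 * (n1 * b1 + n2 * b2 + nu * (t * kf)) - n2 * nu * t * kf - n1 * bf).
    by rewrite /bf; ring.
  by rewrite nb bfE; ring.
- transitivity (n1 * (n1 * k1 + n2 * k2 + nu * (t * kg)) - n1 * nu * t * kg + n2 * bg).
    by rewrite /bg; ring.
  by rewrite nk bgE; ring.
- transitivity (n2 * (n1 * k1 + n2 * k2 + nu * (t * kg)) - n2 * nu * t * kg - n1 * bg).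
    by rewrite /bg; ring.
  by rewrite nk bgE; ring.
Qed.

End ShapeAlgebra.

Lemma slice_trace {R : realType} (t nu n1 n2 f1 f2 f3 g1 g2 g3 b1 b2 b3 k1 k2 k3 : R) :
  n1 = 0 -> n2 = 0 -> f3 = 0 -> g3 = 0 ->
  b1 = t * f2 * nu /\ b2 = - (t * f1 * nu) -> k1 = t * g2 * nu /\ k2 = - (t * g1 * nu) ->
  - (tri b1 b2 b3 g1 g2 g3 n1 n2 nu + tri f1 f2 f3 k1 k2 k3 n1 n2 nu) = 0.
Proof. by move=> -> -> -> -> [-> ->] [-> ->]; rewrite /tri; ring. Qed.

Lemma shape_solution_eq {R : realType} (n1 n2 nu t h f1 f2 f3 g1 g2 g3 b1 b2 b3 k1 k2 k3 : R) :
  n1 * n1 + n2 * n2 + nu * nu = 1 ->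
  n1 * f1 + n2 * f2 + nu * f3 = 0 -> n1 * g1 + n2 * g2 + nu * g3 = 0 ->
  n1 * b1 + n2 * b2 + nu * b3 = 0 -> n1 * k1 + n2 * k2 + nu * k3 = 0 ->
  b3 = t * (f1 * n2 - f2 * n1) -> k3 = t * (g1 * n2 - g2 * n1) ->
  f1 * k1 + f2 * k2 + f3 * k3 = g1 * b1 + g2 * b2 + g3 * b3 ->
  tri f1 f2 f3 g1 g2 g3 n1 n2 nu != 0 ->
  h * tri f1 f2 f3 g1 g2 g3 n1 n2 nu =
    - (tri b1 b2 b3 g1 g2 g3 n1 n2 nu + tri f1 f2 f3 k1 k2 k3 n1 n2 nu) ->
  1 - nu ^+ 2 != 0 ->
  [/\ (1 - nu ^+ 2) * b1 = t * (f3 * n2 - (f1 * n2 - f2 * n1) * nu * n1) - h * (f1 * n2 - f2 * n1) * n2,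
      (1 - nu ^+ 2) * b2 = - t * (f3 * n1 + (f1 * n2 - f2 * n1) * nu * n2) + h * (f1 * n2 - f2 * n1) * n1,
      (1 - nu ^+ 2) * k1 = t * (g3 * n2 - (g1 * n2 - g2 * n1) * nu * n1) - h * (g1 * n2 - g2 * n1) * n2 &
      (1 - nu ^+ 2) * k2 = - t * (g3 * n1 + (g1 * n2 - g2 * n1) * nu * n2) + h * (g1 * n2 - g2 * n1) * n1].
Proof. by move=> nn nf ng + + e3 e3'; rewrite e3 e3' => *; exact: shape_solution. Qed.

Lemma shape_comb {R : realType} (D t h nu n1 n2 x y f1 f2 f3 g1 g2 g3 b1 b2 k1 k2
   F1 F2 F3 B1 B2 : R) :
  F1 = x * f1 + y * g1 -> F2 = x * f2 + y * g2 -> F3 = x * f3 + y * g3 ->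
  B1 = x * b1 + y * k1 -> B2 = x * b2 + y * k2 ->
  [/\ D * b1 = t * (f3 * n2 - (f1 * n2 - f2 * n1) * nu * n1) - h * (f1 * n2 - f2 * n1) * n2,
      D * b2 = - t * (f3 * n1 + (f1 * n2 - f2 * n1) * nu * n2) + h * (f1 * n2 - f2 * n1) * n1,
      D * k1 = t * (g3 * n2 - (g1 * n2 - g2 * n1) * nu * n1) - h * (g1 * n2 - g2 * n1) * n2 &
      D * k2 = - t * (g3 * n1 + (g1 * n2 - g2 * n1) * nu * n2) + h * (g1 * n2 - g2 * n1) * n1] ->
  D * B1 = t * (F3 * n2 - (F1 * n2 - F2 * n1) * nu * n1) - h * (F1 * n2 - F2 * n1) * n2 /\
  D * B2 = - t * (F3 * n1 + (F1 * n2 - F2 * n1) * nu * n2) + h * (F1 * n2 - F2 * n1) * n1.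
Proof.
move=> -> -> -> -> -> [a1 a2 a3 a4]; split.
  by rewrite mulrDr mulrCA a1 [_ * (y * _)]mulrCA a3; ring.
by rewrite mulrDr mulrCA a2 [_ * (y * _)]mulrCA a4; ring.
Qed.

(** As n1^2 + n2^2 = 1 - nu^2 is constant, the horizontal part of n can only rotate; th is its rate
    of rotation, collected from the shape operator and the connection form. *)
Lemma theta_algebra {R : realType} (m t h nu n1 n2 f1 f2 f3 b1 b2 x y : R) :
  1 - nu ^+ 2 != 0 -> n1 * n1 + n2 * n2 + nu * nu = 1 -> n1 * f1 + n2 * f2 + nu * f3 = 0 ->
  (1 - nu ^+ 2) * b1 = t * (f3 * n2 - (f1 * n2 - f2 * n1) * nu * n1) - h * (f1 * n2 - f2 * n1) * n2 /\
  (1 - nu ^+ 2) * b2 = - t * (f3 * n1 + (f1 * n2 - f2 * n1) * nu * n2) + h * (f1 * n2 - f2 * n1) * n1 ->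
  let o := - t * f3 + 2 * m * (y * f1 - x * f2) in
  let th := 2 * t * nu ^+ 2 / (1 - nu ^+ 2) * f3 - h / (1 - nu ^+ 2) * (f1 * n2 - f2 * n1)
    + 2 * m * (y * f1 - x * f2) in
  b1 - (t * f2 * nu - o * n2) = th * n2 /\ b2 - (o * n1 - t * f1 * nu) = - th * n1.
Proof.
move=> D0 nn nf [s1 s2] o th.
have e : nu ^+ 2 = 1 - n1 ^+ 2 - n2 ^+ 2 by rewrite -nn; ring.
have [p [ef1 ef2 ef3]] := perp_cross nn nf.
split; apply: (mulfI D0).
- rewrite mulrBr s1 /th /o; transitivity (2 * t * nu ^+ 2 * f3 * n2 - h * (f1 * n2 - f2 * n1) * n2
    + (1 - nu ^+ 2) * (2 * m * (y * f1 - x * f2)) * n2); last by field.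
  by rewrite ef1 ef2 ef3; ring: e.
- rewrite mulrBr s2 /th /o; transitivity (- (2 * t * nu ^+ 2 * f3 * n1 - h * (f1 * n2 - f2 * n1) * n1
    + (1 - nu ^+ 2) * (2 * m * (y * f1 - x * f2)) * n1)); last by field.
  by rewrite ef1 ef2 ef3; ring: e.
Qed.

Section GaussAlgebra.
Context {R : realType}.
Variables (V : normedModType R) (w d d' : V) (m l h nu : R).
Variables n1 n2 x y f1 f2 f3 g1 g2 g3 : V -> R.
Variables c1 c2 c3 L : R.
Let t := l / 2.
Let of_ := - t * f3 w + 2 * m * (y w * f1 w - x w * f2 w).
Let og := - t * g3 w + 2 * m * (y w * g1 w - x w * g2 w).
Let D := 1 - nu ^+ 2.
Let th (u1 u2 u3 : V -> R) z := 2 * t * nu ^+ 2 / D * u3 z - h / D * (u1 z * n2 z - u2 z * n1 z)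
    + 2 * m * (y z * u1 z - x z * u2 z).
Hypotheses (D0 : D != 0) (nn : n1 w * n1 w + n2 w * n2 w + nu * nu = 1)
  (nf : n1 w * f1 w + n2 w * f2 w + nu * f3 w = 0)
  (ng : n1 w * g1 w + n2 w * g2 w + nu * g3 w = 0)
  (W0 : tri (f1 w) (f2 w) (f3 w) (g1 w) (g2 w) (g3 w) (n1 w) (n2 w) nu != 0)
  (LE : L = 1 + m * (x w ^+ 2 + y w ^+ 2)).
Hypotheses
  (xd : is_derive w d x (L * f1 w)) (yd : is_derive w d y (L * f2 w))
  (xd' : is_derive w d' x (L * g1 w)) (yd' : is_derive w d' y (L * g2 w))
  (n1d : is_derive w d n1 (th f1 f2 f3 w * n2 w)) (n2d : is_derive w d n2 (- th f1 f2 f3 w * n1 w))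
  (n1d' : is_derive w d' n1 (th g1 g2 g3 w * n2 w)) (n2d' : is_derive w d' n2 (- th g1 g2 g3 w * n1 w))
  (f1d' : is_derive w d' f1 (c1 - (t * g2 w * f3 w - og * f2 w)))
  (f2d' : is_derive w d' f2 (c2 - (og * f1 w - t * g1 w * f3 w)))
  (f3d' : is_derive w d' f3 (c3 - (t * g1 w * f2 w - t * g2 w * f1 w)))
  (g1d : is_derive w d g1 (c1 - (t * f2 w * g3 w - of_ * g2 w)))
  (g2d : is_derive w d g2 (c2 - (of_ * g1 w - t * f1 w * g3 w)))
  (g3d : is_derive w d g3 (c3 - (t * f1 w * g2 w - t * f2 w * g1 w))).
Hypothesis closed_theta : forall a b, is_derive w d' (th f1 f2 f3) a ->
  is_derive w d (th g1 g2 g3) b -> a = b.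

(** The form th is minus the differential of the polar angle of (n1, n2), hence closed. In the
    difference of its two derivatives the components c1, c2, c3 of nabla_f g = nabla_g f cancel, and
    what is left is the area times the stated expression divided by D. *)
Lemma gauss_algebra : nu * (4 * m * D + l ^+ 2 * nu ^+ 2 + h ^+ 2) = 0.
Proof.
have A := dadd (dadd (dmul (dcst w d' (2 * t * nu ^+ 2 / D)) f3d') (dopp (dmul (dcst w d' (h / D))
   (dadd (dmul f1d' n2d') (dopp (dmul f2d' n1d'))))))
   (dmul (dcst w d' (2 * m)) (dadd (dmul yd' f1d') (dopp (dmul xd' f2d')))).
have B := dadd (dadd (dmul (dcst w d (2 * t * nu ^+ 2 / D)) g3d) (dopp (dmul (dcst w d (h / D))
   (dadd (dmul g1d n2d) (dopp (dmul g2d n1d))))))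
   (dmul (dcst w d (2 * m)) (dadd (dmul yd g1d) (dopp (dmul xd g2d)))).
have := closed_theta A B; move/eqP; rewrite -subr_eq0 => /eqP.
have nuE : nu ^+ 2 = 1 - D by rewrite /D; ring.
have nE : n2 w ^+ 2 = D - n1 w ^+ 2.
  by rewrite /D -(_ : n1 w * n1 w + n2 w * n2 w = 1 - nu ^+ 2) ?expr2; [ring | rewrite -nn; ring].
have lE : m * x w ^+ 2 = L - 1 - m * y w ^+ 2 by rewrite LE; ring.
move=> H; apply: (mulIf W0); rewrite mul0r.
transitivity (D * 0 : R); last by rewrite mulr0.
rewrite -H /tri /th /of_ /og /t.
have [p [-> -> ->]] := perp_cross nn nf; have [q [-> -> ->]] := perp_cross nn ng.
clearbody D; field: nuE nE lE.
exact: D0.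
Qed.
End GaussAlgebra.

(** The commuting second derivatives of n1 and n2 are multiplied by n2 and - n1 and added: the
    products of p and q cancel, and (a - b) (n1^2 + n2^2) = 0 remains. This proves closedness
    without choosing a polar angle. *)
Lemma rotation_closed {R : realType} (V : normedModType R) (U : set V) (d d' u : V)
  (n1 n2 p q : V -> R) (a b D : R) : open U -> U u -> smooth_on U n1 -> smooth_on U n2 ->
  D != 0 -> n1 u * n1 u + n2 u * n2 u = D ->
  (forall w, U w -> is_derive w d n1 (p w * n2 w) /\ is_derive w d n2 (- p w * n1 w)) ->
  (forall w, U w -> is_derive w d' n1 (q w * n2 w) /\ is_derive w d' n2 (- q w * n1 w)) ->
  is_derive u d' p a -> is_derive u d q b -> a = b.
Proof.
move=> oU Uu s1 s2 D0 DE hd hd' pa qb.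
have [hd1 hd2] := hd u Uu; have [hd1' hd2'] := hd' u Uu.
have nU (P : V -> Prop) : (forall w, U w -> P w) -> \forall w \near u, P w.
  by move=> UP; apply: filterS (open_nbhs_nbhs (conj oU Uu)).
have e1 : 'D_d' ('D_d n1) u = a * n2 u + p u * (- q u * n1 u).
  have [_ <-] := dmul pa hd2'; apply: near_eq_derive; apply: nU => w Uw.
  by have [[_ ->] _] := hd w Uw.
have e2 : 'D_d ('D_d' n1) u = b * n2 u + q u * (- p u * n1 u).
  have [_ <-] := dmul qb hd2; apply: near_eq_derive; apply: nU => w Uw.
  by have [[_ ->] _] := hd' w Uw.
have e3 : 'D_d' ('D_d n2) u = - a * n1 u + - p u * (q u * n2 u).
  have [_ <-] := dmul (dopp pa) hd1'; apply: near_eq_derive; apply: nU => w Uw.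
  by have [_ [_ ->]] := hd w Uw.
have e4 : 'D_d ('D_d' n2) u = - b * n1 u + - q u * (p u * n2 u).
  have [_ <-] := dmul (dopp qb) hd1; apply: near_eq_derive; apply: nU => w Uw.
  by have [_ [_ ->]] := hd' w Uw.
have c1 := etrans (esym e1) (etrans (@smooth_on_derive_comm R V U n1 u d' d oU Uu s1) e2).
have c2 := etrans (esym e3) (etrans (@smooth_on_derive_comm R V U n2 u d' d oU Uu s2) e4).
apply: (mulIf D0); rewrite -DE.
transitivity (n2 u * (a * n2 u + p u * (- q u * n1 u)) - n1 u * (- a * n1 u + - p u * (q u * n2 u))); first by ring.
by rewrite c1 c2; ring.
Qed.

Section ConstantAngle.
Context {R : realType}.
Variables m l : R.
Local Notation lam := (bcv_lam m).
Local Notation fr1 := (bcv_fr1 m).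
Local Notation fr2 := (bcv_fr2 m).
Local Notation fr3 := (bcv_fr3 m l).
Local Notation g := (bcv_metric m l).
Variables (U : set 'rV[R]_2) (psi N : 'rV[R]_2 -> 'rV[R]_3) (h nu : R).
Hypotheses (oU : open U) (ipsi : immersion_on U psi) (lpsi : forall u, U u -> lam (psi u) != 0)
  (sN : smooth_on U N) (uN : forall u, U u -> unit_normal g psi u (N u))
  (hH : forall u, U u -> 2 * mean_curvature g psi u (N u) = h)
  (hnu : forall u, U u -> fr3 (psi u) (N u) = nu) (h0 : h != 0).
Local Notation t := (l / 2).
Local Notation n1 u := (fr1 (psi u) (N u)).
Local Notation n2 u := (fr2 (psi u) (N u)).
Local Notation f1 X u := (fr1 (psi u) ('D_X psi u)).
Local Notation f2 X u := (fr2 (psi u) ('D_X psi u)).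
Local Notation f3 X u := (fr3 (psi u) ('D_X psi u)).
Local Notation b1 X u := (fr1 (psi u) (cov_deriv g psi X N u)).
Local Notation b2 X u := (fr2 (psi u) (cov_deriv g psi X N u)).
Local Notation b3 X u := (fr3 (psi u) (cov_deriv g psi X N u)).
Local Notation e0 := (@basis_vec R 1 0).
Local Notation e1 := (@basis_vec R 1 1).

Lemma angle_smooth : smooth_on U psi. Proof. by case: ipsi. Qed.

Lemma angle_nn u : U u -> n1 u * n1 u + n2 u * n2 u + nu * nu = 1.
Proof.
move=> Uu; have [H _] := uN Uu.
by have := etrans (esym (inner_bcv m l (psi u) _ _)) H; rewrite hnu.
Qed.

Lemma angle_nf u X : U u -> n1 u * f1 X u + n2 u * f2 X u + nu * f3 X u = 0.
Proof.
move=> Uu; have [_ H] := uN Uu.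
by have := etrans (esym (inner_bcv m l (psi u) _ _)) (H X); rewrite hnu.
Qed.

Lemma angle_nb u X : U u -> n1 u * b1 X u + n2 u * b2 X u + nu * b3 X u = 0.
Proof.
move=> Uu; have H := normal_cov oU ipsi lpsi sN uN X Uu.
by have := etrans (esym (inner_bcv m l (psi u) _ _)) H; rewrite hnu.
Qed.

Lemma angle_b3 u X : U u -> b3 X u = t * (f1 X u * n2 u - f2 X u * n1 u).
Proof.
move=> Uu.
have dp := @smooth_on_derivable _ _ _ U psi u X angle_smooth Uu.
have dN := @smooth_on_derivable _ _ _ U N u X sN Uu.
have [_ D] := @is_derive_fr3 R m l _ psi N X u (lpsi Uu) dp dN.
have : 'D_X (fun w => fr3 (psi w) (N w)) u = 0.
  apply: (etrans (@near_eq_derive R _ _ _ (fun=> (nu : R)) u X _)); last exact: derive_cst.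
  by apply: filterS (open_nbhs_nbhs (conj oU Uu)) => y Uy; exact: hnu.
move=> D'; move/eqP: (etrans (esym D) D'); rewrite subr_eq0 => /eqP ->.
by rewrite mulrBr !mulrA.
Qed.

Lemma angle_sym u : U u ->
  f1 e0 u * b1 e1 u + f2 e0 u * b2 e1 u + f3 e0 u * b3 e1 u =
  f1 e1 u * b1 e0 u + f2 e1 u * b2 e0 u + f3 e1 u * b3 e0 u.
Proof.
move=> Uu.
have S a b := second_formE oU ipsi lpsi sN uN a b Uu.
have C : second_form g psi u (N u) 1 0 = second_form g psi u (N u) 0 1.
  apply: (etrans (mxE _ _ _ _)); apply: (etrans _ (esym (mxE _ _ _ _))).
  exact: (congr1 (fun q => inner (g (psi u)) q (N u))
    (@cov_deriv_sym R m l _ U psi oU angle_smooth lpsi u e1 e0 Uu)).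
have := oppr_inj (etrans (esym (S 1 0)) (etrans C (S 0 1))).
move=> E; apply: (etrans _ (etrans (etrans (esym (inner_sym _ _ _ _ _)) E) _)).
- exact: (esym (inner_bcv m l (psi u) _ _)).
- exact: (etrans (inner_sym _ _ _ _ _) (inner_bcv m l (psi u) _ _)).
Qed.

Lemma angle_area u : U u ->
  tri (f1 e0 u) (f2 e0 u) (f3 e0 u) (f1 e1 u) (f2 e1 u) (f3 e1 u) (n1 u) (n2 u) nu != 0.
Proof. by move=> Uu; have := area_neq0 oU ipsi lpsi Uu (uN Uu); rewrite /area hnu. Qed.

Lemma angle_tr u : U u ->
  h * tri (f1 e0 u) (f2 e0 u) (f3 e0 u) (f1 e1 u) (f2 e1 u) (f3 e1 u) (n1 u) (n2 u) nu =
  - (tri (b1 e0 u) (b2 e0 u) (b3 e0 u) (f1 e1 u) (f2 e1 u) (f3 e1 u) (n1 u) (n2 u) nu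
     + tri (f1 e0 u) (f2 e0 u) (f3 e0 u) (b1 e1 u) (b2 e1 u) (b3 e1 u) (n1 u) (n2 u) nu).
Proof.
move=> Uu; have := mean_curvature_shape oU ipsi lpsi sN uN Uu.
by rewrite (hH Uu) /shape_trace /area (hnu Uu).
Qed.

Lemma angle_derive u X : U u ->
  is_derive u X (fun w => n1 w) (b1 X u - (t * f2 X u * nu - bcv_om3 m l (psi u) ('D_X psi u) * n2 u)) /\
  is_derive u X (fun w => n2 w) (b2 X u - (bcv_om3 m l (psi u) ('D_X psi u) * n1 u - t * f1 X u * nu)).
Proof.
move=> Uu.
have dp := @smooth_on_derivable _ _ _ U psi u X angle_smooth Uu.
have dN := @smooth_on_derivable _ _ _ U N u X sN Uu.
have D1 := @is_derive_fr1 R m l _ psi N X u (lpsi Uu) dp dN.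
have D2 := @is_derive_fr2 R m l _ psi N X u (lpsi Uu) dp dN.
by rewrite (hnu Uu) in D1 D2.
Qed.

(** For nu^2 = 1 the tangent planes are horizontal, and the derivative of n along f is l/2 times nu
    times a right-angle rotation of f. Such an operator has trace zero, against h != 0. *)
Lemma angle_neq1 u : U u -> 1 - nu ^+ 2 != 0.
Proof.
move=> Uu; apply/negP => /eqP D0.
have n0 w : U w -> n1 w = 0 /\ n2 w = 0.
  move=> Uw; have [|a b _] := @sum_sqr3_eq0 R (n1 w) (n2 w) 0.
    by rewrite mulr0 addr0 -D0 -(angle_nn Uw); ring.
  by [].
have b12 X : b1 X u = t * f2 X u * nu /\ b2 X u = - (t * f1 X u * nu).
  have [[_ D1] [_ D2]] := angle_derive X Uu.
  have z1 : 'D_X (fun w => n1 w) u = 0.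
    apply: (etrans (@near_eq_derive R _ _ _ (fun=> (0 : R)) u X _)); last exact: derive_cst.
    by apply: filterS (open_nbhs_nbhs (conj oU Uu)) => y Uy; case: (n0 y Uy).
  have z2 : 'D_X (fun w => n2 w) u = 0.
    apply: (etrans (@near_eq_derive R _ _ _ (fun=> (0 : R)) u X _)); last exact: derive_cst.
    by apply: filterS (open_nbhs_nbhs (conj oU Uu)) => y Uy; case: (n0 y Uy).
  have [a b] := n0 u Uu.
  move: (etrans (esym D1) z1) (etrans (esym D2) z2); rewrite a b !mulr0 subr0 sub0r opprK.
  by move=> /eqP; rewrite subr_eq0 => /eqP -> /eqP; rewrite addr_eq0 => /eqP ->.
have [a b] := n0 u Uu.
have nu0 : nu != 0.
  by apply/eqP => z; move: D0; rewrite z expr0n subr0 => /eqP; rewrite oner_eq0.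
have f30 X : f3 X u = 0.
  by have := angle_nf X Uu; rewrite a b !mul0r !add0r => /eqP; rewrite mulf_eq0 (negPf nu0) => /eqP.
have T0 := slice_trace (b3 e0 u) (b3 e1 u) a b (f30 e0) (f30 e1) (b12 e0) (b12 e1).
move/eqP: (etrans (angle_tr Uu) T0); rewrite mulf_eq0 (negPf h0).
by rewrite (negPf (angle_area Uu)).
Qed.

Lemma angle_shape u X : U u ->
  (1 - nu ^+ 2) * b1 X u = t * (f3 X u * n2 u - (f1 X u * n2 u - f2 X u * n1 u) * nu * n1 u)
     - h * (f1 X u * n2 u - f2 X u * n1 u) * n2 u /\
  (1 - nu ^+ 2) * b2 X u = - t * (f3 X u * n1 u + (f1 X u * n2 u - f2 X u * n1 u) * nu * n2 u)
     + h * (f1 X u * n2 u - f2 X u * n1 u) * n1 u.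
Proof.
move=> Uu.
have SS := shape_solution_eq (angle_nn Uu) (angle_nf e0 Uu) (angle_nf e1 Uu)
  (angle_nb e0 Uu) (angle_nb e1 Uu) (angle_b3 e0 Uu) (angle_b3 e1 Uu)
  (angle_sym Uu) (angle_area Uu) (angle_tr Uu) (angle_neq1 Uu).
have C := cov_deriv_dir l oU angle_smooth lpsi X Uu sN.
have P := smooth_mx_derive_rV2 oU X Uu angle_smooth.
have [c1 c2 _] := fr_lin m l (psi u) (X 0 0) (X 0 1) (cov_deriv g psi e0 N u) (cov_deriv g psi e1 N u).
have [d1 d2 d3] := fr_lin m l (psi u) (X 0 0) (X 0 1) ('D_e0 psi u) ('D_e1 psi u).
exact: (shape_comb (etrans (congr1 (bcv_fr1 m (psi u)) P) d1)
  (etrans (congr1 (bcv_fr2 m (psi u)) P) d2) (etrans (congr1 (bcv_fr3 m l (psi u)) P) d3)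
  (etrans (congr1 (bcv_fr1 m (psi u)) C) c1) (etrans (congr1 (bcv_fr2 m (psi u)) C) c2) SS).
Qed.

Definition angle_form X u := 2 * t * nu ^+ 2 / (1 - nu ^+ 2) * f3 X u
  - h / (1 - nu ^+ 2) * (f1 X u * n2 u - f2 X u * n1 u)
  + 2 * m * (psi u 0 1 * f1 X u - psi u 0 0 * f2 X u).

Lemma angle_rotation u X : U u ->
  is_derive u X (fun w => n1 w) (angle_form X u * n2 u) /\
  is_derive u X (fun w => n2 w) (- angle_form X u * n1 u).
Proof.
move=> Uu; have [D1 D2] := angle_derive X Uu.
have [a1 a2] := theta_algebra m (psi u 0 0) (psi u 0 1) (angle_neq1 Uu) (angle_nn Uu)
  (angle_nf X Uu) (angle_shape X Uu).
by split; [exact: is_derive_eq D1 a1 | exact: is_derive_eq D2 a2].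
Qed.

Lemma derive_coord12 u X : U u ->
  is_derive u X (fun w => psi w 0 0) (lam (psi u) * f1 X u) /\
  is_derive u X (fun w => psi w 0 1) (lam (psi u) * f2 X u).
Proof.
move=> Uu; have dp := @smooth_on_derivable _ _ _ U psi u X angle_smooth Uu.
have E1 : lam (psi u) * f1 X u = 'D_X psi u 0 0 by rewrite mulrC; exact: (divfK (lpsi Uu)).
have E2 : lam (psi u) * f2 X u = 'D_X psi u 0 1 by rewrite mulrC; exact: (divfK (lpsi Uu)).
by rewrite E1 E2; split; exact: derive_coord.
Qed.

Lemma angle_gauss u : U u -> nu * (4 * m * (1 - nu ^+ 2) + l ^+ 2 * nu ^+ 2 + h ^+ 2) = 0.
Proof.
move=> Uu.
have dp X := @smooth_on_derivable _ _ _ U psi u X angle_smooth Uu.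
have dD X Y := @smooth_on_derivable _ _ _ U _ u Y (smooth_on_derive X angle_smooth) Uu.
have C1 X Y := @is_derive_fr1 R m l _ psi ('D_X psi) Y u (lpsi Uu) (dp Y) (dD X Y).
have C2 X Y := @is_derive_fr2 R m l _ psi ('D_X psi) Y u (lpsi Uu) (dp Y) (dD X Y).
have C3 X Y := @is_derive_fr3 R m l _ psi ('D_X psi) Y u (lpsi Uu) (dp Y) (dD X Y).
have S := @cov_deriv_sym R m l _ U psi oU angle_smooth lpsi u e0 e1 Uu.
have [x0 y0] := derive_coord12 e0 Uu; have [x1 y1] := derive_coord12 e1 Uu.
have [p0 q0] := angle_rotation e0 Uu; have [p1 q1] := angle_rotation e1 Uu.
have [sn1 sn2 _] := smooth_on_fr l oU angle_smooth lpsi sN.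
have DE : n1 u * n1 u + n2 u * n2 u = 1 - nu ^+ 2 by rewrite -(angle_nn Uu); ring.
have closed a b : is_derive u e1 (angle_form e0) a -> is_derive u e0 (angle_form e1) b -> a = b.
  exact: (rotation_closed oU Uu sn1 sn2 (angle_neq1 Uu) DE
    (fun w Uw => angle_rotation e0 Uw) (fun w Uw => angle_rotation e1 Uw)).
have K1 := C1 e1 e0; have K2 := C2 e1 e0; have K3 := C3 e1 e0.
rewrite S in K1 K2 K3.
pose c := cov_deriv g psi e1 ('D_e0 psi) u.
exact: (@gauss_algebra R _ u e0 e1 m l h nu (fun w => n1 w) (fun w => n2 w)
  (fun w => psi w 0 0) (fun w => psi w 0 1) (fun w => f1 e0 w) (fun w => f2 e0 w)
  (fun w => f3 e0 w) (fun w => f1 e1 w) (fun w => f2 e1 w) (fun w => f3 e1 w)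
  (fr1 (psi u) c) (fr2 (psi u) c) (fr3 (psi u) c) (lam (psi u))
  (angle_neq1 Uu) (angle_nn Uu) (angle_nf e0 Uu) (angle_nf e1 Uu)
  (angle_area Uu) erefl x0 y0 x1 y1 p0 q0 p1 q1 (C1 e0 e1) (C2 e0 e1) (C3 e0 e1) K1 K2 K3 closed).
Qed.

End ConstantAngle.

(** * The tension fields in an adapted frame *)

Section FrameAlgebra.
Context {R : realType}.
Variables (m t h nu s n1 n2 x y a b c : R).
Hypotheses (s0 : s != 0) (nn : n1 * n1 + n2 * n2 + nu * nu = 1) (ss : s ^+ 2 = 1 - nu ^+ 2).
Let al := - 2 * t * nu / s.
Let be := nu * h / s.
Let th (F1 F2 F3 : R) := 2 * t * nu ^+ 2 / (1 - nu ^+ 2) * F3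
  - h / (1 - nu ^+ 2) * (F1 * n2 - F2 * n1) + 2 * m * (y * F1 - x * F2).
Let o (F1 F2 F3 : R) := - t * F3 + 2 * m * (y * F1 - x * F2).
Let S1 (a b c : R) := a * (- nu * n1 / s) + b * (n2 / s) + c * n1.
Let S2 (a b c : R) := a * (- nu * n2 / s) + b * (- n1 / s) + c * n2.
Let S3 (a b c : R) := a * s + c * nu.
Let d1 F1 F2 F3 := a * (- nu * (th F1 F2 F3 * n2) / s) + b * (- th F1 F2 F3 * n1 / s)
  + c * (th F1 F2 F3 * n2).
Let d2 F1 F2 F3 := a * (- nu * (- th F1 F2 F3 * n1) / s) + b * (- (th F1 F2 F3 * n2) / s)
  + c * (- th F1 F2 F3 * n1).

Let nE : n2 ^+ 2 = s ^+ 2 - n1 ^+ 2. Proof. by rewrite ss -nn; ring. Qed.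
Let nuE : nu ^+ 2 = 1 - s ^+ 2. Proof. by rewrite ss; ring. Qed.

(** In the orthonormal frame E0 = T / s, E1 = K / s, n, where s is the length of T, the covariant
    derivative of a E0 + b E1 + c n with constant a, b, c again has constant coefficients. Here al =
    <nabla_E0 E0, E1> and be = <nabla_E1 E0, E1>, and the second fundamental form has the entries 0,
    - t, h. [frame_algebra1] treats the direction E1. *)
Lemma frame_algebra0 (F1 := - nu * n1 / s) (F2 := - nu * n2 / s) (F3 := s) :
  [/\ d1 F1 F2 F3 + (t * F2 * S3 a b c - o F1 F2 F3 * S2 a b c) =
        S1 (- al * b) (al * a + t * c) (- t * b),
      d2 F1 F2 F3 + (o F1 F2 F3 * S1 a b c - t * F1 * S3 a b c) =
        S2 (- al * b) (al * a + t * c) (- t * b) &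
      t * F1 * S2 a b c - t * F2 * S1 a b c = S3 (- al * b) (al * a + t * c) (- t * b)].
Proof.
rewrite /d1 /d2 /S1 /S2 /S3 /o /th /al /F1 /F2 /F3 -ss; split; field: nE nuE; exact: s0.
Qed.

Lemma frame_algebra1 (F1 := n2 / s) (F2 := - n1 / s) (F3 := 0) :
  [/\ d1 F1 F2 F3 + (t * F2 * S3 a b c - o F1 F2 F3 * S2 a b c) =
        S1 (t * c - be * b) (be * a - h * c) (h * b - t * a),
      d2 F1 F2 F3 + (o F1 F2 F3 * S1 a b c - t * F1 * S3 a b c) =
        S2 (t * c - be * b) (be * a - h * c) (h * b - t * a) &
      t * F1 * S2 a b c - t * F2 * S1 a b c = S3 (t * c - be * b) (be * a - h * c) (h * b - t * a)].
Proof.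
rewrite /d1 /d2 /S1 /S2 /S3 /o /th /be /F1 /F2 /F3 -ss; split; field: nE nuE; exact: s0.
Qed.

End FrameAlgebra.

Lemma frame_step0 {R : realType} (m t h nu s n1 n2 x y a b c F1 F2 F3 T1 T2 T3 Z1 Z2 Z3 C1 C2 C3 : R)
  (al := - 2 * t * nu / s)
  (th := 2 * t * nu ^+ 2 / (1 - nu ^+ 2) * F3
    - h / (1 - nu ^+ 2) * (F1 * n2 - F2 * n1) + 2 * m * (y * F1 - x * F2))
  (o := - t * F3 + 2 * m * (y * F1 - x * F2)) :
  s != 0 -> n1 * n1 + n2 * n2 + nu * nu = 1 -> s ^+ 2 = 1 - nu ^+ 2 ->
  [/\ F1 = - nu * n1 / s, F2 = - nu * n2 / s & F3 = s] ->
  [/\ T1 = a * (- nu * n1 / s) + b * (n2 / s) + c * n1,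
      T2 = a * (- nu * n2 / s) + b * (- n1 / s) + c * n2 & T3 = a * s + c * nu] ->
  (let a' := - al * b in let b' := al * a + t * c in let c' := - t * b in
  [/\ Z1 = a' * (- nu * n1 / s) + b' * (n2 / s) + c' * n1,
      Z2 = a' * (- nu * n2 / s) + b' * (- n1 / s) + c' * n2 & Z3 = a' * s + c' * nu]) ->
  C1 - (t * F2 * T3 - o * T2) = a * (- nu * (th * n2) / s) + b * (- th * n1 / s) + c * (th * n2) ->
  C2 - (o * T1 - t * F1 * T3) = a * (- nu * (- th * n1) / s) + b * (- (th * n2) / s) + c * (- th * n1) ->
  C3 - (t * F1 * T2 - t * F2 * T1) = 0 -> [/\ C1 = Z1, C2 = Z2 & C3 = Z3].
Proof.
move=> s0 nn ss FE TE ZE E1 E2 E3.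
have [A1 A2 A3] := frame_algebra0 m t h x y a b c s0 nn ss.
case: FE ZE TE => f1 f2 f3 [-> -> ->] [t1 t2 t3].
rewrite -A1 -A2 -A3 {A1 A2 A3}.
move: E1 E2 E3; rewrite /th /o f1 f2 f3 t1 t2 t3 => E1 E2 E3; split.
- by move/eqP: E1; rewrite subr_eq => /eqP ->.
- by move/eqP: E2; rewrite subr_eq => /eqP ->.
- by move/eqP: E3; rewrite subr_eq add0r => /eqP ->.
Qed.

Lemma frame_step1 {R : realType} (m t h nu s n1 n2 x y a b c F1 F2 F3 T1 T2 T3 Z1 Z2 Z3 C1 C2 C3 : R)
  (be := nu * h / s)
  (th := 2 * t * nu ^+ 2 / (1 - nu ^+ 2) * F3
    - h / (1 - nu ^+ 2) * (F1 * n2 - F2 * n1) + 2 * m * (y * F1 - x * F2))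
  (o := - t * F3 + 2 * m * (y * F1 - x * F2)) :
  s != 0 -> n1 * n1 + n2 * n2 + nu * nu = 1 -> s ^+ 2 = 1 - nu ^+ 2 ->
  [/\ F1 = n2 / s, F2 = - n1 / s & F3 = 0] ->
  [/\ T1 = a * (- nu * n1 / s) + b * (n2 / s) + c * n1,
      T2 = a * (- nu * n2 / s) + b * (- n1 / s) + c * n2 & T3 = a * s + c * nu] ->
  (let a' := t * c - be * b in let b' := be * a - h * c in let c' := h * b - t * a in
  [/\ Z1 = a' * (- nu * n1 / s) + b' * (n2 / s) + c' * n1,
      Z2 = a' * (- nu * n2 / s) + b' * (- n1 / s) + c' * n2 & Z3 = a' * s + c' * nu]) ->
  C1 - (t * F2 * T3 - o * T2) = a * (- nu * (th * n2) / s) + b * (- th * n1 / s) + c * (th * n2) ->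
  C2 - (o * T1 - t * F1 * T3) = a * (- nu * (- th * n1) / s) + b * (- (th * n2) / s) + c * (- th * n1) ->
  C3 - (t * F1 * T2 - t * F2 * T1) = 0 -> [/\ C1 = Z1, C2 = Z2 & C3 = Z3].
Proof.
move=> s0 nn ss FE TE ZE E1 E2 E3.
have [A1 A2 A3] := frame_algebra1 m t h x y a b c s0 nn ss.
case: FE ZE TE => f1 f2 f3 [-> -> ->] [t1 t2 t3].
rewrite -A1 -A2 -A3 {A1 A2 A3}.
move: E1 E2 E3; rewrite /th /o f1 f2 f3 t1 t2 t3 => E1 E2 E3; split.
- by move/eqP: E1; rewrite subr_eq => /eqP ->.
- by move/eqP: E2; rewrite subr_eq => /eqP ->.
- by move/eqP: E3; rewrite subr_eq add0r => /eqP ->.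
Qed.

Lemma frame_components {R : realType} (n1 n2 nu s f1 f2 f3 g1 g2 g3 : R)
  (kf := f1 * n2 - f2 * n1) (kg := g1 * n2 - g2 * n1) (w := f3 * kg - g3 * kf) :
  s != 0 -> s ^+ 2 = 1 - nu ^+ 2 -> w != 0 -> n1 * n1 + n2 * n2 + nu * nu = 1 ->
  n1 * f1 + n2 * f2 + nu * f3 = 0 -> n1 * g1 + n2 * g2 + nu * g3 = 0 ->
  [/\ s * kg / w * f1 + (- (s * kf / w)) * g1 = - nu * n1 / s,
      s * kg / w * f2 + (- (s * kf / w)) * g2 = - nu * n2 / s &
      s * kg / w * f3 + (- (s * kf / w)) * g3 = s] /\
  [/\ (- (s * g3 / w)) * f1 + s * f3 / w * g1 = n2 / s,
      (- (s * g3 / w)) * f2 + s * f3 / w * g2 = - n1 / s &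
      (- (s * g3 / w)) * f3 + s * f3 / w * g3 = 0].
Proof.
move=> s0 ss w0 nn nf ng.
have DE : s ^+ 2 = n1 * n1 + n2 * n2 by rewrite ss -nn; ring.
have e1 : f1 = (- nu * n1 * f3 + n2 * kf) / s ^+ 2.
  apply: (mulIf (expf_neq0 2 s0)); rewrite divfK ?expf_neq0 // DE.
  transitivity (n1 * (n1 * f1 + n2 * f2 + nu * f3) - nu * n1 * f3 + n2 * kf); first by rewrite /kf; ring.
  by rewrite nf; ring.
have e2 : f2 = (- nu * n2 * f3 - n1 * kf) / s ^+ 2.
  apply: (mulIf (expf_neq0 2 s0)); rewrite divfK ?expf_neq0 // DE.
  transitivity (n2 * (n1 * f1 + n2 * f2 + nu * f3) - nu * n2 * f3 - n1 * kf); first by rewrite /kf; ring.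
  by rewrite nf; ring.
have e3 : g1 = (- nu * n1 * g3 + n2 * kg) / s ^+ 2.
  apply: (mulIf (expf_neq0 2 s0)); rewrite divfK ?expf_neq0 // DE.
  transitivity (n1 * (n1 * g1 + n2 * g2 + nu * g3) - nu * n1 * g3 + n2 * kg); first by rewrite /kg; ring.
  by rewrite ng; ring.
have e4 : g2 = (- nu * n2 * g3 - n1 * kg) / s ^+ 2.
  apply: (mulIf (expf_neq0 2 s0)); rewrite divfK ?expf_neq0 // DE.
  transitivity (n2 * (n1 * g1 + n2 * g2 + nu * g3) - nu * n2 * g3 - n1 * kg); first by rewrite /kg; ring.
  by rewrite ng; ring.
clearbody kf kg; rewrite e1 e2 e3 e4 /w in w0 *.
have ws : f3 * kg - g3 * kf != 0 by [].
by split; split; field; rewrite ?s0 ?ws.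
Qed.

Definition row2 {R : realType} (a b : R) : 'rV[R]_2 := \row_(j < 2) (if j == 0 then a else b).

Lemma row2_0 {R : realType} (a b : R) : row2 a b 0 0 = a. Proof. exact: mxE. Qed.
Lemma row2_1 {R : realType} (a b : R) : row2 a b 0 1 = b. Proof. exact: mxE. Qed.

Lemma smooth_row2 {R : realType} (V : normedModType R) (A : set V) (a b : V -> R) : open A ->
  smooth_on A a -> smooth_on A b -> smooth_on A (fun u => row2 (a u) (b u)).
Proof.
move=> oA sa sb; apply: (smooth_on_mx oA) => i; apply: forall2.
  by rewrite (_ : (fun y => _) = a) //; apply/funext => y; rewrite (ord1 i); exact: row2_0.
by rewrite (_ : (fun y => _) = b) //; apply/funext => y; rewrite (ord1 i); exact: row2_1.
Qed.

Section Frame.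
Context {R : realType}.
Variables m l : R.
Local Notation lam := (bcv_lam m).
Local Notation fr1 := (bcv_fr1 m).
Local Notation fr2 := (bcv_fr2 m).
Local Notation fr3 := (bcv_fr3 m l).
Local Notation g := (bcv_metric m l).
Variables (U : set 'rV[R]_2) (psi N : 'rV[R]_2 -> 'rV[R]_3) (h nu s : R).
Hypotheses (oU : open U) (ipsi : immersion_on U psi) (lpsi : forall u, U u -> lam (psi u) != 0)
  (sN : smooth_on U N) (uN : forall u, U u -> unit_normal g psi u (N u))
  (hH : forall u, U u -> 2 * mean_curvature g psi u (N u) = h)
  (hnu : forall u, U u -> fr3 (psi u) (N u) = nu) (h0 : h != 0)
  (s0 : s != 0) (ss : s ^+ 2 = 1 - nu ^+ 2).
Local Notation t := (l / 2).
Local Notation n1 u := (fr1 (psi u) (N u)).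
Local Notation n2 u := (fr2 (psi u) (N u)).
Local Notation e0 := (@basis_vec R 1 0).
Local Notation e1 := (@basis_vec R 1 1).
Local Notation f1 u := (fr1 (psi u) ('D_e0 psi u)).
Local Notation f2 u := (fr2 (psi u) ('D_e0 psi u)).
Local Notation f3 u := (fr3 (psi u) ('D_e0 psi u)).
Local Notation g1 u := (fr1 (psi u) ('D_e1 psi u)).
Local Notation g2 u := (fr2 (psi u) ('D_e1 psi u)).
Local Notation g3 u := (fr3 (psi u) ('D_e1 psi u)).
Let kf u := f1 u * n2 u - f2 u * n1 u.
Let kg u := g1 u * n2 u - g2 u * n1 u.
Let w u := f3 u * kg u - g3 u * kf u.

Let spsi : smooth_on U psi. Proof. by case: ipsi. Qed.

(** Cramer's rule in the parameter plane: the image of [frame0] has inner products s and 0 with T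
    and K, that of [frame1] has 0 and s; w is the determinant. *)
Definition frame0 u := row2 (s * kg u / w u) (- (s * kf u / w u)).
Definition frame1 u := row2 (- (s * g3 u / w u)) (s * f3 u / w u).

Let nnU u (Uu : U u) := angle_nn uN hnu Uu.
Let nfU u X (Uu : U u) := angle_nf uN hnu X Uu.

Lemma frame_w u : U u -> w u != 0.
Proof.
move=> Uu; rewrite /w -(perp_tri (nnU Uu) (nfU e0 Uu) (nfU e1 Uu)).
by rewrite mulf_neq0 -?ss ?expf_neq0 //; exact: (angle_area oU ipsi lpsi uN hnu Uu).
Qed.

Lemma frame_fr u : U u ->
  [/\ fr1 (psi u) ('D_(frame0 u) psi u) = - nu * n1 u / s,
      fr2 (psi u) ('D_(frame0 u) psi u) = - nu * n2 u / s &
      fr3 (psi u) ('D_(frame0 u) psi u) = s] /\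
  [/\ fr1 (psi u) ('D_(frame1 u) psi u) = n2 u / s,
      fr2 (psi u) ('D_(frame1 u) psi u) = - n1 u / s &
      fr3 (psi u) ('D_(frame1 u) psi u) = 0].
Proof.
move=> Uu.
have [[a1 a2 a3] [b1 b2 b3]] := frame_components s0 ss (frame_w Uu) (nnU Uu) (nfU e0 Uu) (nfU e1 Uu).
have P X := smooth_mx_derive_rV2 oU X Uu spsi.
have L (X : 'rV[R]_2) := fr_lin m l (psi u) (X 0 0) (X 0 1) ('D_e0 psi u) ('D_e1 psi u).
have [c1 c2 c3] := L (frame0 u); have [d1 d2 d3] := L (frame1 u).
have r0 := @row2_0 R (s * kg u / w u) (- (s * kf u / w u)).
have r1 := @row2_1 R (s * kg u / w u) (- (s * kf u / w u)).
have q0 := @row2_0 R (- (s * g3 u / w u)) (s * f3 u / w u).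
have q1 := @row2_1 R (- (s * g3 u / w u)) (s * f3 u / w u).
split; split.
- exact: (etrans (congr1 (bcv_fr1 m (psi u)) (P _)) (etrans c1 (etrans (congr2 (fun a b => a * f1 u + b * g1 u) r0 r1) a1))).
- exact: (etrans (congr1 (bcv_fr2 m (psi u)) (P _)) (etrans c2 (etrans (congr2 (fun a b => a * f2 u + b * g2 u) r0 r1) a2))).
- exact: (etrans (congr1 (bcv_fr3 m l (psi u)) (P _)) (etrans c3 (etrans (congr2 (fun a b => a * f3 u + b * g3 u) r0 r1) a3))).
- exact: (etrans (congr1 (bcv_fr1 m (psi u)) (P _)) (etrans d1 (etrans (congr2 (fun a b => a * f1 u + b * g1 u) q0 q1) b1))).
- exact: (etrans (congr1 (bcv_fr2 m (psi u)) (P _)) (etrans d2 (etrans (congr2 (fun a b => a * f2 u + b * g2 u) q0 q1) b2))).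
- exact: (etrans (congr1 (bcv_fr3 m l (psi u)) (P _)) (etrans d3 (etrans (congr2 (fun a b => a * f3 u + b * g3 u) q0 q1) b3))).
Qed.

Lemma smooth_frame : smooth_on U frame0 /\ smooth_on U frame1.
Proof.
have [sn1 sn2 _] := smooth_on_fr l oU spsi lpsi sN.
have [sf1 sf2 sf3] := smooth_on_fr l oU spsi lpsi (smooth_on_derive e0 spsi).
have [sg1 sg2 sg3] := smooth_on_fr l oU spsi lpsi (smooth_on_derive e1 spsi).
have skf : smooth_on U kf by apply: (smooth_onB oU); apply: (smooth_onM oU).
have skg : smooth_on U kg by apply: (smooth_onB oU); apply: (smooth_onM oU).
have sw : smooth_on U w by apply: (smooth_onB oU); apply: (smooth_onM oU).
have siw := smooth_onV oU frame_w sw.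
have sc : smooth_on U (fun=> s : R) by exact: smooth_on_cst.
by split; apply: (smooth_row2 oU); try apply: (smooth_onN oU);
  apply: (smooth_onM oU) => //; apply: (smooth_onM oU).
Qed.

(** Sections with constant coefficients in the adapted frame. By [frame_cov] they are stable under
    covariant differentiation along the frame, which reduces the iterated Laplacians to algebra. *)
Definition frame_sec (a b c : R) u : 'rV[R]_3 :=
  a *: 'D_(frame0 u) psi u + b *: 'D_(frame1 u) psi u + c *: N u.

Lemma fr_frame_sec a b c u : U u ->
  [/\ fr1 (psi u) (frame_sec a b c u) = a * (- nu * n1 u / s) + b * (n2 u / s) + c * n1 u,
      fr2 (psi u) (frame_sec a b c u) = a * (- nu * n2 u / s) + b * (- n1 u / s) + c * n2 u &
      fr3 (psi u) (frame_sec a b c u) = a * s + c * nu].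
Proof.
move=> Uu; have [[a1 a2 a3] [b1 b2 b3]] := frame_fr Uu.
have n3 := hnu Uu; rewrite /frame_sec.
move: a1 a2 a3 b1 b2 b3 n3; move: ('D_(frame0 u) psi u) ('D_(frame1 u) psi u) (N u) => E F n.
move=> a1 a2 a3 b1 b2 b3 n3.
have [x1 x2 x3] := fr_lin m l (psi u) 1 c (a *: E + b *: F) n.
have [y1 y2 y3] := fr_lin m l (psi u) a b E F.
rewrite scale1r !mul1r in x1 x2 x3.
by rewrite x1 x2 x3 y1 y2 y3 a1 a2 a3 b1 b2 b3 n3 mulr0 addr0.
Qed.

Lemma smooth_derive_along (E : 'rV[R]_2 -> 'rV[R]_2) : smooth_on U E ->
  smooth_on U (fun u => 'D_(E u) psi u).
Proof.
move=> sE; have sE0 := smooth_on_coord 0 0 oU sE; have sE1 := smooth_on_coord 0 1 oU sE.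
have sd i := smooth_on_derive (@basis_vec R 1 i) spsi.
apply: (smooth_on_ext oU _ (smooth_onD oU (smooth_onZ_mx oU sE0 (sd 0)) (smooth_onZ_mx oU sE1 (sd 1)))).
by move=> y Uy; exact: (esym (smooth_mx_derive_rV2 oU (E y) Uy spsi)).
Qed.

Lemma smooth_frame_sec a b c : smooth_on U (frame_sec a b c).
Proof.
have [s_0 s_1] := smooth_frame.
have cst (r : R) : smooth_on U (fun=> r) by exact: smooth_on_cst.
apply: (smooth_onD oU); [apply: (smooth_onD oU)|].
- exact: (smooth_onZ_mx oU (cst a) (smooth_derive_along s_0)).
- exact: (smooth_onZ_mx oU (cst b) (smooth_derive_along s_1)).
- exact: (smooth_onZ_mx oU (cst c) sN).
Qed.

Let al := - 2 * t * nu / s.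
Let be := nu * h / s.

(** With a, b, c, nu and s constant, the frame components of the section vary only through n1 and
    n2, whose rotation is given by [angle_form]. *)
Lemma frame_derivs X a b c u : U u ->
  let C := cov_deriv g psi X (frame_sec a b c) u in
  let th := angle_form m l psi N h nu X u in
  [/\ fr1 (psi u) C - (t * fr2 (psi u) ('D_X psi u) * fr3 (psi u) (frame_sec a b c u)
          - bcv_om3 m l (psi u) ('D_X psi u) * fr2 (psi u) (frame_sec a b c u)) =
        a * (- nu * (th * n2 u) / s) + b * (- th * n1 u / s) + c * (th * n2 u),
      fr2 (psi u) C - (bcv_om3 m l (psi u) ('D_X psi u) * fr1 (psi u) (frame_sec a b c u)
          - t * fr1 (psi u) ('D_X psi u) * fr3 (psi u) (frame_sec a b c u)) =
        a * (- nu * (- th * n1 u) / s) + b * (- (th * n2 u) / s) + c * (- th * n1 u) &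
      fr3 (psi u) C - (t * fr1 (psi u) ('D_X psi u) * fr2 (psi u) (frame_sec a b c u)
          - t * fr2 (psi u) ('D_X psi u) * fr1 (psi u) (frame_sec a b c u)) = 0].
Proof.
move=> Uu C th.
have dp := @smooth_on_derivable _ _ _ U psi u X spsi Uu.
have dS := @smooth_on_derivable _ _ _ U _ u X (smooth_frame_sec a b c) Uu.
have [_ D1] := @is_derive_fr1 R m l _ psi _ X u (lpsi Uu) dp dS.
have [_ D2] := @is_derive_fr2 R m l _ psi _ X u (lpsi Uu) dp dS.
have [_ D3] := @is_derive_fr3 R m l _ psi _ X u (lpsi Uu) dp dS.
have [r1 r2] := angle_rotation oU ipsi lpsi sN uN hH hnu h0 X Uu.
have nU (P : 'rV[R]_2 -> Prop) : (forall w, U w -> P w) -> \forall w \near u, P w.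
  by move=> UP; apply: filterS (open_nbhs_nbhs (conj oU Uu)).
have [_ v1] : is_derive u X (fun w => a * (- nu * n1 w / s) + b * (n2 w / s) + c * n1 w)
    (a * (- nu * (th * n2 u) / s) + b * (- th * n1 u / s) + c * (th * n2 u)).
  by eapply is_derive_eq; [derV | rewrite /th; ring].
have [_ v2] : is_derive u X (fun w => a * (- nu * n2 w / s) + b * (- n1 w / s) + c * n2 w)
    (a * (- nu * (- th * n1 u) / s) + b * (- (th * n2 u) / s) + c * (- th * n1 u)).
  by eapply is_derive_eq; [derV | rewrite /th; ring].
have near_derive (f k : 'rV[R]_2 -> R) (v : R) : (forall y, U y -> f y = k y) -> 'D_X k u = v -> 'D_X f u = v.
  by move=> fk; apply: etrans; apply: near_eq_derive; exact: nU.
split.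
- apply: (etrans (esym D1)); apply: (near_derive _ _ _ _ v1) => y Uy.
  by have [] := fr_frame_sec a b c Uy.
- apply: (etrans (esym D2)); apply: (near_derive _ _ _ _ v2) => y Uy.
  by have [] := fr_frame_sec a b c Uy.
- apply: (etrans (esym D3)); apply: (near_derive _ (fun=> a * s + c * nu) _ _ (derive_cst _ _ _)) => y Uy.
  by have [] := fr_frame_sec a b c Uy.
Qed.

Lemma frame_cov a b c (S : 'rV[R]_2 -> 'rV[R]_3) u : U u ->
  (forall w, U w -> S w = frame_sec a b c w) ->
  cov_deriv g psi (frame0 u) S u = frame_sec (- al * b) (al * a + t * c) (- t * b) u /\
  cov_deriv g psi (frame1 u) S u = frame_sec (t * c - be * b) (be * a - h * c) (h * b - t * a) u.
Proof.
move=> Uu SE.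
have eC X : cov_deriv g psi X S u = cov_deriv g psi X (frame_sec a b c) u.
  apply: cov_deriv_near; first by apply: filterE.
  by apply: filterS (open_nbhs_nbhs (conj oU Uu)) => y Uy; exact: SE.
have [F0 F1] := frame_fr Uu; have T := fr_frame_sec a b c Uu.
split.
- have [C1 C2 C3] := frame_derivs (frame0 u) a b c Uu.
  have Z := fr_frame_sec (- al * b) (al * a + t * c) (- t * b) Uu.
  have [z1 z2 z3] := frame_step0 s0 (nnU Uu) ss F0 T Z C1 C2 C3.
  exact: (etrans (eC _) (fr_inj (lpsi Uu) z1 z2 z3)).
- have [C1 C2 C3] := frame_derivs (frame1 u) a b c Uu.
  have Z := fr_frame_sec (t * c - be * b) (be * a - h * c) (h * b - t * a) Uu.
  have [z1 z2 z3] := frame_step1 s0 (nnU Uu) ss F1 T Z C1 C2 C3.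
  exact: (etrans (eC _) (fr_inj (lpsi Uu) z1 z2 z3)).
Qed.

End Frame.

Lemma row_inner_inj {R : realType} (G : 'M[R]_2) (X Y : 'rV[R]_2) : G \in unitmx ->
  (forall c, inner G X (basis_vec c) = inner G Y (basis_vec c)) -> X = Y.
Proof.
move=> uG H; have E Z c : inner G Z (basis_vec c) = (Z *m G) 0 c.
  by rewrite /inner /basis_vec trmx_delta -colE mxE.
rewrite -[X](mulmxK uG) -[Y](mulmxK uG); congr (_ *m _).
by apply/rowP => c; rewrite -!E.
Qed.

(** L1, L2, L3 are the coefficients of the rough Laplacian in the adapted frame, and (x1, x2, x3) is
    the Laplacian of the tension field h n. The hypothesis is the vanishing of the normal component
    of the 3-tension field; its last two groups are the curvature sums of [ricci_algebra] and
    [ricci_mixed_algebra]. *)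
Lemma normal_triharmonic_algebra {R : realType} (c t h nu s : R) (al := - 2 * t * nu / s)
  (be := nu * h / s)
  (L1 := fun a b c : R => - ((- al * (al * a + t * c) - al * (t * c - be * b))
           + ((t * (h * b - t * a) - be * (be * a - h * c)) + be * (- al * b))))
  (L2 := fun a b c : R => - ((al * (- al * b) + t * (- t * b) - al * (be * a - h * c))
           + ((be * (t * c - be * b) - h * (h * b - t * a)) + be * (al * a + t * c))))
  (L3 := fun a b c : R => - ((- t * (al * a + t * c) - al * (h * b - t * a))
           + ((h * (be * a - h * c) - t * (t * c - be * b)) + be * (- t * b))))
  (x1 := L1 0 0 h) (x2 := L2 0 0 h) (x3 := L3 0 0 h) :
  s != 0 -> s ^+ 2 = 1 - nu ^+ 2 -> h != 0 ->
  L3 x1 x2 x3 - (x3 * (2 * t ^+ 2 + c * s ^+ 2) - x1 * (c * nu * s))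
    - h ^+ 3 * (t ^+ 2 + c * s ^+ 2) = 0 ->
  - c * s ^+ 2 * (t ^+ 2 * (4 - 2 * s ^+ 2) + h ^+ 2 * (1 + s ^+ 2))
    + h ^+ 2 * t ^+ 2 * (4 - 3 * s ^+ 2) + h ^+ 4 = 0.
Proof.
move=> s0 ss h0 H.
have nuE : nu ^+ 2 = 1 - s ^+ 2 by rewrite ss; ring.
(* The normal component equals h / s^2 times the claimed polynomial; multiplying by s^4 clears the
   denominators of al and be. *)
apply: (mulfI (mulf_neq0 h0 (expf_neq0 2 s0))); rewrite mulr0.
apply: (etrans _ (etrans (congr1 (fun z => s ^+ 4 * z) H) (mulr0 _))).
by rewrite /x1 /x2 /x3 /L1 /L2 /L3 /al /be; field: nuE.
Qed.

(** The inner product of R(X,Y)Z = Z x rho(X x Y) with n in frame components, where t = l/2 and c =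
    4m - l^2, so that rho has the entries t^2, t^2, t^2 + c. *)
Definition frK {R : realType} (t c n1 n2 nu X1 X2 X3 Y1 Y2 Y3 Z1 Z2 Z3 : R) : R :=
     ((t ^+ 2 + c) * (X1 * Y2 - X2 * Y1) * Z2 - t ^+ 2 * (X3 * Y1 - X1 * Y3) * Z3) * n1
   + (t ^+ 2 * (X2 * Y3 - X3 * Y2) * Z3 - (t ^+ 2 + c) * (X1 * Y2 - X2 * Y1) * Z1) * n2
   + (t ^+ 2 * (X3 * Y1 - X1 * Y3) * Z1 - t ^+ 2 * (X2 * Y3 - X3 * Y2) * Z2) * nu.

(** The sum is Ric(X, n): the term R(X, n) n missing from the tangential trace is orthogonal to n.
    In particular Ric(n, n) = 2 t^2 + c s^2. *)
Lemma ricci_algebra {R : realType} (t c nu s n1 n2 a b d X1 X2 X3 f1 f2 f3 k1 k2 k3 : R) :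
  s != 0 -> s ^+ 2 = 1 - nu ^+ 2 -> n1 * n1 + n2 * n2 + nu * nu = 1 ->
  [/\ X1 = a * (- nu * n1 / s) + b * (n2 / s) + d * n1,
      X2 = a * (- nu * n2 / s) + b * (- n1 / s) + d * n2 & X3 = a * s + d * nu] ->
  [/\ f1 = - nu * n1 / s, f2 = - nu * n2 / s & f3 = s] /\
  [/\ k1 = n2 / s, k2 = - n1 / s & k3 = 0] ->
  frK t c n1 n2 nu X1 X2 X3 f1 f2 f3 f1 f2 f3 + frK t c n1 n2 nu X1 X2 X3 k1 k2 k3 k1 k2 k3 =
  d * (2 * t ^+ 2 + c * s ^+ 2) - a * (c * nu * s).
Proof.
move=> s0 ss nn [-> -> ->] [[-> -> ->] [-> -> ->]].
have nuE : nu ^+ 2 = 1 - s ^+ 2 by rewrite ss; ring.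
have nE : n2 ^+ 2 = s ^+ 2 - n1 ^+ 2 by rewrite ss -nn; ring.
by rewrite /frK; field: nuE nE.
Qed.

(** T is the tension field h n, and P, Q are its derivatives t h E1 and t h E0 - h^2 E1. The
    directions E0 and E1 diagonalize the Jacobi operator of n, so only h^3 times the sectional
    curvature t^2 + c s^2 of the plane of E1 and n survives. *)
Lemma ricci_mixed_algebra {R : realType} (t c h nu s n1 n2 al be
  T1 T2 T3 P1 P2 P3 Q1 Q2 Q3 f1 f2 f3 k1 k2 k3 : R) :
  s != 0 -> s ^+ 2 = 1 - nu ^+ 2 -> n1 * n1 + n2 * n2 + nu * nu = 1 ->
  [/\ T1 = 0 * (- nu * n1 / s) + 0 * (n2 / s) + h * n1,
      T2 = 0 * (- nu * n2 / s) + 0 * (- n1 / s) + h * n2 & T3 = 0 * s + h * nu] ->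
  (let a := - al * 0 in let b := al * 0 + t * h in let d := - t * 0 in
  [/\ P1 = a * (- nu * n1 / s) + b * (n2 / s) + d * n1,
      P2 = a * (- nu * n2 / s) + b * (- n1 / s) + d * n2 & P3 = a * s + d * nu]) ->
  (let a := t * h - be * 0 in let b := be * 0 - h * h in let d := h * 0 - t * 0 in
  [/\ Q1 = a * (- nu * n1 / s) + b * (n2 / s) + d * n1,
      Q2 = a * (- nu * n2 / s) + b * (- n1 / s) + d * n2 & Q3 = a * s + d * nu]) ->
  [/\ f1 = - nu * n1 / s, f2 = - nu * n2 / s & f3 = s] /\
  [/\ k1 = n2 / s, k2 = - n1 / s & k3 = 0] ->
  frK t c n1 n2 nu P1 P2 P3 T1 T2 T3 f1 f2 f3 + frK t c n1 n2 nu Q1 Q2 Q3 T1 T2 T3 k1 k2 k3 =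
  h ^+ 3 * (t ^+ 2 + c * s ^+ 2).
Proof.
move=> s0 ss nn [-> -> ->] [-> -> ->] [-> -> ->] [[-> -> ->] [-> -> ->]].
have nuE : nu ^+ 2 = 1 - s ^+ 2 by rewrite ss; ring.
have nE : n2 ^+ 2 = s ^+ 2 - n1 ^+ 2 by rewrite ss -nn; ring.
by rewrite /frK; field: nuE nE.
Qed.

Lemma frame_onb_algebra {R : realType} (n1 n2 nu s f1 f2 f3 k1 k2 k3 : R) :
  s != 0 -> s ^+ 2 = 1 - nu ^+ 2 -> n1 * n1 + n2 * n2 + nu * nu = 1 ->
  [/\ f1 = - nu * n1 / s, f2 = - nu * n2 / s & f3 = s] /\
  [/\ k1 = n2 / s, k2 = - n1 / s & k3 = 0] ->
  [/\ f1 * f1 + f2 * f2 + f3 * f3 = 1, f1 * k1 + f2 * k2 + f3 * k3 = 0,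
      k1 * f1 + k2 * f2 + k3 * f3 = 0 & k1 * k1 + k2 * k2 + k3 * k3 = 1].
Proof.
move=> s0 ss nn [[-> -> ->] [-> -> ->]].
have nuE : nu ^+ 2 = 1 - s ^+ 2 by rewrite ss; ring.
have nE : n2 ^+ 2 = s ^+ 2 - n1 ^+ 2 by rewrite ss -nn; ring.
by split; field: nuE nE.
Qed.

Lemma frame_sec_comb_algebra {R : realType} (E F n : 'rV[R]_3)
  (p q a1 a2 a3 b1 b2 b3 c1 c2 c3 d1 d2 d3 : R) :
  - ((a1 *: E + a2 *: F + a3 *: n - p *: (b1 *: E + b2 *: F + b3 *: n))
     + (c1 *: E + c2 *: F + c3 *: n - q *: (d1 *: E + d2 *: F + d3 *: n))) =
  (- ((a1 - p * b1) + (c1 - q * d1))) *: E + (- ((a2 - p * b2) + (c2 - q * d2))) *: F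
  + (- ((a3 - p * b3) + (c3 - q * d3))) *: n.
Proof. by apply/rowP => i; rewrite !mxE; ring. Qed.

Lemma onb_delta {R : realType} (m l : R) p (V : 'I_2 -> 'rV[R]_3) :
  let I i j := bcv_fr1 m p (V i) * bcv_fr1 m p (V j) + bcv_fr2 m p (V i) * bcv_fr2 m p (V j)
    + bcv_fr3 m l p (V i) * bcv_fr3 m l p (V j) in
  [/\ I 0 0 = 1, I 0 1 = 0, I 1 0 = 0 & I 1 1 = 1] -> forall i j, I i j = (i == j)%:R.
Proof. by move=> I [a b c d]; apply: forall2; apply: forall2. Qed.

Lemma inner_curvature {R : realType} (m l : R) p X Y Z N : bcv_lam m p != 0 ->
  inner (bcv_metric m l p) (curvature (bcv_metric m l) p X Y Z) N =
  frK (l / 2) (4 * m - l ^+ 2) (bcv_fr1 m p N) (bcv_fr2 m p N) (bcv_fr3 m l p N)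
    (bcv_fr1 m p X) (bcv_fr2 m p X) (bcv_fr3 m l p X)
    (bcv_fr1 m p Y) (bcv_fr2 m p Y) (bcv_fr3 m l p Y)
    (bcv_fr1 m p Z) (bcv_fr2 m p Z) (bcv_fr3 m l p Z).
Proof.
move=> l0; apply: (etrans (inner_bcv m l _ _ _)).
have [-> -> ->] := @fr_curvature R m l p X Y Z l0.
by rewrite /frK; field.
Qed.

Lemma inner_tension_split {R : realType} (m l : R) p (A B0 B1 C0 C1 N : 'rV[R]_3) :
  inner (bcv_metric m l p) (A - (B0 + B1) - (C0 + C1)) N =
  inner (bcv_metric m l p) A N
  - (inner (bcv_metric m l p) B0 N + inner (bcv_metric m l p) B1 N)
  - (inner (bcv_metric m l p) C0 N + inner (bcv_metric m l p) C1 N).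
Proof.
have O v : inner (bcv_metric m l p) (- v) N = - inner (bcv_metric m l p) v N.
  by rewrite -[- v]scaleN1r inner_scalel mulN1r.
by rewrite !inner_addl !O !inner_addl.
Qed.

(** * The normal component of the 3-tension field *)

Section Triharmonic.
Context {R : realType}.
Variables m l : R.
Local Notation lam := (bcv_lam m).
Local Notation fr1 := (bcv_fr1 m).
Local Notation fr2 := (bcv_fr2 m).
Local Notation fr3 := (bcv_fr3 m l).
Local Notation g := (bcv_metric m l).
Variables (U : set 'rV[R]_2) (psi N : 'rV[R]_2 -> 'rV[R]_3) (h nu s : R).
Hypotheses (oU : open U) (ipsi : immersion_on U psi) (lpsi : forall u, U u -> lam (psi u) != 0)
  (sN : smooth_on U N) (uN : forall u, U u -> unit_normal g psi u (N u))
  (hH : forall u, U u -> 2 * mean_curvature g psi u (N u) = h)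
  (hnu : forall u, U u -> fr3 (psi u) (N u) = nu) (h0 : h != 0)
  (s0 : s != 0) (ss : s ^+ 2 = 1 - nu ^+ 2).
Local Notation t := (l / 2).
Local Notation n1 u := (fr1 (psi u) (N u)).
Local Notation n2 u := (fr2 (psi u) (N u)).
Local Notation F := (frame_sec m l psi N s).
Local Notation E0 := (frame0 m l psi N s).
Local Notation E1 := (frame1 m l psi N s).
Local Notation al := (- 2 * t * nu / s).
Local Notation be := (nu * h / s).

Definition normal_frame (i : 'I_2) u := if i == 0 then E0 u else E1 u.

Let spsi : smooth_on U psi. Proof. by case: ipsi. Qed.
Let nnU u (Uu : U u) := angle_nn uN hnu Uu.
Let frE u (Uu : U u) := frame_fr oU ipsi lpsi uN hnu s0 ss Uu.
Let frS a b c u (Uu : U u) := fr_frame_sec oU ipsi lpsi uN hnu s0 ss a b c Uu.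
Let covS a b c S u (Uu : U u) := @frame_cov R m l U psi N h nu s oU ipsi lpsi sN uN hH hnu h0 s0 ss a b c S u Uu.

Lemma normal_frame_orthonormal : orthonormal_frame_on g U psi normal_frame.
Proof.
have [q0 q1] := smooth_frame oU ipsi lpsi sN uN hnu s0 ss.
split; first by apply: forall2.
move=> u i j Uu; have I := @inner_induced R m l U psi oU spsi u (normal_frame i u) (normal_frame j u) Uu.
apply: (etrans I); apply: (etrans (inner_bcv m l _ _ _)).
exact: (@onb_delta R m l (psi u) (fun i => 'D_(normal_frame i u) psi u)
  (frame_onb_algebra s0 ss (nnU Uu) (frE Uu)) i j).
Qed.

Lemma frame_sec100 u : F 1 0 0 u = 'D_(E0 u) psi u.
Proof. by rewrite /frame_sec; move: ('D_(E0 u) psi u) => v; rewrite scale1r !scale0r !addr0. Qed.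

Lemma frame_sec010 u : F 0 1 0 u = 'D_(E1 u) psi u.
Proof. by rewrite /frame_sec; move: ('D_(E1 u) psi u) => v; rewrite scale1r !scale0r !addr0 add0r. Qed.

Lemma inner_frame_sec a b c u X : U u ->
  inner (g (psi u)) (F a b c u) ('D_X psi u) =
  inner (g (psi u)) ('D_(a *: E0 u + b *: E1 u) psi u) ('D_X psi u).
Proof.
move=> Uu; have [_ /(_ X) nX] := uN Uu.
apply: (etrans (inner_addl m l _ _ _ _)).
apply: (etrans (congr1 (+%R _) (inner_scalel m l _ _ _ _))).
apply: (etrans (congr1 (fun z => _ + c * z) nX)); rewrite mulr0 addr0.
congr (inner _ _ _).
have P Z := smooth_mx_derive_rV2 oU Z Uu spsi.
apply: (etrans _ (esym (P _))).
apply: (etrans (congr2 (fun v w => a *: v + b *: w) (P _) (P _))).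
move: ('D_(basis_vec 0) psi u) ('D_(basis_vec 1) psi u) => v w.
by move: (E0 u) (E1 u) => x y; rewrite !mxE !scalerDr !scalerDl !scalerA addrACA.
Qed.

Lemma nabla_frame Y a b c u X : U u -> smooth_on U Y ->
  cov_deriv g psi X (fun w => 'D_(Y w) psi w) u = F a b c u ->
  nabla_surf g psi X Y u = a *: E0 u + b *: E1 u.
Proof.
move=> Uu sY CE; apply: (row_inner_inj (induced_unitmx l oU spsi lpsi ipsi Uu)) => i.
apply: (etrans (@inner_induced R m l U psi oU spsi u _ _ Uu)).
apply: (etrans _ (esym (@inner_induced R m l U psi oU spsi u _ _ Uu))).
apply: (etrans (@nabla_surf_tangential R m l U psi oU spsi lpsi ipsi Y u X i Uu sY)).
apply: (etrans (congr1 (fun v => inner (g (psi u)) v ('D_(basis_vec i) psi u)) CE)).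
exact: inner_frame_sec.
Qed.

Lemma nabla_frames u : U u ->
  nabla_surf g psi (E0 u) E0 u = al *: E1 u /\ nabla_surf g psi (E1 u) E1 u = (- be) *: E0 u.
Proof.
move=> Uu; have [q0 q1] := smooth_frame oU ipsi lpsi sN uN hnu s0 ss.
have [A0 _] := covS Uu (fun w _ => esym (frame_sec100 w)).
have [_ A1] := covS Uu (fun w _ => esym (frame_sec010 w)).
split.
- by rewrite (nabla_frame Uu q0 A0) mulr0 scale0r add0r mulr1 mulr0 addr0.
- by rewrite (nabla_frame Uu q1 A1) !mulr0 mulr1 sub0r subr0 scale0r addr0.
Qed.

(** [lap1], [lap2], [lap3] are the coefficients of the rough Laplacian of a E0 + b E1 + c n. The
    correction terms come from [nabla_frames]: the induced derivative of E0 along itself is al E1,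
    that of E1 along itself is - be E0. *)
Definition lap1 (a b c : R) : R := - ((- al * (al * a + t * c) - al * (t * c - be * b))
           + ((t * (h * b - t * a) - be * (be * a - h * c)) - (- be) * (- al * b))).
Definition lap2 (a b c : R) : R := - ((al * (- al * b) + t * (- t * b) - al * (be * a - h * c))
           + ((be * (t * c - be * b) - h * (h * b - t * a)) - (- be) * (al * a + t * c))).
Definition lap3 (a b c : R) : R := - ((- t * (al * a + t * c) - al * (h * b - t * a))
           + ((h * (be * a - h * c) - t * (t * c - be * b)) - (- be) * (- t * b))).

Lemma smooth_section a b c S : (forall w, U w -> S w = F a b c w) -> smooth_on U S.
Proof.
move=> SE; apply: (smooth_on_ext oU _ (smooth_frame_sec oU ipsi lpsi sN uN hnu s0 ss a b c)).
by move=> w Uw; rewrite SE.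
Qed.

Lemma rough_laplacian_frame a b c S : (forall w, U w -> S w = F a b c w) ->
  forall u, U u -> rough_laplacian g psi normal_frame S u =
    F (lap1 a b c) (lap2 a b c) (lap3 a b c) u.
Proof.
move=> SE u Uu; have sS := smooth_section SE.
have [B0 B1] := covS Uu (fun w Uw => (covS Uw SE).1).
have [C0 C1] := covS Uu (fun w Uw => (covS Uw SE).2).
have [D0 D1] := covS Uu SE.
have [e0 e1] := nabla_frames Uu.
have K0 : cov_deriv g psi (nabla_surf g psi (E0 u) E0 u) S u =
    al *: F (t * c - be * b) (be * a - h * c) (h * b - t * a) u.
  apply: (etrans (congr1 (fun X => cov_deriv g psi X S u) e0)).
  apply: (etrans (@cov_deriv_scale R m l U psi oU spsi lpsi S u _ al Uu sS)).
  exact: (congr1 (fun v => al *: v) D1).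
have K1 : cov_deriv g psi (nabla_surf g psi (E1 u) E1 u) S u =
    (- be) *: F (- al * b) (al * a + t * c) (- t * b) u.
  apply: (etrans (congr1 (fun X => cov_deriv g psi X S u) e1)).
  apply: (etrans (@cov_deriv_scale R m l U psi oU spsi lpsi S u _ (- be) Uu sS)).
  exact: (congr1 (fun v => (- be) *: v) D0).
apply: (etrans (congr1 -%R (sum2 _))).
apply: (etrans (congr1 -%R (congr2 +%R (congr2 (fun x y => x - y) B0 K0) (congr2 (fun x y => x - y) C1 K1)))).
exact: frame_sec_comb_algebra.
Qed.

Lemma tension_frame u : U u -> tension g psi normal_frame u = F 0 0 h u.
Proof.
move=> Uu; have [A0 _] := covS Uu (fun w _ => esym (frame_sec100 w)).
have [_ A1] := covS Uu (fun w _ => esym (frame_sec010 w)).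
have [e0 e1] := nabla_frames Uu.
have P (a : R) X : 'D_(a *: X) psi u = a *: 'D_X psi u.
  apply: (etrans (smooth_mx_derive_rV2 oU _ Uu spsi)).
  apply: (etrans _ (congr1 (fun v => a *: v) (esym (smooth_mx_derive_rV2 oU X Uu spsi)))).
  by move: ('D_(basis_vec 0) psi u) ('D_(basis_vec 1) psi u) => v w; rewrite !mxE scalerDr !scalerA.
have K0 := etrans (congr1 (fun X => 'D_X psi u) e0) (P al (E1 u)).
have K1 := etrans (congr1 (fun X => 'D_X psi u) e1) (P (- be) (E0 u)).
apply: (etrans (sum2 _)).
apply: (etrans (congr2 +%R (congr2 (fun x y => x - y) A0 K0) (congr2 (fun x y => x - y) A1 K1))).
rewrite /frame_sec; move: ('D_(E0 u) psi u) ('D_(E1 u) psi u) (N u) => v w n.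
by apply/rowP => i; rewrite !mxE; ring.
Qed.

Lemma inner_frame_sec_normal a b c u : U u -> inner (g (psi u)) (F a b c u) (N u) = c.
Proof.
move=> Uu; apply: (etrans (inner_bcv m l _ _ _)).
have [-> -> ->] := frS a b c Uu; rewrite (hnu Uu).
have nn := nnU Uu; have nuE : nu ^+ 2 = 1 - s ^+ 2 by rewrite ss; ring.
have nE : n2 u ^+ 2 = s ^+ 2 - n1 u ^+ 2 by rewrite ss -nn; ring.
by field: nE nuE.
Qed.

Lemma inner_tension3 u : U u -> inner (g (psi u)) (tension3 g psi normal_frame u) (N u) =
  (let L a b c := (lap1 a b c, lap2 a b c, lap3 a b c) in
   let: (x1, x2, x3) := L 0 0 h in
   lap3 x1 x2 x3 - (x3 * (2 * t ^+ 2 + (4 * m - l ^+ 2) * s ^+ 2) - x1 * ((4 * m - l ^+ 2) * nu * s))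
   - h ^+ 3 * (t ^+ 2 + (4 * m - l ^+ 2) * s ^+ 2)).
Proof.
move=> Uu; have l0 := lpsi Uu.
have T := rough_laplacian_frame tension_frame.
have TT := rough_laplacian_frame T Uu.
have [A0 A1] := covS Uu tension_frame.
have TS X i : curvature g (psi u) (rough_laplacian g psi normal_frame
     (tension g psi normal_frame) u) ('D_(normal_frame i u) psi u) ('D_(normal_frame i u) psi u) = X ->
   curvature g (psi u) (F (lap1 0 0 h) (lap2 0 0 h) (lap3 0 0 h) u)
     ('D_(normal_frame i u) psi u) ('D_(normal_frame i u) psi u) = X.
  by move=> <-; apply: (congr1 (fun v => curvature g (psi u) v _ _)); rewrite (T u Uu).
apply: (etrans (congr1 (fun v => inner (g (psi u)) v (N u)) (congr2 (fun x y => x - y)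
  (congr2 (fun x y => x - y) TT
    (etrans (sum2 _) (congr2 (fun x y => curvature g (psi u) x ('D_(E0 u) psi u) ('D_(E0 u) psi u) +
        curvature g (psi u) y ('D_(E1 u) psi u) ('D_(E1 u) psi u)) (T u Uu) (T u Uu))))
  (etrans (sum2 _) (congr2 (fun x y => x + y)
     (congr2 (fun x y => curvature g (psi u) x y ('D_(E0 u) psi u)) A0 (tension_frame Uu))
     (congr2 (fun x y => curvature g (psi u) x y ('D_(E1 u) psi u)) A1 (tension_frame Uu))))))).
apply: (etrans (inner_tension_split m l _ _ _ _ _ _ _)).
rewrite (inner_frame_sec_normal _ _ _ Uu).
have K X Y Z := @inner_curvature R m l (psi u) X Y Z (N u) l0.
apply: (etrans (congr2 (fun a b => lap3 (lap1 0 0 h) (lap2 0 0 h) (lap3 0 0 h) - a - b)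
   (congr2 +%R (K _ _ _) (K _ _ _)) (congr2 +%R (K _ _ _) (K _ _ _)))).
rewrite (hnu Uu).
apply: (congr2 (fun a b => lap3 (lap1 0 0 h) (lap2 0 0 h) (lap3 0 0 h) - a - b)).
  exact: (@ricci_algebra R t (4 * m - l ^+ 2) nu s (n1 u) (n2 u) _ _ _ _ _ _ _ _ _ _ _ _ s0 ss (nnU Uu)
    (frS (lap1 0 0 h) (lap2 0 0 h) (lap3 0 0 h) Uu) (frE Uu)).
exact: (@ricci_mixed_algebra R t (4 * m - l ^+ 2) h nu s (n1 u) (n2 u) al be _ _ _ _ _ _ _ _ _ _ _ _ _ _ _
  s0 ss (nnU Uu) (frS 0 0 h Uu) (frS (- al * 0) (al * 0 + t * h) (- t * 0) Uu)
  (frS (t * h - be * 0) (be * 0 - h * h) (h * 0 - t * 0) Uu) (frE Uu)).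
Qed.

Lemma triharmonic_angle u : U u -> triharmonic_on g U psi ->
  - (4 * m - l ^+ 2) * s ^+ 2 * (t ^+ 2 * (4 - 2 * s ^+ 2) + h ^+ 2 * (1 + s ^+ 2))
    + h ^+ 2 * t ^+ 2 * (4 - 3 * s ^+ 2) + h ^+ 4 = 0.
Proof.
move=> Uu /(_ U normal_frame oU (@subset_refl _ U) normal_frame_orthonormal u Uu) T0.
have Z : inner (g (psi u)) (tension3 g psi normal_frame u) (N u) = 0.
  apply: (etrans (congr1 (fun v => inner (g (psi u)) v (N u)) T0)).
  by rewrite -(scale0r (N u)) inner_scalel mul0r.
have H := etrans (esym (inner_tension3 Uu)) Z.
have := @normal_triharmonic_algebra R (4 * m - l ^+ 2) t h nu s s0 ss h0; apply.
by apply: (etrans _ H); rewrite /lap1 /lap2 /lap3; ring.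
Qed.

End Triharmonic.

(** If nu != 0, the integrability condition says - c D = 4 t^2 + h^2, and then every term of the
    triharmonic polynomial is nonnegative because 0 < D <= 1, while h^4 > 0. For nu = 0, that is D =
    1, the polynomial factors as (h^2 + t^2) (h^2 - 2 c). *)
Lemma vertical_angle_algebra {R : realFieldType} (c t h nu D : R) : 0 < D -> D = 1 - nu ^+ 2 -> h != 0 ->
  nu * (c * D + 4 * t ^+ 2 + h ^+ 2) = 0 ->
  - c * D * (t ^+ 2 * (4 - 2 * D) + h ^+ 2 * (1 + D)) + h ^+ 2 * t ^+ 2 * (4 - 3 * D) + h ^+ 4 = 0 ->
  nu = 0 /\ h ^+ 2 = 2 * c.
Proof.
move=> D0 DE h0 G T; have hp : 0 < h ^+ 2 by rewrite exprn_even_gt0.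
have tp := sqr_ge0 t; have np := sqr_ge0 nu.
have n0 : nu = 0.
  apply/eqP; apply/negPn/negP => n0; move/eqP: G; rewrite mulf_eq0 (negPf n0) /= => /eqP G.
  have cD : - c * D = 4 * t ^+ 2 + h ^+ 2 by apply/eqP; rewrite -subr_eq0 -oppr_eq0 -[X in _ == X]G; apply/eqP; ring.
  have D1 : D <= 1 by rewrite DE; lra.
  suff : 0 < - c * D * (t ^+ 2 * (4 - 2 * D) + h ^+ 2 * (1 + D)) + h ^+ 2 * t ^+ 2 * (4 - 3 * D) + h ^+ 4.
    by rewrite T ltxx.
  rewrite cD; apply: ltr_wpDl; last by rewrite exprn_even_gt0.
  apply: addr_ge0; last by apply: mulr_ge0; [apply: mulr_ge0 => //; exact: ltW | lra].
  by apply: mulr_ge0; [lra | apply: addr_ge0; apply: mulr_ge0; lra].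
split=> //; move: T; rewrite DE n0 => T.
have : (h ^+ 2 + t ^+ 2) * (h ^+ 2 - 2 * c) = 0 by apply: etrans T; ring.
move/eqP; rewrite mulf_eq0 gt_eqF /=; last by lra.
by rewrite subr_eq0 => /eqP.
Qed.

Lemma vertical_angle {R : realType} (m l : R) U psi N h nu (g := bcv_metric m l) : open U ->
  immersion_on U psi -> (forall u, U u -> bcv_lam m (psi u) != 0) -> smooth_on U N ->
  (forall u, U u -> unit_normal g psi u (N u)) ->
  (forall u, U u -> 2 * mean_curvature g psi u (N u) = h) ->
  (forall u, U u -> bcv_fr3 m l (psi u) (N u) = nu) -> h != 0 -> triharmonic_on g U psi ->
  forall u, U u -> nu = 0 /\ h ^+ 2 = 2 * (4 * m - l ^+ 2).
Proof.
move=> oU ipsi lpsi sN uN hH hnu h0 T u Uu.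
have G := angle_gauss oU ipsi lpsi sN uN hH hnu h0 Uu.
have nn := angle_nn uN hnu Uu.
have D1 := angle_neq1 oU ipsi lpsi sN uN hH hnu h0 Uu.
have D0 : 0 < 1 - nu ^+ 2.
  rewrite lt_neqAle eq_sym D1 /= -nn.
  by move: (bcv_fr1 _ _ _) (bcv_fr2 _ _ _) => a b; nra.
have s0 : Num.sqrt (1 - nu ^+ 2) != 0 by rewrite gt_eqF ?sqrtr_gt0.
have ss : Num.sqrt (1 - nu ^+ 2) ^+ 2 = 1 - nu ^+ 2 by rewrite sqr_sqrtr ?ltW.
have K := triharmonic_angle oU ipsi lpsi sN uN hH hnu h0 s0 ss Uu T.
rewrite ss in K.
apply: (vertical_angle_algebra D0 erefl h0 _ K).
by rewrite -[RHS]G; field.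
Qed.

(** * Surfaces over circles of the base *)

Definition row3 {R : realType} (a b c : R) : 'rV[R]_3 :=
  \row_(j < 3) (if j == 0 then a else if j == 1 then b else c).

Lemma row3_0 {R : realType} (a b c : R) : row3 a b c 0 0 = a. Proof. exact: mxE. Qed.
Lemma row3_1 {R : realType} (a b c : R) : row3 a b c 0 1 = b. Proof. exact: mxE. Qed.
Lemma row3_2 {R : realType} (a b c : R) : row3 a b c 0 ord_max = c. Proof. exact: mxE. Qed.

Lemma smooth_row3 {R : realType} (V : normedModType R) (A : set V) (a b c : V -> R) : open A ->
  smooth_on A a -> smooth_on A b -> smooth_on A c ->
  smooth_on A (fun u => row3 (a u) (b u) (c u)).
Proof.
move=> oA sa sb sc; apply: (smooth_on_mx oA) => i; apply: forall3.
- by rewrite (_ : (fun y => _) = a) //; apply/funext => y; rewrite (ord1 i) row3_0.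
- by rewrite (_ : (fun y => _) = b) //; apply/funext => y; rewrite (ord1 i) row3_1.
- by rewrite (_ : (fun y => _) = c) //; apply/funext => y; rewrite (ord1 i) row3_2.
Qed.

Definition frame_vec {R : realType} (m l : R) p a b c : 'rV[R]_3 :=
  row3 (bcv_lam m p * a) (bcv_lam m p * b) (c - l / 2 * (p 0 1 * a - p 0 0 * b)).

Lemma fr_frame_vec {R : realType} (m l : R) p (a b c : R) : bcv_lam m p != 0 ->
  [/\ bcv_fr1 m p (frame_vec m l p a b c) = a, bcv_fr2 m p (frame_vec m l p a b c) = b &
      bcv_fr3 m l p (frame_vec m l p a b c) = c].
Proof.
move=> l0; rewrite /bcv_fr1 /bcv_fr2 /bcv_fr3 /frame_vec row3_0 row3_1 row3_2.
by split; field.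
Qed.

(** On the cylinder n = b + k q, hence dn = k dq, and the equation of the cylinder gives k lam = 2 m
    <q, n> - h. With the connection terms added, the derivative of n has the matrix found for
    constant angle at nu = 0, so twice the mean curvature is h. *)
Lemma cylinder_shape_algebra {R : realType} (m t h k b1 b2 x y f1 f2 f3 B1 B2 B3 : R)
  (n1 := b1 + k * x) (n2 := b2 + k * y) (lam := 1 + m * (x ^+ 2 + y ^+ 2))
  (o := - t * f3 + 2 * m * (y * f1 - x * f2)) (K := f1 * n2 - f2 * n1) :
  m * k * (x ^+ 2 + y ^+ 2) + 2 * m * (b1 * x + b2 * y) = h + k ->
  n1 ^+ 2 + n2 ^+ 2 = 1 -> n1 * f1 + n2 * f2 = 0 ->
  B1 - (t * f2 * 0 - o * n2) = k * (lam * f1) -> B2 - (o * n1 - t * f1 * 0) = k * (lam * f2) ->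
  B3 - (t * f1 * n2 - t * f2 * n1) = 0 ->
  [/\ B1 = n2 * (t * f3 - h * K), B2 = - n1 * (t * f3 - h * K) & B3 = t * K].
Proof.
move=> cyl nn nf E1 E2 E3.
have kl : k * lam = 2 * m * (x * n1 + y * n2) - h.
  by rewrite /lam /n1 /n2; apply/eqP; rewrite -subr_eq0 -(subrr (h + k)) -{2}cyl; apply/eqP; ring.
have ef1 : f1 = K * n2.
  by rewrite -[LHS]mulr1 -nn /K -[LHS]subr0 -(mulr0 n1) -nf; ring.
have ef2 : f2 = - K * n1.
  by rewrite -[LHS]mulr1 -nn /K -[LHS]subr0 -(mulr0 n2) -nf; ring.
move/eqP: E1; rewrite subr_eq mulrA kl => /eqP ->.
move/eqP: E2; rewrite subr_eq mulrA kl => /eqP ->.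
move/eqP: E3; rewrite subr_eq => /eqP ->.
rewrite /o; move: ef1 ef2; rewrite -/K; clearbody K n1 n2 => -> ->.
have nE : n2 ^+ 2 = 1 - n1 ^+ 2 by rewrite -nn; ring.
by split; ring: nE.
Qed.

Lemma cylinder_trace_algebra {R : realType} (t h n1 n2 f1 f2 f3 g1 g2 g3 b1 b2 b3 k1 k2 k3 c : R)
  (K := f1 * n2 - f2 * n1) (L := g1 * n2 - g2 * n1) :
  n1 ^+ 2 + n2 ^+ 2 = 1 -> n1 * f1 + n2 * f2 = 0 -> n1 * g1 + n2 * g2 = 0 -> c = 0 ->
  [/\ b1 = n2 * (t * f3 - h * K), b2 = - n1 * (t * f3 - h * K) & b3 = t * K] ->
  [/\ k1 = n2 * (t * g3 - h * L), k2 = - n1 * (t * g3 - h * L) & k3 = t * L] ->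
  - (tri b1 b2 b3 g1 g2 g3 n1 n2 c + tri f1 f2 f3 k1 k2 k3 n1 n2 c) =
  h * tri f1 f2 f3 g1 g2 g3 n1 n2 c.
Proof.
move=> nn nf ng -> [-> -> ->] [-> -> ->].
have ef1 : f1 = K * n2.
  by rewrite -[LHS]mulr1 -nn /K -[LHS]subr0 -(mulr0 n1) -nf; ring.
have ef2 : f2 = - K * n1.
  by rewrite -[LHS]mulr1 -nn /K -[LHS]subr0 -(mulr0 n2) -nf; ring.
have eg1 : g1 = L * n2.
  by rewrite -[LHS]mulr1 -nn /L -[LHS]subr0 -(mulr0 n1) -ng; ring.
have eg2 : g2 = - L * n1.
  by rewrite -[LHS]mulr1 -nn /L -[LHS]subr0 -(mulr0 n2) -ng; ring.
move: ef1 ef2 eg1 eg2; clearbody K L => -> -> -> ->.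
have nE : n2 ^+ 2 = 1 - n1 ^+ 2 by rewrite -nn; ring.
by rewrite /tri; ring: nE.
Qed.

Section CylinderPatch.
Context {R : realType}.
Variables m l : R.
Local Notation lam := (bcv_lam m).
Local Notation fr1 := (bcv_fr1 m).
Local Notation fr2 := (bcv_fr2 m).
Local Notation fr3 := (bcv_fr3 m l).
Local Notation g := (bcv_metric m l).
Variables (U : set 'rV[R]_2) (psi : 'rV[R]_2 -> 'rV[R]_3) (h k b1 b2 : R).
Hypotheses (oU : open U) (ipsi : immersion_on U psi) (lpsi : forall u, U u -> lam (psi u) != 0)
  (m0 : m != 0) (hb : m * (b1 ^+ 2 + b2 ^+ 2) + k * (h + k) = m)
  (hcyl : forall u, U u -> m * k * (psi u 0 0 ^+ 2 + psi u 0 1 ^+ 2)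
            + 2 * m * (b1 * psi u 0 0 + b2 * psi u 0 1) = h + k).
Local Notation n1 u := (b1 + k * psi u 0 0).
Local Notation n2 u := (b2 + k * psi u 0 1).
Local Notation f1 X u := (fr1 (psi u) ('D_X psi u)).
Local Notation f2 X u := (fr2 (psi u) ('D_X psi u)).
Local Notation f3 X u := (fr3 (psi u) ('D_X psi u)).

Definition cylinder_normal u := frame_vec m l (psi u) (n1 u) (n2 u) 0.
Local Notation N := cylinder_normal.

Let spsi : smooth_on U psi. Proof. by case: ipsi. Qed.

Lemma smooth_cylinder_normal : smooth_on U cylinder_normal.
Proof.
have s0 := smooth_on_coord 0 0 oU spsi; have s1 := smooth_on_coord 0 1 oU spsi.
have sl := smooth_on_lam m oU spsi.
have c (r : R) : smooth_on U (fun=> r) by exact: smooth_on_cst.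
have a0 : smooth_on U (fun u => n1 u) by apply: (smooth_onD oU) => //; exact: (smooth_onM oU).
have a1 : smooth_on U (fun u => n2 u) by apply: (smooth_onD oU) => //; exact: (smooth_onM oU).
apply: (smooth_row3 oU); [exact: (smooth_onM oU)|exact: (smooth_onM oU)|].
apply: (smooth_onB oU) => //; apply: (smooth_onM oU) => //.
by apply: (smooth_onB oU); exact: (smooth_onM oU).
Qed.

(** m |b + k q|^2 = m |b|^2 + k (m k |q|^2 + 2 m <b, q>), and the bracket equals h + k on the
    cylinder; the relation [hb] is exactly the normalization making this m. *)
Lemma cylinder_nn u : U u -> n1 u ^+ 2 + n2 u ^+ 2 = 1.
Proof.
move=> Uu; apply: (mulfI m0); rewrite mulr1 -[RHS]hb -(hcyl Uu); ring.
Qed.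

Lemma derive_coord_fr u X : U u ->
  is_derive u X (fun w => psi w 0 0) (lam (psi u) * f1 X u) /\
  is_derive u X (fun w => psi w 0 1) (lam (psi u) * f2 X u).
Proof.
move=> Uu; have dp := @smooth_on_derivable _ _ _ U psi u X spsi Uu.
have D0 := @derive_coord R _ _ _ psi u X 0 0 dp; have D1 := @derive_coord R _ _ _ psi u X 0 1 dp.
have C (v q : R) : q != 0 -> v = q * (v / q) by move=> q0; field.
split.
- exact: (is_derive_eq D0 (C _ _ (lpsi Uu))).
- exact: (is_derive_eq D1 (C _ _ (lpsi Uu))).
Qed.

Lemma cylinder_nf u X : U u -> n1 u * f1 X u + n2 u * f2 X u = 0.
Proof.
move=> Uu; have [d0 d1] := derive_coord_fr X Uu.
have [_ D] : is_derive u X (fun u => m * k * (psi u 0 0 ^+ 2 + psi u 0 1 ^+ 2)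
            + 2 * m * (b1 * psi u 0 0 + b2 * psi u 0 1))
   ((2 * m * lam (psi u)) * (n1 u * f1 X u + n2 u * f2 X u)).
  by eapply is_derive_eq; [derV | move: (f1 X u) (f2 X u) => a b; ring].
have Z : 'D_X (fun u => m * k * (psi u 0 0 ^+ 2 + psi u 0 1 ^+ 2)
            + 2 * m * (b1 * psi u 0 0 + b2 * psi u 0 1)) u = 0.
  apply: (etrans (@near_eq_derive R _ _ _ (fun=> h + k) u X _)); last exact: derive_cst.
  exact: (filterS hcyl (open_nbhs_nbhs (conj oU Uu))).
have c0 : 2 * m * lam (psi u) != 0 by rewrite !mulf_neq0 ?pnatr_eq0 ?(lpsi Uu).
exact: (mulfI c0 (etrans (esym D) (etrans Z (esym (mulr0 _))))).
Qed.

Lemma cylinder_unit_normal u : U u -> unit_normal g psi u (N u).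
Proof.
move=> Uu; have [a1 a2 a3] := fr_frame_vec l (n1 u) (n2 u) 0 (lpsi Uu); split.
- apply: (etrans (inner_bcv m l _ _ _)); rewrite a1 a2 a3 -[RHS](cylinder_nn Uu); ring.
- move=> X; apply: (etrans (inner_bcv m l _ _ _)); rewrite a1 a2 a3.
  by have H := cylinder_nf X Uu; rewrite H mul0r addr0.
Qed.

Lemma cylinder_shape u X : U u -> let C := cov_deriv g psi X N u in
  let K := f1 X u * n2 u - f2 X u * n1 u in
  [/\ fr1 (psi u) C = n2 u * (l / 2 * f3 X u - h * K), fr2 (psi u) C = - n1 u * (l / 2 * f3 X u - h * K) &
      fr3 (psi u) C = l / 2 * K].
Proof.
move=> Uu C K; have [d0 d1] := derive_coord_fr X Uu.
have dp := @smooth_on_derivable _ _ _ U psi u X spsi Uu.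
have dS := @smooth_on_derivable _ _ _ U _ u X smooth_cylinder_normal Uu.
have [_ D1] := @is_derive_fr1 R m l _ psi _ X u (lpsi Uu) dp dS.
have [_ D2] := @is_derive_fr2 R m l _ psi _ X u (lpsi Uu) dp dS.
have [_ D3] := @is_derive_fr3 R m l _ psi _ X u (lpsi Uu) dp dS.
have [a1 a2 a3] := fr_frame_vec l (n1 u) (n2 u) 0 (lpsi Uu).
have nU (P : 'rV[R]_2 -> Prop) : (forall w, U w -> P w) -> \forall w \near u, P w.
  by move=> UP; apply: filterS (open_nbhs_nbhs (conj oU Uu)).
have near_derive (f j : 'rV[R]_2 -> R) (v : R) : (forall y, U y -> f y = j y) -> is_derive u X j v -> 'D_X f u = v.
  by move=> fk [_]; apply: etrans; apply: near_eq_derive; exact: nU.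
have F1 : 'D_X (fun w => fr1 (psi w) (N w)) u = k * (lam (psi u) * f1 X u).
  apply: (near_derive _ (fun w => n1 w)).
    by move=> y Uy; have [] := fr_frame_vec l (n1 y) (n2 y) 0 (lpsi Uy).
  by eapply is_derive_eq; [derV | move: (f1 X u) => a; ring].
have F2 : 'D_X (fun w => fr2 (psi w) (N w)) u = k * (lam (psi u) * f2 X u).
  apply: (near_derive _ (fun w => n2 w)).
    by move=> y Uy; have [] := fr_frame_vec l (n1 y) (n2 y) 0 (lpsi Uy).
  by eapply is_derive_eq; [derV | move: (f2 X u) => a; ring].
have F3 : 'D_X (fun w => fr3 (psi w) (N w)) u = 0.
  apply: (near_derive _ (fun w => 0)).
  by move=> y Uy; have [] := fr_frame_vec l (n1 y) (n2 y) 0 (lpsi Uy).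
move: (etrans (esym D1) F1) (etrans (esym D2) F2) (etrans (esym D3) F3).
rewrite -/(N u) in a1 a2 a3; rewrite a1 a2 a3.
exact: (@cylinder_shape_algebra R m (l / 2) h k b1 b2 (psi u 0 0) (psi u 0 1) _ _ _ _ _ _
  (hcyl Uu) (cylinder_nn Uu) (cylinder_nf X Uu)).
Qed.

Lemma cylinder_mean_curvature u : U u -> 2 * mean_curvature g psi u (N u) = h.
Proof.
move=> Uu; have uN := cylinder_unit_normal.
have a0 := area_neq0 oU ipsi lpsi Uu (uN u Uu).
apply: (mulIf a0).
apply: (etrans (mean_curvature_shape oU ipsi lpsi smooth_cylinder_normal uN Uu)).
have [a1 a2 a3] := fr_frame_vec l (n1 u) (n2 u) 0 (lpsi Uu).
rewrite -/(N u) in a1 a2 a3.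
rewrite /shape_trace /area a1 a2 a3.
exact: (@cylinder_trace_algebra R (l / 2) h (n1 u) (n2 u) _ _ _ _ _ _ _ _ _ _ _ _ 0
  (cylinder_nn Uu) (cylinder_nf _ Uu) (cylinder_nf _ Uu) erefl (cylinder_shape _ Uu) (cylinder_shape _ Uu)).
Qed.

End CylinderPatch.

Lemma tri_vertical {R : realType} (f1 f2 f3 g1 g2 g3 n1 n2 n3 : R) :
  f1 = 0 -> f2 = 0 -> g1 = 0 -> g2 = 0 -> tri f1 f2 f3 g1 g2 g3 n1 n2 n3 = 0.
Proof. by move=> -> -> -> ->; rewrite /tri; ring. Qed.

Section PatchNormals.
Context {R : realType}.
Variables m l : R.
Local Notation lam := (bcv_lam m).
Local Notation g := (bcv_metric m l).
Variables (U : set 'rV[R]_2) (psi : 'rV[R]_2 -> 'rV[R]_3).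
Hypotheses (oU : open U) (ipsi : immersion_on U psi) (lpsi : forall u, U u -> lam (psi u) != 0).

Lemma unit_normal_sign u n n' : U u -> unit_normal g psi u n -> unit_normal g psi u n' ->
  n' = n \/ n' = - n.
Proof.
move=> Uu un un'; have a0 := area_neq0 oU ipsi lpsi Uu un.
have [nn nt] := un; have [nn' nt'] := un'.
exact: (unit_normal_pm (lpsi Uu) a0 nn (nt _) (nt _) nn' (nt' _) (nt' _)).
Qed.

Lemma mean_curvature_sign u n n' : U u -> unit_normal g psi u n -> unit_normal g psi u n' ->
  mean_curvature g psi u n' ^+ 2 = mean_curvature g psi u n ^+ 2.
Proof.
move=> Uu un un'; have [->|->] := unit_normal_sign Uu un un' => //.
by rewrite mean_curvatureN sqrrN.
Qed.

Variables (h k b1 b2 k' b1' b2' : R).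
Hypotheses (m0 : m != 0) (hb : m * (b1 ^+ 2 + b2 ^+ 2) + k * (h + k) = m)
  (hcyl : forall u, U u -> m * k * (psi u 0 0 ^+ 2 + psi u 0 1 ^+ 2)
            + 2 * m * (b1 * psi u 0 0 + b2 * psi u 0 1) = h + k).

Lemma cylinder_mean_curvature_sqr u n : U u -> unit_normal g psi u n ->
  4 * mean_curvature g psi u n ^+ 2 = h ^+ 2.
Proof.
move=> Uu un; have uN := cylinder_unit_normal l oU ipsi lpsi m0 hb hcyl Uu.
rewrite (mean_curvature_sign Uu uN un) -(cylinder_mean_curvature l oU ipsi lpsi m0 hb hcyl Uu).
by move: (mean_curvature _ _ _ _) => H; ring.
Qed.

Hypotheses (h0 : h != 0) (hb' : m * (b1' ^+ 2 + b2' ^+ 2) + k' * (h + k') = m)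
  (hcyl' : forall u, U u -> m * k' * (psi u 0 0 ^+ 2 + psi u 0 1 ^+ 2)
            + 2 * m * (b1' * psi u 0 0 + b2' * psi u 0 1) = h + k').

Lemma cylinder_normal_eq u : U u ->
  b1 + k * psi u 0 0 = b1' + k' * psi u 0 0 /\ b2 + k * psi u 0 1 = b2' + k' * psi u 0 1.
Proof.
move=> Uu; have un := cylinder_unit_normal l oU ipsi lpsi m0 hb hcyl Uu.
have un' := cylinder_unit_normal l oU ipsi lpsi m0 hb' hcyl' Uu.
have E := cylinder_mean_curvature l oU ipsi lpsi m0 hb hcyl Uu.
have E' := cylinder_mean_curvature l oU ipsi lpsi m0 hb' hcyl' Uu.
have [e|e] := unit_normal_sign Uu un un'; last first.
  move/negP: h0; case; apply/eqP.
  move: E'; rewrite e mean_curvatureN mulrN E => E'.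
  by apply/eqP; rewrite -[_ == 0](mulrn_eq0 h 2) mulr2n -{1}E' addNr.
have [a1 a2 _] := fr_frame_vec l (b1 + k * psi u 0 0) (b2 + k * psi u 0 1) 0 (lpsi Uu).
have [c1 c2 _] := fr_frame_vec l (b1' + k' * psi u 0 0) (b2' + k' * psi u 0 1) 0 (lpsi Uu).
split.
- exact: (etrans (esym a1) (etrans (congr1 (bcv_fr1 m (psi u)) (esym e)) c1)).
- exact: (etrans (esym a2) (etrans (congr1 (bcv_fr2 m (psi u)) (esym e)) c2)).
Qed.

(** The normals agree, so (k - k') q is constant on the patch. If k != k', the projection q is
    constant, both coordinate vectors are vertical, and the area vanishes. *)
Lemma cylinder_unique u : U u -> [/\ k = k', b1 = b1' & b2 = b2'].
Proof.
move=> Uu; have un := cylinder_unit_normal l oU ipsi lpsi m0 hb hcyl Uu.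
have a0 := area_neq0 oU ipsi lpsi Uu un.
have kk : k = k'.
  apply/eqP/negPn/negP => kk; move/negP: a0; apply; apply/eqP.
  have Z X : bcv_fr1 m (psi u) ('D_X psi u) = 0 /\ bcv_fr2 m (psi u) ('D_X psi u) = 0.
    have [d0 d1] := derive_coord_fr ipsi lpsi X Uu.
    have Q (f : 'rV[R]_2 -> R) b b' v : (forall w, U w -> b + k * f w = b' + k' * f w) ->
        is_derive u X f (lam (psi u) * v) -> v = 0.
      move=> fE df.
      have c0 : (k - k') * lam (psi u) != 0 by rewrite mulf_neq0 ?subr_eq0 ?kk ?(lpsi Uu).
      have [_ D] : is_derive u X (fun w => b + k * f w - (b' + k' * f w)) ((k - k') * lam (psi u) * v).
        by eapply is_derive_eq; [derV | ring].
      apply: (mulfI c0); rewrite mulr0 -D.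
      apply: (etrans (@near_eq_derive R _ _ _ (fun=> 0 : R) u X _)); last exact: derive_cst.
      by apply: filterS (open_nbhs_nbhs (conj oU Uu)) => w Uw; rewrite fE // subrr.
    split.
    - by apply: (Q (fun w => psi w 0 0) b1 b1' _ _ d0) => w /cylinder_normal_eq[].
    - by apply: (Q (fun w => psi w 0 1) b2 b2' _ _ d1) => w /cylinder_normal_eq[].
  have [z1 z2] := Z (basis_vec 0); have [z3 z4] := Z (basis_vec 1).
  exact: tri_vertical z1 z2 z3 z4.
have [e1 e2] := cylinder_normal_eq Uu.
by split=> //; [move: e1 | move: e2]; rewrite kk => /addIr.
Qed.

End PatchNormals.

Lemma kappa_derive_algebra {R : fieldType} (m h p q v w a b L : R) : q * b = - (p * a) -> L != 0 ->
  (0 * (v * p + w * q) + 2 * m * (L * a * p + v * ((2 * m * (v * p + w * q) - h) / L * (L * a)) +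
    (L * b * q + w * ((2 * m * (v * p + w * q) - h) / L * (L * b)))) + 0) / L
  + (2 * m * (v * p + w * q) - h) * (- (2 * m * L * (v * a + w * b)) / L ^+ 2) = 0.
Proof.
move=> nE L0.
have -> : L * a * p = - (L * b * q) by rewrite -!mulrA -mulrN [a * p]mulrC [b * q]mulrC nE opprK.
by field.
Qed.

Section VerticalPatch.
Context {R : realType}.
Variables m l : R.
Local Notation lam := (bcv_lam m).
Local Notation fr1 := (bcv_fr1 m).
Local Notation fr2 := (bcv_fr2 m).
Local Notation fr3 := (bcv_fr3 m l).
Local Notation g := (bcv_metric m l).
Variables (u0 : 'rV[R]_2) (d : R).
Local Notation U := (ball u0 d).
Variables (psi N : 'rV[R]_2 -> 'rV[R]_3) (h : R).
Hypotheses (d0 : 0 < d) (ipsi : immersion_on U psi) (lpsi : forall u, U u -> lam (psi u) != 0)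
  (sN : smooth_on U N) (uN : forall u, U u -> unit_normal g psi u (N u))
  (hH : forall u, U u -> 2 * mean_curvature g psi u (N u) = h)
  (hnu : forall u, U u -> fr3 (psi u) (N u) = 0) (h0 : h != 0).
Local Notation n1 u := (fr1 (psi u) (N u)).
Local Notation n2 u := (fr2 (psi u) (N u)).
Local Notation x u := (psi u 0 0).
Local Notation y u := (psi u 0 1).

Let oU : open U. Proof. exact: ball_open. Qed.

(* For a curve in the base the equation n' = k q' with k constant says that the
   curve is a circle, [n - k q] being a constant vector. *)
Let kap u := (2 * m * (x u * n1 u + y u * n2 u) - h) / lam (psi u).

(** For nu = 0 the horizontal part of a tangent vector is a multiple of (n2, - n1). Along such a
    vector the rotation form turns into the relation dn = k dq, with K in the role of k. *)
Lemma vertical_kappa_algebra n1 n2 f1 f2 f3 a b : n1 * n1 + n2 * n2 + 0 * 0 = 1 ->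
  n1 * f1 + n2 * f2 + 0 * f3 = 0 -> 
  let L := 1 + m * (a ^+ 2 + b ^+ 2) in
  let K := (2 * m * (a * n1 + b * n2) - h) / L in
  L != 0 ->
  let th := 2 * (l / 2) * 0 ^+ 2 / (1 - 0 ^+ 2) * f3 - h / (1 - 0 ^+ 2) * (f1 * n2 - f2 * n1)
    + 2 * m * (b * f1 - a * f2) in
  th * n2 = K * (L * f1) /\ - th * n1 = K * (L * f2).
Proof.
rewrite !mul0r !addr0 => nn nf L K L0 th.
have ef1 : f1 = (f1 * n2 - f2 * n1) * n2.
  rewrite -[LHS]mulr1 -nn -[LHS]subr0 -(mulr0 n1) -nf; ring.
have ef2 : f2 = - (f1 * n2 - f2 * n1) * n1.
  rewrite -[LHS]mulr1 -nn -[LHS]subr0 -(mulr0 n2) -nf; ring.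
have KE z : K * (L * z) = (2 * m * (a * n1 + b * n2) - h) * z by rewrite /K; field.
rewrite !KE.
rewrite /th expr2 mul0r subr0 !divr1 !(mulr0, mul0r) add0r.
move: ef1 ef2; move: (f1 * n2 - f2 * n1) => c -> ->.
by split; ring.
Qed.

Let rot u X (Uu : U u) := angle_rotation oU ipsi lpsi sN uN hH hnu h0 X Uu.
Let nn u (Uu : U u) := angle_nn uN hnu Uu.
Let nf u X (Uu : U u) := angle_nf uN hnu X Uu.

Lemma vertical_rotation u X : U u ->
  is_derive u X (fun w => n1 w) (kap u * (lam (psi u) * fr1 (psi u) ('D_X psi u))) /\
  is_derive u X (fun w => n2 w) (kap u * (lam (psi u) * fr2 (psi u) ('D_X psi u))).
Proof.
move=> Uu; have [D1 D2] := rot X Uu.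
have [a1 a2] := vertical_kappa_algebra (nn Uu) (nf X Uu) (lpsi Uu).
by split; [exact: is_derive_eq D1 a1 | exact: is_derive_eq D2 a2].
Qed.

Lemma vertical_kappa_derive u X : U u -> is_derive u X kap 0.
Proof.
move=> Uu; have [dn1 dn2] := vertical_rotation X Uu.
have [dx dy] := derive_coord_fr ipsi lpsi X Uu.
have l0 := lpsi Uu; have nfX := nf X Uu.
have dl : is_derive u X (fun w => lam (psi w)) (2 * m * lam (psi u) *
    (x u * fr1 (psi u) ('D_X psi u) + y u * fr2 (psi u) ('D_X psi u))).
  by rewrite /bcv_lam; eapply is_derive_eq; [derV | move: (fr1 _ _) (fr2 _ _) => a b; rewrite /bcv_lam; ring].
rewrite /kap.
move: nfX dn1 dn2 dx dy dl; rewrite /kap; move: (fr1 _ ('D_X psi u)) (fr2 _ ('D_X psi u)) (fr3 _ _) => a b c.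
rewrite mul0r addr0 => nfX dn1 dn2 dx dy dl.
eapply is_derive_eq; first by derV.
have nE : n2 u * b = - (n1 u * a) by apply/eqP; rewrite -addr_eq0 addrC nfX.
move: nE l0; move: (fr1 _ _) (fr2 _ _) (x u) (y u) (lam _) => p q v w L nE L0.
exact: kappa_derive_algebra.
Qed.

(** The constant vector b is the value of n - k q at the centre. The equation of the circle is the
    definition of k with b + k q in place of n, and the relation between b, k and h is |n| = 1 at
    the centre. *)
Lemma vertical_cylinder : m != 0 -> exists k b1 b2, m * (b1 ^+ 2 + b2 ^+ 2) + k * (h + k) = m /\
  forall u, U u -> m * k * (psi u 0 0 ^+ 2 + psi u 0 1 ^+ 2)
            + 2 * m * (b1 * psi u 0 0 + b2 * psi u 0 1) = h + k.
Proof.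
move=> m0; pose k := kap u0; exists k, (n1 u0 - k * x u0), (n2 u0 - k * y u0).
have kE u : U u -> kap u = k by apply: ball_derive0 => w X; exact: vertical_kappa_derive.
have b1E u : U u -> n1 u - k * x u = n1 u0 - k * x u0.
  apply: (@ball_derive0 R _ (fun u => n1 u - k * x u)) => w X Uw.
  have [dn _] := vertical_rotation X Uw; have [dx _] := derive_coord_fr ipsi lpsi X Uw.
  by eapply is_derive_eq; [derV | rewrite kE //; move: (fr1 _ ('D_X psi w)) => a; ring].
have b2E u : U u -> n2 u - k * y u = n2 u0 - k * y u0.
  apply: (@ball_derive0 R _ (fun u => n2 u - k * y u)) => w X Uw.
  have [_ dn] := vertical_rotation X Uw; have [_ dy] := derive_coord_fr ipsi lpsi X Uw.
  by eapply is_derive_eq; [derV | rewrite kE //; move: (fr2 _ ('D_X psi w)) => a; ring].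
have C u : U u -> m * k * (x u ^+ 2 + y u ^+ 2)
            + 2 * m * ((n1 u0 - k * x u0) * x u + (n2 u0 - k * y u0) * y u) = h + k.
  move=> Uu; rewrite -(b1E u Uu) -(b2E u Uu).
  have : k * lam (psi u) = 2 * m * (x u * n1 u + y u * n2 u) - h.
    by rewrite -(kE u Uu) /kap divfK // lpsi.
  rewrite /bcv_lam => E; apply/eqP; rewrite -subr_eq0.
  rewrite (_ : _ - _ = 2 * m * (x u * n1 u + y u * n2 u) - h - k * (1 + m * (x u ^+ 2 + y u ^+ 2))).
    by rewrite E subrr.
  by ring.
split=> //; have U0 : U u0 by exact: ballxx.
have n0 : n1 u0 * n1 u0 + n2 u0 * n2 u0 = 1.
  by have H := nn U0; rewrite mul0r addr0 in H.
have := C u0 U0; move: n0; move: (n1 u0) (n2 u0) (x u0) (y u0) => p q v w pq E.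
rewrite -E (_ : _ + _ = m * (p * p + q * q)); first by rewrite pq mulr1.
by ring.
Qed.

End VerticalPatch.

Lemma triharmonic_on_sub {R : realType} (g : 'rV[R]_3 -> 'M[R]_3) (U V : set 'rV[R]_2) psi :
  V `<=` U -> triharmonic_on g U psi -> triharmonic_on g V psi.
Proof. by move=> VU T W e oW WV; apply: T => // w /WV /VU. Qed.

Lemma immersion_on_sub {R : realType} (U V : set 'rV[R]_2) (psi : 'rV[R]_2 -> 'rV[R]_3) :
  V `<=` U -> immersion_on U psi -> immersion_on V psi.
Proof. by move=> VU [s i]; split; [exact: smooth_on_sub VU s | move=> u X /VU; exact: i]. Qed.

Definition on_cylinder {R : realType} (m h k b1 b2 : R) (p : 'rV[R]_3) : Prop :=
  m * k * (p 0 0 ^+ 2 + p 0 1 ^+ 2) + 2 * m * (b1 * p 0 0 + b2 * p 0 1) = h + k.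

(** The minimal alternative is kept because the constant angle is available only for h != 0. In the
    other case h is normalized to the positive root, so that cylinders found at different points can
    be compared. *)
Lemma local_dichotomy {R : realType} (m l : R) U psi (g := bcv_metric m l) :
  4 * m - l ^+ 2 != 0 -> open U -> immersion_on U psi -> (forall u, U u -> bcv_dom m (psi u)) ->
  isoparametric_on g (bcv_dom m) U psi -> triharmonic_on g U psi ->
  forall u0, U u0 -> exists2 d, 0 < d /\ ball u0 d `<=` U &
    (forall u nu, ball u0 d u -> unit_normal g psi u nu -> mean_curvature g psi u nu = 0) \/
    l ^+ 2 < 4 * m /\ exists k b1 b2, let h := Num.sqrt (2 * (4 * m - l ^+ 2)) in
      m * (b1 ^+ 2 + b2 ^+ 2) + k * (h + k) = m /\
      forall u, ball u0 d u -> on_cylinder m h k b1 b2 (psi u).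
Proof.
move=> hml oU ipsi dpsi iso T u0 Uu0.
have [d [N [h [d0 bU sN uH nuc]]]] := isoparametric_local iso Uu0.
exists d => //; have ib := immersion_on_sub bU ipsi.
have lb u : ball u0 d u -> bcv_lam m (psi u) != 0.
  by move=> /bU /dpsi /bcv_domE l0; rewrite gt_eqF.
have ob : open (ball u0 d) by exact: ball_open.
have uN u : ball u0 d u -> unit_normal g psi u (N u) by move=> /uH[].
have hH u : ball u0 d u -> 2 * mean_curvature g psi u (N u) = h by move=> /uH[].
have [h0|h0] := eqVneq h 0; [left|right].
  move=> u nu bu un; have := mean_curvature_sign ob ib lb bu (uN u bu) un.
  move: (hH u bu) => /eqP; rewrite h0 mulf_eq0 pnatr_eq0 /= => /eqP ->.
  by rewrite expr0n /= => /eqP; rewrite sqrf_eq0 => /eqP.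
have hnu := nuc hml h0.
have b0 : ball u0 d u0 by exact: ballxx.
have [n0 h2] := vertical_angle ob ib lb sN uN hH hnu h0 (triharmonic_on_sub bU T) b0.
have hp2 : 0 < h ^+ 2 by rewrite exprn_even_gt0.
have lt : l ^+ 2 < 4 * m by move: hp2; rewrite h2; lra.
have m0 : m != 0 by apply: lt0r_neq0; have := sqr_ge0 l; lra.
split=> //; rewrite n0 in hnu.
have [k [b1 [b2 [hb hc]]]] := vertical_cylinder d0 ib lb sN uN hH hnu h0 m0.
rewrite -h2 sqrtr_sqr; have [hp|hn] := leP 0 h.
  by exists k, b1, b2; rewrite /= ger0_norm.
(* Reversing the normal changes the sign of h; (h, k, b) and (- h, - k, - b) describe the same
   cylinder. *)
exists (- k), (- b1), (- b2); rewrite /= ltr0_norm //; split.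
  by rewrite !sqrrN -opprD mulrNN.
move=> u /hc; rewrite /on_cylinder => E; rewrite -[RHS]opprD -E; ring.
Qed.

(** * From patches to the whole surface *)

Section OneCylinder.
Context {R : realType} {S : topologicalType} (Sigma : smooth_surface R S).
Variables (m l : R) (phi : S -> 'rV[R]_3).
Hypotheses (hml : 4 * m - l ^+ 2 != 0) (himm : immersed_surface Sigma (bcv_dom m) phi)
  (hiso : isoparametric Sigma (bcv_dom m) (bcv_metric m l) phi)
  (htri : triharmonic Sigma (bcv_metric m l) phi).
Local Notation h := (Num.sqrt (2 * (4 * m - l ^+ 2))).
Local Notation g := (bcv_metric m l).

Let dichotomy c u (ac : atlas Sigma c) := @local_dichotomy R m l c.1 (phi \o c.2) hml
  (chart_open ac) (himm.2 c ac) (fun u _ => himm.1 (c.2 u)) (hiso ac) (htri ac) u.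

Let lam_neq0 p : bcv_lam m (phi p) != 0.
Proof. by rewrite gt_eqF // bcv_domE //; exact: himm.1. Qed.

Lemma chart_ball c v d w (O : set S) : atlas Sigma c -> c.1 w -> open O -> O (c.2 w) -> ball v d w ->
  exists2 e, 0 < e & ball w e `<=` ball v d `&` c.2 @^-1` O.
Proof.
move=> ac cw oO Ow bw.
have n1 : nbhs w (c.2 @^-1` O) by apply: (chart_continuous ac cw); exact: open_nbhs_nbhs.
have n2 : nbhs w (ball v d) by apply: open_nbhs_nbhs; split => //; exact: ball_open.
have [e /= e0 H] : nbhs_ball w (ball v d `&` c.2 @^-1` O) by apply/nbhs_ballP; exact: filterI.
by exists e.
Qed.

(** A point with nonzero mean curvature selects a cylinder. The set A of points having a
    neighbourhood mapped into it is nonempty, open and closed, hence everything. *)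
Lemma one_cylinder : ~ minimal Sigma g phi ->
  l ^+ 2 < 4 * m /\ exists k b1 b2, m * (b1 ^+ 2 + b2 ^+ 2) + k * (h + k) = m /\
    forall p, on_cylinder m h k b1 b2 (phi p).
Proof.
move=> nmin.
have [c ac [u cu [nu un mc]]] : exists2 c, atlas Sigma c & exists2 u, c.1 u & exists2 nu,
    unit_normal g (phi \o c.2) u nu & mean_curvature g (phi \o c.2) u nu != 0.
  apply: contrapT => H; apply: nmin => c ac u nu cu un; apply/eqP/negPn/negP => mc.
  by apply: H; exists c => //; exists u => //; exists nu.
have [d [d0 bd] [z|[lt [k [b1 [b2 [hb hc]]]]]]] := dichotomy ac cu.
  by move/negP: mc; case; apply/eqP; apply: z => //; exact: ballxx.
split=> //; exists k, b1, b2; split => //.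
have h0 : h != 0 by rewrite gt_eqF // sqrtr_gt0; lra.
have m0 : m != 0 by apply: lt0r_neq0; have := sqr_ge0 l; lra.
pose A := [set p | exists2 O : set S, open O /\ O p & forall q, O q -> on_cylinder m h k b1 b2 (phi q)].
suff AT : A = setT.
  by move=> p; have [W [_ Wp] H] : A p; [rewrite AT | exact: H].
apply: (surface_connected Sigma).
- exists (c.2 u), (c.2 @` ball u d); first split.
  + exact: (chart_open_map ac (ball_open _ _)).
  + by exists u => //; exact: ballxx.
  + by move=> q [v /hc + <-].
- exists A; last by rewrite setTI.
  rewrite openE => p [W [oO Op] H]; rewrite /interior; apply: filterS (open_nbhs_nbhs (conj oO Op)).
  by move=> q Oq; exists W.
(* A is closed: if the ball given by the dichotomy at p meets A in q, then the mean curvature at q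
   is not zero, so the ball lies on some cylinder; near q it is the selected one by uniqueness,
   whence p is in A. *)
- exists A; last by rewrite setTI.
  rewrite -openC openE => p nA; rewrite /interior.
  have [c' ac' [v cv vp]] := chart_cover Sigma p.
  have [e [e0 be] D] := dichotomy ac' cv.
  have oB : open (c'.2 @` ball v e) by exact: (chart_open_map ac' (ball_open _ _)).
  have Bp : (c'.2 @` ball v e) p by exists v => //; exact: ballxx.
  apply: filterS (open_nbhs_nbhs (conj oB Bp)) => q [w bw wq] [W [oO Oq] HO].
  have cw : c'.1 w by exact: be.
  rewrite -wq in Oq.
  have [e' e'0 be'] := chart_ball ac' cw oO Oq bw.
  have ib : immersion_on (ball w e') (phi \o c'.2).
    by apply: (immersion_on_sub _ (himm.2 c' ac')) => y /be'[/be].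
  have lb y : ball w e' y -> bcv_lam m ((phi \o c'.2) y) != 0 by move=> _; exact: lam_neq0.
  have hcy y : ball w e' y -> on_cylinder m h k b1 b2 ((phi \o c'.2) y).
    by move=> /be'[_]; exact: HO.
  have bww : ball w e' w by exact: ballxx.
  case: D => [z|[_ [k' [b1' [b2' [hb' hc']]]]]].
    have un' := cylinder_unit_normal l (ball_open _ _) ib lb m0 hb hcy bww.
    have := cylinder_mean_curvature_sqr (ball_open _ _) ib lb m0 hb hcy bww un'.
    rewrite (z _ _ bw un') expr0n mulr0 => /esym/eqP; rewrite sqrf_eq0.
    by rewrite (negPf h0).
  have hcy' y : ball w e' y -> on_cylinder m h k' b1' b2' ((phi \o c'.2) y).
    by move=> /be'[+ _]; exact: hc'.
  have [kk bb1 bb2] := cylinder_unique l (ball_open _ _) ib lb m0 hb hcy h0 hb' hcy' bww.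
  apply: nA; exists (c'.2 @` ball v e) => //.
  by move=> x [y /hc' + <-]; rewrite -kk -bb1 -bb2.
Qed.

End OneCylinder.

(** * The base curve *)

#[local] Transparent derive cov_deriv.

Section Trigonometry.
Context {R : realType}.
Implicit Types V : normedModType R.

Lemma is_derive_along_line V (f : V -> R) x v df :
  is_derive (0 : R) 1 (fun s : R => f (x + s *: v)) df -> is_derive x v f df.
Proof.
have e : (fun h : R => h^-1 *: (((fun s : R => f (x + s *: v)) \o shift 0) (h *: 1) -
     f (x + 0 *: v))) = (fun h => h^-1 *: ((f \o shift x) (h *: v) - f x)).
  by apply/funext => h /=; rewrite [h *: (1 : R)]mulr1 addr0 scale0r addr0 [x + _]addrC.
by case; rewrite /derivable /derive /= e => d1 d2; split.
Qed.

Lemma is_derive_chain V (f : R -> R) (phi : V -> R) x v a b :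
  is_derive x v phi b -> is_derive (phi x) 1 f a -> is_derive x v (fun y => f (phi y)) (a * b).
Proof.
move=> dp df; apply: is_derive_along_line.
have dl : is_derive (0 : R) 1 (fun s => phi (x + s *: v)) b.
  have [d1 d2] := dp; have := @is_derive_line R V R phi x v 0.
  by rewrite scale0r addr0 d2; apply.
apply: (@is_derive1_comp R f (fun s => phi (x + s *: v)) 0 a b _ dl).
by rewrite scale0r addr0.
Qed.

(** The induction treats both functions at once, since up to sign each is the derivative of the
    other. *)
Lemma smooth_on_trigo V (A : set V) (phi : V -> R) : open A -> smooth_on A phi ->
  smooth_on A (fun x => cos (phi x)) /\ smooth_on A (fun x => sin (phi x)).
Proof.
move=> oA sp.
have dc x v : A x -> is_derive x v (fun x => cos (phi x)) (- sin (phi x) * 'D_v phi x).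
  by move=> Ax; apply: is_derive_chain; apply: derivableP; exact: smooth_on_derivable sp Ax.
have ds x v : A x -> is_derive x v (fun x => sin (phi x)) (cos (phi x) * 'D_v phi x).
  by move=> Ax; apply: is_derive_chain; apply: derivableP; exact: smooth_on_derivable sp Ax.
have cc x : A x -> {for x, continuous (fun x => cos (phi x))}.
  move=> Ax; apply: (@continuous_comp _ _ _ phi cos); last exact: continuous_cos.
  exact: smooth_on_continuous sp Ax.
have cs x : A x -> {for x, continuous (fun x => sin (phi x))}.
  move=> Ax; apply: (@continuous_comp _ _ _ phi sin); last exact: continuous_sin.
  exact: smooth_on_continuous sp Ax.
suff H k : Ck_on k A (fun x => cos (phi x)) /\ Ck_on k A (fun x => sin (phi x)).
  by split=> k; case: (H k).
elim: k => [|k [IHc IHs]]; first by split; split.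
have sd v := smooth_on_derive v sp k.
split; split=> // v; split.
- by move=> x /dc - /(_ v)[].
- have C2 : Ck_on k A (fun _ : V => -1 : R) by exact: Ck_on_cst.
  apply: (Ck_on_ext oA _ (Ck_onM oA (Ck_onM oA C2 IHs) (sd v))) => y Ay.
  by have [_ ->] := dc y v Ay; rewrite /GRing.mul /= mulN1r.
- by move=> x /ds - /(_ v)[].
- apply: (Ck_on_ext oA _ (Ck_onM oA IHc (sd v))) => y Ay.
  by have [_ ->] := ds y v Ay.
Qed.

Lemma polar_angle (c s : R) : c ^+ 2 + s ^+ 2 = 1 ->
  exists2 t, - pi <= t <= pi & cos t = c /\ sin t = s.
Proof.
move=> cs; have c1 : -1 <= c <= 1.
  by rewrite -ler_norml -sqrtr_sqr -sqrtr1 ler_sqrt //; have := sqr_ge0 s; lra.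
have ac := acosK; have ic : c \in `[(-1), 1] by rewrite in_itv.
have a0 := acos_ge0 c1; have ap := acos_lepi c1.
have sE : Num.sqrt (1 - c ^+ 2) = `|s| by rewrite -cs addrC addKr sqrtr_sqr.
have [s0|s0] := leP 0 s.
- exists (acos c); first by apply/andP; split => //; apply: le_trans a0; rewrite oppr_le0 pi_ge0.
  by rewrite acosK // sin_acos // sE ger0_norm.
- exists (- acos c); first by rewrite lerN2 ap /=; apply: le_trans (pi_ge0 _); rewrite oppr_le0.
  by rewrite cosN acosK // sinN sin_acos // sE ltr0_norm // opprK.
Qed.

End Trigonometry.

(** * Circles of the sphere in stereographic coordinates *)

Section CircleAlgebra.
Context {R : realFieldType}.
Variables (m h k B be1 be2 w C S : R).
Let a := h + 2 * k.
Let mu := (w ^+ 2 - h * a + 4 * m * B * C) / (2 * w ^+ 2).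
Let X1 := (h * B + a * C) / w ^+ 2.
Let X2 := S / w.
Let x := (X1 * be1 - X2 * be2) / mu.
Let y := (X1 * be2 + X2 * be1) / mu.
Hypotheses (w0 : w != 0) (wE : h ^+ 2 = w ^+ 2 - 4 * m)
  (BE : 4 * (m * B ^+ 2) = w ^+ 2 - a ^+ 2)
  (bE : be2 ^+ 2 = 1 - be1 ^+ 2).

(** For m > 0, stereographic projection identifies the plane with the sphere mu^2 - mu + m (X1^2 +
    X2^2) = 0 without its pole mu = 0. Here mu = 1 / lam, and X1, X2 are the components of mu q
    along be and along be turned by a right angle. Curves of constant curvature h on this sphere of
    curvature 4m are affine in cos (w t) and sin (w t) with w^2 = h^2 + 4m, and C, S stand for these
    two functions. *)
Lemma circle_mu_algebra : mu ^+ 2 - mu + m * (X1 ^+ 2 + X2 ^+ 2) = m * (C ^+ 2 + S ^+ 2 - 1) / w ^+ 2.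
Proof.
rewrite /mu /X1 /X2.
transitivity ((4 * m * B * C - h * a) ^+ 2 / (4 * w ^+ 4) - 1 / 4
   + m * ((h * B + a * C) ^+ 2 / w ^+ 4 + S ^+ 2 / w ^+ 2)).
  by field; exact: w0.
transitivity ((4 * (m * B ^+ 2) + a ^+ 2) * (4 * m * C ^+ 2 + h ^+ 2) / (4 * w ^+ 4) - 1 / 4
   + m * S ^+ 2 / w ^+ 2).
  by field; exact: w0.
by rewrite BE wE; field; exact: w0.
Qed.

(** The plane that cuts the circle out of the sphere: it is the equation of the cylinder multiplied
    by 2 mu. *)
Lemma circle_line_algebra : 4 * m * B * X1 = a * (2 * mu - 1) + h.
Proof.
rewrite /mu /X1; transitivity ((4 * (m * B ^+ 2) * h + 4 * m * B * a * C) / w ^+ 2).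
  by field; exact: w0.
by rewrite BE; field; exact: w0.
Qed.

Hypotheses (CS : S ^+ 2 = 1 - C ^+ 2) (m0 : mu != 0).

Lemma circle_norm : mu ^+ 2 - mu + m * (X1 ^+ 2 + X2 ^+ 2) = 0.
Proof.
by rewrite circle_mu_algebra CS (_ : _ + _ - 1 = 0) ?mulr0 ?mul0r //; ring.
Qed.

Let bb : be1 ^+ 2 + be2 ^+ 2 = 1. Proof. by rewrite bE; ring. Qed.

Lemma circle_conf : 1 + m * (x ^+ 2 + y ^+ 2) = mu^-1.
Proof.
have e : m * (X1 ^+ 2 + X2 ^+ 2) = mu - mu ^+ 2.
  by rewrite -[RHS]addr0 -circle_norm; ring.
rewrite (_ : x ^+ 2 + y ^+ 2 = (be1 ^+ 2 + be2 ^+ 2) * (X1 ^+ 2 + X2 ^+ 2) / mu ^+ 2).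
  by rewrite bb mul1r mulrA e; field.
by rewrite /x /y; clearbody mu X1 X2; field.
Qed.

Lemma circle_on_cylinder :
  m * k * (x ^+ 2 + y ^+ 2) + 2 * m * (B * be1 * x + B * be2 * y) = h + k.
Proof.
have -> : m * k * (x ^+ 2 + y ^+ 2) = k * (mu^-1 - 1) by rewrite -circle_conf; ring.
have -> : B * be1 * x + B * be2 * y = (be1 ^+ 2 + be2 ^+ 2) * (B * X1) / mu.
  by rewrite /x /y; clearbody mu X1 X2; field.
rewrite bb mul1r.
have -> : 2 * m * (B * X1 / mu) = (4 * m * B * X1) / (2 * mu) by clearbody mu X1 X2; field.
rewrite circle_line_algebra /a; clearbody mu; field; exact: m0.
Qed.

Lemma circle_derivative_algebra (mu' := - (2 * m * B * S / w)) (X1' := - a * S / w) (X2' := C) :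
  X1' * mu - X1 * mu' = - k * X2 /\ X2' * mu - X2 * mu' = B * mu + k * X1.
Proof.
split.
  rewrite (_ : _ - _ = - (S / w) * (a * mu - 4 * m * B * X1 / 2)); last first.
    by rewrite /X1' /mu'; clearbody mu X1; field; exact: w0.
  rewrite circle_line_algebra /X2 /a; clearbody mu; field; exact: w0.
rewrite /X2' /mu' /X2 /X1.
rewrite (_ : C * mu - _ = C * (w ^+ 2 - h * a) / (2 * w ^+ 2) + 2 * m * B * (C ^+ 2 + S ^+ 2) / w ^+ 2); last first.
  by rewrite /mu; field; exact: w0.
rewrite CS (_ : C ^+ 2 + _ = 1); last by ring.
have kE : k = (a - h) / 2 by rewrite /a; field.
rewrite (_ : B * mu + k * _ = B * (w ^+ 2 - h * a + (a - h) * h) / (2 * w ^+ 2)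
   + (4 * (m * B ^+ 2) + a ^+ 2 - h * a) * C / (2 * w ^+ 2)); last first.
  by rewrite {1}kE /mu; clearbody a; field; exact: w0.
by rewrite BE; clearbody a; field: wE; exact: w0.
Qed.

(** The velocity of q is lam J n with n = b + k q and J the rotation by a right angle; its length in
    the base metric is |n| = 1. *)
Lemma circle_velocity (mu' := - (2 * m * B * S / w)) (X1' := - a * S / w) (X2' := C) :
  ((X1' * be1 - X2' * be2) * mu - (X1 * be1 - X2 * be2) * mu') / mu ^+ 2 =
    - ((B * be2 + k * y) * mu^-1) /\
  ((X1' * be2 + X2' * be1) * mu - (X1 * be2 + X2 * be1) * mu') / mu ^+ 2 =
    (B * be1 + k * x) * mu^-1.
Proof.
have [e1 e2] := circle_derivative_algebra.
rewrite (_ : (X1' * be1 - X2' * be2) * mu - _ = (X1' * mu - X1 * mu') * be1 - (X2' * mu - X2 * mu') * be2); last by ring.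
rewrite (_ : (X1' * be2 + X2' * be1) * mu - _ = (X1' * mu - X1 * mu') * be2 + (X2' * mu - X2 * mu') * be1); last by ring.
by rewrite e1 e2 /x /y; clearbody mu X1 X2; split; field.
Qed.
End CircleAlgebra.

(** The affine formulas for mu and X1 are inverted: since 4 m B^2 + a^2 = w^2, the combination B (2
    mu - 1) + a X1 returns C without a division by B or a, either of which may vanish. *)
Lemma circle_onto_algebra {R : realFieldType} (m h k B be1 be2 w p r : R)
  (a := h + 2 * k) (L := 1 + m * (p ^+ 2 + r ^+ 2))
  (P := (be1 * p + be2 * r) / L) (Q := (be1 * r - be2 * p) / L)
  (C := B * (2 / L - 1) + a * P) (S := w * Q) :
  m != 0 -> w != 0 -> L != 0 -> h ^+ 2 = w ^+ 2 - 4 * m -> 4 * (m * B ^+ 2) = w ^+ 2 - a ^+ 2 ->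
  be2 ^+ 2 = 1 - be1 ^+ 2 ->
  m * k * (p ^+ 2 + r ^+ 2) + 2 * m * (B * be1 * p + B * be2 * r) = h + k ->
  C ^+ 2 + S ^+ 2 = 1 /\
  (let mu := (w ^+ 2 - h * a + 4 * m * B * C) / (2 * w ^+ 2) in
   let X1 := (h * B + a * C) / w ^+ 2 in let X2 := S / w in
   [/\ mu = L^-1, (X1 * be1 - X2 * be2) / mu = p & (X1 * be2 + X2 * be1) / mu = r]).
Proof.
move=> m0 w0 L0 wE BE bE cyl.
have bb : be1 ^+ 2 + be2 ^+ 2 = 1 by rewrite bE; ring.
have lineE : 4 * m * B * P = a * (2 / L - 1) + h.
  have mL : m * (p ^+ 2 + r ^+ 2) = L - 1 by rewrite /L; ring.
  rewrite (_ : 4 * m * B * P = 2 * (m * k * (p ^+ 2 + r ^+ 2) + 2 * m * (B * be1 * p + B * be2 * r)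
     - k * (m * (p ^+ 2 + r ^+ 2))) / L); last by rewrite /P; clearbody L; field.
  by rewrite cyl mL /a; clearbody L; field.
have muE : (w ^+ 2 - h * a + 4 * m * B * C) / (2 * w ^+ 2) = L^-1.
  rewrite (_ : 4 * m * B * C = 4 * (m * B ^+ 2) * (2 / L - 1) + a * (4 * m * B * P)); last by rewrite /C; ring.
  by rewrite lineE BE; clearbody a L; field; rewrite w0 L0.
have X1E : (h * B + a * C) / w ^+ 2 = P.
  rewrite (_ : h * B + a * C = B * (a * (2 / L - 1) + h) + a ^+ 2 * P); last by rewrite /C; ring.
  rewrite -lineE (_ : _ + _ = (4 * (m * B ^+ 2) + a ^+ 2) * P); last by ring.
  by rewrite BE subrK; field; exact: w0.
have X2E : S / w = Q by rewrite /S; field; exact: w0.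
have PQ : P * be1 - Q * be2 = p / L /\ P * be2 + Q * be1 = r / L.
  split.
    rewrite (_ : _ - _ = p * (be1 ^+ 2 + be2 ^+ 2) / L); first by rewrite bb mulr1.
    by rewrite /P /Q; clearbody L; field.
  rewrite (_ : _ + _ = r * (be1 ^+ 2 + be2 ^+ 2) / L); first by rewrite bb mulr1.
  by rewrite /P /Q; clearbody L; field.
split.
  have := circle_mu_algebra C S w0 wE BE; rewrite -/a muE X1E X2E => E.
  have N : L^-1 ^+ 2 - L^-1 + m * (P ^+ 2 + Q ^+ 2) = 0.
    rewrite (_ : P ^+ 2 + Q ^+ 2 = (be1 ^+ 2 + be2 ^+ 2) * (p ^+ 2 + r ^+ 2) / L ^+ 2).
      rewrite bb.
      have mL : m * (p ^+ 2 + r ^+ 2) = L - 1 by rewrite /L; ring.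
      by rewrite mul1r mulrA mL; clearbody L; field.
    by rewrite /P /Q; clearbody L; field.
  move: E; rewrite N => /esym/eqP; rewrite !mulf_eq0 invr_eq0 expf_eq0 (negPf w0) (negPf m0) andbF orbF /=.
  by rewrite subr_eq0 => /eqP.
move=> mu X1 X2; rewrite /mu /X1 /X2 muE X1E X2E; have [-> ->] := PQ.
by split => //; field; rewrite ?invr_eq0 L0.
Qed.

#[local] Opaque derive cov_deriv.

Section Circle.
Context {R : realType}.
Variables (m h k B be1 be2 w : R).
Hypotheses (mp : 0 < m) (hp : 0 < h) (Bp : 0 <= B) (wp : 0 < w) (wE : h ^+ 2 = w ^+ 2 - 4 * m)
  (BE : 4 * (m * B ^+ 2) = w ^+ 2 - (h + 2 * k) ^+ 2) (bE : be2 ^+ 2 = 1 - be1 ^+ 2).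
Let a := h + 2 * k.
Let C t := cos (w * t).
Let S t := sin (w * t).

Definition circle_mu t := (w ^+ 2 - (h + 2 * k) * h + 4 * m * B * cos (w * t)) / (2 * w ^+ 2).
Definition circle_X1 t := (h * B + (h + 2 * k) * cos (w * t)) / w ^+ 2.
Definition circle_X2 t := sin (w * t) / w.
Definition circle_x t := (circle_X1 t * be1 - circle_X2 t * be2) / circle_mu t.
Definition circle_y t := (circle_X1 t * be2 + circle_X2 t * be1) / circle_mu t.
Definition circle t : 'rV[R]_2 := row2 (circle_x t) (circle_y t).

(* For [k = 0] the cylinder lies over a Euclidean line, and the curve runs to
   infinity as [w t] tends to [pi] or to [- pi]. *)
Definition circle_dom : set R := [set t | k = 0 -> - pi < w * t < pi].

Let w0 : w != 0. Proof. by rewrite gt_eqF. Qed.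
Let CS t : S t ^+ 2 = 1 - C t ^+ 2. Proof. by rewrite /S /C -(cos2Dsin2 (w * t)); ring. Qed.

Let muE t : circle_mu t = (w ^+ 2 - h * (h + 2 * k) + 4 * m * B * cos (w * t)) / (2 * w ^+ 2).
Proof. by rewrite /circle_mu [h * _]mulrC. Qed.

Lemma circle_norm_eq t :
  circle_mu t ^+ 2 - circle_mu t + m * (circle_X1 t ^+ 2 + circle_X2 t ^+ 2) = 0.
Proof. by rewrite muE; exact: (circle_norm w0 wE BE (CS t)). Qed.

(** The equation of the sphere gives mu >= 0, and mu = 0 only at the pole, where X1 = X2 = 0. The
    circle meets the pole only if k = 0, B = 1 and cos (w t) = -1, and the domain leaves these
    parameters out. *)
Lemma circle_mu_gt0 t : circle_dom t -> 0 < circle_mu t.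
Proof.
move=> It; have N := circle_norm_eq t.
have X0 : 0 <= m * (circle_X1 t ^+ 2 + circle_X2 t ^+ 2).
  by rewrite mulr_ge0 ?addr_ge0 ?sqr_ge0 // ltW.
have mu0 : 0 <= circle_mu t by have := sqr_ge0 (circle_mu t); lra.
rewrite lt_neqAle mu0 andbT eq_sym; apply/negP => /eqP z.
move: N; rewrite z expr2 mul0r subr0 add0r => /eqP.
rewrite mulf_eq0 gt_eqF //= paddr_eq0 ?sqr_ge0 // !sqrf_eq0 => /andP[x1 x2].
have s0 : S t = 0 by move: x2; rewrite /circle_X2 mulf_eq0 invr_eq0 (negPf w0) orbF => /eqP.
have x10 : h * B + a * C t = 0.
  by move: x1; rewrite /circle_X1 mulf_eq0 invr_eq0 expf_eq0 (negPf w0) orbF => /eqP.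
have c2 : C t ^+ 2 = 1 by apply/eqP; rewrite eq_sym -subr_eq0 -CS s0 expr2 mul0r.
have mu1 : w ^+ 2 - a * h + 4 * m * B * C t = 0.
  move/eqP: z; rewrite /circle_mu mulf_eq0 invr_eq0 mulf_eq0 expf_eq0 (negPf w0) pnatr_eq0 !orbF.
  by move/eqP.
have hBC : h * B * C t = - a.
  by rewrite -[RHS]mulr1 -c2 -[LHS]subr0 -(mul0r (C t)) -x10; ring.
(* Multiplying mu = 0 by h and inserting h B C = - a gives w^2 (h - a) = 0. *)
have ah : a = h.
  have w2 : w ^+ 2 != 0 by rewrite expf_neq0.
  apply: (mulfI w2); rewrite -[RHS]subr0 -(mulr0 h) -mu1.
  transitivity (a * (h ^+ 2 + 4 * m)); first by rewrite wE; ring.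
  rewrite (_ : 4 * m * B * C t = - (4 * m) * - (h * B * C t) / h); last by field; rewrite gt_eqF.
  by rewrite hBC; field; rewrite gt_eqF.
have k0 : k = 0 by move: ah; rewrite /a; lra.
have B1 : B ^+ 2 = 1.
  apply: (mulfI (lt0r_neq0 mp)); move: BE wE; rewrite k0 mulr0 addr0; lra.
have {}B1 : B = 1.
  move/eqP: B1; rewrite sqrf_eq1 => /orP[/eqP //|/eqP B1]; move: Bp; rewrite B1; lra.
have C1 : C t = -1.
  by apply: (mulfI (lt0r_neq0 hp)); move: x10; rewrite ah B1; lra.
have /andP[t1 t2] := It k0.
suff : `|w * t| = pi by move=> E; have := ltr_norml (w * t) pi; rewrite E ltxx t1 t2.
apply: cos_inj; rewrite ?in_itv /= ?normr_ge0 ?pi_ge0 ?lexx //=.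
  by rewrite ler_norml !ltW.
by rewrite cos_norm cospi.
Qed.

Let mu0 t : circle_dom t -> (w ^+ 2 - h * (h + 2 * k) + 4 * m * B * cos (w * t)) / (2 * w ^+ 2) != 0.
Proof. by move=> It; rewrite -muE gt_eqF // circle_mu_gt0. Qed.

Let circle_xE t : circle_x t = (circle_X1 t * be1 - circle_X2 t * be2) /
  ((w ^+ 2 - h * (h + 2 * k) + 4 * m * B * cos (w * t)) / (2 * w ^+ 2)).
Proof. by rewrite /circle_x muE. Qed.

Let circle_yE t : circle_y t = (circle_X1 t * be2 + circle_X2 t * be1) /
  ((w ^+ 2 - h * (h + 2 * k) + 4 * m * B * cos (w * t)) / (2 * w ^+ 2)).
Proof. by rewrite /circle_y muE. Qed.

Lemma circle_conf_eq t : circle_dom t ->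
  1 + m * (circle_x t ^+ 2 + circle_y t ^+ 2) = (circle_mu t)^-1.
Proof.
by move=> It; rewrite circle_xE circle_yE muE; exact: (circle_conf w0 wE BE bE (CS t) (mu0 It)).
Qed.

Lemma circle_cylinder t : circle_dom t ->
  m * k * (circle_x t ^+ 2 + circle_y t ^+ 2)
  + 2 * m * (B * be1 * circle_x t + B * be2 * circle_y t) = h + k.
Proof.
by move=> It; rewrite circle_xE circle_yE; exact: (circle_on_cylinder w0 wE BE bE (CS t) (mu0 It)).
Qed.

Lemma circle_is_derive t : circle_dom t ->
  is_derive t 1 circle_x (- ((B * be2 + k * circle_y t) * (circle_mu t)^-1)) /\
  is_derive t 1 circle_y ((B * be1 + k * circle_x t) * (circle_mu t)^-1).
Proof.
move=> It; have m0 : circle_mu t != 0 by rewrite gt_eqF // circle_mu_gt0.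
have dw : is_derive t 1 (fun t : R => w * t) w.
  have di : is_derive t 1 (fun t : R => t) 1 := is_derive_id t 1.
  by eapply is_derive_eq; [derV | rewrite mul0r add0r mulr1].
have dc : is_derive t 1 (fun t => cos (w * t)) (- sin (w * t) * w) by exact: is_derive_chain.
have ds : is_derive t 1 (fun t => sin (w * t)) (cos (w * t) * w) by exact: is_derive_chain.
have dmu : is_derive t 1 circle_mu (- (2 * m * B * S t / w)).
  by rewrite /circle_mu; eapply is_derive_eq; [derV | rewrite /S; field].
have dX1 : is_derive t 1 circle_X1 (- (h + 2 * k) * S t / w).
  by rewrite /circle_X1; eapply is_derive_eq; [derV | rewrite /S; field].
have dX2 : is_derive t 1 circle_X2 (C t).
  by rewrite /circle_X2; eapply is_derive_eq; [derV | rewrite /C; field].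
have [v1 v2] := circle_velocity be1 be2 w0 wE BE (CS t) (mu0 It).
rewrite -muE -/(circle_X1 t) -/(circle_X2 t) -/(circle_x t) -/(circle_y t) in v1 v2.
split.
- by rewrite -v1 /circle_x; eapply is_derive_eq; [derV | field; rewrite ?m0 ?w0].
- by rewrite -v2 /circle_y; eapply is_derive_eq; [derV | field; rewrite ?m0 ?w0].
Qed.

Lemma open_circle_dom : open circle_dom.
Proof.
have [k0|k0] := eqVneq k 0; last first.
  by rewrite (_ : circle_dom = setT); [exact: openT | apply/seteqP; split => // t _ k1; rewrite k1 eqxx in k0].
rewrite (_ : circle_dom = (fun t => w * t) @^-1` [set t | - pi < t] `&` (fun t => w * t) @^-1` [set t | t < pi]).
  by apply: openI; apply: open_comp; [move=> t _; exact: mulrl_continuous | exact: open_gt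
    | move=> t _; exact: mulrl_continuous | exact: open_lt].
apply/seteqP; split => [t /(_ k0) /andP[] //|t [t1 t2] _]; exact/andP.
Qed.

Lemma is_interval_circle_dom : is_interval circle_dom.
Proof.
move=> x y Ix Iy z /andP[xz zy] k0; have /andP[x1 _] := Ix k0; have /andP[_ y2] := Iy k0.
by rewrite (lt_le_trans x1) ?ler_pM2l //= (le_lt_trans _ y2) // ler_pM2l.
Qed.

Lemma smooth_circle (V : normedModType R) (A : set V) (phi : V -> R) : open A ->
  smooth_on A phi -> (forall v, A v -> circle_dom (phi v)) ->
  smooth_on A (fun v => circle_x (phi v)) /\ smooth_on A (fun v => circle_y (phi v)).
Proof.
move=> oA sp AI.
have c (r : R) : smooth_on A (fun=> r) by exact: smooth_on_cst.
have [sc ss] := smooth_on_trigo oA (smooth_onM oA (c w) sp).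
have smu : smooth_on A (fun v => circle_mu (phi v)).
  by apply: (smooth_onM oA) => //; apply: (smooth_onD oA) => //; apply: (smooth_onM oA).
have s1 : smooth_on A (fun v => circle_X1 (phi v)).
  by apply: (smooth_onM oA) => //; apply: (smooth_onD oA) => //; apply: (smooth_onM oA).
have s2 : smooth_on A (fun v => circle_X2 (phi v)) by apply: (smooth_onM oA).
have si : smooth_on A (fun v => (circle_mu (phi v))^-1).
  by apply: (smooth_onV oA) => // v /AI It; rewrite gt_eqF // circle_mu_gt0.
by split; apply: (smooth_onM oA) => //; [apply: (smooth_onB oA)|apply: (smooth_onD oA)]; apply: (smooth_onM oA).
Qed.

Lemma circle_onto p r : 0 < 1 + m * (p ^+ 2 + r ^+ 2) ->
  m * k * (p ^+ 2 + r ^+ 2) + 2 * m * (B * be1 * p + B * be2 * r) = h + k ->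
  exists2 t, circle_dom t & circle_x t = p /\ circle_y t = r.
Proof.
move=> L0 cyl; have Ln := lt0r_neq0 L0.
have [cs H] := circle_onto_algebra (lt0r_neq0 mp) w0 Ln wE BE bE cyl.
have [u upi [cu su]] := polar_angle cs.
have wu : w * (u / w) = u by field.
have [e1 e2 e3] := H; rewrite -su -cu -wu in e1 e2 e3.
exists (u / w); last by rewrite circle_xE circle_yE.
(* For k = 0 the polar angle in [- pi, pi] must avoid the end points: cos = -1 would make mu vanish,
   whereas mu is the inverse of the conformal factor at the given point. *)
move=> k0; rewrite wu; have mupos : 0 < circle_mu (u / w) by rewrite muE e1 invr_gt0.
have B1 : B ^+ 2 = 1.
  apply: (mulfI (lt0r_neq0 mp)); move: BE wE; rewrite k0 mulr0 addr0; lra.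
have {}B1 : B = 1.
  move/eqP: B1; rewrite sqrf_eq1 => /orP[/eqP //|/eqP B1]; move: Bp; rewrite B1; lra.
have c1 : cos u != -1.
  apply/negP => /eqP c1; move: mupos; rewrite /circle_mu wu c1 k0 B1.
  rewrite (_ : w ^+ 2 - _ + _ = w ^+ 2 - 4 * m - h ^+ 2); last by ring.
  by rewrite wE subrr mul0r ltxx.
move/andP: upi => [u1 u2]; rewrite !lt_neqAle u1 u2 !andbT; apply/andP; split.
- by apply: contraNneq c1 => <-; rewrite cosN cospi.
- by apply: contraNneq c1 => ->; rewrite cospi.
Qed.

End Circle.

#[local] Transparent derive cov_deriv.

Section BaseConnection.
Context {R : realType}.
Variable m : R.
Implicit Types q u v : 'rV[R]_2.

Lemma inner_base q u v :
  inner (base_metric m q) u v = (conf_factor m q ^- 2) * (u 0 0 * v 0 0 + u 0 1 * v 0 1).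
Proof. by rewrite inner2E /base_metric !mxE /= !mulr1n !mulr0n; ring. Qed.

Lemma derive_base_metric q i j k : conf_factor m q != 0 ->
  'D_(basis_vec i) (fun p => base_metric m p j k) q =
  - (4 * m * q 0 i / conf_factor m q ^+ 3) * (j == k)%:R.
Proof.
move=> c0.
have d0 := is_derive_coordinate q (basis_vec i) 0.
have d1 := is_derive_coordinate q (basis_vec i) 1.
have dc : is_derive q (basis_vec i) (conf_factor m) (2 * m * q 0 i).
  rewrite /conf_factor; eapply is_derive_eq; first by derV.
  by rewrite !mxE /=; move: i {d0 d1}; apply: forall2; rewrite !eqE /=; ring.
have -> : (fun p => base_metric m p j k) = fun p => (conf_factor m p)^-1 ^+ 2 * (j == k)%:R.
  by apply/funext => p; rewrite mxE mulr_natr exprVn.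
have [_ ->] : is_derive q (basis_vec i) (fun p => (conf_factor m p)^-1 ^+ 2 * (j == k)%:R)
   (- (4 * m * q 0 i / conf_factor m q ^+ 3) * (j == k)%:R).
  by eapply is_derive_eq; [derV | field].
by [].
Qed.

Lemma christoffel_base q i j k : conf_factor m q != 0 ->
  christoffel (base_metric m) k i j q = - (2 * m / conf_factor m q) *
    (q 0 i * (j == k)%:R + q 0 j * (i == k)%:R - q 0 k * (i == j)%:R).
Proof.
move=> c0; move: k; apply: christoffel_koszul.
  by rewrite unitmxE det_scalar unitfE expf_neq0 // invr_eq0 expf_neq0.
move=> k; rewrite !derive_base_metric // sum2 !mxE.
move: i j k; apply: forall2; apply: forall2; apply: forall2; rewrite !eqE /= ?mulr1n ?mulr0n; field; exact: c0.
Qed.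

Lemma cov_deriv_baseE (V : normedModType R) (psi : V -> 'rV[R]_2) S X x (v := 'D_X psi x)
  (q := psi x) (a := S x) : conf_factor m q != 0 ->
  cov_deriv (base_metric m) psi X S x 0 0 = 'D_X S x 0 0 - 2 * m / conf_factor m q *
    (q 0 0 * v 0 0 * a 0 0 + q 0 1 * v 0 0 * a 0 1 + q 0 1 * v 0 1 * a 0 0 - q 0 0 * v 0 1 * a 0 1) /\
  cov_deriv (base_metric m) psi X S x 0 1 = 'D_X S x 0 1 - 2 * m / conf_factor m q *
    (- q 0 1 * v 0 0 * a 0 0 + q 0 0 * v 0 0 * a 0 1 + q 0 0 * v 0 1 * a 0 0 + q 0 1 * v 0 1 * a 0 1).
Proof.
rewrite /v /a /q => c0; rewrite /cov_deriv; split; apply: (etrans (mxE _ _ _ _)); congr (_ + _);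
  rewrite mxE !sum2 !christoffel_base //; move: ('D_X psi x) (S x) => w b;
  rewrite !eqE /=; ring.
Qed.

End BaseConnection.

#[local] Opaque derive cov_deriv.

(** The velocity (p, r) is L J n, so the left normal (- r, p) is - L n, which accounts for the sign
    of h. The computation rests on k L - 2 m <q, n> = - h, the equation of the circle rewritten. *)
Lemma frenet_algebra {R : realFieldType} (m h k b1 b2 x y : R) (L := 1 + m * (x ^+ 2 + y ^+ 2))
  (p := - ((b2 + k * y) * L)) (r := (b1 + k * x) * L) (L' := 2 * m * (x * p + y * r))
  (p' := - (k * r * L + (b2 + k * y) * L')) (r' := k * p * L + (b1 + k * x) * L') :
  L != 0 -> (b1 + k * x) ^+ 2 + (b2 + k * y) ^+ 2 = 1 ->
  m * k * (x ^+ 2 + y ^+ 2) + 2 * m * (b1 * x + b2 * y) = h + k ->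
  L ^- 2 * ((p' - (2 * m / L) * (x * p * p + y * p * r + y * r * p - x * r * r)) * - r
    + (r' - (2 * m / L) * (- y * p * p + x * p * r + x * r * p + y * r * r)) * p) = - h.
Proof.
move=> L0 nn cyl.
have kL : k * L - 2 * m * (x * (b1 + k * x) + y * (b2 + k * y)) = - h.
  by rewrite -[RHS]add0r -(subrr (h + k)) -{2}cyl /L; ring.
rewrite -kL /p' /r' /L' /p /r.
move: nn L0 {kL cyl}; clearbody L.
move: (b1 + k * x) (b2 + k * y) => n1 n2 nn L0.
have nE : n2 ^+ 2 = 1 - n1 ^+ 2 by rewrite -nn; ring.
by field: nE.
Qed.

Section CurveOfCylinder.
Context {R : realType}.
Variables (m l h k b1 b2 : R) (I : set R) (x y : R -> R).
Local Notation L t := (1 + m * (x t ^+ 2 + y t ^+ 2)).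
Hypotheses (oI : open I) (m0 : m != 0) (hb : m * (b1 ^+ 2 + b2 ^+ 2) + k * (h + k) = m)
  (Lp : forall t, I t -> 0 < L t) (sx : smooth_on I x) (sy : smooth_on I y)
  (cyl : forall t, I t -> m * k * (x t ^+ 2 + y t ^+ 2) + 2 * m * (b1 * x t + b2 * y t) = h + k)
  (dx : forall t, I t -> is_derive t 1 x (- ((b2 + k * y t) * L t)))
  (dy : forall t, I t -> is_derive t 1 y ((b1 + k * x t) * L t)).
Let gam t : 'rV[R]_2 := row2 (x t) (y t).

Let confE t : conf_factor m (gam t) = L t.
Proof. by rewrite /conf_factor row2_0 row2_1. Qed.

Let conf0 t : I t -> conf_factor m (gam t) != 0.
Proof. by move=> It; rewrite confE gt_eqF // Lp. Qed.

Let nn t : I t -> (b1 + k * x t) ^+ 2 + (b2 + k * y t) ^+ 2 = 1.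
Proof. by move=> It; apply: (mulfI m0); rewrite mulr1 -[RHS]hb -(cyl It); ring. Qed.

Let sgam : smooth_on I gam. Proof. exact: smooth_row2. Qed.

Let gam0 t : I t -> 'D_1 gam t 0 0 = - ((b2 + k * y t) * L t).
Proof.
move=> It; have [_ <-] := @derive_coord R _ _ _ gam t 1 0 0 (smooth_on_derivable sgam It).
rewrite (_ : (fun t => gam t 0 0) = x); first by have [_ ->] := dx It.
by apply/funext => r; exact: row2_0.
Qed.

Let gam1 t : I t -> 'D_1 gam t 0 1 = (b1 + k * x t) * L t.
Proof.
move=> It; have [_ <-] := @derive_coord R _ _ _ gam t 1 0 1 (smooth_on_derivable sgam It).
rewrite (_ : (fun t => gam t 0 1) = y); first by have [_ ->] := dy It.
by apply/funext => r; exact: row2_1.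
Qed.

Lemma arclength_of_cylinder : arclength_curve m I gam.
Proof.
split=> // [_ [t It <-]|t It]; first by rewrite /base_dom /= confE Lp.
apply: (etrans (inner_base _ _ _ _)); rewrite confE gam0 // gam1 //.
have L0 := conf0 It; rewrite confE in L0.
rewrite -[RHS](nn It); move: L0; move: (L t) (b1 + _) (b2 + _) => c p q c0.
by field.
Qed.

Lemma geodesic_curvature_of_cylinder t : I t -> geodesic_curvature m gam t = - h.
Proof.
move=> It; have L0 := conf0 It; have dxt := dx It; have dyt := dy It.
have sD : smooth_on I ('D_1 gam) by exact: smooth_on_derive sgam.
have nI (P : R -> Prop) : (forall r, I r -> P r) -> \forall r \near t, P r.
  by move=> IP; apply: filterS (open_nbhs_nbhs (conj oI It)).
have g0 : 'D_1 ('D_1 gam) t 0 0 = - (k * ((b1 + k * x t) * L t) * L t + (b2 + k * y t) *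
    (2 * m * (x t * (- ((b2 + k * y t) * L t)) + y t * ((b1 + k * x t) * L t)))).
  have [_ <-] := @derive_coord R _ _ _ ('D_1 gam) t 1 0 0 (smooth_on_derivable sD It).
  apply: (etrans (@near_eq_derive R _ _ _ (fun t => - ((b2 + k * y t) * L t)) t 1 (nI _ gam0))).
  have [] : is_derive t 1 (fun t => - ((b2 + k * y t) * L t)) (- (k * ((b1 + k * x t) * L t) * L t + (b2 + k * y t) *
    (2 * m * (x t * (- ((b2 + k * y t) * L t)) + y t * ((b1 + k * x t) * L t))))) by
    eapply is_derive_eq; [derV | ring].
  by [].
have g1 : 'D_1 ('D_1 gam) t 0 1 = k * (- ((b2 + k * y t) * L t)) * L t + (b1 + k * x t) *
    (2 * m * (x t * (- ((b2 + k * y t) * L t)) + y t * ((b1 + k * x t) * L t))).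
  have [_ <-] := @derive_coord R _ _ _ ('D_1 gam) t 1 0 1 (smooth_on_derivable sD It).
  apply: (etrans (@near_eq_derive R _ _ _ (fun t => (b1 + k * x t) * L t) t 1 (nI _ gam1))).
  have [] : is_derive t 1 (fun t => (b1 + k * x t) * L t) (k * (- ((b2 + k * y t) * L t)) * L t + (b1 + k * x t) *
    (2 * m * (x t * (- ((b2 + k * y t) * L t)) + y t * ((b1 + k * x t) * L t)))) by
    eapply is_derive_eq; [derV | ring].
  by [].
have [c0 c1] := @cov_deriv_baseE R m R gam ('D_1 gam) 1 t L0.
rewrite /geodesic_curvature; apply: (etrans (inner_base _ _ _ _)).
move: g0 g1 c0 c1 (gam0 It) (gam1 It) (confE t) L0.
move: ('D_1 ('D_1 gam) t) (cov_deriv _ _ _ _ _) ('D_1 gam t) (conf_factor _ _) => D c T cf.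
rewrite !mxE /= => -> -> -> -> -> -> -> L0.

rewrite -(@frenet_algebra R m h k b1 b2 (x t) (y t) L0 (nn It) (cyl It)).
by congr (_ * (_ + _)); rewrite ?eqE /= ; ring.
Qed.

Let V : set 'rV[R]_2 := [set w | I (w 0 0)].

Let oV : open V.
Proof.
apply: (@open_comp _ _ (fun w : 'rV[R]_2 => w 0 0) I) => // w _; exact: coord_continuous.
Qed.

Lemma hopf_paramE : hopf_param gam = fun w => row3 (x (w 0 0)) (y (w 0 0)) (w 0 1).
Proof.
apply/funext => w; rewrite /hopf_param.
pose M (w : 'rV[R]_2) (i : 'I_(2 + 1)) := (row_mx (gam (w 0 0)) (w 0 1)%:M : 'M[R]_(1, 2 + 1)) 0 i.
have e0 : (0 : 'I_3) = lshift 1 (0 : 'I_2) by exact: val_inj.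
have e1 : (1 : 'I_3) = lshift 1 (1 : 'I_2) by exact: val_inj.
have e2 : (ord_max : 'I_3) = rshift 2 (0 : 'I_1) by exact: val_inj.
apply: row3P.
- exact: (etrans (etrans (congr1 (M w) e0) (row_mxEl _ _ _ _)) (etrans (row2_0 _ _) (esym (row3_0 _ _ _)))).
- exact: (etrans (etrans (congr1 (M w) e1) (row_mxEl _ _ _ _)) (etrans (row2_1 _ _) (esym (row3_1 _ _ _)))).
- apply: (etrans (etrans (congr1 (M w) e2) (row_mxEr _ _ _ _)) (etrans _ (esym (row3_2 _ _ _)))).
  by rewrite mxE eqxx mulr1n.
Qed.

Lemma cmc_of_cylinder : smooth_on V (fun w => x (w 0 0)) -> smooth_on V (fun w => y (w 0 0)) ->
  cmc_hopf_cylinder m l I gam.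
Proof.
move=> sxV syV; rewrite /cmc_hopf_cylinder hopf_paramE; set psi := (X in cmc_on _ _ X).
have p0 : (fun w => psi w 0 0) = (fun w : 'rV[R]_2 => x (w 0 0)) by apply/funext => w; exact: row3_0.
have p1 : (fun w => psi w 0 1) = (fun w : 'rV[R]_2 => y (w 0 0)) by apply/funext => w; exact: row3_1.
have p2 : (fun w => psi w 0 ord_max) = (fun w : 'rV[R]_2 => w 0 1) by apply/funext => w; exact: row3_2.
have sV (i : 'I_2) : smooth_on V (fun w : 'rV[R]_2 => w 0 i).
  exact: (smooth_on_coord 0 i oV (@smooth_on_id R _ V)).
have spsi : smooth_on V psi by exact: (smooth_row3 oV sxV syV (sV 1)).
have lE w : V w -> bcv_lam m (psi w) = L (w 0 0) by move=> Vw; rewrite /bcv_lam row3_0 row3_1.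
have lpsi w : V w -> bcv_lam m (psi w) != 0 by move=> Vw; rewrite lE // gt_eqF // Lp.
have ipsi : immersion_on V psi.
  split=> // w X Vw D0.
  have dc i : 'D_X psi w 0 i = 0 by rewrite D0 mxE.
  have C i : is_derive w X (fun w => psi w 0 i) 0.
    by have := @derive_coord R _ _ _ psi w X 0 i (smooth_on_derivable spsi Vw); rewrite dc.
  have [_ C2] := C ord_max; rewrite p2 in C2.
  have X1 : X 0 1 = 0 by rewrite -C2; have [_ ->] := is_derive_coordinate w X 1.
  have dw0 := is_derive_coordinate w X 0.
  have [_ ex] := is_derive_chain dw0 (dx Vw); have [_ ey] := is_derive_chain dw0 (dy Vw).
  have [_ C0] := C 0; rewrite p0 ex in C0; have [_ C1] := C 1; rewrite p1 ey in C1.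
  (* The velocity of the base curve is lam (- n2, n1) with n1^2 + n2^2 = 1, so the combination of
     the first two coordinates with coefficients - n2 and n1 isolates lam times [X 0 0]. *)
  have X0 : X 0 0 = 0.
    have L0 : L (w 0 0) != 0 by rewrite gt_eqF // Lp.
    apply: (mulfI L0); rewrite mulr0 -[LHS]mul1r -{1}(nn Vw).
    transitivity ((b1 + k * x (w 0 0)) * ((b1 + k * x (w 0 0)) * L (w 0 0) * X 0 0)
      - (b2 + k * y (w 0 0)) * (- ((b2 + k * y (w 0 0)) * L (w 0 0)) * X 0 0)); first by ring.
    by rewrite C0 C1 !mulr0 subrr.
  by apply/rowP; apply: forall2; rewrite mxE.
have hc w : V w -> m * k * (psi w 0 0 ^+ 2 + psi w 0 1 ^+ 2)
            + 2 * m * (b1 * psi w 0 0 + b2 * psi w 0 1) = h + k.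
  by move=> Vw; rewrite row3_0 row3_1; exact: cyl.
exists (cylinder_normal m l psi k b1 b2), (h / 2); split.
  exact: smooth_cylinder_normal.
move=> w Vw; split; first exact: (cylinder_unit_normal l oV ipsi lpsi m0 hb hc Vw).
have E := cylinder_mean_curvature l oV ipsi lpsi m0 hb hc Vw.
by rewrite -E; field.
Qed.

End CurveOfCylinder.

Lemma polar_form {R : realType} (b1 b2 : R) : exists B be1 be2,
  [/\ 0 <= B, be2 ^+ 2 = 1 - be1 ^+ 2, b1 = B * be1 & b2 = B * be2].
Proof.
pose B := Num.sqrt (b1 ^+ 2 + b2 ^+ 2).
have B2 : B ^+ 2 = b1 ^+ 2 + b2 ^+ 2 by rewrite sqr_sqrtr ?addr_ge0 ?sqr_ge0.
have [B0|B0] := eqVneq B 0.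
  (* For b = 0 the direction is arbitrary, and (1, 0) is taken. *)
  exists 0, 1, 0; move: B2; rewrite B0 expr2 mul0r => /esym/eqP.
  by rewrite paddr_eq0 ?sqr_ge0 // !sqrf_eq0 => /andP[/eqP -> /eqP ->]; split; rewrite ?mulr0 ?mul0r //; ring.
exists B, (b1 / B), (b2 / B); split; rewrite ?sqrtr_ge0 //; last 2 first.
- by field.
- by field.
have e : b2 ^+ 2 = B ^+ 2 - b1 ^+ 2 by rewrite B2; ring.
by rewrite expr_div_n e; field.
Qed.

Lemma hopf_cylinderE {R : realType} (I : set R) (x y : R -> R) p :
  hopf_cylinder I (fun t => row2 (x t) (y t)) p <-> exists2 t, I t & x t = p 0 0 /\ y t = p 0 1.
Proof.
have e0 : lshift 1 (0 : 'I_2) = (0 : 'I_3) by exact: val_inj.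
have e1 : lshift 1 (1 : 'I_2) = (1 : 'I_3) by exact: val_inj.
have h0 : hopf_proj p 0 0 = p 0 0 by rewrite mxE e0.
have h1 : hopf_proj p 0 1 = p 0 1 by rewrite mxE e1.
split=> [[t It /= E]|[t It [E0 E1]]]; exists t => //=.
  by rewrite -h0 -h1 E row2_0 row2_1.
apply/rowP; apply: forall2; first by rewrite h0 row2_0.
by rewrite h1 row2_1.
Qed.

Lemma hopf_curve_exists {R : realType} (m l h k b1 b2 : R) : 0 < m -> 0 < h ->
  m * (b1 ^+ 2 + b2 ^+ 2) + k * (h + k) = m ->
  exists (I : set R) (gam : R -> 'rV[R]_2),
    [/\ [/\ open I, is_interval I & arclength_curve m I gam],
        cmc_hopf_cylinder m l I gam,
        forall s, I s -> geodesic_curvature m gam s ^+ 2 = h ^+ 2 &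
        forall p, bcv_dom m p -> hopf_cylinder I gam p <-> on_cylinder m h k b1 b2 p].
Proof.
move=> mp hp hb; have [B [be1 [be2 [Bp bE B1 B2]]]] := polar_form b1 b2.
(* A curve of curvature h on a sphere of curvature 4m has curvature sqrt (h^2 + 4m) in Euclidean
   space; this is its frequency in the arc length. *)
pose w := Num.sqrt (h ^+ 2 + 4 * m).
have w2p : 0 < h ^+ 2 + 4 * m by rewrite addr_gt0 ?exprn_gt0 ?mulr_gt0.
have wp : 0 < w by rewrite sqrtr_gt0.
have w2 : w ^+ 2 = h ^+ 2 + 4 * m by rewrite sqr_sqrtr // ltW.
have wE : h ^+ 2 = w ^+ 2 - 4 * m by rewrite w2 addrK.
have bb : b1 ^+ 2 + b2 ^+ 2 = B ^+ 2 by rewrite B1 B2 !exprMn bE; ring.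
(* Four times the relation [hb], with 4 k (h + k) completed to the square (h + 2k)^2. *)
have BE : 4 * (m * B ^+ 2) = w ^+ 2 - (h + 2 * k) ^+ 2.
  by rewrite w2 -{2}hb bb; ring.
pose I := circle_dom k w; pose x := circle_x m h k B be1 be2 w; pose y := circle_y m h k B be1 be2 w.
have oI : open I by exact: open_circle_dom.
have mu_gt0 t : I t -> 0 < circle_mu m h k B w t by exact: circle_mu_gt0.
have LE t : I t -> 1 + m * (x t ^+ 2 + y t ^+ 2) = (circle_mu m h k B w t)^-1.
  by move=> It; exact: circle_conf_eq.
have Lp t : I t -> 0 < 1 + m * (x t ^+ 2 + y t ^+ 2) by move=> It; rewrite LE // invr_gt0 mu_gt0.
have cyl t : I t -> m * k * (x t ^+ 2 + y t ^+ 2) + 2 * m * (b1 * x t + b2 * y t) = h + k.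
  by move=> It; rewrite B1 B2; exact: circle_cylinder.
have D t : I t -> is_derive t 1 x (- ((b2 + k * y t) * (1 + m * (x t ^+ 2 + y t ^+ 2)))) /\
    is_derive t 1 y ((b1 + k * x t) * (1 + m * (x t ^+ 2 + y t ^+ 2))).
  move=> It; have D := circle_is_derive be1 be2 mp hp Bp wp wE BE It.
  by rewrite (LE t It) B1 B2; exact: D.
have dx t (It : I t) := (D t It).1; have dy t (It : I t) := (D t It).2.
have sI : smooth_on I (id : R -> R) by exact: smooth_on_id.
have [sx sy] := smooth_circle be1 be2 mp hp Bp wp wE BE oI sI (fun t It => It).
have oV : open [set v : 'rV[R]_2 | I (v 0 0)].
  by apply: (@open_comp _ _ (fun w : 'rV[R]_2 => w 0 0) I) => // v _; exact: coord_continuous.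
have sV : smooth_on [set v : 'rV[R]_2 | I (v 0 0)] (fun v : 'rV[R]_2 => v 0 0).
  exact: (smooth_on_coord 0 0 oV (@smooth_on_id R _ _)).
have [sxV syV] := smooth_circle be1 be2 mp hp Bp wp wE BE oV sV (fun v Iv => Iv).
have m0 := lt0r_neq0 mp.
exists I, (fun t => row2 (x t) (y t)); split.
- split=> //; first exact: is_interval_circle_dom.
  exact: (arclength_of_cylinder oI m0 hb Lp sx sy cyl dx dy).
- exact: (cmc_of_cylinder l oI m0 hb Lp cyl dx dy sxV syV).
- move=> t It; rewrite (geodesic_curvature_of_cylinder oI m0 hb Lp sx sy cyl dx dy It).
  by rewrite sqrrN.
- move=> p /bcv_domE lp; split=> [/hopf_cylinderE[t It [E0 E1]]|C].
    by rewrite /on_cylinder -E0 -E1; exact: cyl.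
  apply/hopf_cylinderE; apply: circle_onto => //.
  by rewrite -B1 -B2; exact: C.
Qed.

(** * The image is open in the cylinder *)

Lemma interior_min_derive {R : realType} (V : normedModType R) (f : V -> R) x v d : 0 < d ->
  (forall y, ball x d y -> derivable f y v) -> (forall y, ball x d y -> f x <= f y) -> 'D_v f x = 0.
Proof.
move=> d0 df fm; pose a := d / (1 + `|v|).
have v1 : 0 < 1 + `|v| by rewrite ltr_wpDr.
have a0 : 0 < a by rewrite divr_gt0.
have B t : t \in `]- a, a[ -> ball x d (x + t *: v).
  rewrite in_itv /= -ltr_norml => ta; rewrite -ball_normE /= opprD addrA subrr sub0r normrN normrZ.
  apply: (le_lt_trans (y := `|t| * (1 + `|v|))); first by rewrite ler_wpM2l // ler_wpDl.
  by rewrite -ltr_pdivlMr.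
have D t : t \in `]- a, a[ -> is_derive t 1 (fun s => f (x + s *: v)) ('D_v f (x + t *: v)).
  by move=> /B /df; exact: is_derive_line.
have z : (0 : R) \in `]- a, a[ by rewrite in_itv /= oppr_lt0 a0.
have le : - a <= a by rewrite ge0_cp // ltW.
have := @derive1_at_min R (fun s => f (x + s *: v)) (- a) a 0 le _ z _.
case=> [t /D[] //|t /B bt|_ <-]; first by rewrite scale0r addr0; exact: fm.
by have [_ ->] := D 0 z; rewrite scale0r addr0.
Qed.

Lemma cramer2_eq0 {R : idomainType} (x y p q r s : R) : p * s - q * r != 0 ->
  x * p + y * q = 0 -> x * r + y * s = 0 -> x = 0 /\ y = 0.
Proof.
move=> M0 E F; split; apply: (mulfI M0); rewrite mulr0.
  transitivity (s * (x * p + y * q) - q * (x * r + y * s)); first by ring.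
  by rewrite E F !mulr0 subrr.
transitivity (p * (x * r + y * s) - r * (x * p + y * q)); first by ring.
by rewrite E F !mulr0 subrr.
Qed.

Section LocalInjectivity.
Context {R : realType}.
Variables (U : set 'rV[R]_2) (psi : 'rV[R]_2 -> 'rV[R]_3).
Hypotheses (oU : open U) (ipsi : immersion_on U psi).
Let spsi : smooth_on U psi. Proof. by case: ipsi. Qed.
Local Notation e0 := (@basis_vec R 1 0).
Local Notation e1 := (@basis_vec R 1 1).

Lemma immersion_minor u : U u -> exists i j,
  'D_e0 psi u 0 i * 'D_e1 psi u 0 j - 'D_e1 psi u 0 i * 'D_e0 psi u 0 j != 0.
Proof.
move=> Uu; apply: contrapT => H.
have z i j : 'D_e0 psi u 0 i * 'D_e1 psi u 0 j = 'D_e1 psi u 0 i * 'D_e0 psi u 0 j.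
  by apply/eqP; rewrite -subr_eq0; apply/negPn/negP => ij; apply: H; exists i, j.
have P a b : a *: 'D_e0 psi u + b *: 'D_e1 psi u = 0 -> a = 0 /\ b = 0.
  move=> E; have X0 : row2 a b = 0.
    apply: (ipsi.2 u _ Uu); apply: (etrans (smooth_mx_derive_rV2 oU _ Uu spsi)).
    by rewrite row2_0 row2_1.
  by have := row2_0 a b; have := row2_1 a b; rewrite X0 !mxE => <- <-.
move: z P; move: ('D_e0 psi u) ('D_e1 psi u) => v w z P.
have v0 : v = 0.
  apply/rowP => i; rewrite mxE.
  have [_ /eqP] : w 0 i = 0 /\ - v 0 i = 0.
    by apply: P; apply/rowP => j; rewrite !mxE mulNr -z subrr.
  by rewrite oppr_eq0 => /eqP.
have [/eqP] : (1 : R) = 0 /\ (0 : R) = 0 by apply: P; rewrite v0 scaler0 scale0r addr0.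
by rewrite oner_eq0.
Qed.

(** If psi u = psi u0, the mean value theorem in the coordinates i and j gives two linear equations
    for u - u0 whose matrix is a nonzero minor of the differential, up to a small displacement of
    its rows. *)
Lemma immersion_local_inj u0 : U u0 -> exists2 d, 0 < d &
  forall u, ball u0 d u -> U u /\ (psi u = psi u0 -> u = u0).
Proof.
move=> Uu0; have [i [j ij]] := immersion_minor Uu0.
pose a (b : 'I_2) (c : 'I_3) u := 'D_(@basis_vec R 1 b) (fun y => psi y 0 c) u.
have aE b c u : U u -> 'D_(@basis_vec R 1 b) psi u 0 c = a b c u.
  move=> Uu; have [_ <-] := @derive_coord R _ _ _ psi u (basis_vec b) 0 c (smooth_on_derivable spsi Uu).
  by [].
have ca b c : {for u0, continuous (a b c)}.
  exact: (smooth_on_continuous (smooth_on_derive _ (smooth_on_coord 0 c oU spsi)) Uu0).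
(* The mean value theorem returns a separate intermediate point for each coordinate, so the minor is
   regarded as a function of a pair of points. *)
pose M (z : 'rV[R]_2 * 'rV[R]_2) := a 0 i z.1 * a 1 j z.2 - a 1 i z.1 * a 0 j z.2.
have cM : {for (u0, u0), continuous M}.
  have c1 b c : {for (u0, u0), continuous (fun z : 'rV[R]_2 * 'rV[R]_2 => a b c z.1)}.
    by apply: (@continuous_comp _ _ _ fst (a b c)); [exact: cvg_fst | exact: ca].
  have c2 b c : {for (u0, u0), continuous (fun z : 'rV[R]_2 * 'rV[R]_2 => a b c z.2)}.
    by apply: (@continuous_comp _ _ _ snd (a b c)); [exact: cvg_snd | exact: ca].
  by apply: continuousB; apply: continuousM.
have M0 : M (u0, u0) != 0 by rewrite /M /= -!aE.
have nM : \forall z \near (u0, u0), M z != 0.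
  by apply: (cM [set x | x != 0]); apply: open_nbhs_nbhs; split => //; exact: open_neq.
have [d1 /= d1p H1] : nbhs_ball (u0, u0) [set z | M z != 0] by apply/nbhs_ballP.
have [d2 /= d2p H2] : nbhs_ball u0 U by apply/nbhs_ballP; exact: open_nbhs_nbhs.
pose d := Num.min d1 d2; have dp : 0 < d by rewrite lt_min d1p.
have dd1 : d <= d1 by rewrite ge_min lexx.
have dd2 : d <= d2 by rewrite ge_min lexx orbT.
exists d => // u bu; have bU v : ball u0 d v -> U v by move=> bv; apply: H2; exact: le_ball bv.
split=> [|E]; first exact: bU.
pose X := u - u0.
have MV c : exists2 v, ball u0 d v & X 0 0 * a 0 c v + X 0 1 * a 1 c v = 0.
  have sc := smooth_on_coord 0 c oU spsi.
  have [|t t01 F] := @line_MVT R _ (fun y => psi y 0 c) u0 X 1 ler01.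
    move=> t t01; apply: smooth_on_derivable sc _; apply: bU; exact: ball_segment.
  have bt : ball u0 d (u0 + t *: X) by exact: ball_segment.
  exists (u0 + t *: X) => //.
  rewrite -(smooth_on_derive_rV2 X oU (bU _ bt) sc) -[LHS]mul1r -F scale1r /X addrC.
  by rewrite [u0 + _]addrC subrK E addrC subrr.
have [v bv Ev] := MV i; have [w bw Ew] := MV j.
have Mvw : M (v, w) != 0.
  by apply: (H1 (v, w)); split; [exact: le_ball bv | exact: le_ball bw].
have [X0 X1] := cramer2_eq0 Mvw Ev Ew.
apply/eqP; rewrite -subr_eq0; apply/eqP/rowP; apply: forall2; rewrite [RHS]mxE.
- exact: X0.
- exact: X1.
Qed.

End LocalInjectivity.

(** The Euclidean distance in coordinates rather than that of g. It is polynomial, and its normal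
    lines to the cylinder are horizontal lines in direction b + k q, as the base curve is a
    Euclidean circle or line. *)
Definition sqdist {R : realType} (p q : 'rV[R]_3) : R :=
  (p 0 0 - q 0 0) ^+ 2 + (p 0 1 - q 0 1) ^+ 2 + (p 0 ord_max - q 0 ord_max) ^+ 2.

Lemma sqdist_ge0 {R : realType} (p q : 'rV[R]_3) : 0 <= sqdist p q.
Proof. by rewrite !addr_ge0 ?sqr_ge0. Qed.

Lemma sqdist_eq0 {R : realType} (p q : 'rV[R]_3) : sqdist p q = 0 -> p = q.
Proof.
move/eqP; rewrite /sqdist !paddr_eq0 ?addr_ge0 ?sqr_ge0 // !sqrf_eq0 !subr_eq0.
by move=> /andP[/andP[/eqP a /eqP b] /eqP c]; exact: row3P.
Qed.

Lemma sqdist_triangle {R : realType} (p q r : 'rV[R]_3) : sqdist p r <= 2 * (sqdist p q + sqdist r q).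
Proof.
rewrite /sqdist; move: (p 0 0) (p 0 1) (p 0 ord_max) (q 0 0) (q 0 1) (q 0 ord_max) (r 0 0) (r 0 1) (r 0 ord_max).
move=> p0 p1 p2 q0 q1 q2 r0 r1 r2; rewrite -subr_ge0.
rewrite (_ : _ - _ = (p0 + r0 - 2 * q0) ^+ 2 + (p1 + r1 - 2 * q1) ^+ 2 + (p2 + r2 - 2 * q2) ^+ 2).
  by rewrite !addr_ge0 ?sqr_ge0.
by ring.
Qed.

Lemma smooth_sqdist {R : realType} (V : normedModType R) (A : set V) (f : V -> 'rV[R]_3) p :
  open A -> smooth_on A f -> smooth_on A (fun u => sqdist (f u) p).
Proof.
move=> oA sf; have c (r : R) : smooth_on A (fun=> r) by exact: smooth_on_cst.
by apply: (smooth_onD oA); first apply: (smooth_onD oA); apply: (smooth_onX _ oA);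
  apply: (smooth_onB oA) => //; exact: smooth_on_coord.
Qed.

Lemma proportional_algebra {R : idomainType} (p1 p2 p3 W1 W2 W3 c1 c2 c3 : R) : c1 != 0 ->
  p2 * c1 = p1 * c2 -> p3 * c1 = p1 * c3 -> W2 * c1 = W1 * c2 -> W3 * c1 = W1 * c3 ->
  [/\ W1 * p2 = W2 * p1, W1 * p3 = W3 * p1 & W2 * p3 = W3 * p2].
Proof.
move=> c0 x2 x3 y2 y3.
have z2 : W1 * p2 = W2 * p1.
  by apply: (mulIf c0); rewrite -mulrA x2 [RHS]mulrAC y2; ring.
have z3 : W1 * p3 = W3 * p1.
  by apply: (mulIf c0); rewrite -mulrA x3 [RHS]mulrAC y3; ring.
split=> //; apply: (mulIf c0); rewrite -mulrA x3 mulrA -z2 [RHS]mulrAC y3; ring.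
Qed.

(** Both p and W are orthogonal to v and w, hence parallel to the nonzero vector v x w and to each
    other; the factor is <W, p> because p is a unit vector. *)
Lemma parallel_algebra {R : idomainType} (v1 v2 v3 w1 w2 w3 p1 p2 p3 W1 W2 W3 : R)
  (c1 := v2 * w3 - v3 * w2) (c2 := v3 * w1 - v1 * w3) (c3 := v1 * w2 - v2 * w1) :
  [|| c1 != 0, c2 != 0 | c3 != 0] ->
  p1 * v1 + p2 * v2 + p3 * v3 = 0 -> p1 * w1 + p2 * w2 + p3 * w3 = 0 ->
  W1 * v1 + W2 * v2 + W3 * v3 = 0 -> W1 * w1 + W2 * w2 + W3 * w3 = 0 ->
  p1 * p1 + p2 * p2 + p3 * p3 = 1 ->
  let s := W1 * p1 + W2 * p2 + W3 * p3 in [/\ W1 = s * p1, W2 = s * p2 & W3 = s * p3].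
Proof.
move=> c0 pv pw Wv Ww pp s.
have C a1 a2 a3 : a1 * v1 + a2 * v2 + a3 * v3 = 0 -> a1 * w1 + a2 * w2 + a3 * w3 = 0 ->
    [/\ a2 * c3 = a3 * c2, a3 * c1 = a1 * c3 & a1 * c2 = a2 * c1].
  move=> av aw; split; apply/eqP; rewrite -subr_eq0; apply/eqP.
  - transitivity (v1 * (a1 * w1 + a2 * w2 + a3 * w3) - w1 * (a1 * v1 + a2 * v2 + a3 * v3)); last by rewrite av aw !mulr0 subrr.
    by rewrite /c2 /c3; ring.
  - transitivity (v2 * (a1 * w1 + a2 * w2 + a3 * w3) - w2 * (a1 * v1 + a2 * v2 + a3 * v3)); last by rewrite av aw !mulr0 subrr.
    by rewrite /c1 /c3; ring.
  - transitivity (v3 * (a1 * w1 + a2 * w2 + a3 * w3) - w3 * (a1 * v1 + a2 * v2 + a3 * v3)); last by rewrite av aw !mulr0 subrr.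
    by rewrite /c1 /c2; ring.
have [x1 x2 x3] := C _ _ _ pv pw; have [y1 y2 y3] := C _ _ _ Wv Ww.
have [z1 z2 z3] : [/\ W1 * p2 = W2 * p1, W1 * p3 = W3 * p1 & W2 * p3 = W3 * p2].
  case/or3P: c0 => c0.
  - by have [] := proportional_algebra c0 (esym x3) x2 (esym y3) y2.
  - by have [-> -> ->] := proportional_algebra c0 x3 (esym x1) y3 (esym y1).
  - by have [-> -> ->] := proportional_algebra c0 (esym x2) x1 (esym y2) y1.
have E a b c : a = a * (p1 * p1 + p2 * p2 + p3 * p3) + b * 0 + c * 0 by rewrite pp; ring.
rewrite /s; split.
- rewrite [LHS](E _ 0 0); transitivity (W1 * p1 * p1 + p2 * (W1 * p2) + p3 * (W1 * p3)); first by ring.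
  by rewrite z1 z2; ring.
- rewrite [LHS](E _ 0 0); transitivity (W2 * p2 * p2 + p1 * (W2 * p1) + p3 * (W2 * p3)); first by ring.
  by rewrite -z1 z3; ring.
- rewrite [LHS](E _ 0 0); transitivity (W3 * p3 * p3 + p1 * (W3 * p1) + p2 * (W3 * p2)); first by ring.
  by rewrite -z2 -z3; ring.
Qed.

(** Inserting q - s n into the equation of the circle gives m s (k s - 2) = 0. The root with k s = 2
    violates k^2 s^2 < 1. *)
Lemma normal_line_algebra {R : realFieldType} (m h k b1 b2 x y s d : R) : m != 0 ->
  (b1 + k * x) ^+ 2 + (b2 + k * y) ^+ 2 = 1 ->
  m * k * (x ^+ 2 + y ^+ 2) + 2 * m * (b1 * x + b2 * y) = h + k ->
  (let p := x - s * (b1 + k * x) in let q := y - s * (b2 + k * y) in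
   m * k * (p ^+ 2 + q ^+ 2) + 2 * m * (b1 * p + b2 * q) = h + k) ->
  s ^+ 2 = d -> k ^+ 2 * d < 1 -> s = 0.
Proof.
move=> m0 nn E F sd kd.
have : m * (s * (k * s - 2)) = 0.
  transitivity (m * (s * (k * s - 2)) * ((b1 + k * x) ^+ 2 + (b2 + k * y) ^+ 2)); first by rewrite nn mulr1.
  rewrite -[RHS](subrr (h + k)) -{1}F -E; ring.
move/eqP; rewrite !mulf_eq0 (negPf m0) /= => /orP[/eqP //|ks].
have {}ks : k * s = 2 by apply/eqP; rewrite -subr_eq0.
by move: kd; rewrite -sd -exprMn ks; lra.
Qed.

Section CylinderOpen.
Context {R : realType}.
Variables m : R.
Variables (U : set 'rV[R]_2) (psi : 'rV[R]_2 -> 'rV[R]_3) (h k b1 b2 : R).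
Hypotheses (oU : open U) (ipsi : immersion_on U psi) (lpsi : forall u, U u -> bcv_lam m (psi u) != 0)
  (m0 : m != 0) (hb : m * (b1 ^+ 2 + b2 ^+ 2) + k * (h + k) = m)
  (hcyl : forall u, U u -> on_cylinder m h k b1 b2 (psi u)).
Let spsi : smooth_on U psi. Proof. by case: ipsi. Qed.
Local Notation e0 := (@basis_vec R 1 0).
Local Notation e1 := (@basis_vec R 1 1).

(* At an interior minimum of the distance to [p] the vector [psi u - p] is normal
   to the cylinder, and such a normal line meets the cylinder again only at
   distance [2 / k]. *)
Lemma critical_point_on_cylinder u p d : U u -> 0 < d -> ball u d `<=` U ->
  (forall v, ball u d v -> sqdist (psi u) p <= sqdist (psi v) p) ->
  on_cylinder m h k b1 b2 p -> k ^+ 2 * sqdist (psi u) p < 1 -> psi u = p.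
Proof.
move=> Uu d0 bU mn cp kd.
have sf := smooth_sqdist p oU spsi.
have D0 X : 'D_X (fun u => sqdist (psi u) p) u = 0.
  by apply: (interior_min_derive d0 _ mn) => v bv; exact: smooth_on_derivable sf (bU _ bv).
have W X : (psi u 0 0 - p 0 0) * 'D_X psi u 0 0 + (psi u 0 1 - p 0 1) * 'D_X psi u 0 1
    + (psi u 0 ord_max - p 0 ord_max) * 'D_X psi u 0 ord_max = 0.
  have dp := @smooth_on_derivable _ _ _ U psi u X spsi Uu.
  have d_0 := derive_coord 0 0 dp; have d_1 := derive_coord 0 1 dp; have d_2 := derive_coord 0 ord_max dp.
  have [_ D] : is_derive u X (fun u => sqdist (psi u) p) (2 * ((psi u 0 0 - p 0 0) * 'D_X psi u 0 0
      + (psi u 0 1 - p 0 1) * 'D_X psi u 0 1 + (psi u 0 ord_max - p 0 ord_max) * 'D_X psi u 0 ord_max)).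
    by rewrite /sqdist; eapply is_derive_eq; [derV | move: ('D_X psi u) => v; ring].
  have two0 : (2 : R) != 0 by rewrite pnatr_eq0.
  exact: (mulfI two0 (etrans (etrans (esym D) (D0 X)) (esym (mulr0 _)))).
have nf X : (b1 + k * psi u 0 0) * 'D_X psi u 0 0 + (b2 + k * psi u 0 1) * 'D_X psi u 0 1
    + 0 * 'D_X psi u 0 ord_max = 0.
  have := cylinder_nf oU ipsi lpsi m0 hcyl X Uu; move: (lpsi Uu); rewrite /bcv_fr1 /bcv_fr2.
  move: (bcv_lam _ _) ('D_X psi u) => L v L0; rewrite !mulrA -mulrDl => /eqP.
  by rewrite mulf_eq0 invr_eq0 (negPf L0) orbF mul0r addr0 => /eqP.
have nn := cylinder_nn m0 hb hcyl Uu.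
have nn0 : (b1 + k * psi u 0 0) * (b1 + k * psi u 0 0) + (b2 + k * psi u 0 1) * (b2 + k * psi u 0 1) + 0 * 0 = 1.
  by rewrite -[RHS]nn mulr0 addr0 -!expr2.
have [i [j ij]] := immersion_minor oU ipsi Uu.
have := W e0; have := W e1; have := nf e0; have := nf e1; move: ij.
move: ('D_e0 psi u) ('D_e1 psi u) => v w ij nw nv Ww Wv.
have c0 : [|| v 0 1 * w 0 ord_max - v 0 ord_max * w 0 1 != 0, v 0 ord_max * w 0 0 - v 0 0 * w 0 ord_max != 0
   | v 0 0 * w 0 1 - v 0 1 * w 0 0 != 0].
  apply/negPn/negP; rewrite !negb_or !negbK => /and3P[/eqP z1 /eqP z2 /eqP z3].
  move/negP: ij; apply; apply/eqP; move: i j; apply: forall3; apply: forall3; rewrite ?[w 0 _ * _]mulrC ?subrr //.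
  - by rewrite -[RHS]oppr0 -z2; ring.
  - by rewrite -[RHS]oppr0 -z3; ring.
  - by rewrite -[RHS]oppr0 -z1; ring.
have [w1 w2 w3] := parallel_algebra c0 nv nw Wv Ww nn0.
move: w1 w2 w3; set s := (_ + _ + _) => w1 w2 w3.
have s0 : s = 0.
  apply: (@normal_line_algebra R m h k b1 b2 (psi u 0 0) (psi u 0 1) s _ m0 nn (hcyl Uu) _ _ kd).
    by rewrite /= -w1 -w2 !opprB ![psi u _ _ + _]addrC !subrK.
  by rewrite /sqdist w1 w2 w3 -[LHS]mulr1 -nn; ring.
rewrite s0 !mul0r in w1 w2 w3.
by apply: row3P; apply/eqP; rewrite -subr_eq0; apply/eqP.
Qed.

(** On the boundary of a small closed disc the distance to psi u0 is bounded below, by compactness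
    and local injectivity. For p close to psi u0 the minimum of the distance to p is therefore
    attained in the interior, where [critical_point_on_cylinder] applies. *)
Lemma cylinder_patch_open u0 : U u0 -> exists O : set 'rV[R]_3, [/\ open O, O (psi u0) &
  forall p, O p -> on_cylinder m h k b1 b2 p -> exists2 u, U u & psi u = p].
Proof.
move=> Uu0; have [e e0 He] := immersion_local_inj oU ipsi Uu0.
pose r := e / 2; have r0 : 0 < r by rewrite divr_gt0.
have re : r < e by rewrite ltr_pdivrMr // ltr_pMr // ltr1n.
pose N (u : 'rV[R]_2) := `|u - u0|.
have cN : continuous N.
  move=> u; have H : {for u, continuous (fun v : 'rV[R]_2 => v + - u0)}.
    apply: (@continuousD _ _ _ id (fun=> - u0) u); [exact: cvg_id | exact: (@cst_continuous _ _ (- u0) u)].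
  exact: (continuous_comp H (@norm_continuous _ _ _)).
pose K := N @^-1` [set x | x <= r].
have KU u : K u -> ball u0 e u.
  by rewrite -ball_normE /K /N /= distrC => ur; exact: le_lt_trans ur re.
have clK : closed K by apply: preimage_closed; [move=> u _; exact: cN | exact: closed_le].
have cK : compact K.
  apply: bounded_closed_compact => //; exists (r + `|u0|); split; first exact: num_real.
  move=> x rx u Ku /=; apply: le_trans (ltW rx).
  by rewrite -[u](subrK u0); apply: le_trans (ler_normD _ _) _; rewrite lerD2r.
have cP p (A : set 'rV[R]_2) : A `<=` K -> {within A, continuous (fun u => sqdist (psi u) p)}.
  move=> AK; apply: continuous_in_subspaceT => u; rewrite inE => /AK /KU /He[Uu _].
  exact: (smooth_on_continuous (smooth_sqdist p oU spsi) Uu).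
pose Q := K `&` N @^-1` [set x | r <= x].
have clQ : closed Q.
  by apply: closedI => //; apply: preimage_closed; [move=> u _; exact: cN | exact: closed_ge].
have QK : Q `<=` K by move=> u [].
have cQ : compact Q by exact: subclosed_compact clQ cK QK.
have [dl dl0 Hdl] : exists2 dl, 0 < dl & forall u, Q u -> dl <= sqdist (psi u) (psi u0).
  (* On an empty boundary any positive number is a lower bound; 1 is taken. *)
  have [Q0|nQ] := pselect (Q !=set0); last first.
    by exists 1 => // u Qu; case: nQ; exists u.
  have [c] := EVT_min_rV Q0 cQ (cP (psi u0) Q QK).
  rewrite inE => Qc mc; exists (sqdist (psi c) (psi u0)) => [|u Qu]; last by apply: mc; rewrite inE.
  rewrite lt_neqAle sqdist_ge0 andbT eq_sym; apply/negP => /eqP /sqdist_eq0 E.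
  have [_ /(_ E) cu0] := He c (KU c (QK c Qc)).
  by case: Qc => _; rewrite /N /= cu0 subrr normr0 leNgt r0.
have so := smooth_sqdist (psi u0) openT (@smooth_on_id R 'rV[R]_3 setT).
have co : continuous (fun p => sqdist p (psi u0)) by move=> p; exact: (smooth_on_continuous so I).
(* The first bound absorbs the factor 2 of [sqdist_triangle] applied to two squared distances below
   a; the second gives k^2 a < 1, as required at the critical point. *)
pose a := Num.min (dl / 4) (1 / (1 + k ^+ 2)).
have k1 : 0 < 1 + k ^+ 2 by rewrite ltr_wpDr ?sqr_ge0.
have a0 : 0 < a by rewrite lt_min !divr_gt0.
exists ((fun p => sqdist p (psi u0)) @^-1` [set x | x < a]); split.
- by apply: open_comp; [move=> p _; exact: co | exact: open_lt].
- by rewrite /= (_ : sqdist _ _ = 0) // /sqdist !subrr expr2 mul0r !addr0.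
move=> p /= pa cp.
have K0 : K u0 by rewrite /K /N /= subrr normr0 ltW.
have [u] := EVT_min_rV (ex_intro K u0 K0) cK (cP p K (@subset_refl _ K)).
rewrite inE => Ku mu; have [Uu _] := He u (KU u Ku).
have sym q q' : sqdist q q' = sqdist q' q by rewrite /sqdist; ring.
have ua : sqdist (psi u) p < a.
  by apply: le_lt_trans pa; rewrite [leRHS]sym; apply: mu; rewrite inE.
exists u => //.
have Nu : N u < r.
  rewrite ltNge; apply/negP => ru; have := Hdl u (conj Ku ru); rewrite leNgt => /negP; apply.
  apply: le_lt_trans (sqdist_triangle _ p _) _; rewrite [sqdist (psi u0) p]sym.
  have : a <= dl / 4 by rewrite ge_min lexx.
  move: ua pa; lra.
have d0 : 0 < r - N u by rewrite subr_gt0.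
have bK : ball u (r - N u) `<=` K.
  move=> v; rewrite -ball_normE /K /N /= distrC => uv.
  rewrite -[v](subrK u) -addrA; apply: le_trans (ler_normD _ _) _.
  by rewrite -lerBrDr ltW.
apply: (critical_point_on_cylinder Uu d0 _ _ cp).
- by move=> v /bK /KU /He[].
- by move=> v /bK Kv; apply: mu; rewrite inE.
- have : a <= 1 / (1 + k ^+ 2) by rewrite ge_min lexx orbT.
  rewrite ler_pdivlMr // => ak; have := sqr_ge0 k; have := sqdist_ge0 (psi u) p.
  by move: ua ak; move: (sqdist _ _) (k ^+ 2) => x y; nra.
Qed.

End CylinderOpen.

Theorem theorem2p6 (R : realType) (m l : R) (S : topologicalType)
    (Sigma : smooth_surface R S) (phi : S -> 'rV[R]_3)
    (hml : 4 * m - l ^+ 2 != 0)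
    (himm : immersed_surface Sigma (bcv_dom m) phi)
    (hiso : isoparametric Sigma (bcv_dom m) (bcv_metric m l) phi)
    (htri : proper_triharmonic Sigma (bcv_metric m l) phi) :
  l ^+ 2 < 4 * m /\
  exists (I : set R) (gam : R -> 'rV[R]_2),
    [/\ open I, is_interval I & arclength_curve m I gam] /\
    [/\ cmc_hopf_cylinder m l I gam,
        forall s, I s -> geodesic_curvature m gam s ^+ 2 = 2 * (4 * m - l ^+ 2) &
        exists2 O : set 'rV[R]_3, open O &
          range phi = O `&` hopf_cylinder I gam].
Proof.
have [T nmin] := htri.
have [lt [k [b1 [b2 [hb hc]]]]] := one_cylinder hml himm hiso T nmin.
split=> //; set h := Num.sqrt _ in hb hc.
have mp : 0 < m by have := sqr_ge0 l; lra.
have hp : 0 < h by rewrite sqrtr_gt0; lra.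
have h2 : h ^+ 2 = 2 * (4 * m - l ^+ 2) by rewrite sqr_sqrtr //; lra.
have [I [gam [HI Hcmc Hg Hcyl]]] := @hopf_curve_exists R m l h k b1 b2 mp hp hb.
exists I, gam; split=> //; split=> // [s Is|]; first by rewrite Hg.
(* The open set of the conclusion is the union of all open V in which every point of the cylinder
   belongs to the image; every point of the image has such a neighbourhood by
   [cylinder_patch_open]. *)
pose P (V : set 'rV[R]_3) := open V /\ forall p, V p -> on_cylinder m h k b1 b2 p -> range phi p.
(* As m > 0, the conformal factor is positive everywhere, and the equation of the cylinder describes
   the Hopf cylinder on all of R^3. *)
have dom p : bcv_dom m p.
  rewrite /bcv_dom /preimage /base_dom /= /conf_factor ltr_wpDr // mulr_ge0 ?addr_ge0 ?sqr_ge0 //.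
  exact: ltW.
exists (\bigcup_(V in P) V); first by apply: bigcup_open => V [].
apply/seteqP; split=> [_ [x _ <-]|p [[V [oV HV] Vp] /(Hcyl p (dom p)) cp]]; last exact: HV.
split; last by apply/(Hcyl _ (dom _)); exact: hc.
have [c ac [u cu ux]] := chart_cover Sigma x.
have lpsi w : c.1 w -> bcv_lam m ((phi \o c.2) w) != 0.
  by move=> _; rewrite gt_eqF // bcv_domE.
have hcy w : c.1 w -> on_cylinder m h k b1 b2 ((phi \o c.2) w) by move=> _; exact: hc.
have [V [oV Vu HV]] := cylinder_patch_open (chart_open ac) (himm.2 c ac) lpsi (lt0r_neq0 mp) hb hcy cu.
exists V; last by rewrite -ux.
split=> // p Vp /(HV p Vp)[w cw <-]; by exists (c.2 w).
Qed.
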